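(* Let $\mathfrak{e}\subset\mathbb{R}$ be a compact set of positive logarithmic capacity, and let $x_*$ be a point in $\overline{\mathbb{R}}\setminus\mathfrak{e}$. Assume that the weight $w:\mathfrak{e}\to[0,\infty)$ is continuous at $\rho_{\mathfrak{e}}$-almost every point of $\mathfrak{e}$ and that $w\ge|P|$ on $\mathfrak{e}$ for some polynomial $P\not\equiv0$. Then $$\liminf_{n\to\infty}W_n(\mathfrak{e},w,x_* )\ge 2\,S(\mathfrak{e},w,x_* ).$$
   Context: $\overline{\mathbb{R}}=\mathbb{R}\cup\{\infty\}$. A weight on $\mathfrak{e}$ is an upper semi-continuous function $w:\mathfrak{e}\to[0,\infty)$ that is positive at infinitely many points of $\mathfrak{e}$. $\|\cdot\|_{\mathfrak{e}}$ is the sup norm over $\mathfrak{e}$, $\mathrm{C}(\mathfrak{e})$ is logarithmic capacity, $\rho_{\mathfrak{e}}$ is the equilibrium measure of $\mathfrak{e}$, and $g_{\mathfrak{e}}(z,z_0)$ is the Green function of $\overline{\mathbb{C}}\setminus\mathfrak{e}$ with logarithmic pole at $z_0$. Widom factors ($n\ge1$): for finite $x_*$, $$W_n(\mathfrak{e},w,x_* )=e^{n g_{\mathfrak{e}}(x_*,\infty)}\min\{\|wP\|_{\mathfrak{e}}: P \text{ a polynomial},\ \deg P\le n,\ P(x_* )=1\},$$ and for $x_*=\infty$, $$W_n(\mathfrak{e},w,\infty)=\mathrm{C}(\mathfrak{e})^{-n}\min\{\|wP\|_{\mathfrak{e}}: P \text{ monic of degree } n\}.$$ Szegő factor: $S(\mathfrak{e},w,x_*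 )=\exp\left[\int\log w(z)\,d\omega_{\mathfrak{e}}(z,x_* )\right]$, where $\omega_{\mathfrak{e}}(\cdot,x_* )$ is the harmonic measure of $\overline{\mathbb{C}}\setminus\mathfrak{e}$ at $x_*$. One has $\omega_{\mathfrak{e}}(\cdot,\infty)=\rho_{\mathfrak{e}}$, and all the measures $\omega_{\mathfrak{e}}(\cdot,x_* )$ are mutually comparable up to positive constants, so they have the same null sets. *)

(* Defs.v *)
From mathcomp Require Import all_boot all_order all_algebra.
From mathcomp Require Import complex.
From mathcomp Require Import all_classical all_reals all_analysis.

Set Implicit Arguments.
Unset Strict Implicit.
Unset Printing Implicit Defensive.

Import Order.TTheory GRing.Theory Num.Theory.
Import numFieldNormedType.Exports.

Local Open Scope classical_set_scope.
Local Open Scope ring_scope.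

(* Potential theory is done on the plane R * R and on its one-point
   compactification, in which None is the point at infinity; R[i] is used only
   for the coefficients of polynomials.  The extended real line with a single
   point at infinity is the one-point compactification of R. *)

Notation plane R := (R * R)%type.
Notation sphere R := (one_point_compactification (R * R)%type).
Notation ext_line R := (one_point_compactification R).

Section Potential.
Context {R : realType}.

Definition sphere_of_line (p : ext_line R) : sphere R :=
  omap (fun x : R => (x, 0)) p.

Definition domain (e : set R) : set (sphere R) :=
  [set p | forall x, e x -> p <> Some (x, 0)].

Definition finite_domain (e : set R) : set (plane R) :=
  [set z | forall x, e x -> z <> (x, 0)].

(* The norm of R * R is the max norm; this is the Euclidean one. *)
Definition modulus (z : plane R) : R := Num.sqrt (z.1 ^+ 2 + z.2 ^+ 2).

Definition carried_by (E : set R) (mu : probability (measurableTypeR R) R) :=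
  exists K : set R, [/\ compact K, K `<=` E & mu K = 1%E].

(* lne 0 = -oo, so the kernel is +oo on the diagonal. *)
Definition log_energy (mu : probability (measurableTypeR R) R) : \bar R :=
  (\int[mu]_x \int[mu]_y - lne (`|x - y|%:E))%E.

Definition capacity (E : set R) : \bar R :=
  expeR (- ereal_inf [set log_energy mu | mu in carried_by E])%E.

(* For compact e of positive capacity there is exactly one such measure; likewise
   there is exactly one Green function and one harmonic measure in the sense of
   the predicates below. *)
Definition is_equilibrium_measure (e : set R)
    (rho : probability (measurableTypeR R) R) :=
  carried_by e rho /\
  forall mu, carried_by e mu -> (log_energy rho <= log_energy mu)%E.

Definition pdx (h : plane R -> R) (z : plane R) : R := 'D_((1, 0) : plane R) h z.
Definition pdy (h : plane R -> R) (z : plane R) : R := 'D_((0, 1) : plane R) h z.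

Definition C2_on (U : set (plane R)) (h : plane R -> R) :=
  forall z : plane R, U z ->
  [/\ differentiable h z,
      differentiable (pdx h) z /\ differentiable (pdy h) z,
      {for z, continuous (pdx (pdx h))} /\ {for z, continuous (pdy (pdx h))} &
      {for z, continuous (pdx (pdy h))} /\ {for z, continuous (pdy (pdy h))}].

Definition harmonic_on (U : set (plane R)) (h : plane R -> R) :=
  C2_on U h /\ forall z, U z -> pdx (pdx h) z + pdy (pdy h) z = 0.

(* Only the values of g on finite_domain e matter.  The boundary values vanish
   outside a Borel set of capacity zero. *)
Definition is_green_function_infty (e : set R) (g : plane R -> R) :=
  [/\ harmonic_on (finite_domain e) g /\
        (forall z, finite_domain e z -> 0 <= g z),
      forall r : R, exists M : R, forall z,
        finite_domain e z -> modulus z <= r -> g z <= M,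
      exists r M : R, forall z,
        finite_domain e z -> r < modulus z -> `|g z - ln (modulus z)| <= M &
      exists N : set R,
        [/\ measurable (N : set (measurableTypeR R)), capacity N = 0%E &
            forall x, e x -> ~ N x ->
              g @ within (finite_domain e) (nbhs ((x, 0) : plane R)) --> (0 : R)]].

Definition usc_on {T : topologicalType} (A : set T) (u : T -> \bar R) :=
  forall x, A x -> forall a : R, (u x < a%:E)%E ->
  \forall y \near within A (nbhs x), (u y < a%:E)%E.

Definition circle (z : plane R) (r t : R) : plane R :=
  (z.1 + r * cos t, z.2 + r * sin t).

Definition circle_mean (v : plane R -> \bar R) (z : plane R) (r : R) : \bar R :=
  (((2 * pi)^-1)%:E *
     \int[@lebesgue_measure R]_(t in `[0%R, (2 * pi)%R]) v (circle z r t))%E.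

(* The chart z |-> 1 / z at the point at infinity. *)
Definition chart_infty (z : plane R) : sphere R :=
  if z == (0, 0) then None
  else Some (z.1 / modulus z ^+ 2, - z.2 / modulus z ^+ 2).

(* The function identically -oo is subharmonic. *)
Definition subharmonic_on (D : set (sphere R))
    (u : sphere R -> \bar R) :=
  [/\ forall p, D p -> (u p < +oo)%E,
      usc_on D u,
      forall z, D (Some z) ->
        \forall r \near 0^'+, (u (Some z) <= circle_mean (u \o Some) z r)%E &
      D None ->
        \forall r \near 0^'+, (u None <= circle_mean (u \o chart_infty) (0%R, 0%R) r)%E].

(* As e is a compact subset of the line, it is the boundary of domain e. *)
Definition perron_family (e : set R) (f : R -> R) :
    set (sphere R -> \bar R) :=
  [set u | subharmonic_on (domain e) u /\
     forall x, e x ->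
       (limf_esup u
          (within (domain e) (nbhs (Some (x, 0%R) : sphere R)))
        <= (f x)%:E)%E].

Definition perron_solution (e : set R) (f : R -> R) (p : sphere R) : \bar R :=
  ereal_sup [set u p | u in perron_family e f].

Definition is_harmonic_measure (e : set R) (p : sphere R)
    (om : probability (measurableTypeR R) R) :=
  om e = 1%E /\
  forall f : R -> R, {within e, continuous f} ->
    perron_solution e f p = (\int[om]_(x in e) (f x)%:E)%E.

End Potential.

Section Widom.
Context {R : realType}.

(* Only the values of w on e matter. *)
Definition is_weight (e : set R) (w : R -> R) :=
  [/\ forall x, e x -> 0 <= w x,
      usc_on e (fun x => (w x)%:E) &
      infinite_set [set x | e x /\ 0 < w x]].

Definition poly_abs (P : {poly R[i]}) (x : R) : R :=
  complex.Re `|P.[x%:C%C]|.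

Definition weighted_norm (e : set R) (w : R -> R) (P : {poly R[i]}) : \bar R :=
  ereal_sup [set (w x * poly_abs P x)%:E | x in e].

Definition residual_polys (x : R) (n : nat) : set {poly R[i]} :=
  [set P : {poly R[i]} | (size P <= n.+1)%N /\ P.[x%:C%C] = 1].

Definition monic_polys (n : nat) : set {poly R[i]} :=
  [set P : {poly R[i]} | P \is monic /\ size P = n.+1].

(* g is meant to be the Green function with pole at infinity.  For a weight w
   both infima are attained. *)
Definition widom_factor (e : set R) (g : plane R -> R) (w : R -> R)
    (xs : ext_line R) (n : nat) : \bar R :=
  match xs with
  | Some x => ((expR (n%:R * g (x, 0)))%:E *
      ereal_inf [set weighted_norm e w P | P in residual_polys x n])%E
  | None => ((fine (capacity e) ^- n)%:E *
      ereal_inf [set weighted_norm e w P | P in monic_polys n])%E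
  end.

(* om is meant to be the harmonic measure at the relevant point. *)
Definition szego_factor (e : set R) (w : R -> R)
    (om : probability (measurableTypeR R) R) : \bar R :=
  expeR (\int[om]_(x in e) lne ((w x)%:E))%E.

End Widom.

(* Main.v *)
(* Let [|w P| <= M] on e, and let [Q] be a polynomial close to [1 / w] from above.  The homogeneous Chebyshev polynomial
   [T_k (P / M, Q)] is bounded by [Q ^ k] wherever [|P / M| <= Q], but it is about [(2 P / M) ^ k / 2] where [P / M]
   dominates [Q].  Since [k^-1 ln |T_k (P / M, Q)| - n g] is subharmonic off e, it belongs to the Perron family of [ln Q],
   so that its value at [x0] is at most the integral of [ln Q] against harmonic measure.  As [Q] tends to [1 / w], this
   integral tends to [- \int ln w], and the factor [2] is what the Chebyshev polynomial gains.  For finite [x0] the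
   competing term [Q (x0) exp (- n g (x0))] vanishes in the limit because [g (x0) > 0].  The polynomial minorant of
   the weight makes [ln w] integrable and controls the places where [Q] cannot follow [1 / w].

   Harmonic measure is only known through the Perron solution, so one needs the Green function of the equilibrium
   potential (Frostman) and the fact that rho-null sets are null for harmonic measure.  For the latter, the Green
   functions with poles at infinity and at [x0] are compared near e, and hence so are the two measures on small balls. *)

(* The Green function [g] and the harmonic measure are known only through their defining properties.
   Of [g] only [green <= g] at a finite pole is proved; that suffices, because [g] enters through
   the factor [exp (n g)]. Symmetry of the Green function is replaced by Fubini's theorem: the
   potential of [om] integrated against [rho] equals that of [rho] integrated against [om], which
   Frostman's theorem evaluates. All tests are judged by the sign of a second-order expansion at a
   point. A harmonic test has no sign to spare, so a small multiple of a strictly subharmonic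
   function is added each time and removed in the limit. The Perron solution is tied to an integral
   only for continuous boundary data, while [ln (1 / w)] may be infinite at the zeros of the
   minorant; tests are therefore multiplied by a small power of a polynomial with those zeros.
   Absolute continuity is established for compact sets, where finite coverings do: the
   discontinuities of an upper semicontinuous weight form a countable union of compact sets. *)
Require Import Defs.
From HB Require Import structures.
From mathcomp Require Import all_boot all_order all_algebra.
From mathcomp Require Import complex.
From mathcomp Require Import all_classical all_reals all_analysis.
From mathcomp Require Import measurable_realfun.
From mathcomp Require Import ring lra zify.

Set Implicit Arguments.
Unset Strict Implicit.
Unset Printing Implicit Defensive.

Import Order.TTheory GRing.Theory Num.Theory.
Import numFieldNormedType.Exports.

Local Open Scope classical_set_scope.
Local Open Scope ring_scope.

(** * Second-order expansions and circle means *)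

Section Expansions.
Context {R : realType}.
Implicit Types (h u v : plane R -> R) (z : plane R).

Definition quad (a b al be ga x y : R) : R :=
  a * x + b * y + al * x ^+ 2 + be * (x * y) + ga * y ^+ 2.

(* Second-order expansion of [h] at [z] with Laplacian [2 * L]; [lexp] is its one-sided version, with positive Laplacian.
   Neither asks for derivatives in a neighbourhood. *)
Definition expn h z (L : R) := exists a b al be ga, al + ga = L /\
  forall eta, 0 < eta -> exists2 d, 0 < d & forall x y, x ^+ 2 + y ^+ 2 < d ->
    `|h (z.1 + x, z.2 + y) - (h z + quad a b al be ga x y)|
      <= eta * (x ^+ 2 + y ^+ 2).

Definition lexp h z := exists a b al be ga, 0 < al + ga /\
  exists2 d, 0 < d & forall x y, x ^+ 2 + y ^+ 2 < d ->
    h z + quad a b al be ga x y <= h (z.1 + x, z.2 + y).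

(** The product carries the max norm; squared Euclidean radii match the error terms of [expn] and
    avoid square roots. *)
Definition near_sq z (P : plane R -> Prop) :=
  exists2 d, 0 < d & forall x y, x ^+ 2 + y ^+ 2 < d -> P (z.1 + x, z.2 + y).

Lemma sqr_sum_ge0 (x y : R) : 0 <= x ^+ 2 + y ^+ 2.
Proof. by rewrite addr_ge0 // sqr_ge0. Qed.

Lemma nbhs_planeP z (P : plane R -> Prop) : (\forall w \near z, P w) <-> near_sq z P.
Proof.
split.
  move=> /nbhs_ballP[d /= d0 dP]; exists (d ^+ 2); first by rewrite exprn_gt0.
  move=> x y xy; apply: dP; split; rewrite /ball /= opprD addrA subrr sub0r normrN.
    rewrite -(@ltr_pXn2r _ 2)// ?nnegrE// ?ltW// real_normK ?num_real//.
    by rewrite (le_lt_trans _ xy)// lerDl sqr_ge0.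
  rewrite -(@ltr_pXn2r _ 2)// ?nnegrE// ?ltW// real_normK ?num_real//.
  by rewrite (le_lt_trans _ xy)// lerDr sqr_ge0.
move=> [d d0 dP]; apply/nbhs_ballP; exists (Num.sqrt (d / 2)).
  by rewrite /= sqrtr_gt0 divr_gt0.
move=> [w1 w2] [/= h1 h2].
have -> : (w1, w2) = (z.1 + (w1 - z.1), z.2 + (w2 - z.2)) by rewrite !subrKC.
apply: dP; rewrite [ltRHS](splitr d) ltrD//.
  rewrite -(@sqr_sqrtr _ (d / 2)) ?divr_ge0 ?ltW//.
  rewrite -real_normK ?num_real// ltr_pXn2r// ?nnegrE ?sqrtr_ge0//.
  by rewrite distrC.
rewrite -(@sqr_sqrtr _ (d / 2)) ?divr_ge0 ?ltW//.
rewrite -[ltLHS]real_normK ?num_real// ltr_pXn2r// ?nnegrE ?sqrtr_ge0//.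
by rewrite distrC.
Qed.

(** Lowering [al] and [ga] by [L / 4] each absorbs the error term with [eta = L / 4] and leaves half
    of the Laplacian. *)
Lemma expn_lexp h z L : 0 < L -> expn h z L -> lexp h z.
Proof.
move=> L0 [a [b [al [be [ga [alga H]]]]]].
exists a, b, (al - L / 4), be, (ga - L / 4); split; first by lra.
have [d d0 dP] := H (L / 4) ltac:(lra).
exists d => // x y /dP; rewrite ler_norml => /andP[h1 _].
rewrite -subr_ge0; move: h1; rewrite -subr_ge0 => h1.
apply: le_trans h1 _; rewrite /quad; lra.
Qed.

(** Touching from below: this is how the maximum of a test function and a constant is handled. *)
Lemma lexp_le h u z : lexp u z -> u z = h z -> near_sq z (fun w => u w <= h w) ->
  lexp h z.
Proof.
move=> [a [b [al [be [ga [alga [d d0 H]]]]]]] uh [d' d'0 H'].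
exists a, b, al, be, ga; split => //; exists (Num.min d d').
  by rewrite lt_min d0.
move=> x y; rewrite lt_min => /andP[/H h1 /H' h2].
by rewrite -uh (le_trans h1).
Qed.

(** Summed over the four points at distance [s] on the axes, the linear and mixed terms cancel and
    [2 * (al + ga) * s ^+ 2] remains, so one of the four values exceeds [h z]. *)
Lemma lexp_not_max h z : lexp h z ->
  forall d, 0 < d -> exists x y, x ^+ 2 + y ^+ 2 < d /\ h z < h (z.1 + x, z.2 + y).
Proof.
move=> [a [b [al [be [ga [alga [d' d'0 H]]]]]]] d d0.
pose m := Num.min d d'; have m0 : 0 < m by rewrite lt_min d0.
pose s := Num.sqrt (m / 2).
have s0 : 0 < s by rewrite sqrtr_gt0 divr_gt0.
have s2 : s ^+ 2 = m / 2 by rewrite sqr_sqrtr ?divr_ge0// ltW.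
have md : m <= d by rewrite ge_min lexx.
have md' : m <= d' by rewrite ge_min lexx orbT.
have ss0 : 0 < s ^+ 2 by rewrite s2; lra.
have H1 := H s 0 ltac:(rewrite expr0n/=; lra).
have H2 := H (- s) 0 ltac:(rewrite expr0n sqrrN/=; lra).
have H3 := H 0 s ltac:(rewrite expr0n/=; lra).
have H4 := H 0 (- s) ltac:(rewrite expr0n sqrrN/=; lra).
apply: contrapT => /forallNP HN.
have G x y : x ^+ 2 + y ^+ 2 < d -> h (z.1 + x, z.2 + y) <= h z.
  by move=> xy; rewrite leNgt; apply/negP => hz; apply: (HN x); exists y.
have G1 := G s 0 ltac:(rewrite expr0n/=; lra).
have G2 := G (- s) 0 ltac:(rewrite expr0n sqrrN/=; lra).
have G3 := G 0 s ltac:(rewrite expr0n/=; lra).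
have G4 := G 0 (- s) ltac:(rewrite expr0n sqrrN/=; lra).
have al0 : (al + ga) * s ^+ 2 > 0 by rewrite mulr_gt0.
rewrite /quad sqrrN !expr0n /= in H1 H2 H3 H4.
lra.
Qed.

Lemma expnD h u z L K : expn h z L -> expn u z K -> expn (h \+ u) z (L + K).
Proof.
move=> [a [b [al [be [ga [<- H]]]]]] [a' [b' [al' [be' [ga' [<- H']]]]]].
exists (a + a'), (b + b'), (al + al'), (be + be'), (ga + ga'); split; first by ring.
move=> eta eta0.
have [d d0 dP] := H (eta / 2) ltac:(lra).
have [d' d'0 dP'] := H' (eta / 2) ltac:(lra).
exists (Num.min d d'); first by rewrite lt_min d0.
move=> x y; rewrite lt_min => /andP[/dP h1 /dP' h2].
rewrite (splitr eta) mulrDl (le_trans _ (lerD h1 h2))// (le_trans _ (ler_normD _ _))//.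
by rewrite le_eqVlt; apply/orP; left; apply/eqP; congr (`|_|); rewrite /quad /=; ring.
Qed.

Lemma expnZ c h z L : expn h z L -> expn (fun w => c * h w) z (c * L).
Proof.
move=> [a [b [al [be [ga [<- H]]]]]].
exists (c * a), (c * b), (c * al), (c * be), (c * ga); split; first by ring.
move=> eta eta0.
have c1 : 0 < `|c| + 1 by rewrite ltr_wpDl.
have [d d0 dP] := H (eta / (`|c| + 1)) ltac:(by rewrite divr_gt0).
exists d => // x y /dP h1.
have -> : c * h (z.1 + x, z.2 + y) -
    (c * h z + quad (c * a) (c * b) (c * al) (c * be) (c * ga) x y) =
   c * (h (z.1 + x, z.2 + y) - (h z + quad a b al be ga x y)).
  by rewrite /quad; ring.
rewrite normrM (le_trans (ler_wpM2l (normr_ge0 c) h1))//.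
rewrite mulrA ler_wpM2r ?sqr_sum_ge0// mulrCA ger_pMr//.
by rewrite ler_pdivrMr// mul1r lerDl.
Qed.

Lemma expn_cst c z : expn (fun=> c) z 0.
Proof.
exists 0, 0, 0, 0, 0; split; first by rewrite addr0.
move=> eta eta0; exists 1 => // x y _.
by rewrite /quad !mul0r !addr0 subrr normr0 mulr_ge0 ?sqr_sum_ge0// ltW.
Qed.

Lemma expn_near h u z L : expn u z L -> u z = h z ->
  near_sq z (fun w => u w = h w) -> expn h z L.
Proof.
move=> [a [b [al [be [ga [aL H]]]]]] uh [d' d'0 H'].
exists a, b, al, be, ga; split => // eta /H[d d0 dP].
exists (Num.min d d'); first by rewrite lt_min d0.
by move=> x y; rewrite lt_min => /andP[/dP h1 /H' <-]; rewrite -uh.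
Qed.

Lemma expn_cont h z L : expn h z L -> {for z, continuous h}.
Proof.
move=> [a [b [al [be [ga [_ H]]]]]].
apply/cvgrPdist_lt => e e0; apply/nbhs_planeP.
have [d d0 dP] := H 1 ltr01.
pose B := `|a| + `|b| + `|al| + `|be| + `|ga| + 1 + 1.
have B0 : 0 < B by rewrite ltr_wpDl// !addr_ge0.
pose m := Num.min 1 (e / B).
have m0 : 0 < m by rewrite lt_min ltr01 divr_gt0.
exists (Num.min d (m ^+ 2)); first by rewrite lt_min d0 exprn_gt0.
move=> x y; rewrite lt_min => /andP[/dP h1 h2].
have m1 : m <= 1 by rewrite ge_min lexx.
have mm : m ^+ 2 <= m by rewrite expr2 ger_pMr.
have hx : `|x| <= m.
  rewrite -(@ler_pXn2r _ 2)// ?nnegrE ?(ltW m0)// real_normK ?num_real//.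
  by rewrite (le_trans _ (ltW h2))// lerDl sqr_ge0.
have hy : `|y| <= m.
  rewrite -(@ler_pXn2r _ 2)// ?nnegrE ?(ltW m0)// real_normK ?num_real//.
  by rewrite (le_trans _ (ltW h2))// lerDr sqr_ge0.
have hx2 : x ^+ 2 <= m by rewrite (le_trans _ mm)// (le_trans _ (ltW h2))// lerDl sqr_ge0.
have hy2 : y ^+ 2 <= m by rewrite (le_trans _ mm)// (le_trans _ (ltW h2))// lerDr sqr_ge0.
have hxy : `|x * y| <= m.
  by rewrite normrM -[leRHS]mulr1 ler_pM// (le_trans hy).
have Q : `|quad a b al be ga x y| <= (`|a| + `|b| + `|al| + `|be| + `|ga|) * m.
  rewrite /quad !mulrDl.
  do 4 (apply: le_trans (ler_normD _ _) _; apply: lerD; last first;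
    first by rewrite normrM ler_wpM2l// ger0_norm ?sqr_ge0).
  by rewrite normrM ler_wpM2l.
have Bm : B * m <= e by rewrite mulrC -ler_pdivlMr// ge_min lexx orbT.
have : `|h (z.1 + x, z.2 + y) - h z| < B * m.
  have -> : h (z.1 + x, z.2 + y) - h z =
     (h (z.1 + x, z.2 + y) - (h z + quad a b al be ga x y)) + quad a b al be ga x y by ring.
  rewrite (le_lt_trans (ler_normD _ _))//.
  apply: (@le_lt_trans _ _ (m + (`|a| + `|b| + `|al| + `|be| + `|ga|) * m)).
    rewrite lerD// (le_trans h1)// mul1r; exact: le_trans (ltW h2) mm.
  rewrite /B; lra.
by move=> /lt_le_trans /(_ Bm); rewrite distrC.
Qed.

End Expansions.

Section Mean.
Context {R : realType}.
Implicit Types (h : plane R -> R) (z : plane R).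

Lemma quad_circle_continuous (c a b al be ga r : R) :
  continuous (fun t : R => c + quad a b al be ga (r * cos t) (r * sin t)).
Proof.
move=> x; apply/differentiable_continuous/derivable1_diffP; rewrite /quad.
apply: ex_derive; apply: is_derive_eq; reflexivity.
Qed.

Lemma integral_quad (c a b al be ga r : R) :
  (\int[@lebesgue_measure R]_(t in `[0%R, (2 * pi)%R])
     (c + quad a b al be ga (r * cos t) (r * sin t))%:E =
   (2 * pi * c + pi * r ^+ 2 * (al + ga))%:E)%E.
Proof.
pose F (t : R) : R := c * t + a * r * sin t - b * r * cos t + al * r ^+ 2 * 2^-1 * (t + sin t * cos t)
  + be * r ^+ 2 * 2^-1 * (sin t * sin t) + ga * r ^+ 2 * 2^-1 * (t - sin t * cos t).
have dF (t : R) : is_derive t (1 : R) F (c + quad a b al be ga (r * cos t) (r * sin t)).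
  rewrite /F; apply: is_derive_eq.
  rewrite /quad /GRing.scale /=.
  have H := cos2Dsin2 t.
  (* The derivatives agree only modulo [cos t ^+ 2 + sin t ^+ 2 = 1]; the right multiple of this
     relation is supplied by hand so that [field] can finish. *)
  have E : forall u v w : R, u = v + w * (cos t ^+ 2 + sin t ^+ 2 - 1) -> u = v.
    by move=> u v w ->; rewrite H subrr mulr0 addr0.
  apply: (E _ _ (- (al * r ^+ 2 * 2^-1) - ga * r ^+ 2 * 2^-1)); by field.
have cF : continuous F.
  by move=> x; apply/differentiable_continuous/derivable1_diffP; case: (dF x).
have pi2 : 0 < 2 * (pi : R) by rewrite mulr_gt0 ?pi_gt0.
have cf := @quad_circle_continuous c a b al be ga r.
rewrite (@continuous_FTC2 _ _ F)//.
- rewrite -EFinB; congr EFin; rewrite /F.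
  have -> : sin (2 * pi) = 0 :> R by rewrite mulr_natl -[_ *+ _]add0r sinD2pi sin0.
  have -> : cos (2 * pi) = 1 :> R by rewrite mulr_natl -[_ *+ _]add0r cosD2pi cos0.
  by rewrite sin0 cos0; field.
- exact: continuous_subspaceT.
- split.
  + by move=> x _; case: (dF x).
  + exact/cvg_at_right_filter/cF.
  + exact/cvg_at_left_filter/cF.
- by move=> x _; rewrite derive1E; case: (dF x).
Qed.

Lemma circle_continuous z (r t : R) : {for t, continuous (circle z r : R -> plane R)}.
Proof.
have C (f : R -> R) (c : R) : {for t, continuous f} -> {for t, continuous (fun x => c + r * f x)}.
  by move=> cf; apply: continuousD; [exact: cst_continuous|apply: continuousM => //; exact: cst_continuous].
exact: (cvg_pair (C cos z.1 (@continuous_cos R t)) (C sin z.2 (@continuous_sin R t))).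
Qed.

(* A strictly positive Laplacian makes the lower second-order bound beat the value at the centre. *)
Lemma circle_mean_ge h z : near_sq z (fun w => {for w, continuous h}) -> lexp h z ->
  \forall r \near 0^'+, ((h z)%:E <= circle_mean (EFin \o h) z r)%E.
Proof.
move=> [d d0 dc] [a [b [al [be [ga [alga [d' d'0 dl]]]]]]].
pose m := Num.sqrt (Num.min d d').
have mm0 : 0 < Num.min d d' by rewrite lt_min d0.
have m0 : 0 < m by rewrite sqrtr_gt0.
near=> r.
have r0 : 0 < r by near: r; exact: nbhs_right_gt.
have rm : r < m by near: r; exact: nbhs_right_lt.
have r2 : r ^+ 2 < Num.min d d'.
  by rewrite -(sqr_sqrtr (ltW mm0)) ltr_pXn2r ?nnegrE// ltW.
have cs t : (r * cos t) ^+ 2 + (r * sin t) ^+ 2 = r ^+ 2.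
  by rewrite !exprMn -mulrDr cos2Dsin2 mulr1.
have ch : {within `[0, 2 * pi], continuous (h \o circle z r : R -> R)}.
  apply: continuous_subspaceT => t.
  apply: continuous_comp; first exact: circle_continuous.
  by apply: dc; rewrite cs; move: r2; rewrite lt_min => /andP[].
have pi2 : 0 < 2 * (pi : R) by rewrite mulr_gt0 ?pi_gt0.
rewrite /circle_mean -lee_pdivrMl//; last by rewrite invr_gt0.
rewrite invrK -EFinM.
have cq := @quad_circle_continuous (h z) a b al be ga r.
apply: (@le_trans _ _ (2 * pi * h z + pi * r ^+ 2 * (al + ga))%:E).
  by rewrite lee_fin lerDl mulr_ge0 ?mulr_ge0 ?pi_ge0// ?sqr_ge0// ltW.
rewrite -(integral_quad (h z) a b al be ga r).
apply: le_integral => //.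
- by apply: continuous_compact_integrable; [exact: segment_compact|exact: continuous_subspaceT].
- by apply: continuous_compact_integrable; [exact: segment_compact|].
- move=> t _ /=; rewrite lee_fin /circle; apply: dl; rewrite cs.
  by move: r2; rewrite lt_min => /andP[].
Unshelve. all: by end_near.
Qed.

End Mean.

(** * Logarithmic potentials *)

Section LogKernel.
Context {R : realType}.
Implicit Types (z : plane R).

(* [lam 0 x y] is the logarithm of the modulus, with junk value [0] at the origin; [k > 0] removes the singularity. *)
Definition lam (k x y : R) : R := 2^-1 * ln (x ^+ 2 + y ^+ 2 + k).

(** The remainder has derivative [x ^+ 2 / (1 + x)], at most twice [q ^+ 2] between [0] and [q]
    because [1 + x >= 1 / 2] there; the mean value theorem supplies the third power. *)
Lemma ln1D_taylor2 (q : R) : `|q| <= 2^-1 -> `|ln (1 + q) - q + q ^+ 2 / 2| <= 2 * `|q| ^+ 3.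
Proof.
move=> q12.
pose F (x : R) : R := ln (1 + x) - x + x ^+ 2 / 2.
have dF (x : R) : -1 < x -> is_derive x (1 : R) F (x ^+ 2 / (1 + x)).
  move=> x1; have x10 : 0 < 1 + x by lra.
  have dl : is_derive x (1:R) (fun y : R => ln (1 + y)) ((1 + x)^-1).
    have := @is_derive1_comp R (@ln R) (fun y : R => 1 + y) x (1 + x)^-1 1 (is_derive1_ln x10).
    rewrite mulr1 => H; apply: H; rewrite -[X in is_derive _ _ _ X]add0r.
    exact: is_deriveD.
  rewrite /F; apply: is_derive_eq; rewrite /GRing.scale /=; field; lra.
have F0 : F 0 = 0 by rewrite /F addr0 ln1 expr0n /=; ring.
have bnd (x : R) : `|x| <= `|q| -> `|x ^+ 2 / (1 + x)| <= 2 * `|q| ^+ 2.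
  move=> xq; have : `|x| <= 2^-1 by apply: le_trans q12.
  rewrite ler_norml => /andP[h1 h2].
  rewrite normrM normfV (ger0_norm (sqr_ge0 x)) (@ger0_norm _ (1 + x)); last lra.
  rewrite mulrC; apply: ler_pM; rewrite ?invr_ge0 ?sqr_ge0//; try lra.
    by rewrite invf_ple ?posrE; lra.
  by rewrite -real_normK ?num_real// lerXn2r ?nnegrE.
have main : `|F q| <= 2 * `|q| ^+ 3.
  have [q0|q0] := leP 0 q.
    have [x xi E] : exists2 c, c \in `[0, q] & F q - F 0 = c ^+ 2 / (1 + c) * (q - 0).
      apply: (@MVT_segment _ F (fun c => c ^+ 2 / (1 + c))) => //.
        by move=> x; rewrite in_itv/= => /andP[h _]; apply: dF; lra.
      apply: derivable_within_continuous => x; rewrite in_itv/= => /andP[h _].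
      by case: (dF x ltac:(lra)).
    rewrite F0 !subr0 in E; rewrite E normrM exprS mulrA.
    rewrite [leRHS]mulrAC; apply: ler_wpM2r => //; apply: bnd.
    by move: xi; rewrite in_itv/= => /andP[h1 h2]; rewrite !ger0_norm.
  have [x xi E] : exists2 c, c \in `[q, 0] & F 0 - F q = c ^+ 2 / (1 + c) * (0 - q).
    have qm : - 2^-1 <= q by move: q12; rewrite ler_norml => /andP[].
    apply: (@MVT_segment _ F (fun c => c ^+ 2 / (1 + c))); first exact: ltW.
      by move=> x; rewrite in_itv/= => /andP[h _]; apply: dF; lra.
    apply: derivable_within_continuous => x; rewrite in_itv/= => /andP[h _].
    by case: (dF x ltac:(lra)).
  rewrite F0 !sub0r in E; rewrite -normrN E normrM normrN exprS mulrA.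
  rewrite [leRHS]mulrAC; apply: ler_wpM2r => //; apply: bnd.
  by move: xi; rewrite in_itv/= => /andP[h1 h2]; rewrite !ler0_norm ?lerN2// ltW.
by [].
Qed.

(** The shifted argument of the logarithm is [S * (1 + q)] with [q = 2 * D + u ^+ 2], where [u] is
    the length of the increment divided by the square root of [S], and [D] is at most [u] in modulus
    by Cauchy-Schwarz. The bound [s0 / 36] gives [u <= 1 / 6], hence [q] is at most [1 / 2] in
    modulus; [29] is [27], from the cube of [3 * u], plus two leftover terms. The error is expressed
    in [s0] rather than [S] to be uniform when integrated over the pole. *)
Lemma lam_taylor (k s0 x y v w S : R) : S = x ^+ 2 + y ^+ 2 + k ->
  0 < s0 -> 0 <= k -> s0 <= S -> v ^+ 2 + w ^+ 2 <= s0 / 36 ->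
  `|lam k (x + v) (y + w) - (lam k x y +
     quad (x / S) (y / S) ((2 * S)^-1 - (x / S) ^+ 2) (- (2 * (x / S) * (y / S)))
        ((2 * S)^-1 - (y / S) ^+ 2) v w)|
   <= 29 * Num.sqrt ((v ^+ 2 + w ^+ 2) / s0) * ((v ^+ 2 + w ^+ 2) / s0).
Proof.
move=> SE s00 k0 s0S mS.
have S0 : 0 < S by apply: lt_le_trans s0S.
set m2 := v ^+ 2 + w ^+ 2 in mS *.
have m20 : 0 <= m2 by rewrite sqr_sum_ge0.
pose u := Num.sqrt (m2 / S).
have u0 : 0 <= u by rewrite sqrtr_ge0.
have u2 : u ^+ 2 = m2 / S by rewrite sqr_sqrtr ?divr_ge0// ltW.
pose D := (x * v + y * w) / S.
have D2 : D ^+ 2 <= u ^+ 2.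
  have -> : D ^+ 2 = (x * v + y * w) ^+ 2 / S / S by rewrite /D; field; rewrite gt_eqF.
  rewrite u2 ler_pM2r ?invr_gt0// ler_pdivrMr//.
  rewrite -subr_ge0; have -> : m2 * S - (x * v + y * w) ^+ 2 = (x * w - y * v) ^+ 2 + m2 * k.
    by rewrite /m2 SE; ring.
  by rewrite addr_ge0 ?sqr_ge0// mulr_ge0.
have Du : `|D| <= u by rewrite -(ger0_norm u0) -ler_sqr ?nnegrE// !real_normK ?num_real.
have u16 : u <= 6^-1.
  rewrite -ler_sqr ?nnegrE ?invr_ge0// u2 ler_pdivrMr//.
  apply: le_trans mS _; rewrite exprVn mulrC (_ : 6 ^+ 2 = 36); first by rewrite ler_pM2l ?invr_gt0.
  by rewrite -natrX.
pose q := 2 * D + u ^+ 2.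
have uu : u ^+ 2 <= u / 6 by rewrite expr2 ler_wpM2l.
have q3 : `|q| <= 3 * u.
  rewrite /q (le_trans (ler_normD _ _))// normrM (ger0_norm (sqr_ge0 u)) ger0_norm//; lra.
have q12 : `|q| <= 2^-1 by lra.
have q1 : 0 < 1 + q by move: q12; rewrite ler_norml => /andP[]; lra.
have E : (x + v) ^+ 2 + (y + w) ^+ 2 + k = S * (1 + q).
  rewrite /q u2 /D /m2 mulrDr mulr1 {1}SE; field; by rewrite gt_eqF.
have T := ln1D_taylor2 q12.
rewrite /lam E lnM ?posrE// -SE.
have -> : 2^-1 * (ln S + ln (1 + q)) - (2^-1 * ln S + quad (x / S) (y / S)
     ((2 * S)^-1 - (x / S) ^+ 2) (- (2 * (x / S) * (y / S))) ((2 * S)^-1 - (y / S) ^+ 2) v w)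
   = 2^-1 * (ln (1 + q) - q + q ^+ 2 / 2) - D * u ^+ 2 - u ^+ 4 / 4.
  have -> : u ^+ 4 = u ^+ 2 * u ^+ 2 by ring.
  by rewrite /q /quad u2 /D /m2; field; rewrite gt_eqF.
have us : u <= Num.sqrt (m2 / s0) by rewrite ler_wsqrtr// ler_wpM2l// lef_pV2 ?posrE.
have us2 : u ^+ 2 <= m2 / s0 by rewrite u2 ler_wpM2l// lef_pV2 ?posrE.
apply: (@le_trans _ _ (29 * (u * u ^+ 2))); last first.
  by rewrite -mulrA ler_wpM2l// ler_pM ?sqr_ge0.
have q33 : `|q| ^+ 3 <= 27 * (u * u ^+ 2).
  have -> : 27 * (u * u ^+ 2) = (3 * u) ^+ 3 by ring.
  by rewrite lerXn2r ?nnegrE ?mulr_ge0.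
have h1 : `|D * u ^+ 2| <= u * u ^+ 2.
  by rewrite normrM (ger0_norm (sqr_ge0 u)) ler_wpM2r ?sqr_ge0.
have h2 : `|u ^+ 4 / 4| <= u * u ^+ 2.
  rewrite ger0_norm; last by rewrite divr_ge0// exprn_ge0.
  have -> : u ^+ 4 / 4 = u * u ^+ 2 * (u / 4) by ring.
  by rewrite ler_piMr ?mulr_ge0 ?sqr_ge0//; lra.
have h3 : `|2^-1 * (ln (1 + q) - q + q ^+ 2 / 2)| <= 27 * (u * u ^+ 2).
  by rewrite normrM ger0_norm ?invr_ge0// (le_trans _ q33)//; lra.
apply: le_trans (ler_normB _ _) _; apply: le_trans (lerD (ler_normB _ _) (lexx _)) _; lra.
Qed.

(** The Laplacian is zero for [k = 0], away from the pole, and positive for [k > 0]: the regularized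
    kernels supply the strictly subharmonic perturbations used below. *)
Lemma expn_lam (k : R) (t z : plane R) : 0 <= k ->
  0 < (z.1 - t.1) ^+ 2 + (z.2 - t.2) ^+ 2 + k ->
  expn (fun w => lam k (w.1 - t.1) (w.2 - t.2)) z
    (k / ((z.1 - t.1) ^+ 2 + (z.2 - t.2) ^+ 2 + k) ^+ 2).
Proof.
set x := z.1 - t.1; set y := z.2 - t.2; set S := _ + k => k0 S0.
exists (x / S), (y / S), ((2 * S)^-1 - (x / S) ^+ 2), (- (2 * (x / S) * (y / S))),
  ((2 * S)^-1 - (y / S) ^+ 2); split.
  by rewrite /S; field; rewrite gt_eqF.
move=> eta eta0.
exists (Num.min (S / 36) (((eta * S) / 29) ^+ 2 * S)).
  by rewrite lt_min divr_gt0//= mulr_gt0// exprn_gt0// divr_gt0// mulr_gt0.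
move=> v w; rewrite lt_min => /andP[/ltW h1 /ltW h2] /=.
have -> : z.1 + v - t.1 = x + v by rewrite /x; ring.
have -> : z.2 + w - t.2 = y + w by rewrite /y; ring.
apply: le_trans (lam_taylor erefl S0 k0 (lexx _) h1) _.
rewrite mulrCA mulrC ler_wpM2r ?sqr_sum_ge0//.
rewrite ler_pdivrMr//.
have := @ler_wsqrtr R ((v ^+ 2 + w ^+ 2) / S) ((eta * S / 29) ^+ 2).
rewrite ler_pdivrMr// => /(_ h2); rewrite sqrtr_sqr ger0_norm; last first.
  by rewrite divr_ge0// mulr_ge0// ltW.
by lra.
Qed.

Lemma lam_bound (s B k x y : R) : 0 < s -> s <= x ^+ 2 + y ^+ 2 + k <= B ->
  `|lam k x y| <= `|ln s| + `|ln B|.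
Proof.
move=> s0 /andP[h1 h2].
have S0 := lt_le_trans s0 h1.
have l1 : ln s <= ln (x ^+ 2 + y ^+ 2 + k) by rewrite ler_ln ?posrE.
have l2 : ln (x ^+ 2 + y ^+ 2 + k) <= ln B by rewrite ler_ln ?posrE// (lt_le_trans S0).
have a1 := ler_norm (- ln s); have a2 := ler_norm (ln B).
rewrite normrN in a1.
have a3 := normr_ge0 (ln s); have a4 := normr_ge0 (ln B).
rewrite /lam ler_norml; apply/andP; split; lra.
Qed.

Lemma measurable_lam (D : set (measurableTypeR R)) (k x y : R) :
  measurable_fun D (fun t : measurableTypeR R => lam k (x - t) y).
Proof.
apply: measurable_funS (@measurableT _ _) (@subsetT _ _) _.
apply: measurable_funM => //.
apply: (measurableT_comp (@measurable_ln R)).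
apply: measurable_funD => //; apply: measurable_funD => //.
by apply: measurable_funX; apply: measurable_funB.
Qed.

End LogKernel.

Section LogPotential.
Context {R : realType} (mu : probability (measurableTypeR R) R).
Implicit Types (D : set (measurableTypeR R)) (z : plane R).

Lemma bnd_integrable D (f : R -> R) M : measurable D -> measurable_fun D f ->
  (forall t, D t -> `|f t| <= M) -> mu.-integrable D (EFin \o f).
Proof.
move=> mD mf fM; apply: measurable_bounded_integrable => //.
  by rewrite (le_lt_trans (probability_le1 _ mD))// ltry.
exists M; split; rewrite ?num_real// => N MN t Dt /=.
exact: le_trans (fM _ Dt) (ltW MN).
Qed.

Lemma intD D (f g : R -> R) : measurable D -> mu.-integrable D (EFin \o f) ->
  mu.-integrable D (EFin \o g) -> mu.-integrable D (EFin \o (fun x => f x + g x)).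
Proof. by move=> mD If Ig; exact: (integrableD mD If Ig). Qed.

Lemma intB D (f g : R -> R) : measurable D -> mu.-integrable D (EFin \o f) ->
  mu.-integrable D (EFin \o g) -> mu.-integrable D (EFin \o (fun x => f x - g x)).
Proof. by move=> mD If Ig; exact: (integrableB mD If Ig). Qed.

Lemma intZl D (f : R -> R) c : measurable D -> mu.-integrable D (EFin \o f) ->
  mu.-integrable D (EFin \o (fun x => c * f x)).
Proof. by move=> mD If; exact: (integrableZl mD c If). Qed.

Lemma intZr D (f : R -> R) c : measurable D -> mu.-integrable D (EFin \o f) ->
  mu.-integrable D (EFin \o (fun x => f x * c)).
Proof.
move=> mD If; have -> : (fun x => f x * c) = (fun x => c * f x) by apply/funext => x; rewrite mulrC.
exact: intZl.
Qed.

Lemma Rint_quad D (a b al be ga : R -> R) v w : measurable D ->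
  mu.-integrable D (EFin \o a) -> mu.-integrable D (EFin \o b) -> mu.-integrable D (EFin \o al) ->
  mu.-integrable D (EFin \o be) -> mu.-integrable D (EFin \o ga) ->
  mu.-integrable D (EFin \o (fun t => quad (a t) (b t) (al t) (be t) (ga t) v w)) /\
  \int[mu]_(t in D) quad (a t) (b t) (al t) (be t) (ga t) v w =
  quad (\int[mu]_(t in D) a t) (\int[mu]_(t in D) b t) (\int[mu]_(t in D) al t)
    (\int[mu]_(t in D) be t) (\int[mu]_(t in D) ga t) v w.
Proof.
move=> mD ia ib ial ibe iga; rewrite /quad.
have i1 := intZr v mD ia; have i2 := intZr w mD ib.
have i3 := intZr (v ^+ 2) mD ial; have i4 := intZr (v * w) mD ibe.
have i5 := intZr (w ^+ 2) mD iga.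
have i12 := intD mD i1 i2; have i123 := intD mD i12 i3; have i1234 := intD mD i123 i4.
split; first exact: (intD mD i1234 i5).
by rewrite (RintegralD mD i1234 i5) (RintegralD mD i123 i4) (RintegralD mD i12 i3)
  (RintegralD mD i1 i2) !RintegralZr.
Qed.

Definition Lpot (k : R) D z : R := \int[mu]_(t in D) lam k (z.1 - t) z.2.

Lemma lam_integrable D (b k s x y : R) : measurable D -> (forall t, D t -> `|t| <= b) ->
  0 < s -> (forall t, D t -> s <= (x - t) ^+ 2 + y ^+ 2 + k) ->
  mu.-integrable D (EFin \o (fun t => lam k (x - t) y)).
Proof.
move=> mD Db s0 sD; apply: bnd_integrable => //.
  exact: measurable_lam.
move=> t Dt; apply: (@lam_bound _ s ((`|x| + b) ^+ 2 + y ^+ 2 + k)) => //.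
rewrite sD//= -!addrA lerD2r -real_normK ?num_real// lerXn2r ?nnegrE//.
  by rewrite addr_ge0// (le_trans _ (Db _ Dt)).
by rewrite (le_trans (ler_normB _ _))// lerD2l Db.
Qed.

(** The expansions of [lam_taylor] are integrated coefficient by coefficient; [s] makes their error
    uniform in the pole. The resulting [L] is the integral of [k / S ^+ 2]. *)
Lemma expn_Lpot D (b k s z1 z2 : R) : measurable D -> (forall t, D t -> `|t| <= b) ->
  0 <= k -> 0 < s -> (forall t, D t -> s <= (z1 - t) ^+ 2 + z2 ^+ 2 + k) ->
  exists L, [/\ 0 <= L, k = 0 -> L = 0 & expn (Lpot k D) (z1, z2) L].
Proof.
move=> mD Db k0 s0 sD.
(* Cut off at [s], so that the coefficients are continuous on the whole line and therefore
   measurable. *)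
pose S (t : R) := Num.max s ((z1 - t) ^+ 2 + z2 ^+ 2 + k).
have SE t : D t -> S t = (z1 - t) ^+ 2 + z2 ^+ 2 + k by move=> /sD h; rewrite /S max_r.
have sS t : s <= S t by rewrite le_max lexx.
have S0 t : 0 < S t by rewrite (lt_le_trans s0).
have cS : continuous S.
  move=> t; apply: (@continuous_max R R (cst s) (fun t => (z1 - t) ^+ 2 + z2 ^+ 2 + k)).
    exact: cst_continuous.
  have c1 : {for t, continuous (fun t : R => z1 - t)}.
    by apply: continuousB; [exact: cst_continuous|].
  have -> : (fun t : R => (z1 - t) ^+ 2 + z2 ^+ 2 + k) =
            (fun t : R => (z1 - t) * (z1 - t) + z2 ^+ 2 + k) by apply/funext => u; rewrite expr2.
  apply: continuousD; last exact: cst_continuous.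
  apply: continuousD; last exact: cst_continuous.
  exact: continuousM.
have cV : continuous (fun t => (S t)^-1) by move=> t; apply: cvgV; [rewrite gt_eqF|exact: cS].
have mV : measurable_fun setT (fun t : measurableTypeR R => (S t)^-1).
  exact: continuous_measurable_fun.
have mx : measurable_fun setT (fun t : measurableTypeR R => z1 - t) by apply: measurable_funB.
pose p (t : R) := (z1 - t) / S t.
pose q (t : R) := z2 / S t.
have mp : measurable_fun setT (p : measurableTypeR R -> R) by apply: measurable_funM.
have mq : measurable_fun setT (q : measurableTypeR R -> R) by apply: measurable_funM.
have bV t : (S t)^-1 <= s^-1 by rewrite lef_pV2 ?posrE.
have bz : 0 <= `|z1| + `|b| + `|z2| by rewrite !addr_ge0.
have bp t : D t -> `|p t| <= (`|z1| + `|b| + `|z2|) / s.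
  move=> Dt; rewrite normrM normfV (gtr0_norm (S0 t)); apply: ler_pM; rewrite ?invr_ge0 ?(ltW (S0 t))//.
  rewrite (le_trans (ler_normB _ _))// -addrA lerD2l (le_trans (Db _ Dt))//.
  by rewrite (le_trans (ler_norm _))// lerDl.
have bq t : D t -> `|q t| <= (`|z1| + `|b| + `|z2|) / s.
  move=> Dt; rewrite normrM normfV (gtr0_norm (S0 t)); apply: ler_pM; rewrite ?invr_ge0 ?(ltW (S0 t))//.
  by rewrite lerDr addr_ge0.
set B := _ / s in bp bq.
have B0 : 0 <= B by rewrite divr_ge0// ltW.
have ip : mu.-integrable D (EFin \o p).
  by apply: (bnd_integrable mD _ bp); exact: measurable_funS (@measurableT _ _) (@subsetT _ _) mp.
have iq : mu.-integrable D (EFin \o q).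
  by apply: (bnd_integrable mD _ bq); exact: measurable_funS (@measurableT _ _) (@subsetT _ _) mq.
pose al (t : R) := (2 * S t)^-1 - p t ^+ 2.
pose be (t : R) := - (2 * p t * q t).
pose ga (t : R) := (2 * S t)^-1 - q t ^+ 2.
have m2 : measurable_fun setT (fun t : measurableTypeR R => (2 * S t)^-1).
  have -> : (fun t : measurableTypeR R => (2 * S t)^-1) = (fun t => 2^-1 * (S t)^-1).
    by apply/funext => t; rewrite invfM.
  exact: measurable_funM.
have b2 t : `|(2 * S t)^-1| <= s^-1.
  rewrite ger0_norm ?invr_ge0 ?mulr_ge0 ?(ltW (S0 t))// invfM (le_trans _ (bV t))//.
  by rewrite ler_piMl ?invr_ge0 ?(ltW (S0 t))//; lra.
have sqle u : `|u| <= B -> `|u ^+ 2| <= B ^+ 2.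
  by move=> uB; rewrite normrX lerXn2r ?nnegrE.
have ial : mu.-integrable D (EFin \o al).
  apply: (@bnd_integrable _ _ (s^-1 + B ^+ 2)) => //.
    apply: measurable_funS (@measurableT _ _) (@subsetT _ _) _.
    by apply: measurable_funB => //; exact: measurable_funX.
  by move=> t Dt; rewrite (le_trans (ler_normB _ _))// lerD// sqle// bp.
have iga : mu.-integrable D (EFin \o ga).
  apply: (@bnd_integrable _ _ (s^-1 + B ^+ 2)) => //.
    apply: measurable_funS (@measurableT _ _) (@subsetT _ _) _.
    by apply: measurable_funB => //; exact: measurable_funX.
  by move=> t Dt; rewrite (le_trans (ler_normB _ _))// lerD// sqle// bq.
have ibe : mu.-integrable D (EFin \o be).
  apply: (@bnd_integrable _ _ (2 * (B * B))) => //.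
    apply: measurable_funS (@measurableT _ _) (@subsetT _ _) _.
    by apply: measurableT_comp => //; apply: measurable_funM => //; exact: measurable_funM.
  move=> t Dt; rewrite normrN -mulrA normrM ger0_norm// ler_wpM2l// normrM ler_pM//.
    exact: bp.
  exact: bq.
have i0 : mu.-integrable D (EFin \o (fun t => lam k (z1 - t) z2)) by exact: (lam_integrable mD Db s0).
have agE t : D t -> al t + ga t = k / S t ^+ 2.
  move=> Dt; rewrite /al /ga /p /q.
  have := SE t Dt; set T := S t => E.
  have -> : k = T - (z1 - t) ^+ 2 - z2 ^+ 2 by rewrite E; ring.
  by field; rewrite gt_eqF// /T.
exists (\int[mu]_(t in D) (al t + ga t)); split.
- by apply: Rintegral_ge0 => t Dt; rewrite agE// divr_ge0// exprn_ge0// ltW.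
- move=> k00; transitivity (\int[mu]_(t in D) (0 : R)).
    by apply: eq_Rintegral => t /[!inE] Dt; rewrite agE// k00 mul0r.
  by rewrite Rintegral_cst// mul0r.
exists (\int[mu]_(t in D) p t), (\int[mu]_(t in D) q t), (\int[mu]_(t in D) al t),
  (\int[mu]_(t in D) be t), (\int[mu]_(t in D) ga t); split; first exact: (esym (RintegralD mD ial iga)).
move=> eta eta0.
exists (Num.min (s / 36) ((eta * s / 29) ^+ 2 * s)).
  by rewrite lt_min divr_gt0//= mulr_gt0// exprn_gt0// divr_gt0// mulr_gt0.
move=> v w; rewrite lt_min => /andP[/ltW h1 /ltW h2] /=.
set m := v ^+ 2 + w ^+ 2 in h1 h2 *.
have m0 : 0 <= m by exact: sqr_sum_ge0.
(* An increment of squared length at most [s / 36] leaves a quarter of the squared distance, so the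
   kernel at the shifted point is still integrable. *)
have sv t : D t -> s / 4 <= (z1 + v - t) ^+ 2 + (z2 + w) ^+ 2 + k.
  move=> Dt; have := sD _ Dt.
  have e1 := sqr_ge0 ((z1 - t) + 2 * v); have e2 := sqr_ge0 (z2 + 2 * w).
  rewrite /m in h1 => e3.
  have -> : (z1 + v - t) ^+ 2 + (z2 + w) ^+ 2 + k =
    2^-1 * ((z1 - t) ^+ 2 + z2 ^+ 2 + k) + 2^-1 * k - (v ^+ 2 + w ^+ 2)
     + 2^-1 * ((z1 - t + 2 * v) ^+ 2 + (z2 + 2 * w) ^+ 2) by field.
  lra.
have iv : mu.-integrable D (EFin \o (fun t => lam k (z1 + v - t) (z2 + w))).
  by apply: (lam_integrable mD Db _ sv); rewrite divr_gt0.
pose Q t := quad (p t) (q t) (al t) (be t) (ga t) v w.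
have [iQ <-] := Rint_quad v w mD ip iq ial ibe iga; rewrite -/Q in iQ *.
have i0Q := intD mD i0 iQ.
rewrite /Lpot /= -(RintegralD mD i0 iQ) -(RintegralB mD iv i0Q).
have idiff := intB mD iv i0Q.
apply: le_trans (le_normr_Rintegral mD idiff) _.
have C0 : 0 <= eta * m by rewrite mulr_ge0// ltW.
apply: (@le_trans _ _ (\int[mu]_(t in D) (eta * m))); last first.
  rewrite Rintegral_cst// ler_piMr// -[leRHS]/(fine 1%:E) fine_le//.
    by rewrite ge0_fin_numE// (le_lt_trans (probability_le1 _ mD))// ltry.
  exact: probability_le1.
apply: le_Rintegral => //.
- exact: (integrable_norm idiff).
- by apply: (@bnd_integrable _ _ `|eta * m|).
move=> t Dt.
have := @lam_taylor _ k s (z1 - t) z2 v w (S t) (SE t Dt) s0 k0 (sS t) h1.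
have -> : z1 - t + v = z1 + v - t by ring.
move=> h; apply: le_trans h _; rewrite -/m.
rewrite mulrCA mulrC ler_wpM2r// ler_pdivrMr//.
have := @ler_wsqrtr R (m / s) ((eta * s / 29) ^+ 2).
rewrite ler_pdivrMr// => /(_ h2); rewrite sqrtr_sqr ger0_norm; last first.
  by rewrite divr_ge0// mulr_ge0// ltW.
by lra.
Qed.

End LogPotential.

(** * Perron test functions *)

Section PerronTest.
Context {R : realType}.
Implicit Types (z : plane R) (e : set R).

Lemma near_sq_nbhs_line (x : R) (A : set R) : nbhs x A ->
  exists2 d, 0 < d & forall v, v ^+ 2 < d -> A (x + v).
Proof.
move=> /nbhs_ballP[d /= d0 dA]; exists (d ^+ 2); first by rewrite exprn_gt0.
move=> v vd; apply: dA; rewrite /ball /= opprD addrA subrr sub0r normrN.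
by rewrite -(@ltr_pXn2r _ 2)// ?nnegrE// ?ltW// real_normK ?num_real.
Qed.

Lemma near_sqW z (P Q : plane R -> Prop) : (forall w, P w -> Q w) -> near_sq z P -> near_sq z Q.
Proof. by move=> PQ [d d0 H]; exists d => // x y /H /PQ. Qed.

Lemma near_sqI z (P Q : plane R -> Prop) : near_sq z P -> near_sq z Q ->
  near_sq z (fun w => P w /\ Q w).
Proof.
move=> [d d0 H] [d' d'0 H']; exists (Num.min d d'); first by rewrite lt_min d0.
by move=> x y; rewrite lt_min => /andP[/H ? /H' ?].
Qed.

Lemma near_sq_refl z (P : plane R -> Prop) : near_sq z P -> P z.
Proof.
by case: z => z1 z2 [d d0 /(_ 0 0)]; rewrite !expr0n /= !addr0; apply.
Qed.

Lemma finite_domain_near e z : closed e -> finite_domain e z -> near_sq z (finite_domain e).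
Proof.
move=> ce; case: z => x y ez.
have [y0|y0] := eqVneq y 0; last first.
  exists (y ^+ 2); first by rewrite exprn_even_gt0.
  move=> v w /= vw x' _ [_ yw]; move: vw; have -> : w = - y by apply/eqP; rewrite -addr_eq0 addrC yw.
  by rewrite sqrrN ltNge lerDr sqr_ge0.
rewrite y0 in ez *.
have : nbhs x (~` e).
  apply: open_nbhs_nbhs; split; first exact: closed_openC.
  by move=> ex; exact: (ez x ex).
move=> /near_sq_nbhs_line[d d0 H]; exists d => // v w vw x' ex' [E _].
apply: (H v); first by rewrite (le_lt_trans _ vw)// lerDl sqr_ge0.
by rewrite /= E.
Qed.

(** The complex inversion [1 / z] in coordinates. *)
Definition inv_pt z : plane R := (z.1 / (z.1 ^+ 2 + z.2 ^+ 2), - z.2 / (z.1 ^+ 2 + z.2 ^+ 2)).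

Lemma inv_pt_sq z : (inv_pt z).1 ^+ 2 + (inv_pt z).2 ^+ 2 = (z.1 ^+ 2 + z.2 ^+ 2)^-1.
Proof.
rewrite /inv_pt /=.
have [->|n0] := eqVneq (z.1 ^+ 2 + z.2 ^+ 2) 0; first by rewrite invr0 !mulr0 expr0n /= addr0.
by field.
Qed.

Lemma sqr_sum_eq0 (x y : R) : (x ^+ 2 + y ^+ 2 == 0) = (x == 0) && (y == 0).
Proof. by rewrite paddr_eq0 ?sqr_ge0// !expf_eq0. Qed.

Lemma sq_gt0 z : z != (0, 0) -> 0 < z.1 ^+ 2 + z.2 ^+ 2.
Proof. by case: z => x y; rewrite lt_def sqr_sum_ge0 andbT sqr_sum_eq0. Qed.

Lemma chart_inftyE z : z != (0, 0) -> chart_infty z = Some (inv_pt z).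
Proof.
move=> z0; rewrite /chart_infty (negbTE z0) /inv_pt /modulus sqr_sqrtr//.
exact: sqr_sum_ge0.
Qed.

Lemma inv_ptK z : z != (0, 0) -> inv_pt (inv_pt z) = z.
Proof.
move=> z0; have := sq_gt0 z0.
rewrite [LHS]/inv_pt inv_pt_sq /inv_pt /=; case: z {z0} => x y /= h.
by congr pair; field; rewrite gt_eqF.
Qed.

Lemma inv_pt_neq0 z : z != (0, 0) -> inv_pt z != (0, 0).
Proof.
move=> z0; apply/eqP => E; have := inv_pt_sq z; rewrite E /= expr0n /= addr0.
by move=> /esym/eqP; rewrite invr_eq0 gt_eqF// sq_gt0.
Qed.

Lemma inv_pt_cont z : z != (0, 0) -> {for z, continuous inv_pt}.
Proof.
move=> z0; have s0 := sq_gt0 z0.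
have c1 : {for z, continuous (fun w : plane R => w.1)} by exact: cvg_fst.
have c2 : {for z, continuous (fun w : plane R => w.2)} by exact: cvg_snd.
have cS : {for z, continuous (fun w : plane R => w.1 ^+ 2 + w.2 ^+ 2)}.
  have -> : (fun w : plane R => w.1 ^+ 2 + w.2 ^+ 2) = (fun w : plane R => w.1 * w.1 + w.2 * w.2).
    by apply/funext => w; rewrite !expr2.
  by apply: continuousD; apply: continuousM.
have cV : {for z, continuous (fun w : plane R => (w.1 ^+ 2 + w.2 ^+ 2)^-1)}.
  by apply: continuousV; rewrite ?gt_eqF.
have h1 : {for z, continuous (fun w : plane R => w.1 * (w.1 ^+ 2 + w.2 ^+ 2)^-1)} by apply: continuousM.
have h2 : {for z, continuous (fun w : plane R => - w.2 * (w.1 ^+ 2 + w.2 ^+ 2)^-1)}.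
  by apply: continuousM => //; exact: continuousN.
exact: (cvg_pair h1 h2).
Qed.

Lemma nbhs_infty (A : set (sphere R)) (r : R) : A None ->
  (forall z, r < z.1 ^+ 2 + z.2 ^+ 2 -> A (Some z)) -> nbhs (None : sphere R) A.
Proof.
move=> A0 H.
pose m := Num.max r 0 + 1.
have m1 : 1 <= m by rewrite lerDr le_max lexx orbT.
have mr : r < m by rewrite ltr_pwDr// le_max lexx.
exists (`[- m, m]%classic `*` `[- m, m]%classic).
  have C : compact (`[- m, m]%classic `*` `[- m, m]%classic : set (plane R)).
    by apply: compact_setX; exact: segment_compact.
  split => //; apply: compact_closed => //; exact: norm_hausdorff.
move=> [z|] //= [[[z1 z2] nz [<-]]|//]; apply: H => /=.
rewrite ltNge; apply/negP => h; apply: nz; rewrite /= !in_itv /= -!ler_norml.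
have mm : r <= m ^+ 2 by rewrite (le_trans (ltW mr))// expr2 ler_peMr// (le_trans _ m1).
have m0 : 0 <= m by rewrite (le_trans _ m1).
split; rewrite -(@ler_pXn2r _ 2) ?nnegrE// real_normK ?num_real// (le_trans _ mm)// (le_trans _ h)//.
  by rewrite lerDl sqr_ge0.
by rewrite lerDr sqr_ge0.
Qed.

Lemma compact_bound e : compact e -> exists2 b, 0 < b & forall x, e x -> `|x| <= b.
Proof.
move=> /compact_bounded /ex_strict_bound_gt0[b b0 H]; exists b => // x ex.
exact: ltW (H x ex).
Qed.

(* Membership of [u] in the Perron family is local, and the hypothesis on the harmonic measure says that the supremum of the family is the integral: no maximum principle is needed. *)
Lemma perron_le_integral e (om : probability (measurableTypeR R) R) (p : sphere R)
    (u : sphere R -> R) (f : R -> R) :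
  compact e -> is_harmonic_measure e p om -> {within e, continuous f} ->
  (forall z, finite_domain e z -> {for z, continuous (u \o Some : plane R -> R)}) ->
  (forall z, finite_domain e z -> lexp (u \o Some) z) ->
  {for ((0, 0) : plane R), continuous (u \o @chart_infty R)} ->
  lexp (u \o @chart_infty R) (0, 0) ->
  (forall x, e x -> forall eta, 0 < eta ->
     near_sq (x, 0) (fun z => finite_domain e z -> u (Some z) <= f x + eta)) ->
  ((u p)%:E <= \int[om]_(x in e) (f x)%:E)%E.
Proof.
move=> cpt [_ omP] cf cu lu cinf linf bd.
have ce : closed e by apply: compact_closed => //; exact: norm_hausdorff.
have [b b0 eb] := compact_bound cpt.
rewrite -omP//; apply: ereal_sup_ubound; exists (EFin \o u) => //.
have far z : b ^+ 2 < z.1 ^+ 2 + z.2 ^+ 2 -> finite_domain e z.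
  move=> bz x ex zx; move: bz; rewrite zx /= expr0n /= addr0.
  rewrite ltNge -[x ^+ 2]real_normK ?num_real// lerXn2r ?nnegrE ?eb//.
  exact: ltW.
split; first split.
- by move=> q _; rewrite ltry.
- move=> [z|] Dz a; rewrite /= lte_fin => ua.
    have fz : finite_domain e z by move=> x ex zx; apply: (Dz x ex); rewrite zx.
    rewrite near_withinE.
    have : \forall w \near z, u (Some w) < a by apply: (cvgr_lt _ (cu z fz)).
    move=> H; apply: (@filterS _ _ _ (Some @` [set w | u (Some w) < a])).
      by move=> _ [w /= uw <-] _; rewrite lte_fin.
    exact: one_point_compactification_some_nbhs.
  have u0 : u None = (u \o @chart_infty R) (0, 0) by rewrite /= /chart_infty eqxx.
  have : \forall w \near ((0, 0) : plane R), u (chart_infty w) < a.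
    by apply: (cvgr_lt _ cinf); rewrite -u0.
  move=> /nbhs_planeP[d d0 H].
  rewrite near_withinE; apply: (@nbhs_infty _ d^-1) => [_|z zd _]; rewrite lte_fin//.
  have z0 : z != (0, 0).
    by apply/eqP => E; move: zd; rewrite E /= expr0n /= addr0 ltNge invr_ge0 ltW.
  have := H (inv_pt z).1 (inv_pt z).2; rewrite !add0r -surjective_pairing.
  rewrite chart_inftyE ?inv_pt_neq0// inv_ptK//; apply.
  by rewrite inv_pt_sq invf_plt ?posrE// sq_gt0.
- move=> z Dz.
  have fz : finite_domain e z by move=> x ex zx; apply: (Dz x ex); rewrite zx.
  apply: (@circle_mean_ge _ (u \o Some)); last exact: lu.
  exact: near_sqW cu (finite_domain_near ce fz).
- move=> _.
  have u0 : (u \o @chart_infty R) (0, 0) = u None by rewrite /= /chart_infty eqxx.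
  have : near_sq (0, 0) (fun w => {for w, continuous (u \o @chart_infty R)}); last first.
    by move=> /circle_mean_ge /(_ linf); rewrite u0.
  exists (b ^+ 2)^-1; first by rewrite invr_gt0 exprn_gt0.
  move=> x y; set w := (_, _) => xy.
  have wE : w.1 ^+ 2 + w.2 ^+ 2 = x ^+ 2 + y ^+ 2 by rewrite /w /= !add0r.
  have [->//|w0] := eqVneq w (0, 0).
  have cw : {for w, continuous (u \o Some \o inv_pt)}.
    apply: continuous_comp; first exact: inv_pt_cont.
    apply: cu; apply: far; rewrite inv_pt_sq invf_pgt ?posrE ?exprn_gt0 ?wE//.
    by rewrite -wE sq_gt0.
  apply: (@cvg_trans _ ((u \o Some \o inv_pt) @ w)); last first.
    by rewrite /= chart_inftyE//; exact: cw.
  apply: near_eq_cvg; apply/nbhs_planeP; exists (w.1 ^+ 2 + w.2 ^+ 2); first exact: sq_gt0.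
  move=> v v' vv; rewrite /= chart_inftyE//; apply/eqP => -[E1 E2]; move: vv.
  have -> : v = - w.1 by apply/eqP; rewrite -addr_eq0 addrC E1.
  have -> : v' = - w.2 by apply/eqP; rewrite -addr_eq0 addrC E2.
  by rewrite !sqrrN ltxx.
- move=> x ex; apply/lee_addgt0Pr => eta eta0; rewrite /limf_esup -EFinD.
  apply: ge_ereal_inf => /=.
  have := bd x ex eta eta0 => H.
  pose V := Some @` [set w : plane R | finite_domain e w /\ u (Some w) <= f x + eta].
  exists (ereal_sup [set (EFin \o u) q | q in V]); last first.
    by apply: ge_ereal_sup => _ [_ [w [_ uw] <-] <-]; rewrite lee_fin.
  exists V => //; rewrite /V.
  rewrite /within /=.
  have /nbhs_planeP H' := H.
    apply: (@filterS _ _ _ (Some @` [set w | finite_domain e w -> u (Some w) <= f x + eta])).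
      move=> _ [w /= uw <-] Dw; exists w => //; split.
        by move=> y ey wy; apply: (Dw y ey); rewrite wy.
      by apply: uw => y ey wy; apply: (Dw y ey); rewrite wy.
    exact: one_point_compactification_some_nbhs.
Qed.

End PerronTest.

(** * Logarithmic energy *)

Section TailKernel.
Context {R : realType}.
Local Notation T := (measurableTypeR R).

(* The singular part of the logarithmic kernel: [tker k (x ^+ 2)] is [lam k x 0 - ln `|x|], with the value +oo
   that the convention [ln 0 = 0] would hide. *)
Definition tker (k r : R) : \bar R :=
  if r == 0 then +oo%E else (2^-1 * (ln (r + k) - ln r))%:E.

Lemma tker_ge0 k r : 0 <= k -> 0 <= r -> (0 <= tker k r)%E.
Proof.
move=> k0 r0; rewrite /tker; have [//|n0] := eqVneq r 0.
have rp : 0 < r by rewrite lt_def n0.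
by rewrite lee_fin mulr_ge0 ?invr_ge0// subr_ge0 ler_ln ?posrE ?lerDl// ltr_wpDr.
Qed.

Lemma measurable_tker k : measurable_fun [set: T] (tker k : T -> \bar R).
Proof.
apply: measurable_fun_ifT => //; first by apply: measurable_fun_eqr.
apply/measurable_EFinP; apply: measurable_funM => //; apply: measurable_funB.
  by apply: (measurableT_comp (@measurable_ln R)); exact: measurable_funD.
exact: measurable_ln.
Qed.

Lemma lne_tker (k x : R) : 0 < k ->
  (- lne `|x|%:E)%E = (tker k (x ^+ 2 + 0 ^+ 2) - (lam k x 0)%:E)%E.
Proof.
move=> k0; rewrite expr0n addr0 /tker expf_eq0 /=.
have [->|x0] := eqVneq x 0; first by rewrite normr0 lexx.
have xx : 0 < x ^+ 2 by rewrite exprn_even_gt0.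
rewrite leNgt normr_gt0 x0 /= -EFinB; congr EFin; rewrite /lam expr0n addr0.
have -> : x ^+ 2 = `|x| ^+ 2 by rewrite real_normK ?num_real.
by rewrite [ln (`|x| ^+ 2)]lnXn ?normr_gt0// mulr2n; field.
Qed.

(** On the diagonal both sides are [+oo]; this is why the relation between two regularizations is
    written with sums and not with differences. *)
Lemma tker_add (k k' x y : R) :
  (tker k (x ^+ 2 + y ^+ 2) + (lam k' x y)%:E = tker k' (x ^+ 2 + y ^+ 2) + (lam k x y)%:E)%E.
Proof.
rewrite /tker; case: eqP => // _; rewrite -!EFinD; congr EFin.
by rewrite /lam; ring.
Qed.

Lemma tker_lam (k x y : R) : x ^+ 2 + y ^+ 2 != 0 ->
  (tker k (x ^+ 2 + y ^+ 2) = (lam k x y - lam 0 x y)%:E)%E.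
Proof.
by move=> r0; rewrite /tker (negbTE r0); congr EFin; rewrite /lam addr0; ring.
Qed.

Lemma tker_anti (k r r' : R) : 0 <= k -> 0 <= r -> r <= r' -> (tker k r' <= tker k r)%E.
Proof.
move=> k0 r0 rr'; rewrite /tker; have [_|n0] := eqVneq r 0; first by rewrite leey.
have rp : 0 < r by rewrite lt_def n0.
have r'p : 0 < r' by apply: lt_le_trans rr'.
rewrite gt_eqF// lee_fin ler_pM2l ?invr_gt0//.
rewrite -!ln_div ?posrE ?ltr_wpDr// ler_ln ?posrE ?divr_gt0// ?ltr_wpDr//.
rewrite !mulrDl !divff ?gt_eqF// lerD2l; apply: ler_wpM2l => //.
by rewrite lef_pV2.
Qed.

Lemma lam1_ge0 (k x y : R) : 1 <= k -> 0 <= lam k x y.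
Proof.
move=> k1; rewrite /lam mulr_ge0 ?invr_ge0// ln_ge0// (le_trans k1)// lerDr.
exact: sqr_sum_ge0.
Qed.

Lemma lam_mono (k k' x y : R) : 0 <= k -> k <= k' -> 0 < x ^+ 2 + y ^+ 2 + k -> lam k x y <= lam k' x y.
Proof.
move=> k0 kk h; rewrite /lam ler_pM2l ?invr_gt0// ler_ln ?posrE//; first by rewrite lerD2l.
by apply: lt_le_trans h _; rewrite lerD2l.
Qed.

End TailKernel.

Section ExtInt.
Context d (T : measurableType d) (R : realType) (mu : {measure set T -> \bar R}).
Local Open Scope ereal_scope.

(** If [f] is not integrable, the positive part of the difference has infinite integral while the
    negative part is dominated by [g] in modulus; both sides are then [+oo]. *)
Lemma integral_subge0 (D : set T) (f : T -> \bar R) (g : T -> R) : measurable D ->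
  measurable_fun D f -> (forall x, D x -> 0 <= f x) -> mu.-integrable D (EFin \o g) ->
  \int[mu]_(x in D) (f x - (g x)%:E) = \int[mu]_(x in D) f x - \int[mu]_(x in D) (g x)%:E.
Proof.
move=> mD mf f0 ig.
have mg : measurable_fun D (EFin \o g) by exact: measurable_int ig.
have [ff|] := ltP (\int[mu]_(x in D) f x) +oo.
  have If : mu.-integrable D f.
    apply/integrableP; split => //; rewrite (_ : \int[mu]_(x in D) `|f x| = \int[mu]_(x in D) f x)//.
    by apply: eq_integral => x /[!inE] Dx; rewrite gee0_abs// f0.
  by rewrite -(integralB mD If ig).
rewrite leye_eq => /eqP fy.
have gf : \int[mu]_(x in D) (g x)%:E \is a fin_num by exact: integrable_fin_num ig.
rewrite fy -(fineK gf) /=.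
have mfg : measurable_fun D (fun x => f x - (g x)%:E) by exact: emeasurable_funB.
have I2 : \int[mu]_(x in D) (fun x => f x - (g x)%:E)^\- x < +oo.
  have /integrableP[_ h] := ig; apply: le_lt_trans h.
  apply: ge0_le_integral => //.
  - exact: measurable_funeneg.
  - exact: measurableT_comp.
  move=> x Dx; rewrite funenegE ge_max; apply/andP; split; last exact: abse_ge0.
  rewrite fin_num_oppeB// -[leRHS]add0e leeD//; first by rewrite leeNl oppe0 f0.
  by rewrite lee_fin ler_norm.
have I1 : \int[mu]_(x in D) (fun x => f x - (g x)%:E)^\+ x = +oo.
  apply/eqP; rewrite -leye_eq leNgt; apply/negP => h.
  have : +oo <= \int[mu]_(x in D) ((fun x => f x - (g x)%:E)^\+ x + `|(g x)%:E|).
    rewrite -fy; apply: ge0_le_integral => //.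
    - by apply: emeasurable_funD; [exact: measurable_funepos|exact: measurableT_comp].
    move=> x Dx; apply: (@le_trans _ _ (f x - (g x)%:E + (g x)%:E)); first by rewrite subeK.
    by apply: leeD; [rewrite funeposE le_max lexx|rewrite lee_fin ler_norm].
  rewrite leye_eq ge0_integralD//; last first.
  - exact: measurableT_comp.
  - exact: measurable_funepos.
  have /integrableP[_ h'] := ig.
  by move=> /eqP E; have := lte_add_pinfty h h'; rewrite E.
rewrite integralE I1; move: I2; case: (\int[mu]_(x in D) _) => //=.
Qed.

Lemma integral_carrier (e : set T) (f : T -> \bar R) : measurable e -> mu (~` e) = 0 ->
  measurable_fun setT f -> \int[mu]_x f x = \int[mu]_(x in e) f x.
Proof.
move=> me m0 mf.
have E : setT `\` ~` e = e by rewrite setTD setCK.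
rewrite integralE [RHS]integralE.
by congr (_ - _); rewrite (@ge0_negligible_integral _ _ _ mu setT (~` e)) ?E//;
  [exact: measurableC|exact: measurable_funepos|exact: measurableC|exact: measurable_funeneg].
Qed.

End ExtInt.

(** [mnormalize] leaves a measure of mass one unchanged and turns it into a [probability]; mixtures
    and conditionings are packed this way. *)
Lemma prob_of_measure d (T : measurableType d) (R : realType) (P : probability T R)
    (m : {measure set T -> \bar R}) : m [set: T] = 1%E ->
  exists pi : probability T R, forall A, pi A = m A.
Proof.
move=> m1; exists (mnormalize m P) => A.
by rewrite /= /mnormalize m1 (negbTE (@onee_neq0 R)) /= invr1 mule1.
Qed.

(** * Energy of mixtures and its first variation *)

Section Mixtures.
Context {R : realType}.
Local Notation T := (measurableTypeR R).
Local Open Scope ereal_scope.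
Implicit Types (m : probability (measurableTypeR R) R).

Lemma EFin_quad (t u v w : R) :
  (1 - t)%:E * ((1 - t)%:E * u%:E + t%:E * v%:E) + t%:E * ((1 - t)%:E * v%:E + t%:E * w%:E)
  = ((1 - t) ^+ 2 * u + 2 * t * (1 - t) * v + t ^+ 2 * w)%:E.
Proof. by rewrite /= -[in LHS]EFinD; congr EFin; ring. Qed.

Lemma quad_sub (t a b c a' b' c' : R) :
  ((1 - t) ^+ 2 * a + 2 * t * (1 - t) * b + t ^+ 2 * c -
   ((1 - t) ^+ 2 * a' + 2 * t * (1 - t) * b' + t ^+ 2 * c') =
   (1 - t) ^+ 2 * (a - a') + 2 * t * (1 - t) * (b - b') + t ^+ 2 * (c - c'))%R.
Proof. by ring. Qed.

Lemma integral_mix (m1 m2 : probability T R) (t : R) : (0 <= t <= 1)%R ->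
  exists pi : probability T R, forall (f : T -> \bar R) D, measurable D -> measurable_fun D f ->
    (forall x, D x -> 0 <= f x) ->
    \int[pi]_(x in D) f x = (1 - t)%:E * \int[m1]_(x in D) f x + t%:E * \int[m2]_(x in D) f x.
Proof.
move=> /andP[t0 t1].
have s0 : (0 <= 1 - t)%R by rewrite subr_ge0.
pose m := measure_add (mscale (NngNum s0) m1) (mscale (NngNum t0) m2).
have [|pi piE] := @prob_of_measure _ _ _ m1 m.
  transitivity ((1 - t)%:E * m1 [set: T] + t%:E * m2 [set: T]); first exact: measure_addE.
  by rewrite !probability_setT !mule1 -EFinD subrK.
exists pi => f D mD mf f0.
rewrite (@eq_measure_integral _ _ _ _ m) => [|A _ _]; last exact: piE.
by rewrite ge0_integral_measure_add// !ge0_integral_mscale.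
Qed.

Lemma integral_cond (m1 : probability T R) (B : set T) : measurable B -> 0 < m1 B ->
  exists pi : probability T R, forall (f : T -> \bar R) D, measurable D -> measurable_fun D f ->
    (forall x, D x -> 0 <= f x) ->
    \int[pi]_(x in D) f x = (fine (m1 B))^-1%:E * \int[m1]_(x in D `&` B) f x.
Proof.
move=> mB B0.
have Bf : m1 B \is a fin_num by rewrite fin_num_measure.
have c0 : (0 <= (fine (m1 B))^-1)%R by rewrite invr_ge0 fine_ge0// ltW.
pose m := mscale (NngNum c0) (mrestr m1 mB).
have [|pi piE] := @prob_of_measure _ _ _ m1 m.
  transitivity ((fine (m1 B))^-1%:E * m1 B).
    by rewrite -[X in _ * m1 X]setTI.
  rewrite -[X in _ * X]fineK// -EFinM mulVf//.
  by rewrite gt_eqF// fine_gt0// B0/= ltey_eq Bf.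
exists pi => f D mD mf f0.
rewrite (@eq_measure_integral _ _ _ _ m) => [|A _ _]; last exact: piE.
rewrite ge0_integral_mscale//; congr (_ * _).
have mDB : measurable (D `&` B) by exact: measurableI.
have mDC : measurable (D `\` B) by exact: measurableD.
rewrite -{1}(setUIDK D B) ge0_integral_setU// ?setUIDK//; last first.
  by apply/disj_setPS => x [[_ ?] [_ ?]].
rewrite (@eq_measure_integral _ _ _ _ m1) => [|A mA AB]; last first.
  by rewrite /= /mrestr; congr (m1 _); apply/setIidPl => x /AB[].
rewrite [X in _ + X](@eq_measure_integral _ _ _ _ mzero) => [|A mA AB]; last first.
  rewrite /= /mrestr /mzero; rewrite (_ : A `&` B = set0) ?measure0//.
  by apply/seteqP; split => // x [/AB[]].
by rewrite integral_measure_zero adde0.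
Qed.

Variables (e : set R) (b : R).
Hypotheses (cpt : compact e) (eb : forall x, e x -> (`|x| <= b)%R).

(** The regularization [k = 1] makes both parts of the kernel nonnegative, so Tonelli's theorem
    applies to each; the mutual energy is [Tint - Lint] by [pot_int]. *)
Definition tk2 (xy : T * T) : \bar R := tker 1 ((xy.1 - xy.2) ^+ 2 + 0 ^+ 2).
Definition lm2 (xy : T * T) : \bar R := (lam 1 (xy.1 - xy.2) 0)%:E.
Definition Tint (m1 m2 : probability T R) := \int[m1]_x \int[m2]_y tk2 (x, y).
Definition Lint (m1 m2 : probability T R) := \int[m1]_x \int[m2]_y lm2 (x, y).

Lemma meas_e : measurable (e : set T).
Proof. by apply: closed_measurable; apply: compact_closed => //; exact: norm_hausdorff. Qed.

Lemma tk2_ge0 xy : 0 <= tk2 xy.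
Proof. by apply: tker_ge0 => //; exact: sqr_sum_ge0. Qed.

Lemma lm2_ge0 xy : 0 <= lm2 xy.
Proof. by rewrite lee_fin lam1_ge0. Qed.

Lemma measurable_diff2 : measurable_fun [set: T * T] (fun xy : T * T => xy.1 - xy.2)%R.
Proof. by apply: measurable_funB; [exact: measurable_fst|exact: measurable_snd]. Qed.

Lemma measurable_tk2 : measurable_fun setT tk2.
Proof.
apply: (measurableT_comp (@measurable_tker R 1)).
by apply: measurable_funD => //; apply: measurable_funX; exact: measurable_diff2.
Qed.

Lemma measurable_lm2 : measurable_fun setT lm2.
Proof.
apply/measurable_EFinP; apply: measurable_funM => //.
apply: (measurableT_comp (@measurable_ln R)); apply: measurable_funD => //.
by apply: measurable_funD => //; apply: measurable_funX; exact: measurable_diff2.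
Qed.

Lemma tk2C x y : tk2 (x, y) = tk2 (y, x).
Proof. by rewrite /tk2 /= -sqrrN opprB. Qed.

Lemma lm2C x y : lm2 (x, y) = lm2 (y, x).
Proof. by rewrite /lm2 /lam /= -sqrrN opprB. Qed.

Lemma TintC m1 m2 : Tint m1 m2 = Tint m2 m1.
Proof.
rewrite /Tint (fubini_tonelli (m1 := m1) (m2 := m2) tk2 measurable_tk2 tk2_ge0).
by apply: eq_integral => x _; apply: eq_integral => y _; rewrite tk2C.
Qed.

Lemma LintC m1 m2 : Lint m1 m2 = Lint m2 m1.
Proof.
rewrite /Lint (fubini_tonelli (m1 := m1) (m2 := m2) lm2 measurable_lm2 lm2_ge0).
by apply: eq_integral => x _; apply: eq_integral => y _; rewrite lm2C.
Qed.

Lemma measurable_Tin m : measurable_fun setT (fun x => \int[m]_y tk2 (x, y)).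
Proof. exact: (measurable_fun_fubini_tonelli_F (m2 := m) tk2 measurable_tk2 tk2_ge0). Qed.

Lemma measurable_Lin m : measurable_fun setT (fun x => \int[m]_y lm2 (x, y)).
Proof. exact: (measurable_fun_fubini_tonelli_F (m2 := m) lm2 measurable_lm2 lm2_ge0). Qed.

Lemma Tin_ge0 m x : 0 <= \int[m]_y tk2 (x, y).
Proof. by apply: integral_ge0 => y _; exact: tk2_ge0. Qed.

Lemma Lin_ge0 m x : 0 <= \int[m]_y lm2 (x, y).
Proof. by apply: integral_ge0 => y _; exact: lm2_ge0. Qed.

Lemma carrier0 m : m e = 1 -> m (~` e) = 0.
Proof. by move=> me; rewrite probability_setC ?me ?subee//; exact: meas_e. Qed.

Lemma integral_cst1 m (c : R) : m e = 1 -> \int[m]_(y in e) c%:E = c%:E.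
Proof.
move=> me; rewrite integral_cst; last exact: meas_e.
by transitivity (c%:E * 1); [congr (_ * _); exact: me|rewrite mule1].
Qed.

Lemma mslice2 (f : T * T -> \bar R) x : measurable_fun setT f -> measurable_fun setT (fun y => f (x, y)).
Proof. by move=> mf; apply: measurableT_comp => //; exact: measurable_pair1. Qed.

Lemma lm2_le x y B : (`|x| <= B)%R -> e y -> lm2 (x, y) <= (lam 1 (B + b) 0)%:E.
Proof.
move=> xB /eb yb; rewrite /lm2 lee_fin /lam /= ler_pM2l ?invr_gt0//.
have h : (`|x - y| <= B + b)%R by rewrite (le_trans (ler_normB _ _))// lerD.
have h' : ((x - y) ^+ 2 <= (B + b) ^+ 2)%R.
  by rewrite -real_normK ?num_real// lerXn2r ?nnegrE// (le_trans _ h).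
by rewrite ler_ln ?posrE ?expr0n /= ?addr0 ?ltr_wpDl ?sqr_ge0// lerD2r.
Qed.

Lemma Lin_le m x B : m e = 1 -> (`|x| <= B)%R -> \int[m]_y lm2 (x, y) <= (lam 1 (B + b) 0)%:E.
Proof.
move=> me xB; rewrite (integral_carrier meas_e (carrier0 me) (mslice2 x measurable_lm2)).
apply: (@le_trans _ _ (\int[m]_(y in e) (lam 1 (B + b) 0)%:E)); last first.
  by rewrite integral_cst1.
apply: ge0_le_integral => //.
- exact: meas_e.
- by move=> y _; exact: lm2_ge0.
- exact: measurable_funS (@measurableT _ _) (@subsetT _ _) (mslice2 x measurable_lm2).
- by move=> y ey; exact: lm2_le.
Qed.

Lemma Lint_fin m1 m2 : m1 e = 1 -> m2 e = 1 -> Lint m1 m2 \is a fin_num.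
Proof.
move=> e1 e2; rewrite ge0_fin_numE; last by apply: integral_ge0 => x _; exact: Lin_ge0.
rewrite /Lint (integral_carrier meas_e (carrier0 e1) (measurable_Lin m2)).
apply: (@le_lt_trans _ _ (\int[m1]_(y in e) (lam 1 (b + b) 0)%:E)); last first.
  by rewrite integral_cst1// ltry.
apply: ge0_le_integral => //.
- exact: meas_e.
- by move=> y _; exact: Lin_ge0.
- exact: measurable_funS (@measurableT _ _) (@subsetT _ _) (measurable_Lin m2).
- by move=> y /eb ey; exact: Lin_le.
Qed.

Lemma energy_inner m x : m e = 1 ->
  \int[m]_y - lne `|x - y|%:E = \int[m]_y tk2 (x, y) - \int[m]_y lm2 (x, y).
Proof.
move=> me.
have mt := mslice2 x measurable_tk2; have ml := mslice2 x measurable_lm2.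
transitivity (\int[m]_y (tk2 (x, y) - (lam 1 (x - y) 0)%:E)).
  by apply: eq_integral => y _; rewrite (@lne_tker _ 1).
rewrite integral_subge0//; first by move=> y _; exact: tk2_ge0.
apply/integrableP; split => //=.
rewrite (_ : \int[m]_y _ = \int[m]_y lm2 (x, y)); last first.
  by apply: eq_integral => y _ /=; rewrite ger0_norm// lam1_ge0.
by apply: le_lt_trans (Lin_le me (lexx _)) _; rewrite ltry.
Qed.

Lemma pot_int m1 m2 : m1 e = 1 -> m2 e = 1 ->
  \int[m1]_x \int[m2]_y - lne `|x - y|%:E = Tint m1 m2 - Lint m1 m2.
Proof.
move=> e1 e2.
under eq_integral do rewrite energy_inner//.
have mT := measurable_Tin m2; have mL := measurable_Lin m2.
have E : {in setT, (fun x => \int[m2]_y lm2 (x, y)) =1 EFin \o (fun x => fine (\int[m2]_y lm2 (x, y)))}.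
  move=> x _ /=; rewrite fineK// ge0_fin_numE ?Lin_ge0//.
  by apply: le_lt_trans (Lin_le e2 (lexx _)) _; rewrite ltry.
rewrite /Lint (eq_integral _ _ E).
transitivity (\int[m1]_x (\int[m2]_y tk2 (x, y) - (fine (\int[m2]_y lm2 (x, y)))%:E)).
  by apply: eq_integral => x xT; rewrite (E x xT).
rewrite integral_subge0//; first by move=> y _; exact: Tin_ge0.
apply/integrableP; split.
  by apply/(measurable_fun_eqP _ E).
apply: (@le_lt_trans _ _ (Lint m1 m2)).
  rewrite /Lint; apply: ge0_le_integral => //.
  - apply: measurableT_comp => //; exact/(measurable_fun_eqP _ E).
  - by move=> x _; rewrite (E x) ?inE// gee0_abs//= lee_fin fine_ge0// Lin_ge0.
by rewrite -ge0_fin_numE ?Lint_fin//; apply: integral_ge0 => x _; exact: Lin_ge0.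
Qed.

Lemma carried_by_1 m : carried_by e m -> m e = 1.
Proof.
move=> [K [cK Ke K1]]; apply/eqP; rewrite eq_le probability_le1 ?meas_e//=.
have mK : measurable (K : set T).
  by apply: closed_measurable; apply: compact_closed => //; exact: norm_hausdorff.
have : m K <= m e by apply: le_measure => //; rewrite inE//; exact: meas_e.
by rewrite K1.
exact: meas_e.
Qed.

Lemma carried_by_of_1 m : m e = 1 -> carried_by e m.
Proof. by move=> e1; exists e; split. Qed.

(** The energy of [(1 - t) rho + t mu] is a quadratic polynomial in [t], minimal at [t = 0]; hence
    its derivative [2 * (B - A)] there is nonnegative, where [A] is the energy of [rho] and [B] its
    mutual energy with [mu]. *)
Lemma frostman_variation (rho mu : probability T R) : is_equilibrium_measure e rho ->
  log_energy rho \is a fin_num -> mu e = 1 -> Tint mu mu < +oo ->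
  log_energy rho <= Tint mu rho - Lint mu rho.
Proof.
move=> [car min] Ifin mue Tmu.
have re := carried_by_1 car.
have IE m : m e = 1 -> log_energy m = Tint m m - Lint m m by move=> me; exact: pot_int.
have [fy|] := eqVneq (Tint mu rho) +oo.
  by rewrite fy -(fineK (Lint_fin mue re)) /= leey.
rewrite -ltey => fy.
have T0 m1 m2 : 0 <= Tint m1 m2 by apply: integral_ge0 => x _; exact: Tin_ge0.
have Trr : Tint rho rho \is a fin_num.
  move: Ifin; rewrite IE// -(fineK (Lint_fin re re)).
  by case: (Tint rho rho) (T0 rho rho).
have Tmr : Tint mu rho \is a fin_num by rewrite ge0_fin_numE.
have Tmm : Tint mu mu \is a fin_num by rewrite ge0_fin_numE.
have Lrr := Lint_fin re re; have Lmr := Lint_fin mue re; have Lmm := Lint_fin mue mue.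
have key (t : R) : (0 <= t <= 1)%R ->
  (fine (Tint rho rho) - fine (Lint rho rho) <=
   (1 - t) ^+ 2 * (fine (Tint rho rho) - fine (Lint rho rho)) +
   2 * t * (1 - t) * (fine (Tint mu rho) - fine (Lint mu rho)) +
   t ^+ 2 * (fine (Tint mu mu) - fine (Lint mu mu)))%R.
  move=> t01; have [pi piE] := integral_mix rho mu t01.
  have pe : pi e = 1.
    have := piE (fun _ => 1) e meas_e (measurable_cst _) (fun _ _ => lee01).
    rewrite (integral_cst1 1 re) (integral_cst1 1 mue) !mule1 -EFinD subrK => <-.
    rewrite integral_cst; last exact: meas_e.
    by rewrite mul1e.
  have quad (f : T * T -> \bar R) : measurable_fun setT f -> (forall xy, 0 <= f xy) ->
     (forall x y, f (x, y) = f (y, x)) ->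
     \int[rho]_x \int[rho]_y f (x, y) \is a fin_num ->
     \int[mu]_x \int[rho]_y f (x, y) \is a fin_num ->
     \int[mu]_x \int[mu]_y f (x, y) \is a fin_num ->
     \int[pi]_x \int[pi]_y f (x, y) = ((1 - t) ^+ 2 * fine (\int[rho]_x \int[rho]_y f (x, y)) +
       2 * t * (1 - t) * fine (\int[mu]_x \int[rho]_y f (x, y)) +
       t ^+ 2 * fine (\int[mu]_x \int[mu]_y f (x, y)))%:E.
    move=> mf f0 fC F1 F2 F3.
    have mF (m : probability T R) := measurable_fun_fubini_tonelli_F (m2 := m) f mf f0.
    have F0 (m : probability T R) x : 0 <= \int[m]_y f (x, y) by apply: integral_ge0.
    have t0 : (0 <= t)%R by case/andP: t01.
    have t1 : (0 <= 1 - t)%R by rewrite subr_ge0; case/andP: t01.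
    have sl x : measurable_fun setT (fun y => f (x, y)) by exact: mslice2.
    have C : \int[rho]_x \int[mu]_y f (x, y) = \int[mu]_x \int[rho]_y f (x, y).
      rewrite (fubini_tonelli (m1 := rho) (m2 := mu) f mf f0).
      by apply: eq_integral => x _; apply: eq_integral => y _; rewrite fC.
    have inner x : \int[pi]_y f (x, y) = (1 - t)%:E * \int[rho]_y f (x, y) + t%:E * \int[mu]_y f (x, y).
      by rewrite piE.
    have mix (m : probability T R) : \int[m]_x \int[pi]_y f (x, y) =
       (1 - t)%:E * \int[m]_x \int[rho]_y f (x, y) + t%:E * \int[m]_x \int[mu]_y f (x, y).
      under eq_integral do rewrite inner.
      rewrite ge0_integralD//; last 4 first.
      - by move=> x _; rewrite mule_ge0 ?lee_fin.
      - by apply: measurable_funeM; exact: mF.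
      - by move=> x _; rewrite mule_ge0 ?lee_fin.
      - by apply: measurable_funeM; exact: mF.
      by rewrite !ge0_integralZl//; exact: mF.
    rewrite piE//; last by exact: mF.
    rewrite !mix C; move: F1 F2 F3.
    move: (\int[rho]_x \int[rho]_y f (x, y)) (\int[mu]_x \int[rho]_y f (x, y))
      (\int[mu]_x \int[mu]_y f (x, y)) => [u| |] [v| |] [w| |] //= _ _ _.
    exact: EFin_quad.
  have := min pi (carried_by_of_1 pe).
  have QT := quad tk2 measurable_tk2 tk2_ge0 tk2C Trr Tmr Tmm.
  have QL := quad lm2 measurable_lm2 lm2_ge0 lm2C Lrr Lmr Lmm.
  rewrite (IE _ re) (IE _ pe) -/(Tint pi pi) -/(Lint pi pi) in QT QL *.
  rewrite [Tint pi pi]QT [Lint pi pi]QL -[Tint rho rho]fineK// -[Lint rho rho]fineK//.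
  rewrite -!EFinB lee_fin /= => /le_trans; apply.
  by rewrite quad_sub.
rewrite IE// -(fineK Trr) -(fineK Lrr) -(fineK Tmr) -(fineK Lmr) -!EFinB lee_fin.
move: key; set A := (fine _ - _)%R; set B := (fine (Tint mu rho) - _)%R; set C := (fine (Tint mu mu) - _)%R.
move=> key; rewrite leNgt; apply/negP => BA.
have nA := ler_norm (- A)%R; have nA' := ler_norm A; have nB := ler_norm (- B)%R.
have nB' := ler_norm B.
have nC := ler_norm C; have nC0 := normr_ge0 C; have nC' := ler_norm (- C)%R.
rewrite !normrN in nA nB nC'.
(* The denominator [M] is positive and at least [A + C - 2 * B], so for this [t] the quadratic term
   undoes at most half of the decrease [2 * t * (A - B)]. *)
pose t := Num.min 1%R ((A - B) / (A + C - 2 * B + 2 * `|C| + 2 * `|B| + 2 * `|A| + 1))%R.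
set M := (A + C - 2 * B + 2 * `|C| + 2 * `|B| + 2 * `|A| + 1)%R in t *.
have M0 : (0 < M)%R by rewrite /M; have := normr_ge0 B; have := normr_ge0 A; lra.
have t0 : (0 < t)%R by rewrite lt_min ltr01 divr_gt0// subr_gt0.
have t1 : (t <= 1)%R by rewrite ge_min lexx.
have tM : (t * M <= A - B)%R by rewrite -ler_pdivlMr// ge_min lexx orbT.
have := key t; rewrite t1 (ltW t0) => /(_ isT) k.
have : (0 <= t * (2 * (B - A) + t * (A + C - 2 * B)))%R by move: k; lra.
rewrite pmulr_rge0// => k'.
have : (t * (A + C - 2 * B) <= t * M)%R.
  by rewrite ler_pM2l// /M; have := normr_ge0 B; have := normr_ge0 A; lra.
lra.
Qed.

End Mixtures.

(** * Singular parts of potentials *)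

Section Tails.
Context {R : realType} (m : probability (measurableTypeR R) R).
Local Notation T := (measurableTypeR R).
Variables (D : set T) (b : R).
Hypotheses (mD : measurable D) (Db : forall t, D t -> `|t| <= b).
Implicit Types (z : plane R) (k : R).

(** Away from [D] this is [Lpot m k D z - Lpot m 0 D z] by [tl_far]; on [D] it also records the
    value [+oo], which the real-valued [Lpot m 0] cannot represent. *)
Definition tl (k : R) (D : set T) (z : plane R) : \bar R :=
  (\int[m]_(t in D) tker k ((z.1 - t) ^+ 2 + z.2 ^+ 2))%E.

Lemma measurable_tker_line k z (E : set T) : measurable_fun E (fun t : T => tker k ((z.1 - t) ^+ 2 + z.2 ^+ 2)).
Proof.
apply: measurable_funS (@measurableT _ _) (@subsetT _ _) _.
apply: (measurableT_comp (@measurable_tker R k)).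
by apply: measurable_funD => //; apply: measurable_funX; apply: measurable_funB.
Qed.

Lemma tl_ge0 k z (E : set T) : 0 <= k -> (0 <= tl k E z)%E.
Proof. by move=> k0; apply: integral_ge0 => t _; apply: tker_ge0 => //; exact: sqr_sum_ge0. Qed.

Lemma lam_int k z : 0 < k -> m.-integrable D (EFin \o (fun t => lam k (z.1 - t) z.2)).
Proof.
move=> k0; apply: (lam_integrable m mD Db k0) => t _.
by rewrite lerDr; exact: sqr_sum_ge0.
Qed.

Lemma Lpot_EFin k z : 0 < k -> (Lpot m k D z)%:E = (\int[m]_(t in D) (lam k (z.1 - t) z.2)%:E)%E.
Proof. by move=> k0; rewrite /Lpot /Rintegral fineK//; exact: integrable_fin_num (lam_int z k0). Qed.

Lemma tl_add k k' z : 0 < k -> 0 < k' ->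
  (tl k D z + (Lpot m k' D z)%:E = tl k' D z + (Lpot m k D z)%:E)%E.
Proof.
move=> k0 k'0.
have H j j' : 0 < j -> 0 < j' ->
   (tl j D z + (Lpot m j' D z)%:E = \int[m]_(t in D) (tker j ((z.1 - t) ^+ 2 + z.2 ^+ 2) - (- lam j' (z.1 - t) z.2)%:E))%E.
  move=> j0 j'0; rewrite integral_subge0//.
  - rewrite /tl Lpot_EFin//; congr (_ + _)%E; under [in RHS]eq_integral do rewrite EFinN.
    have -> : (\int[m]_(t in D) - (lam j' (z.1 - t) z.2)%:E = (\int[m]_(t in D) (- lam j' (z.1 - t) z.2))%:E)%E.
      by rewrite /Rintegral fineK//; exact: integrable_fin_num (integrableN (lam_int z j'0)).
    rewrite -EFinN -Lpot_EFin// /Lpot; congr EFin.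
    have -> : \int[m]_(t in D) (- lam j' (z.1 - t) z.2) = \int[m]_(t in D) (-1 * lam j' (z.1 - t) z.2).
      by apply: eq_Rintegral => t _; rewrite mulN1r.
    rewrite (@RintegralZl _ _ _ m D (fun t => lam j' (z.1 - t) z.2) (-1) mD (lam_int z j'0)).
    by rewrite mulN1r opprK.
  - exact: measurable_tker_line.
  - by move=> t _; apply: tker_ge0; [exact: ltW|exact: sqr_sum_ge0].
  - exact: (integrableN (lam_int z j'0)).
rewrite !H//; apply: eq_integral => t _.
by rewrite -!EFinN !opprK tker_add.
Qed.

Lemma tl_far k z s : 0 < k -> 0 < s -> (forall t, D t -> s <= (z.1 - t) ^+ 2 + z.2 ^+ 2) ->
  tl k D z = (Lpot m k D z - Lpot m 0 D z)%:E.
Proof.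
move=> k0 s0 sD.
have i0 : m.-integrable D (EFin \o (fun t => lam 0 (z.1 - t) z.2)).
  by apply: (lam_integrable m mD Db s0) => t Dt; rewrite addr0 sD.
have ik := lam_int z k0.
have -> : Lpot m k D z - Lpot m 0 D z = \int[m]_(t in D) (lam k (z.1 - t) z.2 - lam 0 (z.1 - t) z.2).
  by rewrite RintegralB.
rewrite /Rintegral fineK; last exact: integrable_fin_num (intB mD ik i0).
apply: eq_integral => t /[!inE] Dt; rewrite tker_lam// gt_eqF//.
by apply: lt_le_trans (sD t Dt).
Qed.

Lemma tl_subset k z (E F : set T) : measurable E -> measurable F -> E `<=` F -> 0 <= k ->
  (tl k E z <= tl k F z)%E.
Proof.
move=> mE mF EF k0; apply: ge0_subset_integral => //.
  exact: measurable_tker_line.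
by move=> t _; apply: tker_ge0 => //; exact: sqr_sum_ge0.
Qed.

Lemma Lpot_sub_le_tl k k' z : 0 < k' -> k' <= k -> ((Lpot m k D z - Lpot m k' D z)%:E <= tl k D z)%E.
Proof.
move=> k'0 kk; have k0 := lt_le_trans k'0 kk.
have := tl_add z k0 k'0.
have := tl_ge0 z D (ltW k'0); have := tl_ge0 z D (ltW k0).
case: (tl k D z) => [u| |] //= u0; last by rewrite leey.
case: (tl k' D z) => [v| |] //=; rewrite !lee_fin => v0 [] E.
lra.
Qed.

Lemma tker_cvg k r : 0 < k -> 0 <= r ->
  ((2^-1 * (ln (r + k) - ln (r + k / n.+1%:R)))%:E)%E @[n --> \oo] --> tker k r.
Proof.
move=> k0 r0; rewrite /tker; have [->|n0] := eqVneq r 0.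
  rewrite !add0r.
  have E n : 2^-1 * (ln k - ln (k / n.+1%:R)) = 2^-1 * ln (n.+1%:R : R).
    by rewrite ln_div ?posrE//; ring.
  apply/cvgeryP/cvgryPge => A; near=> n; rewrite add0r E.
  rewrite -ler_pdivrMl ?invr_gt0// invrK -ler_expR lnK ?posrE//.
  have : expR (2 * A) <= n%:R by near: n; exact: nbhs_infty_ger.
  by move=> /le_trans; apply; rewrite ler_nat.
apply: cvg_EFin; first by near=> n.
have rp : 0 < r by rewrite lt_def n0.
apply: cvgMr; apply: cvgB; first exact: cvg_cst.
apply: (@cvg_comp _ _ _ (fun n : nat => r + k / n.+1%:R) (@ln R) _ (nbhs r)); last exact: continuous_ln.
have H : r + k / n.+1%:R @[n --> \oo] --> r + k * 0.
  by apply: cvgD; [exact: cvg_cst|apply: cvgMr; exact: cvg_harmonic].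
by move: H; rewrite mulr0 addr0.
Unshelve. all: by end_near.
Qed.

(** [tker k] is the increasing limit of the bounded kernels [lam k - lam (k / n.+1)], so monotone
    convergence reduces a bound on the singular integral to bounds on differences of continuous
    potentials. *)
Lemma tl_leP k z (c : R) : 0 < k ->
  (forall n, Lpot m k D z - Lpot m (k / n.+1%:R) D z <= c) -> (tl k D z <= c%:E)%E.
Proof.
move=> k0 H.
pose g n (t : T) : \bar R := (lam k (z.1 - t) z.2 - lam (k / n.+1%:R) (z.1 - t) z.2)%:E.
have kn n : 0 < k / n.+1%:R by rewrite divr_gt0.
have knk n p : (n <= p)%N -> k / p.+1%:R <= k / n.+1%:R.
  by move=> np; rewrite ler_pM2l// lef_pV2 ?posrE// ler_nat.
have kk n : k / n.+1%:R <= k by rewrite ler_pdivrMr//; apply: ler_peMr; [exact: ltW|rewrite ler1n].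
have S0 n x : 0 < x ^+ 2 + z.2 ^+ 2 + k / n.+1%:R by rewrite ltr_wpDl ?sqr_sum_ge0.
have gE n t : g n t = (2^-1 * (ln ((z.1 - t) ^+ 2 + z.2 ^+ 2 + k) - ln ((z.1 - t) ^+ 2 + z.2 ^+ 2 + k / n.+1%:R)))%:E.
  by rewrite /g /lam; congr EFin; ring.
have mg n : measurable_fun D (g n).
  by apply/measurable_EFinP; apply: measurable_funB; exact: measurable_lam.
have g0 n t : D t -> (0 <= g n t)%E.
  by move=> _; rewrite lee_fin subr_ge0 lam_mono// ltW.
have gm t : D t -> {homo g ^~ t : n p / (n <= p)%N >-> (n <= p)%E}.
  move=> _ n p np; rewrite lee_fin lerD2l lerN2 lam_mono//; first exact: ltW.
  exact: knk.
have E : tl k D z = (\int[m]_(t in D) (fun t => limn (g ^~ t)) t)%E.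
  apply: eq_integral => t _; apply/esym/cvg_lim => //.
  under eq_fun do rewrite gE.
  by apply: tker_cvg => //; exact: sqr_sum_ge0.
rewrite E monotone_convergence//.
have I n : (\int[m]_(t in D) g n t)%E = (Lpot m k D z - Lpot m (k / n.+1%:R) D z)%:E.
  have ik := lam_int z k0; have ikn := lam_int z (kn n).
  rewrite /Lpot -(RintegralB mD ik ikn) /Rintegral fineK//.
  exact: integrable_fin_num (intB mD ik ikn).
apply: lime_le; last by apply: nearW => n; rewrite I lee_fin H.
apply: ereal_nondecreasing_is_cvgn => n p np.
by apply: ge0_le_integral => //; [move=> t Dt; exact: g0|move=> t Dt; exact: gm].
Qed.

(** If all the smaller tails were at least [eta], then [tl_add] would bound every difference in
    [tl_leP] by the finite value of [tl k D z] minus [eta]. *)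
Lemma tl_small k z (eta : R) : 0 < k -> (tl k D z < +oo)%E -> 0 < eta ->
  exists n, (tl (k / n.+1%:R) D z < eta%:E)%E.
Proof.
move=> k0 fin eta0; apply: contrapT => /forallNP H.
have tf : tl k D z \is a fin_num by rewrite ge0_fin_numE// tl_ge0// ltW.
have : (tl k D z <= (fine (tl k D z) - eta)%:E)%E.
  apply: tl_leP => // n.
  have kn : 0 < k / n.+1%:R by rewrite divr_gt0.
  have := tl_add z k0 kn; have := H n; move/negP; rewrite -leNgt.
  rewrite -(fineK tf) /=; case: (tl (k / n.+1%:R) D z) => [v| |] //=.
  by rewrite lee_fin => h [] E; lra.
by rewrite -{1}(fineK tf) lee_fin; lra.
Qed.

Lemma Lpot_continuous k z : 0 < k -> {for z, continuous (Lpot m k D)}.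
Proof.
move=> k0; case: z => z1 z2.
have [L [_ _ H]] := @expn_Lpot _ m D b k k z1 z2 mD Db (ltW k0) k0
  (fun t _ => ltac:(by rewrite lerDr; exact: sqr_sum_ge0)).
exact: expn_cont H.
Qed.

(** Lower semicontinuity: by [tl_leP] the sublevel set is an intersection of sublevel sets of
    continuous functions. *)
Lemma tl_le_closed k (c : R) : 0 < k -> closed [set x : R | (tl k D (x, 0%R) <= c%:E)%E].
Proof.
move=> k0.
have kn n : 0 < k / n.+1%:R by rewrite divr_gt0.
have -> : [set x : R | (tl k D (x, 0%R) <= c%:E)%E] =
    \bigcap_n [set x : R | Lpot m k D (x, 0) - Lpot m (k / n.+1%:R) D (x, 0) <= c].
  apply/seteqP; split => x /=.
    move=> h n _ /=; rewrite -lee_fin; apply: le_trans h; apply: Lpot_sub_le_tl => //.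
    by rewrite ler_pdivrMr//; apply: ler_peMr; [exact: ltW|rewrite ler1n].
  by move=> h; apply: tl_leP => // n; exact: h.
apply: closed_bigI => n _.
apply: (@preimage_closed _ _ (fun x : R => Lpot m k D (x, 0) - Lpot m (k / n.+1%:R) D (x, 0)) [set y | y <= c]); last first.
  exact: closed_le.
move=> x _.
have cx : {for x, continuous (fun x : R => (x, 0) : plane R)}.
  have c1 : {for x, continuous (fun y : R => y)} by exact: cvg_id.
  have c2 : {for x, continuous (fun y : R => 0 : R)} by exact: cst_continuous.
  exact: (cvg_pair c1 c2).
have L1 : {for x, continuous (fun x0 : R => Lpot m k D (x0, 0))}.
  by apply: (continuous_comp cx); exact: Lpot_continuous.
have L2 : {for x, continuous (fun x0 : R => Lpot m (k / n.+1%:R) D (x0, 0))}.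
  by apply: (continuous_comp cx); exact: Lpot_continuous.
exact: (cvgB L1 L2).
Qed.

End Tails.

(** * The domination principle *)

Section MaxPrinciple.
Context {R : realType}.

(** If [psi z1 > M], the set [A] where [psi >= psi z1] stays away from [X] and from infinity. It is
    therefore compact and [psi] attains a maximum on it, which strict subharmonicity excludes. *)
Lemma max_principle (X : set (plane R)) (psi : plane R -> R) (M r : R) :
  closed X ->
  (forall z, ~ X z -> lexp psi z) -> (forall z, ~ X z -> {for z, continuous psi}) ->
  (forall z, X z -> near_sq z (fun w => ~ X w -> psi w <= M)) ->
  (forall z, r < z.1 ^+ 2 + z.2 ^+ 2 -> ~ X z -> psi z <= M) ->
  forall z, ~ X z -> psi z <= M.
Proof.
move=> cX lx cpsi bd inf z1 Xz1; rewrite leNgt; apply/negP => Mz1.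
pose A : set (plane R) := [set z | ~ X z /\ psi z1 <= psi z].
have near_out z : ~ A z -> near_sq z (fun w => ~ A w).
  move=> nAz; have [Xz|Xz] := pselect (X z).
    apply: near_sqW (bd z Xz) => w H [Xw h].
    by have := lt_le_trans Mz1 (le_trans h (H Xw)); rewrite ltxx.
  have hz : psi z < psi z1 by rewrite ltNge; apply/negP => h; exact: nAz.
  apply/nbhs_planeP.
  have : \forall w \near z, psi w < psi z1 by apply: (cvgr_lt _ (cpsi z Xz)).
  by apply: filterS => w h [_ h']; have := lt_le_trans h h'; rewrite ltxx.
have cA : closed A.
  rewrite -openC openE => z /= nAz; apply/nbhs_planeP; exact: near_out.
pose B := Num.max r 0 + 1.
have B1 : 1 <= B by rewrite lerDr le_max lexx orbT.
have rB : r < B by rewrite ltr_pwDr// le_max lexx.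
have kA : compact A.
  apply: (@subclosed_compact _ _ (`[- B, B]%classic `*` `[- B, B]%classic)) => //.
    by apply: compact_setX; exact: segment_compact.
  move=> [x y] [Xz h]; rewrite /= !in_itv /= -!ler_norml.
  have xr : x ^+ 2 + y ^+ 2 <= r.
    rewrite leNgt; apply/negP => rx; have := inf (x, y) rx Xz => h'.
    by have := lt_le_trans Mz1 (le_trans h h'); rewrite ltxx.
  have BB : r <= B ^+ 2 by rewrite (le_trans (ltW rB))// expr2 ler_peMr// (le_trans _ B1).
  have B0 : 0 <= B by rewrite (le_trans _ B1).
  split; rewrite -(@ler_pXn2r _ 2) ?nnegrE// real_normK ?num_real// (le_trans _ BB)// (le_trans _ xr)//.
    by rewrite lerDl sqr_ge0.
  by rewrite lerDr sqr_ge0.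
have [c cinA cmax] : exists2 c, c \in A & forall t, t \in A -> psi t <= psi c.
  apply: compact_EVT_max => //; first by exists z1; split.
  apply: continuous_in_subspaceT => z; rewrite inE => -[Xz _]; exact: cpsi.
move: cinA; rewrite inE => -[Xc hc].
have nX : near_sq c (fun w => ~ X w).
  by apply/nbhs_planeP; apply: open_nbhs_nbhs; split => //; rewrite openC.
case: nX => d d0 nX; have [x [y [xy h]]] := lexp_not_max (lx c Xc) d0.
have := cmax (c.1 + x, c.2 + y); rewrite inE => /(_ (conj (nX _ _ xy) (le_trans hc (ltW h)))).
by rewrite leNgt h.
Qed.

End MaxPrinciple.

Section PointContinuity.
Context {R : realType} {X : topologicalType}.
Implicit Types (f g : X -> R) (z : X).

Lemma forD f g z : {for z, continuous f} -> {for z, continuous g} ->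
  {for z, continuous (fun w => f w + g w)}.
Proof. by move=> cf cg; exact: (cvgD cf cg). Qed.

Lemma forM f g z : {for z, continuous f} -> {for z, continuous g} ->
  {for z, continuous (fun w => f w * g w)}.
Proof. by move=> cf cg; exact: (cvgM cf cg). Qed.

Lemma forN f z : {for z, continuous f} -> {for z, continuous (fun w => - f w)}.
Proof. by move=> cf; exact: (cvgN cf). Qed.

Lemma forC (c : R) z : {for z, continuous (fun _ : X => c)}.
Proof. exact: cst_continuous. Qed.

Lemma forB f g z : {for z, continuous f} -> {for z, continuous g} ->
  {for z, continuous (fun w => f w - g w)}.
Proof. by move=> cf cg; exact: (cvgB cf cg). Qed.

Lemma forZ c f z : {for z, continuous f} -> {for z, continuous (fun w => c * f w)}.
Proof. by move=> cf; apply: forM => //; exact: forC. Qed.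

Lemma forX n f z : {for z, continuous f} -> {for z, continuous (fun w => f w ^+ n)}.
Proof.
move=> cf; elim: n => [|n IH].
  by have -> : (fun w => f w ^+ 0) = (fun _ : X => 1) by []; exact: forC.
have -> : (fun w => f w ^+ n.+1) = (fun w => f w * f w ^+ n) by apply/funext => w; rewrite exprS.
exact: forM.
Qed.

Lemma for_comp (h : R -> R) f z : {for z, continuous f} -> {for f z, continuous h} ->
  {for z, continuous (fun w => h (f w))}.
Proof. by move=> cf ch; exact: (continuous_comp cf ch). Qed.

Lemma for_ln f z : 0 < f z -> {for z, continuous f} -> {for z, continuous (fun w => ln (f w))}.
Proof. by move=> f0 cf; apply: for_comp => //; exact: continuous_ln. Qed.

Lemma for_max f g z : {for z, continuous f} -> {for z, continuous g} ->
  {for z, continuous (fun w => Num.max (f w) (g w))}.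
Proof. by move=> cf cg; exact: (@continuous_max R X f g z). Qed.

End PointContinuity.

Section Domination.
Context {R : realType}.
Local Notation T := (measurableTypeR R).
Implicit Types (z : plane R).

Lemma lexpD_expn0 (h u : plane R -> R) z L : lexp h z -> expn u z L -> 0 <= L ->
  lexp (fun w => h w + u w) z.
Proof.
move=> [a [b [al [be [ga [alga [d d0 H]]]]]]] [a' [b' [al' [be' [ga' [E H']]]]]] L0.
exists (a + a'), (b + b'), (al + al' - (al + ga) / 4), (be + be'), (ga + ga' - (al + ga) / 4).
split; first by lra.
have [d' d'0 dP] := H' ((al + ga) / 4) ltac:(lra).
exists (Num.min d d'); first by rewrite lt_min d0.
move=> x y; rewrite lt_min => /andP[/H h1 /dP]; rewrite ler_norml => /andP[h2 _].
move: h1 h2; rewrite /quad; lra.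
Qed.

Lemma lexp_nbhs_eq (h u : plane R -> R) z : lexp u z -> near_sq z (fun w => u w = h w) -> lexp h z.
Proof.
move=> lu n; apply: (lexp_le lu); first exact: (near_sq_refl n).
by apply: near_sqW n => w ->.
Qed.

Lemma cont_near_eq (h u : plane R -> R) z : {for z, continuous u} -> near_sq z (fun w => u w = h w) ->
  {for z, continuous h}.
Proof.
move=> cu n; have E := near_sq_refl n; apply: (@cvg_trans _ (u @ z)).
  by apply: near_eq_cvg; apply/nbhs_planeP; apply: near_sqW n => w ->.
by rewrite -E; exact: cu.
Qed.

Lemma tker_scale (k r : R) : 0 <= k -> 0 <= r -> (tker (k / 4) r = tker k (4 * r))%E.
Proof.
move=> k0 r0; rewrite /tker mulf_eq0 pnatr_eq0 /=; have [//|n0] := eqVneq r 0.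
have rp : 0 < r by rewrite lt_def n0.
congr EFin; have -> : 4 * r + k = 4 * (r + k / 4) by field.
have p1 : 0 < r + k / 4 by rewrite ltr_pwDl// divr_ge0.
by rewrite !lnM ?posrE//; ring.
Qed.

Lemma compact_nearest (K : set R) z : compact K -> K !=set0 -> exists2 x, K x &
  forall t, K t -> (z.1 - x) ^+ 2 + z.2 ^+ 2 <= (z.1 - t) ^+ 2 + z.2 ^+ 2.
Proof.
move=> cK K0.
have [|x xK xmin] := @compact_EVT_min _ _ (fun t : R => (z.1 - t) * (z.1 - t)) K K0 cK.
  apply: continuous_subspaceT => t.
  have c1 : {for t, continuous (fun t : R => z.1 - t)}.
    by apply: forB; [exact: forC|exact: cvg_id].
  exact: (forM c1 c1).
exists x; first by rewrite inE in xK.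
by move=> t Kt; rewrite lerD2r !expr2; apply: xmin; rewrite inE.
Qed.

Lemma finite_domain_dist (K : set R) z : compact K -> finite_domain K z ->
  exists2 s, 0 < s & forall t, K t -> s <= (z.1 - t) ^+ 2 + z.2 ^+ 2.
Proof.
move=> cK fz; have [K0|/set0P/negP/negPn/eqP K0] := pselect (K !=set0); last first.
  by exists 1 => // t; rewrite K0.
have [x Kx xmin] := compact_nearest z cK K0.
exists ((z.1 - x) ^+ 2 + z.2 ^+ 2) => //.
rewrite lt_def sqr_sum_ge0 andbT sqr_sum_eq0; apply/negP => /andP[/eqP h1 /eqP h2].
apply: (fz x Kx); rewrite -h2; case: (z) h1 => z1 z2 /= h1; congr pair.
by apply/eqP; rewrite -subr_eq0 h1.
Qed.

Variables (m : probability T R).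

Lemma expn_Lpot0 (K : set R) b z : compact K -> (forall t, K t -> `|t| <= b) -> finite_domain K z ->
  expn (Lpot m 0 (K : set T)) z 0.
Proof.
move=> cK Kb fz.
have mK : measurable (K : set T).
  by apply: closed_measurable; apply: compact_closed => //; exact: norm_hausdorff.
have [s s0 sK] := finite_domain_dist cK fz.
move: fz sK; case: z => z1 z2 fz sK.
have [|L [_ /(_ erefl) -> //]] := @expn_Lpot _ m K b 0 s z1 z2 mK Kb (lexx _) s0.
by move=> t Kt; rewrite addr0; exact: sK.
Qed.

(** For the point [x] of [K] nearest to [z], the distance from [x] to [t] is at most twice that from
    [z] to [t]. The kernel for [k] at [4 * r] is the kernel for [k / 4] at [r], whence the
    [k / 4]. *)
Lemma tl_nearest (K : set R) b k z (th : R) : compact K -> (forall t, K t -> `|t| <= b) -> 0 < k ->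
  (forall x, K x -> (tl m k K (x, 0%R) <= th%:E)%E) -> K !=set0 -> finite_domain K z ->
  - Lpot m 0 K z <= th - Lpot m (k / 4) K z.
Proof.
move=> cK Kb k0 Kth K0 fz.
have mK : measurable (K : set T).
  by apply: closed_measurable; apply: compact_closed => //; exact: norm_hausdorff.
have [x Kx xmin] := compact_nearest z cK K0.
have [s s0 sK] := finite_domain_dist cK fz.
have k4 : 0 < k / 4 by rewrite divr_gt0.
have : (tl m (k / 4) K z <= th%:E)%E.
  apply: le_trans (Kth x Kx); rewrite /tl /=.
  apply: ge0_le_integral => //.
  - by move=> t _; apply: tker_ge0; [exact: ltW|exact: sqr_sum_ge0].
  - exact: measurable_tker_line.
  - exact: (measurable_tker_line k (x, 0)).
  move=> t Kt; rewrite tker_scale ?sqr_sum_ge0//; last exact: ltW.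
  apply: tker_anti; [exact: ltW|exact: sqr_sum_ge0|].
  have := xmin t Kt; have := sqr_ge0 (2 * z.1 - x - t); have := sqr_ge0 z.2.
  rewrite expr0n addr0 => h1 h2 h3.
  have -> : (x - t) ^+ 2 = 2 * (z.1 - x) ^+ 2 + 2 * (z.1 - t) ^+ 2 - (2 * z.1 - x - t) ^+ 2 by ring.
  lra.
rewrite (tl_far m mK Kb k4 s0 sK) lee_fin; lra.
Qed.

(** A continuity principle: on [K] the tail is at most [th], so near [K] the singular potential
    exceeds the continuous one for [k / 4] by at most [th]. This gives the boundary values at [K]
    for the maximum principle; those near [X0], which may enclose a pole of [be], and near infinity
    are hypotheses. *)
Lemma domination (K : set R) b k th (C M eta r : R) (X0 : set (plane R)) (be : plane R -> R) :
  compact K -> (forall t, K t -> `|t| <= b) -> 0 < k -> 0 < C -> 0 < eta -> closed X0 ->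
  (forall x, K x -> (tl m k K (x, 0%R) <= th%:E)%E) ->
  (forall z, ~ X0 z -> lexp be z /\ {for z, continuous be}) ->
  (forall x, K x -> {for ((x, 0) : plane R), continuous be}) ->
  (forall x, K x -> - (C * Lpot m (k / 4) K (x, 0)) + be (x, 0) <= M) ->
  (forall z, X0 z -> near_sq z (fun w => finite_domain K w -> ~ X0 w ->
     - (C * Lpot m 0 K w) + be w <= M + C * th + eta)) ->
  (forall w, r < w.1 ^+ 2 + w.2 ^+ 2 -> finite_domain K w -> ~ X0 w ->
     - (C * Lpot m 0 K w) + be w <= M + C * th + eta) ->
  forall w, finite_domain K w -> ~ X0 w -> - (C * Lpot m 0 K w) + be w <= M + C * th + eta.
Proof.
move=> cK Kb k0 C0 eta0 cX Kth lbe cbe hK hX hinf w fw Xw.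
have clK : closed K by apply: compact_closed => //; exact: norm_hausdorff.
have mK : measurable (K : set T) by exact: closed_measurable.
have k4 : 0 < k / 4 by rewrite divr_gt0.
pose X := X0 `|` ~` finite_domain K.
have oF : open (finite_domain K).
  by rewrite openE => z fz; apply/nbhs_planeP; exact: finite_domain_near.
have cXX : closed X by apply: closedU => //; exact: open_closedC.
have nX z : ~ X z -> ~ X0 z /\ finite_domain K z.
  by move=> h; split; [move=> ?; apply: h; left|apply: contrapT => ?; apply: h; right].
have lx z : ~ X z -> lexp (fun w => - (C * Lpot m 0 K w) + be w) z.
  move=> /nX[Xz fz]; have [l _] := lbe z Xz.
  have E := expnZ (- C) (expn_Lpot0 cK Kb fz); rewrite mulr0 in E.
  apply: (lexp_nbhs_eq (lexpD_expn0 l E (lexx 0))).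
  by exists 1 => // x y _; rewrite /= addrC mulNr.
have cx z : ~ X z -> {for z, continuous (fun w => - (C * Lpot m 0 K w) + be w)}.
  move=> /nX[Xz fz]; have [_ c] := lbe z Xz.
  have c1 := expn_cont (expnZ (- C) (expn_Lpot0 cK Kb fz)).
  apply: (cont_near_eq (forD c1 c)).
  by exists 1 => // x y _; rewrite /= mulNr.
apply: (max_principle (r := r) cXX lx cx); last by move=> [].
  move=> z Xz; have [X0z|nX0z] := pselect (X0 z).
    by apply: near_sqW (hX z X0z) => v h /nX[h1 h2]; exact: h.
  have [x Kx ->] : exists2 x, K x & z = (x, 0).
    case: Xz => // h; apply: contrapT => nh; apply: h => x Kx zx; apply: nh; by exists x.
  have K0 : K !=set0 by exists x.
  have c1 : {for (x, 0), continuous (fun w => - (C * Lpot m (k / 4) K w) + be w)}.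
    have cL := @Lpot_continuous _ m K b mK Kb (k / 4) (x, 0) k4.
    by apply: forD; [apply: forN; exact: forZ|exact: cbe].
  have : \forall v \near ((x, 0) : plane R), - (C * Lpot m (k / 4) K v) + be v < M + eta.
    by apply: (cvgr_lt _ c1); rewrite (le_lt_trans (hK x Kx))// ltrDl.
  move=> /nbhs_planeP; apply: near_sqW => v hv /nX[_ fv].
  have := tl_nearest cK Kb k0 Kth K0 fv; rewrite -(ler_pM2l C0) => h.
  move: hv h; lra.
move=> z rz /nX[h1 h2]; exact: hinf.
Qed.

End Domination.

Lemma gt0_null d (T : measurableType d) (R : realType) (mu : {measure set T -> \bar R})
    (B : set T) (f : T -> \bar R) : measurable B -> measurable_fun B f ->
  (forall x, B x -> (0 < f x)%E) -> (\int[mu]_(x in B) f x <= 0)%E -> mu B = 0%E.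
Proof.
move=> mB mf f0 int0.
have E : (\int[mu]_(x in B) `|f x| = 0)%E.
  apply/eqP; rewrite eq_le integral_ge0 ?andbT//.
  apply: le_trans int0; rewrite le_eqVlt; apply/orP; left; apply/eqP.
  by apply: eq_integral => x /[!inE] Bx; rewrite gee0_abs// ltW// f0.
have /(ae_eq_integral_abs mu mB mf)[N [mN N0 BN]] := E.
apply/eqP; rewrite eq_le measure_ge0 andbT -N0; apply: le_measure; rewrite ?inE//.
move=> x Bx; apply: BN => /= /(_ Bx) f00; by have := f0 x Bx; rewrite f00 ltxx.
Qed.

Section DominationLimit.
Context {R : realType}.
Local Notation T := (measurableTypeR R).
Implicit Types (z : plane R).
Variables (e : set R) (b : R) (m : probability T R).
Hypotheses (cpt : compact e) (eb : forall x, e x -> `|x| <= b) (me : m e = 1%E).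

Lemma clos_e : closed e.
Proof. by apply: compact_closed => //; exact: norm_hausdorff. Qed.

Lemma tl_mono_k k k' z (E : set T) : measurable E -> 0 <= k -> k <= k' ->
  (tl m k E z <= tl m k' E z)%E.
Proof.
move=> mE k0 kk; apply: ge0_le_integral => //.
- by move=> t _; apply: tker_ge0 => //; exact: sqr_sum_ge0.
- exact: measurable_tker_line.
- exact: measurable_tker_line.
move=> t _; rewrite /tker; case: eqP => // /eqP n0.
have rp : 0 < (z.1 - t) ^+ 2 + z.2 ^+ 2 by rewrite lt_def n0 sqr_sum_ge0.
have k'0 := le_trans k0 kk.
by rewrite lee_fin ler_pM2l ?invr_gt0// lerD2r ler_ln ?posrE; [rewrite lerD2l|rewrite ltr_wpDr|rewrite ltr_wpDr].
Qed.

(** Egorov's argument: by [tl_small] the tails decrease to zero wherever they are finite, so the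
    sets where they exceed [th] decrease to a null set. *)
Lemma tail_egorov (th eps : R) : m.-negligible [set x | e x /\ tl m 1 e (x, 0%R) = +oo%E] ->
  0 < th -> 0 < eps ->
  exists2 k, 0 < k <= 1 & (m (e `\` [set x : R | tl m k e (x, 0%R) <= th%:E]%E) < eps%:E)%E.
Proof.
move=> neg th0 eps0.
pose k n : R := 1 / n.+1%:R.
have k0 n : 0 < k n by rewrite divr_gt0.
have k1 n : k n <= 1 by rewrite ler_pdivrMr// mul1r ler1n.
pose F n : set T := e `\` [set x : R | tl m (k n) e (x, 0%R) <= th%:E]%E.
have mF n : measurable (F n).
  apply: measurableD; first exact: meas_e cpt.
  apply: closed_measurable; exact: (tl_le_closed (m := m) (c := th) (meas_e cpt) eb (k0 n)).
have F0 : m (\bigcap_n F n) = 0%E.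
  have [N [mN N0 NF]] := neg.
  apply/eqP; rewrite eq_le measure_ge0 andbT -N0; apply: le_measure; rewrite ?inE//.
    exact: bigcap_measurable.
  move=> x Fx; apply: NF; split; first by case: (Fx 0%N I).
  apply: contrapT => /eqP; rewrite -ltey => fin.
  have [n nn] := tl_small (m := m) (meas_e cpt) eb ltr01 fin th0.
  by case: (Fx n I) => _; apply; exact: ltW.
have : m (F n) @[n --> \oo] --> m (\bigcap_n F n).
  apply: nonincreasing_cvg_mu => //.
  - by apply: le_lt_trans (probability_le1 m (mF 0%N)) _; rewrite ltry.
  - exact: bigcap_measurable.
  move=> n p np; apply/subsetPset => x [ex h]; split => // h'; apply: h.
  apply: le_trans h'; apply: tl_mono_k; [exact: meas_e|exact: ltW|].
  by rewrite ler_pM2l// lef_pV2 ?posrE// ler_nat.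
rewrite F0 => /fine_cvgP[fin /cvgrPdist_lt /(_ _ eps0)].
move=> H; have [n _ /(_ n (leqnn n))] : \forall n \near \oo, m (F n) \is a fin_num /\ `|0 - fine (m (F n))| < eps.
  by near=> n; split; [near: n|near: n].
move=> [f1 f2]; exists (k n); first by rewrite k0 k1.
rewrite -/(F n) -(fineK f1) lte_fin (le_lt_trans _ f2)// sub0r normrN ler_norm//.
Unshelve. all: by end_near.
Qed.

Lemma Lpot_le (D : set T) (k A : R) z : measurable D -> 0 <= A ->
  m.-integrable D (EFin \o (fun t => lam k (z.1 - t) z.2)) ->
  (forall t, D t -> lam k (z.1 - t) z.2 <= A) -> Lpot m k D z <= A * fine (m D).
Proof.
move=> mD A0 i H; rewrite -(Rintegral_cst m mD); apply: le_Rintegral => //.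
by apply: (@bnd_integrable _ m D (fun _ => A) `|A|).
Qed.

Lemma Lpot_ge (D : set T) (k A : R) z : measurable D -> 
  m.-integrable D (EFin \o (fun t => lam k (z.1 - t) z.2)) ->
  (forall t, D t -> A <= lam k (z.1 - t) z.2) -> A * fine (m D) <= Lpot m k D z.
Proof.
move=> mD i H; rewrite -(Rintegral_cst m mD); apply: le_Rintegral => //.
by apply: (@bnd_integrable _ m D (fun _ => A) `|A|).
Qed.

Lemma Lpot_splitD (K : set T) (k : R) z : measurable K -> K `<=` e ->
  m.-integrable e (EFin \o (fun t => lam k (z.1 - t) z.2)) ->
  Lpot m k e z = Lpot m k K z + Lpot m k (e `\` K) z.
Proof.
move=> mK Ke i; rewrite /Lpot -{1}(setDUK Ke) Rintegral_setU//.
- by apply: measurableD => //; exact: meas_e.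
- by rewrite setDUK.
- by apply/disj_setPS => x [? []].
Qed.

Lemma fine_mK (K : set T) : measurable K -> K `<=` e -> fine (m K) = 1 - fine (m (e `\` K)).
Proof.
move=> mK Ke.
have mD : measurable (e `\` K : set T) by apply: measurableD => //; exact: meas_e.
have : m e = (m K + m (e `\` K))%E.
  rewrite -measureU//; first by rewrite setDUK.
  by apply/seteqP; split => // x [? []].
have fK : m K \is a fin_num by exact: fin_num_measure.
have fD : m (e `\` K) \is a fin_num by exact: fin_num_measure.
rewrite -(fineK fK) -(fineK fD) => E.
have : (1%:E = (fine (m K) + fine (m (e `\` K)))%:E)%E by rewrite -me E.
by move=> [] ->; rewrite addrK.
Qed.

(** [domination] is applied to the compact part [K] of [G] where the tail is small. Removing the
    remaining mass [p] from the potential costs at most [C * Lam * p] on e and near [X0], and at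
    most [C * (2^-1 * |ln s|) * p] at [w], whose squared distance from e is at least [s]. The
    condition on [gam] lets the potential of the mass on [K] dominate [be] at infinity. *)
Lemma domination_pot (G : set R) (C gam B Lam s : R) (X0 : set (plane R)) (be : plane R -> R) w :
  m.-negligible [set x | e x /\ tl m 1 e (x, 0%R) = +oo%E] ->
  closed G -> 0 < C -> 0 <= gam -> closed X0 ->
  (forall z, ~ X0 z -> lexp be z /\ {for z, continuous be}) ->
  (forall x, e x -> {for ((x, 0) : plane R), continuous be}) ->
  (forall x, e x -> G x -> forall k, 0 < k -> k <= 1 -> - (C * Lpot m k e (x, 0)) + be (x, 0) <= 0) ->
  0 <= Lam -> (forall x t, e x -> e t -> lam 1 (x - t) 0 <= Lam) ->
  (forall z, X0 z -> near_sq z (fun w => ~ X0 w ->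
     [/\ finite_domain e w, - (C * Lpot m 0 e w) + be w <= 0 &
         forall t, e t -> lam 0 (w.1 - t) w.2 <= Lam])) ->
  (forall w, ~ X0 w -> be w <= gam * lam 1 w.1 w.2 + B) ->
  gam < C * (1 - fine (m (e `\` G))) ->
  finite_domain e w -> ~ X0 w -> 0 < s -> s <= 1 ->
  (forall t, e t -> s <= (w.1 - t) ^+ 2 + w.2 ^+ 2) ->
  - (C * Lpot m 0 e w) + be w <= C * (Lam + 2^-1 * `|ln s|) * fine (m (e `\` G)).
Proof.
move=> neg cG C0 gam0 cX lbe cbe hG Lam0 hLam hX hinf gamC fw Xw s0 s1 sw.
have ce := clos_e; have meas := meas_e cpt.
have mG : measurable (G : set T) by exact: closed_measurable.
pose A := C * (Lam + 2^-1 * `|ln s|).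
have A0 : 0 <= A by rewrite mulr_ge0 ?addr_ge0 ?mulr_ge0 ?invr_ge0// ltW.
set q := fine (m (e `\` G)) in gamC *.
have q0 : 0 <= q by rewrite fine_ge0.
apply/ler_addgt0Pr => eta eta0.
(* The first bound keeps the loss [A * q'] below [eta / 4]; the second preserves half of the margin
   in the growth condition when [K] replaces [G]. *)
pose q' := Num.min (eta / (4 * (A + 1))) ((C * (1 - q) - gam) / (2 * C)).
have A1 : 0 < A + 1 by rewrite ltr_wpDl.
have q'0 : 0 < q' by rewrite lt_min !divr_gt0 ?mulr_gt0// subr_gt0.
have q'1 : A * q' <= eta / 4.
  have : q' <= eta / (4 * (A + 1)) by rewrite ge_min lexx.
  rewrite ler_pdivlMr ?mulr_gt0// => h.
  have : q' * (4 * (A + 1)) = 4 * (A * q') + 4 * q' by ring.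
  move=> E; rewrite E in h; have := ltW q'0; lra.
have q'2 : C * q' <= (C * (1 - q) - gam) / 2.
  have : q' <= (C * (1 - q) - gam) / (2 * C) by rewrite ge_min lexx orbT.
  rewrite ler_pdivlMr ?mulr_gt0// => h; lra.
pose th := eta / (4 * C).
have th0 : 0 < th by rewrite divr_gt0// mulr_gt0.
have [k /andP[k0 k1] mk] := tail_egorov neg th0 q'0.
pose K : set R := e `&` G `&` [set x : R | tl m k e (x, 0%R) <= th%:E]%E.
have clK : closed K by apply: closedI; [exact: closedI|exact: (tl_le_closed (m := m) (c := th) meas eb k0)].
have Ke : K `<=` e by move=> x [[]].
have cK : compact K by exact: (subclosed_compact clK cpt Ke).
have mK : measurable (K : set T) by exact: closed_measurable.
have mEK : measurable (e `\` K : set T) by exact: measurableD.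
have Kb t : K t -> `|t| <= b by move=> /Ke /eb.
pose p := fine (m (e `\` K)).
have p0 : 0 <= p by rewrite fine_ge0.
have pq : p <= q + q'.
  rewrite -lee_fin EFinD /p /q !fineK ?fin_num_measure//; [|exact: measurableD..].
  apply: (@le_trans _ _ (m ((e `\` G) `|` (e `\` [set x : R | tl m k e (x, 0%R) <= th%:E]%E)))).
    apply: le_measure; rewrite ?inE//.
      apply: measurableU; apply: measurableD => //.
      by apply: closed_measurable; exact: (tl_le_closed (m := m) (c := th) meas eb k0).
    move=> x [ex nK]; have [Gx|Gx] := pselect (G x); last by left.
    by right; split => // h; apply: nK; split.
  apply: le_trans (measureU2 _ _ _) _; [exact: measurableD| |by rewrite leeD2l// ltW].
  by apply: measurableD => //; apply: closed_measurable; exact: (tl_le_closed (m := m) (c := th) meas eb k0).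
have mKE : fine (m K) = 1 - p by exact: fine_mK.
have Lkpos k' z : 0 < k' -> m.-integrable e (EFin \o (fun t => lam k' (z.1 - t) z.2)).
  by move=> k'0; exact: (lam_int m meas eb).
have sub_int k' z : m.-integrable e (EFin \o (fun t => lam k' (z.1 - t) z.2)) ->
   m.-integrable (e `\` K) (EFin \o (fun t => lam k' (z.1 - t) z.2)).
  by apply: integrableS => //; move=> x [].
have far0 z s' : 0 < s' -> (forall t, e t -> s' <= (z.1 - t) ^+ 2 + z.2 ^+ 2) ->
    m.-integrable e (EFin \o (fun t => lam 0 (z.1 - t) z.2)).
  by move=> s'0 H; apply: (lam_integrable m meas eb s'0) => t et; rewrite addr0; exact: H.
have k4 : 0 < k / 4 by rewrite divr_gt0.
have k41 : k / 4 <= 1 by lra.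
have main : - (C * Lpot m 0 K w) + be w <= C * Lam * p + C * th + eta / 4.
  have fK v : finite_domain e v -> finite_domain K v by move=> fe x Kx; exact: fe (Ke _ Kx).
  (* Beyond squared radius [r] every point of [K] is at squared distance at least [S / 4], and
     [ln S] times the growth margin outweighs all constants. *)
  pose r := Num.max (4 * b ^+ 2) (Num.max 1 (expR (2 * ((C * ln 4 + gam * ln 2 + 2 * `|B|) / (C * (1 - p) - gam))))).
  have cp : 0 < C * (1 - p) - gam by have := ler_wpM2l (ltW C0) pq; lra.
  apply: (@domination _ m K b k th C (C * Lam * p) (eta / 4) r X0 be) => //.
  - by rewrite divr_gt0.
  - move=> x Kx; case: (Kx) => _; apply: le_trans.
    by apply: tl_subset => //; exact: ltW.
  - by move=> x /Ke; exact: cbe.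
  - move=> x Kx; have := hG x (Ke x Kx) _ _ k4 k41; case: (Kx) => -[_ Gx] _ /(_ Gx).
    rewrite (@Lpot_splitD K)//; last exact: Lkpos.
    have : Lpot m (k / 4) (e `\` K) (x, 0) <= Lam * p.
      apply: Lpot_le => //; first by apply: sub_int; exact: Lkpos.
      move=> t [et _] /=; apply: le_trans (hLam x t (Ke x Kx) et).
      by apply: lam_mono; [exact: ltW| |rewrite ltr_wpDl ?sqr_sum_ge0].
    rewrite -(ler_pM2l C0); lra.
  - move=> z Xz; apply: near_sqW (hX z Xz) => v H fv Xv.
    have [fev h1 h2] := H Xv.
    have [s' s'0 s'v] := finite_domain_dist cpt fev.
    have i0 := far0 _ _ s'0 s'v.
    move: h1; rewrite (@Lpot_splitD K)//.
    have : Lpot m 0 (e `\` K) v <= Lam * p.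
      apply: Lpot_le => //; first exact: sub_int.
      by move=> t [et _] /=; exact: h2.
    rewrite -(ler_pM2l C0); have := mulr_gt0 C0 th0; lra.
  - move=> v rv fv Xv.
    move: rv; rewrite /r !gt_max => /andP[r1 /andP[r2 r3]].
    set S := v.1 ^+ 2 + v.2 ^+ 2 in r1 r2 r3 *.
    have S0 : 0 < S by lra.
    have K4 t : K t -> S / 4 <= (v.1 - t) ^+ 2 + v.2 ^+ 2.
      move=> /Kb tb; have tb2 : t ^+ 2 <= b ^+ 2.
        by rewrite -real_normK ?num_real// lerXn2r ?nnegrE// (le_trans _ tb).
      have := sqr_ge0 (v.1 - 2 * t); have := sqr_ge0 v.2; rewrite /S in r1 * => h1 h2.
      have -> : (v.1 - t) ^+ 2 + v.2 ^+ 2 = (v.1 ^+ 2 + v.2 ^+ 2) / 2 - t ^+ 2 + ((v.1 - 2 * t) ^+ 2) / 2 + v.2 ^+ 2 / 2 by field.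
      lra.
    have S4 : 0 < S / 4 by rewrite divr_gt0.
    have iK : m.-integrable K (EFin \o (fun t => lam 0 (v.1 - t) v.2)).
      by apply: (lam_integrable m mK Kb S4) => t Kt; rewrite addr0; exact: K4.
    have l1 : (2^-1 * ln (S / 4)) * (1 - p) <= Lpot m 0 K v.
      rewrite -mKE; apply: Lpot_ge => // t Kt; rewrite /lam addr0 ler_pM2l ?invr_gt0//.
      by rewrite ler_ln ?posrE ?K4// (lt_le_trans S4 (K4 t Kt)).
    have l2 : lam 1 v.1 v.2 <= 2^-1 * (ln S + ln 2).
      rewrite /lam -/S ler_pM2l ?invr_gt0// -lnM ?posrE// ler_ln ?posrE ?mulr_gt0//; lra.
    have l3 : 2 * ((C * ln 4 + gam * ln 2 + 2 * `|B|) / (C * (1 - p) - gam)) <= ln S.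
      by rewrite -ler_expR lnK ?posrE// ltW.
    have l4 := hinf v Xv.
    have p1 : 0 <= 1 - p.
      rewrite -mKE fine_ge0//.
    rewrite ln_div ?posrE// in l1.
    have l5 : C * ((2^-1 * (ln S - ln 4)) * (1 - p)) <= C * Lpot m 0 K v by rewrite ler_pM2l.
    have l6 : gam * lam 1 v.1 v.2 <= gam * (2^-1 * (ln S + ln 2)) by rewrite ler_wpM2l.
    have l7 : 2 * (C * ln 4 + gam * ln 2 + 2 * `|B|) <= ln S * (C * (1 - p) - gam).
      by move: l3; rewrite mulrA ler_pdivrMr.
    have n2 : 0 <= ln 2 :> R by rewrite ln_ge0// ler1n.
    have n4 : 0 <= ln 4 :> R by rewrite ln_ge0// ler1n.
    have B1 := ler_norm B; have B2 := normr_ge0 B.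
    have Cl : 0 <= C * ln 4 by rewrite mulr_ge0// ltW.
    have gl : 0 <= gam * ln 2 by rewrite mulr_ge0.
    have Cp : C * ln 4 * p >= 0 by rewrite mulr_ge0.
    have CL : 0 <= C * Lam * p by rewrite !mulr_ge0// ltW.
    have Ct : 0 <= C * th by rewrite mulr_ge0// ltW.
    lra.
  - exact: fK.
have i0 := far0 _ _ s0 sw.
rewrite (@Lpot_splitD K)//.
have : - (2^-1 * `|ln s|) * p <= Lpot m 0 (e `\` K) w.
  apply: Lpot_ge => //; first exact: sub_int.
  move=> t [et _]; rewrite /lam addr0 -mulrN ler_pM2l ?invr_gt0//.
  apply: (@le_trans _ _ (ln s)); first by rewrite lerNl; have := ler_norm (- ln s); rewrite normrN.
  by rewrite ler_ln ?posrE ?sw// (lt_le_trans s0 (sw t et)).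
rewrite -(ler_pM2l C0) => h.
have : A * p <= A * (q + q') by rewrite ler_wpM2l.
have Cth : C * th = eta / 4 by rewrite /th; field; rewrite gt_eqF.
rewrite Cth in main.
rewrite -/A; have AE : A * p = C * Lam * p + C * (2^-1 * `|ln s|) * p by rewrite /A; ring.
move=> h2; move: main h; rewrite mulrDr => h1 h.
have -> : A * q = A * (q + q') - A * q' by ring.
lra.
Qed.

End DominationLimit.

(** * The equilibrium potential *)

Section Equilibrium.
Context {R : realType}.
Local Notation T := (measurableTypeR R).
Implicit Types (z : plane R) (m mu : probability T R).
Variables (e : set R) (b : R).
Hypotheses (cpt : compact e) (eb : forall x, e x -> `|x| <= b).

(* The potential [\int - ln `|x - t| dm(t)], as a nonnegative singular part minus a continuous part. *)
Definition upot m (x : R) : \bar R := (tl m 1 e (x, 0%R) - (Lpot m 1 e (x, 0%R))%:E)%E.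

Let meas := meas_e cpt.

(** By monotone convergence the potential is the supremum of its continuous regularizations, which
    [Lpot_shift] reads as values off the line. *)
Lemma upot_leP m x c : (upot m x <= c%:E)%E <->
  (forall k, 0 < k -> k <= 1 -> - Lpot m k e (x, 0) <= c).
Proof.
rewrite /upot leeBlDr -?EFinD//; split => [H k k0 k1|H].
  have := Lpot_sub_le_tl m meas eb (x, 0) k0 k1.
  by move=> /le_trans /(_ H); rewrite lee_fin; lra.
apply: (tl_leP (m := m) meas eb) => // n.
have k0 : 0 < 1 / n.+1%:R :> R by rewrite divr_gt0.
have k1 : 1 / n.+1%:R <= 1 :> R by rewrite ler_pdivrMr// mul1r ler1n.
by have := H _ k0 k1; lra.
Qed.

Lemma upot_gt_oo m x : (-oo < upot m x)%E.
Proof.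
rewrite /upot; have := tl_ge0 m (x, 0) e (@ler01 R).
by case: (tl m 1 e (x, 0)) => // r _; rewrite -EFinB ltNyr.
Qed.

Lemma tlE_setT m x : m e = 1%E -> tl m 1 e (x, 0%R) = (\int[m]_y tk2 (x, y))%E.
Proof.
move=> me; rewrite (integral_carrier meas (carrier0 cpt me)) //.
by apply: mslice2; exact: measurable_tk2.
Qed.

Lemma Lpot1_setT m x : m e = 1%E -> (Lpot m 1 e (x, 0%R))%:E = (\int[m]_y lm2 (x, y))%E.
Proof.
move=> me; rewrite (Lpot_EFin m meas eb)// (integral_carrier meas (carrier0 cpt me)) //.
by apply: mslice2; exact: measurable_lm2.
Qed.

Lemma measurable_tl1 m (D : set T) : m e = 1%E -> measurable_fun D (fun x : T => tl m 1 e (x, 0%R)).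
Proof.
move=> me; apply: measurable_funTS.
apply: eq_measurable_fun (measurable_Tin m) => x _; by rewrite tlE_setT.
Qed.

Lemma measurable_Lpot1 m (D : set T) : m e = 1%E -> measurable_fun D (fun x : T => Lpot m 1 e (x, 0%R)).
Proof.
move=> me; apply: measurable_funTS; apply/measurable_EFinP.
apply: eq_measurable_fun (measurable_Lin m) => x _; by rewrite /= Lpot1_setT.
Qed.

Lemma measurable_upot m (D : set T) : m e = 1%E -> measurable_fun D (upot m : T -> _).
Proof.
move=> me; apply: emeasurable_funB; first exact: measurable_tl1.
by apply/measurable_EFinP; exact: measurable_Lpot1.
Qed.

Lemma Lpot1_bnd m x : m e = 1%E -> e x -> 0 <= Lpot m 1 e (x, 0) <= lam 1 (b + b) 0.
Proof.
move=> me ex; rewrite -!lee_fin Lpot1_setT//; apply/andP; split.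
  by apply: integral_ge0 => y _; exact: lm2_ge0.
exact: (Lin_le cpt eb me (eb ex)).
Qed.

Lemma Lpot1_integrable m mu (D : set T) : m e = 1%E -> measurable D -> D `<=` e ->
  mu.-integrable D (EFin \o (fun x => Lpot m 1 e (x, 0))).
Proof.
move=> me mD De; apply: (@bnd_integrable _ mu D _ (lam 1 (b + b) 0)) => //.
  exact: measurable_Lpot1.
move=> t /De /(Lpot1_bnd me)/andP[h1 h2]; by rewrite ger0_norm.
Qed.

Lemma upot_int m1 m2 : m1 e = 1%E -> m2 e = 1%E ->
  (\int[m1]_(x in e) upot m2 x = Tint m1 m2 - Lint m1 m2)%E.
Proof.
move=> e1 e2.
rewrite integral_subge0//; last 3 first.
- exact: measurable_tl1.
- by move=> x _; apply: tl_ge0.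
- exact: Lpot1_integrable.
have -> : (\int[m1]_(x in e) tl m2 1 e (x, 0%R) = Tint m1 m2)%E.
  rewrite /Tint (integral_carrier meas (carrier0 cpt e1)); last exact: measurable_Tin.
  by apply: eq_integral => x _; rewrite tlE_setT.
have -> // : (\int[m1]_(x in e) (Lpot m2 1 e (x, 0%R))%:E = Lint m1 m2)%E.
rewrite /Lint (integral_carrier meas (carrier0 cpt e1)); last exact: measurable_Lin.
by apply: eq_integral => x _; rewrite Lpot1_setT.
Qed.

Lemma upot_intC m1 m2 : m1 e = 1%E -> m2 e = 1%E ->
  (\int[m1]_(x in e) upot m2 x = \int[m2]_(x in e) upot m1 x)%E.
Proof. by move=> e1 e2; rewrite !upot_int// TintC LintC. Qed.

Lemma Tint_lt_pinfty m : m e = 1%E -> (log_energy m < +oo)%E -> (Tint m m < +oo)%E.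
Proof.
move=> me; rewrite /log_energy (pot_int cpt eb me me).
by move: (Lint_fin cpt eb me me); case: (Lint m m) => // r _; case: (Tint m m) => // r' _; rewrite ltry.
Qed.

Lemma log_energy_upot m : m e = 1%E -> log_energy m = (\int[m]_(x in e) upot m x)%E.
Proof. by move=> me; rewrite upot_int// /log_energy (pot_int cpt eb me me). Qed.

Section WithRho.
Variable rho : probability T R.
Hypotheses (rhoP : is_equilibrium_measure e rho) (e_cap : (0 < capacity e)%E).

Lemma rho_e : rho e = 1%E. Proof. exact: (carried_by_1 cpt rhoP.1). Qed.

Let re := rho_e.

Lemma log_energy_fin : log_energy rho \is a fin_num.
Proof.
have Lf := Lint_fin cpt eb re re.
have T0 : (0 <= Tint rho rho)%E by apply: integral_ge0 => x _; exact: Tin_ge0.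
have E : log_energy rho = (Tint rho rho - Lint rho rho)%E by rewrite /log_energy (pot_int cpt eb re re).
rewrite fin_numE; apply/andP; split.
  by rewrite E; move: Lf T0; case: (Lint rho rho) => // r _; case: (Tint rho rho).
apply/eqP => Iy; move: e_cap; rewrite /capacity.
have -> : ereal_inf [set log_energy mu | mu in carried_by e] = +oo%E.
  apply/eqP; rewrite eq_le leey/=; apply: le_ereal_inf_tmp => _ [mu cmu <-].
  by rewrite -Iy; case: rhoP => _; exact.
by rewrite /= ltxx.
Qed.

Lemma capacityE : fine (capacity e) = expR (- fine (log_energy rho)).
Proof.
rewrite /capacity; have -> : ereal_inf [set log_energy mu | mu in carried_by e] = log_energy rho.
  apply/eqP; rewrite eq_le; apply/andP; split.
    by apply: ereal_inf_lbound; exists rho => //; case: rhoP.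
  by apply: le_ereal_inf_tmp => _ [mu cmu <-]; case: rhoP => _; exact.
by rewrite -(fineK log_energy_fin) /=.
Qed.

Let I := fine (log_energy rho).

Lemma frostman_le m : m e = 1%E -> (Tint m m < +oo)%E -> (I%:E <= \int[m]_(x in e) upot rho x)%E.
Proof.
move=> me Tm; rewrite upot_int// /I fineK; last exact: log_energy_fin.
exact: (frostman_variation cpt eb rhoP log_energy_fin me Tm).
Qed.

Lemma Tint_rho : (Tint rho rho < +oo)%E.
Proof.
by apply: Tint_lt_pinfty; [exact: re|]; rewrite -(fineK log_energy_fin) ltry.
Qed.

(** If [m B > 0], conditioning [m] on the set [B] where the potential lies below [I] gives a measure
    [pi] of finite energy, and [frostman_le] for [pi] contradicts the strict inequality on [B]. *)
Lemma frostman_ge_ae m : m e = 1%E -> (Tint m m < +oo)%E ->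
  m [set x | e x /\ (upot rho x < I%:E)%E] = 0%E.
Proof.
move=> me Tm; set B := [set x | _].
have BE : B = e `&` [set x | (upot rho x < I%:E)%E] by [].
have mB : measurable (B : set T).
  by rewrite BE; apply: emeasurable_fun_infty_o => //; exact: measurable_upot.
have Be : B `<=` e by move=> x [].
apply/eqP/negPn/negP => mB0.
have mBgt : (0 < m B)%E by rewrite lt_def mB0 measure_ge0.
have [pi piE] := integral_cond mB mBgt.
have fB : m B \is a fin_num by rewrite fin_num_measure.
set c := (fine (m B))^-1 in piE.
have fB0 : 0 < fine (m B) by rewrite fine_gt0// mBgt ltey_eq fB.
have c0 : 0 < c by rewrite invr_gt0.
have pe : pi e = 1%E.
  have := piE (cst 1%E) e meas (measurable_cst _) (fun _ _ => lee01).
  rewrite !integral_cst ?mul1e//; last exact: measurableI.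
  move=> ->; rewrite [X in (c%:E * X)%E](_ : _ = (fine (m B))%:E); last by rewrite (setIidr Be) fineK.
  by rewrite -EFinM mulVf ?gt_eqF.
have piT (f : T -> \bar R) : measurable_fun setT f -> (forall x, (0 <= f x)%E) ->
   (\int[pi]_x f x = c%:E * \int[m]_(x in B) f x)%E.
  by move=> mf f0; rewrite piE// setTI.
have Tpi : (Tint pi pi < +oo)%E.
  rewrite /Tint piT; last 2 first.
    exact: measurable_Tin.
    by move=> x; exact: Tin_ge0.
  apply: (@le_lt_trans _ _ (c%:E * (c%:E * Tint m m))%E); last first.
    have : (0 <= Tint m m)%E by apply: integral_ge0 => x _; exact: Tin_ge0.
    by move: Tm; case: (Tint m m) => // r _ _; rewrite -!EFinM ltry.
  rewrite lee_pmul2l ?lte_fin//.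
  apply: (@le_trans _ _ (\int[m]_(x in B) (c%:E * \int[m]_y tk2 (x, y)))%E).
    apply: ge0_le_integral => //.
    - by move=> x _; exact: Tin_ge0.
    - by apply: measurable_funTS; exact: measurable_Tin.
    - by apply: measurable_funeM; by apply: measurable_funTS; exact: measurable_Tin.
    move=> x _; rewrite piT; last 2 first.
      by apply: mslice2; exact: measurable_tk2.
      by move=> y; exact: tk2_ge0.
    rewrite lee_pmul2l ?lte_fin//.
    apply: ge0_subset_integral => //.
      by apply: mslice2; exact: measurable_tk2.
    by move=> y _; exact: tk2_ge0.
  rewrite ge0_integralZl//; last 3 first.
  - by apply: measurable_funTS; exact: measurable_Tin.
  - by move=> x _; exact: Tin_ge0.
  - by rewrite lee_fin ltW.
  rewrite lee_pmul2l ?lte_fin//.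
  apply: ge0_subset_integral => //; first exact: measurable_Tin.
  by move=> y _; exact: Tin_ge0.
have := frostman_le pe Tpi.
have mtl D := @measurable_tl1 rho D re.
have iL D (mu : probability T R) := @Lpot1_integrable rho mu D re.
have E1 : (\int[pi]_(x in e) upot rho x = c%:E * \int[m]_(x in B) tl rho 1 e (x, 0%R) -
    c%:E * \int[m]_(x in B) (Lpot rho 1 e (x, 0%R))%:E)%E.
  rewrite integral_subge0//; last 2 first.
  - by move=> x _; apply: tl_ge0.
  - exact: iL.
  congr (_ - _)%E; rewrite piE ?(setIidr Be)//.
  - by move=> x _; apply: tl_ge0.
  - by apply/measurable_EFinP; exact: measurable_Lpot1.
  - by move=> x /(Lpot1_bnd re)/andP[].
have tlle x : B x -> (tl rho 1 e (x, 0%R) <= (I + lam 1 (b + b) 0)%:E)%E.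
  move=> [ex]; rewrite /upot => /ltW; rewrite leeBlDr// => /le_trans; apply.
  by rewrite -EFinD lee_fin lerD2l; case/andP: (Lpot1_bnd re ex).
have itl : m.-integrable B (fun x => tl rho 1 e (x, 0%R)).
  apply: (@le_integrable _ _ _ m B mB _ (cst (I + lam 1 (b + b) 0)%:E)).
  - exact: mtl.
  - move=> x Bx; rewrite gee0_abs; last exact: tl_ge0.
    by apply: le_trans (tlle x Bx) _ => /=; rewrite lee_fin ler_norm.
  - by apply: finite_measure_integrable_cst.
have iLB := iL B m mB Be.
have := gt0_null (mu := m) (B := B) (f := fun x => ((I + Lpot rho 1 e (x, 0))%:E - tl rho 1 e (x, 0%R))%E) mB.
move=> /(_ _ _ _)H E2; suff : m B = 0%E by apply/eqP.
have iIL : m.-integrable B (EFin \o (fun x => I + Lpot rho 1 e (x, 0))).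
  by apply: intD => //; apply: finite_measure_integrable_cst.
apply: H.
- apply: emeasurable_funB; last exact: mtl.
  by apply: measurable_int iIL.
- move=> x Bx; rewrite sube_gt0; case: Bx => ex; rewrite /upot lteBlDr//.
- rewrite integralB//=.
  have -> : (\int[m]_(x in B) (I + Lpot rho 1 e (x, 0))%:E = I%:E * m B + \int[m]_(x in B) (Lpot rho 1 e (x, 0))%:E)%E.
    under eq_integral do rewrite EFinD.
    rewrite integralD//; first by rewrite integral_cst.
    by apply: finite_measure_integrable_cst.
  have f1 := integrable_fin_num mB itl; have f2 := integrable_fin_num mB iLB.
  move: E2 f1 f2; rewrite E1 -(fineK fB) /comp.
  case: (\int[m]_(x in B) tl rho 1 e (x, 0%R))%E => // u.
  case: (\int[m]_(x in B) (Lpot rho 1 e (x, 0%R))%:E)%E => // v h0 _ _.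
  change (I * fine (m B) + v - u <= 0); move: h0.
  change (I <= c * u - c * v -> I * fine (m B) + v - u <= 0); rewrite -mulrBr => h.
  have : fine (m B) * I <= fine (m B) * (c * (u - v)) by rewrite ler_pM2l.
  rewrite mulrA /c divff ?gt_eqF// mul1r; lra.
Qed.

(** The potential is at least [I] almost everywhere and its integral against [rho] is exactly [I],
    so it cannot exceed [I] on a set of positive mass. *)
Lemma upot_eq_ae : rho [set x | e x /\ (I%:E < upot rho x)%E] = 0%E.
Proof.
set A := [set x | _].
have AE : A = e `&` [set x | (I%:E < upot rho x)%E] by [].
have mA : measurable (A : set T).
  by rewrite AE; apply: emeasurable_fun_o_infty => //; exact: measurable_upot.
pose B := e `&` [set x | (upot rho x < I%:E)%E].
have mB : measurable (B : set T).
  by apply: emeasurable_fun_infty_o => //; exact: measurable_upot.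
have B0 : rho B = 0%E by exact: (frostman_ge_ae re Tint_rho).
have mtl D := @measurable_tl1 rho D re.
have iL := @Lpot1_integrable rho rho e re meas (@subset_refl _ e).
have tl0 x : (0 <= tl rho 1 e (x, 0%R))%E by exact: tl_ge0.
have itl : rho.-integrable e (fun x => tl rho 1 e (x, 0%R)).
  apply/integrableP; split; first exact: mtl.
  apply: le_lt_trans Tint_rho; rewrite /Tint (integral_carrier meas (carrier0 cpt re)); last exact: measurable_Tin.
  by rewrite le_eqVlt; apply/orP; left; apply/eqP; apply: eq_integral => x _; rewrite gee0_abs// tlE_setT.
have iI : rho.-integrable e (EFin \o cst I) by apply: finite_measure_integrable_cst.
have iLI : rho.-integrable e (EFin \o (fun x => Lpot rho 1 e (x, 0) + I)) by exact: intD.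
pose f x := (tl rho 1 e (x, 0%R) - (Lpot rho 1 e (x, 0) + I)%:E)%E.
have fi : rho.-integrable e f by exact: (integrableB meas itl iLI).
have fE x : f x = (upot rho x - I%:E)%E.
  by rewrite /f /upot EFinD oppeD ?adde_defN// addeA.
have int0 : (\int[rho]_(x in e) f x = 0)%E.
  rewrite /f integral_subge0//.
  rewrite [X in (_ - X)%E](_ : _ = \int[rho]_(x in e) (Lpot rho 1 e (x, 0%R))%:E + I%:E)%E; last first.
    under eq_integral do rewrite EFinD.
    by rewrite integralD//; congr (_ + _)%E; rewrite integral_cst1.
  have := log_energy_upot re; rewrite -(fineK log_energy_fin) -/I /upot integral_subge0//.
  have f1 := integrable_fin_num meas itl; have f2 := integrable_fin_num meas iL.
  move: f1 f2; case: (\int[_]_(x in _) tl _ _ _ _)%E => // u _.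
  case: (\int[_]_(x in _) _%:E)%E => // v _ [->].
  by rewrite -!EFinD; congr EFin; ring.
have H := @gt0_null _ _ R rho A f mA; apply: H.
- by apply: (measurable_funS meas) (measurable_int rho fi) => x [].
- by move=> x [ex h]; rewrite fE sube_gt0.
apply: (@le_trans _ _ (\int[rho]_(x in e `\` B) f x)%E).
  apply: ge0_subset_integral => //.
  - exact: measurableD.
  - by apply: (measurable_funS meas) (measurable_int rho fi) => x [].
  - move=> x [ex nB]; rewrite fE sube_ge0//.
    by rewrite leNgt; apply/negP => h; apply: nB.
  - move=> x [ex h]; split => // -[_ /=] h'; by have := lt_trans h h'; rewrite ltxx.
by rewrite -(negligible_integral mB meas fi B0) int0.
Qed.

Lemma lam1_le (x c : R) : `|x| <= c -> lam 1 x 0 <= lam 1 c 0.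
Proof.
move=> xc; have x2 : x ^+ 2 <= c ^+ 2 by rewrite -real_normK ?num_real// lerXn2r ?nnegrE// (le_trans _ xc).
rewrite /lam ler_pM2l ?invr_gt0// ler_ln ?posrE ?lerD2r//; apply: ltr_wpDl => //; exact: sqr_sum_ge0.
Qed.

(** The bound holds on e off a [rho]-null set and spreads to the whole domain by [domination_pot],
    with [C = 1], a perturbation of the constant [- I] as comparison function, and the closed set
    [G] where the bound holds. *)
Lemma Lpot_rho_ge z : finite_domain e z -> - Lpot rho 0 e z <= I.
Proof.
move=> fz.
have e0 x : e x -> 0 < b + 1 by move=> /eb h; rewrite ltr_wpDl// (le_trans _ h).
pose G := [set x : R | forall n, - Lpot rho (n.+1%:R^-1) e (x, 0) <= I].
have cG : closed G.
  have -> : G = \bigcap_n [set x : R | - Lpot rho (n.+1%:R^-1) e (x, 0) <= I].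
    by apply/seteqP; split => x /= H; [move=> n _; exact: H|move=> n; exact: H].
  apply: closed_bigI => n _.
  apply: (@closed_comp _ _ (fun x : R => - Lpot rho n.+1%:R^-1 e (x, 0)) [set y | y <= I]); last exact: closed_le.
  move=> x _; apply: cvgN; apply: (@continuous_comp _ _ _ (fun x : R => (x, 0) : plane R)).
    have c1 : (fun y : R => y) @ x --> x by exact: cvg_id.
    have c2 : (fun _ : R => 0 : R) @ x --> (0 : R) by exact: cvg_cst.
    exact: (cvg_pair c1 c2).
  by apply: (Lpot_continuous (m := rho) meas eb); rewrite invr_gt0.
have Gx x : (upot rho x <= I%:E)%E -> G x.
  by move=> /upot_leP H n; apply: H; rewrite ?invr_gt0// invf_le1// ler1n.
have GP x : G x -> (upot rho x <= I%:E)%E.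
  move=> H; rewrite /upot leeBlDr// -EFinD; apply: (tl_leP (m := rho) meas eb) => // n.
  by have := H n; rewrite div1r; lra.
pose N : set T := [set x | e x /\ (I%:E < upot rho x)%E].
have mN : measurable (N : set T).
  rewrite (_ : N = e `&` [set x | (I%:E < upot rho x)%E])//.
  by apply: emeasurable_fun_o_infty => //; exact: measurable_upot.
have N0 : rho N = 0%E by exact: upot_eq_ae.
have mG0 : rho (e `\` G) = 0%E.
  apply/eqP; rewrite eq_le measure_ge0 andbT -N0; apply: le_measure; rewrite ?inE//.
    by apply: measurableD => //; exact: closed_measurable.
  by move=> x [ex nG]; split => //; rewrite ltNge; apply/negP => /Gx.
have [s0 s00 s0P] := finite_domain_dist cpt fz.
have s1 : 0 < Num.min s0 1 by rewrite lt_min s00 ltr01.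
pose L0 := lam 1 b 0.
pose L1 := lam 1 z.1 z.2.
have lle (x c : R) : `|x| <= c -> lam 1 x 0 <= lam 1 c 0 by exact: lam1_le.
have key eps : 0 < eps -> eps < 1 -> - Lpot rho 0 e z <= I + eps * (L0 - L1).
  (* [lam 1 - L0] is nonpositive on e and has positive Laplacian: it makes [be] strictly subharmonic
     without harming the bound on e, and [eps < 1] keeps its growth below that of the potential. *)
  move=> ep0 ep1; pose be (v : plane R) := - I + eps * (lam 1 v.1 v.2 - L0).
  have ebe v : expn be v (0 + eps * (1 / (v.1 ^+ 2 + v.2 ^+ 2 + 1) ^+ 2 + 0)).
    apply: expnD; first exact: expn_cst.
    apply: expnZ; apply: expnD; last exact: expn_cst.
    have := @expn_lam R 1 (0, 0) v ler01; rewrite /= !subr0 => /(_ _)H.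
    have {}H := H (ltr_wpDl (sqr_sum_ge0 _ _) ltr01).
    have -> // : (fun w : plane R => lam 1 w.1 w.2) = (fun w => lam 1 (w.1 - 0) (w.2 - 0)).
    by apply/funext => w; rewrite !subr0.
  have cbe v : {for v, continuous be} by exact: expn_cont (ebe v).
  have lbe v : lexp be v.
    apply: expn_lexp (ebe v); rewrite add0r addr0 mulr_gt0// divr_gt0// exprn_gt0//.
    by rewrite ltr_wpDl// sqr_sum_ge0.
  have ab x : e x -> (0 <= b)%R by move=> /eb; exact: le_trans.
  have := @domination_pot R e b rho cpt eb re G 1 eps (- I - eps * L0) (lam 1 (b + b) 0) (Num.min s0 1) set0 be z.
  rewrite mul1r [fine _](_ : _ = 0); last by rewrite mG0.
  rewrite mulr0 subr0 mul1r => H.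
  have : - Lpot rho 0 e z + be z <= 0; last by rewrite /be -/L1; lra.
  apply: H => //.
  - exists N; split => // x [ex tx]; split => //.
    by rewrite /upot tx ltry.
  - exact: ltW.
  - exact: closed0.
  - move=> x ex Gx' k k0 k1; have /upot_leP/(_ k k0 k1) := GP x Gx'.
    rewrite mul1r /be /=; have := lle x b (eb ex); rewrite -/L0 => h.
    have : eps * (lam 1 x 0 - L0) <= 0 by rewrite pmulr_rle0// subr_le0.
    lra.
  - exact: lam1_ge0.
  - move=> x t ex et; apply: lle; apply: le_trans (ler_normB _ _) _.
    by apply: lerD; exact: eb.
  - by move=> v _; rewrite /be; lra.
  - by rewrite ge_min lexx orbT.
  - by move=> t et; apply: le_trans (s0P t et); rewrite ge_min lexx.
apply/ler_addgt0Pr => eta eta0.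
pose eps := Num.min 2^-1 (eta / (`|L0 - L1| + 1)).
have ep0 : 0 < eps by rewrite lt_min invr_gt0 ltr0n divr_gt0// ltr_wpDl.
have ep1 : eps < 1 by rewrite gt_min invf_lt1 ?ltr1n.
apply: le_trans (key eps ep0 ep1) _; rewrite lerD2l.
have : eps <= eta / (`|L0 - L1| + 1) by rewrite ge_min lexx orbT.
rewrite ler_pdivlMr ?ltr_wpDl// => h.
apply: le_trans h; rewrite ler_pM2l//; have := ler_norm (L0 - L1); lra.
Qed.

(** As e lies on the line, regularizing the kernel by [k] amounts to moving the point to height
    [Num.sqrt k]. Bounds proved off the line thus pass to every point of it. *)
Lemma Lpot_shift (m : probability T R) k x : 0 <= k -> Lpot m k e (x, 0) = Lpot m 0 e (x, Num.sqrt k).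
Proof.
by move=> k0; rewrite /Lpot; apply: eq_Rintegral => t _; rewrite /lam /= sqr_sqrtr// expr0n/= !addr0.
Qed.

Lemma upot_rho_le x : (upot rho x <= I%:E)%E.
Proof.
apply/upot_leP => k k0 _; rewrite (Lpot_shift _ _ (ltW k0)); apply: Lpot_rho_ge => t _ [_ /eqP].
by rewrite sqrtr_eq0 leNgt k0.
Qed.

(** Values below [I] are excluded by [frostman_ge_ae], values above by the bound that holds
    everywhere: a measure of finite energy does not charge the exceptional set of Frostman's
    theorem. *)
Lemma upot_rho_ae (m : probability T R) : m e = 1%E -> (Tint m m < +oo)%E ->
  m [set x | e x /\ upot rho x != I%:E] = 0%E.
Proof.
move=> me Tm; rewrite -(frostman_ge_ae me Tm); congr (m _); apply/seteqP; split => x [ex h]; split => //.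
  by rewrite lt_neqAle h upot_rho_le.
by rewrite lt_eqF.
Qed.

Lemma upot_rho_int (m : probability T R) : m e = 1%E -> (Tint m m < +oo)%E ->
  (\int[m]_(x in e) upot rho x = I%:E)%E.
Proof.
move=> me Tm; apply/eqP; rewrite eq_le frostman_le// andbT.
have -> : (I%:E = \int[m]_(x in e) I%:E)%E by rewrite integral_cst1.
rewrite le_eqVlt; apply/orP; left; apply/eqP; apply: ae_eq_integral => //.
  exact: measurable_upot.
exists [set x | e x /\ upot rho x != I%:E]; split; last 1 first.
- by move=> x /= h; have [ex|ex] := pselect (e x); [split=> //; apply/eqP => E; apply: h|case: h].
- rewrite (_ : [set x | _] = e `&` [set x | upot rho x != I%:E])//.
  by apply: emeasurable_neq => //; exact: measurable_upot.
- exact: upot_rho_ae.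
Qed.

End WithRho.
End Equilibrium.

(** * Perron tests with logarithmic poles *)

Section Infinity.
Context {R : realType} (mu : probability (measurableTypeR R) R).
Implicit Types (D : set (measurableTypeR R)) (z : plane R).

(* The potential read in the chart [z |-> 1 / z], without its logarithmic pole. *)
Definition Rpot D z : R := \int[mu]_(t in D) lam 0 (1 - z.1 * t) (z.2 * t).

(** From [|1 / z - t| = |1 - z * t| / |z|], integrated against a measure of mass one on [D]. *)
Lemma Rpot_chart D (b : R) z : measurable D -> mu D = 1%E -> (forall t, D t -> `|t| <= b) ->
  z != (0, 0) -> (exists2 s, 0 < s & forall t, D t -> s <= ((inv_pt z).1 - t) ^+ 2 + (inv_pt z).2 ^+ 2) ->
  Lpot mu 0 D (inv_pt z) = Rpot D z - lam 0 z.1 z.2.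
Proof.
move=> mD D1 Db z0 [s s0 sD]; rewrite /Lpot /Rpot.
have N0 := sq_gt0 z0; set N := z.1 ^+ 2 + z.2 ^+ 2 in N0.
have E t : D t -> lam 0 (1 - z.1 * t) (z.2 * t) = lam 0 ((inv_pt z).1 - t) (inv_pt z).2 + lam 0 z.1 z.2.
  move=> Dt; rewrite /lam !addr0 -mulrDr -lnM ?posrE ?(lt_le_trans s0 (sD t Dt))//.
  by congr (_ * ln _); rewrite /inv_pt -/N /= /N; field; rewrite gt_eqF.
have i1 : mu.-integrable D (EFin \o (fun t => lam 0 ((inv_pt z).1 - t) (inv_pt z).2)).
  by apply: (lam_integrable mu mD Db s0) => t /sD; rewrite addr0.
have -> : \int[mu]_(t in D) lam 0 (1 - z.1 * t) (z.2 * t) =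
    \int[mu]_(t in D) (lam 0 ((inv_pt z).1 - t) (inv_pt z).2 + lam 0 z.1 z.2).
  by apply: eq_Rintegral => t /[!inE]; exact: E.
rewrite RintegralD//; last exact: finite_measure_integrable_cst.
by rewrite Rintegral_cst// [fine _](_ : _ = 1); [rewrite mulr1 addrK|exact: (congr1 fine D1)].
Qed.

Lemma Rpot0 D : measurable D -> Rpot D (0, 0) = 0.
Proof.
move=> mD; transitivity (\int[mu]_(t in D) (0 : R)); last by rewrite Rintegral_cst// mul0r.
apply: eq_Rintegral => t _.
by rewrite /= !mul0r subr0 /lam expr1n expr0n /= !addr0 ln1 mulr0.
Qed.

(** Each integrand is expanded at [(1, 0)] in the increment [(- v * t, w * t)], with coefficients
    [- t], [- t ^+ 2 / 2] and [t ^+ 2 / 2]. The last two cancel in the Laplacian, and the bound [b]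
    makes the error uniform. *)
Lemma expn_Rpot D (b : R) : measurable D -> 0 < b -> (forall t, D t -> `|t| <= b) ->
  expn (Rpot D) (0, 0) 0.
Proof.
move=> mD b0 Db.
have mt : measurable_fun D (fun t : measurableTypeR R => t) by exact: measurable_id.
have it : mu.-integrable D (EFin \o (fun t : R => t)) by apply: (bnd_integrable mu mD _ Db).
have b2 t : D t -> `|t ^+ 2 / 2| <= b ^+ 2 / 2.
  move=> Dt; rewrite ger0_norm ?divr_ge0 ?sqr_ge0// ler_pM2r ?invr_gt0//.
  by rewrite -real_normK ?num_real// lerXn2r ?nnegrE// ?Db// ltW.
have it2 : mu.-integrable D (EFin \o (fun t : R => t ^+ 2 / 2)).
  by apply: (bnd_integrable mu mD _ b2); apply: measurable_funM => //; exact: measurable_funX.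
have i0 : mu.-integrable D (EFin \o (fun t : R => 0 : R)) by apply: finite_measure_integrable_cst.
have itN : mu.-integrable D (EFin \o (fun t : R => -1 * t)) by exact: intZl.
have it2N : mu.-integrable D (EFin \o (fun t : R => -1 * (t ^+ 2 / 2))) by exact: intZl.
have c0 : lam 0 1 0 = 0 :> R.
  by rewrite /lam expr1n expr0n /= !addr0 ln1 mulr0.
have R0 := Rpot0 mD.
exists (\int[mu]_(t in D) (-1 * t)), (\int[mu]_(t in D) 0), (\int[mu]_(t in D) (-1 * (t ^+ 2 / 2))),
  (\int[mu]_(t in D) 0), (\int[mu]_(t in D) (t ^+ 2 / 2)); split.
  rewrite -RintegralD//; transitivity (\int[mu]_(t in D) (0 : R)); last by rewrite Rintegral_cst// mul0r.
  by apply: eq_Rintegral => t _; rewrite mulN1r addNr.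
move=> eta eta0.
exists (Num.min ((36 * b ^+ 2)^-1 / 2) ((eta / (29 * b ^+ 3)) ^+ 2)).
  have b3 : 0 < 29 * b ^+ 3 by rewrite mulr_gt0// exprn_gt0.
  rewrite lt_min; apply/andP; split; last by rewrite exprn_gt0// divr_gt0.
  by rewrite divr_gt0// invr_gt0 mulr_gt0// exprn_gt0.
move=> v w; rewrite lt_min => /andP[/ltW h1 /ltW h2] /=; rewrite !add0r R0 add0r.
set m := v ^+ 2 + w ^+ 2 in h1 h2 *.
have m0 : 0 <= m by exact: sqr_sum_ge0.
have [iQ <-] := Rint_quad v w mD itN i0 it2N i0 it2.
set Q := fun t => quad _ _ _ _ _ _ _ in iQ *.
have mb2 : m * b ^+ 2 <= 72^-1.
  have -> : 72^-1 = (36 * b ^+ 2)^-1 / 2 * b ^+ 2 by field; rewrite gt_eqF.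
  by rewrite ler_pM2r// exprn_gt0.
have tm t : D t -> (v * t) ^+ 2 + (w * t) ^+ 2 <= m * b ^+ 2.
  move=> Dt; rewrite !exprMn -mulrDl -/m ler_wpM2l// -[t ^+ 2]real_normK ?num_real//.
  by rewrite lerXn2r ?nnegrE ?Db// ltW.
have iv : mu.-integrable D (EFin \o (fun t => lam 0 (1 - v * t) (w * t))).
  apply: (@bnd_integrable _ mu D _ (`|ln 4^-1| + `|ln 4|)) => //.
    apply: measurable_funM => //; apply: (measurableT_comp (@measurable_ln R)) => //.
    apply: measurable_funD => //; apply: measurable_funD; apply: measurable_funX.
      by apply: measurable_funB => //; exact: measurable_funM.
    exact: measurable_funM.
  move=> t Dt; apply: lam_bound; first by rewrite invr_gt0.
  have := tm t Dt => h; have h' := le_trans h mb2.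
  have s1 := sqr_ge0 (v * t); have s2 := sqr_ge0 (w * t).
  rewrite addr0; apply/andP; split.
    have := sqr_ge0 (1 - 2 * (v * t)); rewrite !expr2 in h' s1 s2 *; lra.
  have := sqr_ge0 (1 + (v * t)); rewrite !expr2 in h' s1 s2 *; lra.
rewrite /Rpot /= -(RintegralB mD iv iQ).
have idiff := intB mD iv iQ.
apply: le_trans (le_normr_Rintegral mD idiff) _.
have C0 : 0 <= eta * m by rewrite mulr_ge0// ltW.
apply: (@le_trans _ _ (\int[mu]_(t in D) (eta * m))); last first.
  rewrite Rintegral_cst// ler_piMr// -[leRHS]/(fine 1%:E) fine_le//.
    by rewrite ge0_fin_numE// (le_lt_trans (probability_le1 _ mD))// ltry.
  exact: probability_le1.
apply: le_Rintegral => //.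
- exact: (integrable_norm idiff).
- by apply: (@bnd_integrable _ _ _ _ `|eta * m|).
move=> t Dt.
have SE : (1 : R) = 1 ^+ 2 + 0 ^+ 2 + 0 by rewrite expr1n expr0n /= !addr0.
have small : (- (v * t)) ^+ 2 + (w * t) ^+ 2 <= 1 / 36.
  by rewrite sqrrN; have := le_trans (tm t Dt) mb2; lra.
have := @lam_taylor _ 0 1 1 0 (- (v * t)) (w * t) 1 SE ltr01 (lexx 0) (lexx 1) small.
rewrite c0 !add0r.
have -> : quad (1 / 1) (0 / 1) ((2 * 1)^-1 - (1 / 1) ^+ 2) (- (2 * (1 / 1) * (0 / 1)))
   ((2 * 1)^-1 - (0 / 1) ^+ 2) (- (v * t)) (w * t) = Q t.
  by rewrite /Q /quad; field.
rewrite !divr1 sqrrN => h; apply: le_trans h _.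
have := tm t Dt => h.
have t0 : 0 <= (v * t) ^+ 2 + (w * t) ^+ 2 by exact: sqr_sum_ge0.
apply: (@le_trans _ _ (29 * Num.sqrt (m * b ^+ 2) * (m * b ^+ 2))).
  apply: ler_pM => //; rewrite ?mulr_ge0 ?sqrtr_ge0//.
  by rewrite ler_pM2l// ler_wsqrtr.
rewrite sqrtrM// sqrtr_sqr (ger0_norm (ltW b0)).
have := @ler_wsqrtr R m ((eta / (29 * b ^+ 3)) ^+ 2) h2; rewrite sqrtr_sqr ger0_norm; last first.
  by rewrite divr_ge0// ?mulr_ge0 ?exprn_ge0// ltW.
rewrite ler_pdivlMr ?mulr_gt0 ?exprn_gt0// => h3.
have -> : 29 * (Num.sqrt m * b) * (m * b ^+ 2) = (Num.sqrt m * (29 * b ^+ 3)) * m by ring.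
by rewrite ler_wpM2r.
Qed.

End Infinity.

(** * Truncated logarithms in the Perron family *)

Section PerronCore.
Context {R : realType}.
Local Notation T := (measurableTypeR R).
Implicit Types (z : plane R).
Variables (e : set R) (b : R) (rho : probability T R).
Hypotheses (cpt : compact e) (eb : forall x, e x -> `|x| <= b) (b0 : 0 < b).
Hypotheses (rhoP : is_equilibrium_measure e rho) (e_cap : (0 < capacity e)%E).

Let meas := meas_e cpt.
Let re := rho_e cpt rhoP.

Definition robin := fine (log_energy rho).
(* An explicit Green function; it is below the given one by [green_le_green_infty]. *)
Definition green z := robin + Lpot rho 0 e z.

Lemma green_ge0 z : finite_domain e z -> 0 <= green z.
Proof. by move=> fz; have := Lpot_rho_ge cpt eb rhoP e_cap fz; rewrite /green /robin; lra. Qed.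

Lemma expn_green z : finite_domain e z -> expn green z 0.
Proof.
move=> fz; rewrite -[X in expn _ _ X](addr0 0); apply: expnD; first exact: expn_cst.
exact: expn_Lpot0 eb fz.
Qed.

Lemma far_domain z : b ^+ 2 < z.1 ^+ 2 + z.2 ^+ 2 -> finite_domain e z.
Proof.
move=> bz x ex zx; move: bz; rewrite zx /= expr0n /= addr0.
by rewrite ltNge -[x ^+ 2]real_normK ?num_real// lerXn2r ?nnegrE ?eb// ltW.
Qed.

Lemma green_chart z : z != (0, 0) -> finite_domain e (inv_pt z) ->
  green (inv_pt z) = robin + Rpot rho e z - lam 0 z.1 z.2.
Proof.
move=> z0 fz; rewrite /green (Rpot_chart meas re eb z0) ?addrA//.
exact: finite_domain_dist.
Qed.

Lemma chart_far z : z.1 ^+ 2 + z.2 ^+ 2 < b ^- 2 -> z != (0, 0) -> finite_domain e (inv_pt z).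
Proof.
move=> zb z0; apply: far_domain; rewrite inv_pt_sq -(invrK (b ^+ 2)) ltf_pV2 ?posrE ?sq_gt0//.
by rewrite invr_gt0 exprn_gt0.
Qed.

Lemma near_sq00 (P : plane R -> Prop) (d : R) : 0 < d -> (forall z, z.1 ^+ 2 + z.2 ^+ 2 < d -> P z) ->
  near_sq (0, 0) P.
Proof. by move=> d0 H; exists d => // x y xy; apply: H; rewrite /= !add0r. Qed.

(* Bounded above and strictly subharmonic: a small multiple of it makes a harmonic test strictly subharmonic. *)
Definition barrier (p : sphere R) : R :=
  if p is Some z then lam 1 z.1 z.2 - green z else - robin.

Lemma expn_lam1 z : exists2 L, 0 < L & expn (fun w => lam 1 w.1 w.2) z L.
Proof.
exists (1 / (z.1 ^+ 2 + z.2 ^+ 2 + 1) ^+ 2).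
  by rewrite divr_gt0// exprn_gt0// ltr_wpDl// sqr_sum_ge0.
have := @expn_lam R 1 (0, 0) z ler01; rewrite /= !subr0 => /(_ _)H.
have {}H := H (ltr_wpDl (sqr_sum_ge0 _ _) ltr01).
have -> // : (fun w : plane R => lam 1 w.1 w.2) = (fun w => lam 1 (w.1 - 0) (w.2 - 0)).
by apply/funext => w; rewrite !subr0.
Qed.

Lemma expn_barrier z : finite_domain e z -> exists2 L, 0 < L & expn (barrier \o Some) z L.
Proof.
move=> fz; have [L L0 EL] := expn_lam1 z; exists L => //.
have := expnD EL (expnZ (-1) (expn_green fz)); rewrite mulr0 addr0.
by congr (expn _ z L); apply/funext => w; rewrite /= mulN1r.
Qed.

(** Inverting the point makes the same term [- lam 0 w.1 w.2] appear in [lam 1] and in [green], so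
    the poles cancel and [lam 1 - robin - Rpot] remains in the chart. *)
Lemma expn_barrier_infty : exists2 L, 0 < L & expn (barrier \o @chart_infty R) (0, 0) L.
Proof.
have [L L0 EL] := expn_lam1 (0, 0); exists L => //.
have R0 := Rpot0 rho meas.
have EN : expn (fun w => lam 1 w.1 w.2 + (- robin + -1 * Rpot rho e w)) (0, 0) L.
  have := expnD EL (expnD (expn_cst (- robin) (0, 0)) (expnZ (-1) (expn_Rpot rho meas b0 eb))).
  by rewrite mulr0 !addr0.
apply: expn_near EN _ _.
  by rewrite /= /chart_infty eqxx /= R0 /lam expr0n /= !add0r ln1 !mulr0 !addr0 add0r.
apply: (@near_sq00 _ (b ^- 2)); first by rewrite invr_gt0 exprn_gt0.
move=> w wb /=; have [->|w0] := eqVneq w (0, 0).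
  by rewrite /chart_infty eqxx /= R0 /lam expr0n /= !add0r ln1 !mulr0 !addr0 add0r.
rewrite chart_inftyE//= green_chart//; last exact: chart_far.
have := sq_gt0 w0; rewrite /lam inv_pt_sq addr0; set N := _ ^+ 2 + _ => N0.
have -> : N^-1 + 1 = (N + 1) / N by field; rewrite gt_eqF.
rewrite ln_div ?posrE//; last by lra.
by ring.
Qed.

Lemma within_continuous_integrable (m : probability T R) (f : R -> R) :
  {within e, continuous f} -> m.-integrable e (EFin \o f).
Proof.
move=> cf.
have mf : measurable_fun (e : set T) (f : T -> R) by exact: subspace_continuous_measurable_fun.
have /compact_bounded[M [_ MP]] := continuous_compact cf cpt.
apply: (@bnd_integrable _ m e f (M + 1)) => // t et.
by apply: MP; [rewrite ltrDl|exists t].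
Qed.

(* Then [ln (max (E, expR (- C)))] is locally constant or the maximum of a harmonic function and a constant;
   zeros of [E] are allowed. *)
Definition log_test (C : R) (E : plane R -> R) z :=
  near_sq z (fun w => E w <= expR (- C)) \/
  ({for z, continuous E} /\ (0 < E z -> expn (fun w => ln (E w)) z 0)).

Lemma log_test_cont C E z : log_test C E z ->
  {for z, continuous (fun w => ln (Num.max (E w) (expR (- C))))}.
Proof.
move=> [n|[cE _]].
  apply: (cont_near_eq (u := fun=> - C)); first exact: forC.
  by apply: near_sqW n => w h; rewrite max_r// expRK.
apply: for_ln; first by rewrite lt_max expR_gt0 orbT.
by apply: for_max => //; exact: forC.
Qed.

(** Below the truncation level the constant [- C] touches from below; above it the function is
    locally [ln E + q] with [ln E] harmonic. Strictness comes from [q] alone. *)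
Lemma log_test_lexp C E z (q : plane R -> R) L : log_test C E z -> 0 < L -> expn q z L ->
  lexp (fun w => ln (Num.max (E w) (expR (- C))) + q w) z.
Proof.
move=> T1 L0 Eq.
have lc : lexp (fun w => - C + q w) z.
  by apply: expn_lexp L0 _; rewrite -[L]add0r; apply: expnD => //; exact: expn_cst.
have low w : - C + q w <= ln (Num.max (E w) (expR (- C))) + q w.
  by rewrite lerD2r -[X in X <= _](expRK (- C)) ler_ln ?posrE ?expR_gt0 ?lt_max ?expR_gt0 ?orbT// le_max lexx orbT.
have [Ez|Ez] := leP (E z) (expR (- C)).
  apply: (lexp_le lc); first by rewrite max_r// expRK.
  by exists 1 => // x y _; exact: low.
case: T1 => [/near_sq_refl|[cE /(_ (lt_trans (expR_gt0 _) Ez)) EE]]; first by rewrite leNgt Ez.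
apply: (lexp_nbhs_eq (u := fun w => ln (E w) + q w)).
  by apply: expn_lexp L0 _; rewrite -[L]add0r; exact: expnD.
have : \forall w \near z, expR (- C) < E w by apply: (cvgr_gt _ cE).
by move=> /nbhs_planeP; apply: near_sqW => w /ltW h /=; rewrite max_l.
Qed.

(** Adding [eps * barrier] gives the strict inequality that [perron_le_integral] asks for. [Lam]
    bounds [lam 1] within unit distance of e and [green >= 0], so the boundary values rise by at
    most [eps * Lam]; then [eps] tends to 0. *)
Lemma perron_core (om : probability T R) (p : sphere R) (E : sphere R -> R) (f : R -> R) (C : R) :
  is_harmonic_measure e p om -> {within e, continuous f} ->
  (forall z, finite_domain e z -> log_test C (E \o Some) z) ->
  log_test C (E \o @chart_infty R) (0, 0) ->
  (forall x, e x -> forall eta, 0 < eta -> near_sq (x, 0) (fun z => finite_domain e z ->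
     ln (Num.max (E (Some z)) (expR (- C))) <= f x + eta)) ->
  ((ln (Num.max (E p) (expR (- C))))%:E <= \int[om]_(x in e) (f x)%:E)%E.
Proof.
move=> omP cf tE tinf bd.
have fi := within_continuous_integrable om cf.
have ome : om e = 1%E by case: omP.
pose Lam := lam 1 (b + 1) 1.
have key eps : 0 < eps -> ((ln (Num.max (E p) (expR (- C))) + eps * barrier p)%:E <=
    \int[om]_(x in e) (f x + eps * Lam)%:E)%E.
  move=> ep0.
  have cf' : {within e, continuous (fun x : R => f x + eps * Lam)}.
    by move=> x; apply: (@forD R (subspace e) f (fun=> eps * Lam)); [exact: cf|exact: forC].
  apply: (@perron_le_integral R e om p (fun s => ln (Num.max (E s) (expR (- C))) + eps * barrier s)) => //.
    - move=> z fz; apply: (@forD _ _ (fun w => ln (Num.max ((E \o Some) w) (expR (- C))))).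
      exact: log_test_cont (tE z fz).
    apply: (@forZ _ _ eps (barrier \o Some)); have [L _] := expn_barrier fz; exact: expn_cont.
  - move=> z fz; have [L L0 EL] := expn_barrier fz.
    by apply: (log_test_lexp (tE z fz) _ (expnZ eps EL)); rewrite mulr_gt0.
  - apply: (@forD _ _ (fun w => ln (Num.max ((E \o @chart_infty R) w) (expR (- C))))).
      exact: log_test_cont tinf.
    apply: (@forZ _ _ eps (barrier \o @chart_infty R)); have [L _] := expn_barrier_infty; exact: expn_cont.
  - have [L L0 EL] := expn_barrier_infty.
    by apply: (log_test_lexp tinf _ (expnZ eps EL)); rewrite mulr_gt0.
  move=> x ex eta eta0.
  have near1 : near_sq (x, 0) (fun z => lam 1 z.1 z.2 <= Lam).
    exists 1 => // v w vw /=; rewrite add0r /Lam /lam ler_pM2l ?invr_gt0//.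
    have v1 : v ^+ 2 <= 1 by have := sqr_ge0 w; lra.
    have w1 : w ^+ 2 <= 1 by have := sqr_ge0 v; lra.
    have xb : (x + v) ^+ 2 <= (b + 1) ^+ 2.
      rewrite -real_normK ?num_real// lerXn2r ?nnegrE// ?addr_ge0// ?(ltW b0)//.
      apply: le_trans (ler_normD _ _) _; apply: lerD; first exact: eb.
      by rewrite -(ler_pXn2r (n := 2))// ?nnegrE// expr1n real_normK ?num_real.
    rewrite ler_ln ?posrE; [by rewrite expr1n; lra| |].
      by rewrite ltr_wpDl// sqr_sum_ge0.
    by rewrite ltr_wpDl// sqr_sum_ge0.
  apply: near_sqW (near_sqI near1 (bd x ex eta eta0)) => z [h1 h2] fz.
  have := h2 fz; have := green_ge0 fz => g0 h3 /=.
  rewrite addrAC; apply: lerD => //.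
  by rewrite ler_pM2l//; lra.
have If := integrable_fin_num meas fi.
have E1 eps : (\int[om]_(x in e) (f x + eps * Lam)%:E = \int[om]_(x in e) (f x)%:E + (eps * Lam)%:E)%E.
  under eq_integral do rewrite EFinD.
  by rewrite integralD//=; [congr (_ + _)%E; rewrite integral_cst1|apply: finite_measure_integrable_cst].
rewrite -(fineK If) lee_fin.
apply/ler_addgt0Pr => eta eta0.
set r := fine _; set v := ln _.
have D0 : 0 < `|Lam - barrier p| + 1 by rewrite ltr_wpDl.
have := key (eta / (`|Lam - barrier p| + 1)) (divr_gt0 eta0 D0); rewrite E1 -(fineK If) -/r -/v lee_fin.
set ep := eta / _ => h.
have : ep * (`|Lam - barrier p| + 1) = eta by rewrite divfK// gt_eqF.
have ep0 : 0 < ep by rewrite divr_gt0.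
have : ep * (Lam - barrier p) <= ep * `|Lam - barrier p| by rewrite ler_pM2l// ler_norm.
by lra.
Qed.

End PerronCore.

(** * Logarithms of polynomials in the plane and at infinity *)

Section PolynomialTests.
Context {R : realType}.
Local Notation T := (measurableTypeR R).
Implicit Types (z w a : plane R) (s : seq (plane R)).

(** The logarithm of the modulus of the monic polynomial with roots [s]. At a root the junk value of
    [ln] drops the factor, whence the guards [w \notin s] below. *)
Definition slam s z : R := \sum_(a <- s) lam 0 (z.1 - a.1) (z.2 - a.2).

Lemma slam_nil z : slam [::] z = 0. Proof. by rewrite /slam big_nil. Qed.

Lemma slam_cons a s z : slam (a :: s) z = lam 0 (z.1 - a.1) (z.2 - a.2) + slam s z.
Proof. by rewrite /slam big_cons. Qed.

Lemma dist_gt0 z a : z != a -> 0 < (z.1 - a.1) ^+ 2 + (z.2 - a.2) ^+ 2.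
Proof.
move=> za; apply: (@sq_gt0 R (z.1 - a.1, z.2 - a.2)); apply: contra za => /eqP[/eqP h1 /eqP h2].
by move: h1 h2; rewrite !subr_eq0 => /eqP h1 /eqP h2; apply/eqP; case: z a h1 h2 => ? ? [? ?] /= -> ->.
Qed.

Lemma expn_slam s z : z \notin s -> expn (slam s) z 0.
Proof.
elim: s => [|a s IH].
  by move=> _; rewrite (_ : slam [::] = fun=> 0); [exact: expn_cst|apply/funext => w; rewrite slam_nil].
rewrite in_cons negb_or => /andP[za zs].
rewrite (_ : slam (a :: s) = (fun w => lam 0 (w.1 - a.1) (w.2 - a.2) + slam s w)); last first.
  by apply/funext => w; rewrite slam_cons.
have h := dist_gt0 za.
have := @expn_lam R 0 a z (lexx 0); rewrite addr0 mul0r => /(_ h) H.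
by have := expnD H (IH zs); rewrite addr0.
Qed.

Lemma near_sq_cont_lt (h : plane R -> R) z c : {for z, continuous h} -> h z < c ->
  near_sq z (fun w => h w < c).
Proof. by move=> ch hc; apply/nbhs_planeP; apply: (cvgr_lt _ ch). Qed.

Lemma near_sq_bound (h : plane R -> R) z : {for z, continuous h} ->
  near_sq z (fun w => h w <= h z + 1).
Proof.
by move=> ch; apply: near_sqW (near_sq_cont_lt ch (_ : h z < h z + 1)); [move=> w /ltW|rewrite ltrDl].
Qed.

Lemma slam_above s z : exists K, near_sq z (fun w => slam s w <= K).
Proof.
elim: s => [|a s [K HK]]; first by exists 0, 1 => // x y _; rewrite slam_nil.
have ca : {for z, continuous (fun w => lam 1 (w.1 - a.1) (w.2 - a.2))}.
  by apply: expn_cont (expn_lam _ _) => //; rewrite ltr_wpDl// sqr_sum_ge0.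
exists (lam 1 (z.1 - a.1) (z.2 - a.2) + 1 + K).
apply: near_sqW (near_sqI (near_sq_bound ca) HK) => w [h1 h2]; rewrite slam_cons.
apply: lerD h2; apply: le_trans h1.
have [->|wa] := eqVneq w a; first by rewrite !subrr /lam expr0n /= !addr0 add0r ln1 mulr0 ln0 ?mulr0.
by apply: lam_mono => //; rewrite addr0; exact: dist_gt0.
Qed.

Lemma lam_small a (M : R) : near_sq a (fun w => w != a -> lam 0 (w.1 - a.1) (w.2 - a.2) <= - M).
Proof.
exists (expR (- (2 * M))); first exact: expR_gt0.
move=> x y xy /=; rewrite !(addrC a.1) !(addrC a.2) !addrK => na.
have xy0 : 0 < x ^+ 2 + y ^+ 2.
  have := @dist_gt0 (x + a.1, y + a.2) a; rewrite /= !addrK; apply.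
  exact.
rewrite /lam addr0 -ler_pdivlMl ?invr_gt0// invrK.
by rewrite -ler_expR lnK ?posrE// mulrN ltW.
Qed.

Lemma slam_small s a (M : R) : a \in s -> near_sq a (fun w => w \notin s -> slam s w <= - M).
Proof.
elim: s M => // c s IH M; rewrite in_cons => /orP[/eqP ->|as_].
  have [K HK] := slam_above s c.
  apply: near_sqW (near_sqI (lam_small c (M + K)) HK) => w [h1 h2].
  rewrite in_cons negb_or => /andP[/h1 h _]; rewrite slam_cons.
  by apply: le_trans (lerD h h2) _; lra.
have [K HK] := slam_above [:: c] a.
apply: near_sqW (near_sqI (IH (M + K) as_) HK) => w [h1 h2].
rewrite in_cons negb_or => /andP[_ /h1 h]; rewrite slam_cons.
move: h2; rewrite slam_cons slam_nil addr0 => h2.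
by apply: le_trans (lerD h2 h) _; lra.
Qed.

Lemma near_sq_notin s z : z \notin s -> near_sq z (fun w => w \notin s).
Proof.
elim: s => [_|a s IH]; first by exists 1.
rewrite in_cons negb_or => /andP[za zs].
have nza : near_sq z (fun w => w != a).
  exists ((z.1 - a.1) ^+ 2 + (z.2 - a.2) ^+ 2); first exact: dist_gt0.
  move=> x y; apply: contraTneq => <- /=.
  by rewrite !opprD !addrA !subrr !sub0r !sqrrN ltxx.
by apply: near_sqW (near_sqI nza (IH zs)) => w [h1 h2]; rewrite in_cons negb_or h1.
Qed.

Lemma log_test_exp (C : R) (E LE : plane R -> R) z : expn LE z 0 ->
  near_sq z (fun w => E w = expR (LE w)) -> log_test C E z.
Proof.
move=> EL n; right; split.
  apply: (cont_near_eq (u := fun w => expR (LE w))); last by apply: near_sqW n => w ->.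
  by apply: for_comp; [exact: expn_cont EL|exact: continuous_expR].
move=> _; apply: expn_near EL _ _; first by rewrite (near_sq_refl n) expRK.
by apply: near_sqW n => w ->; rewrite expRK.
Qed.

(** At a root the function is set to 0 in place of the junk value. There the first alternative of
    [log_test] holds since [slam] tends to [-oo]; elsewhere the logarithm is harmonic. *)
Lemma log_test_roots (C kap c0 : R) s (W : set (plane R)) (LB : plane R -> R) z :
  0 < kap -> expn LB z 0 -> near_sq z (fun w => ~ W w) ->
  log_test C (fun w => if (w \in s) || `[< W w >] then 0 else expR (c0 + kap * slam s w + LB w)) z.
Proof.
move=> k0 ELB nW.
have [zs|zs] := boolP (z \in s); last first.
  apply: (@log_test_exp _ _ (fun w => c0 + kap * slam s w + LB w)).
    have := expnD (expnD (expn_cst c0 z) (expnZ kap (expn_slam zs))) ELB.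
    by rewrite mulr0 !addr0.
  apply: near_sqW (near_sqI (near_sq_notin zs) nW) => w [/negbTE -> nw].
  by rewrite (asboolF nw).
left.
have H := slam_small ((LB z + 1 + c0 + C) / kap) zs.
have B := near_sq_bound (expn_cont ELB).
apply: near_sqW (near_sqI H B) => w [h1 h2]; case: ifPn => [_|]; first exact: expR_ge0.
rewrite negb_or => /andP[/h1 h _]; rewrite ler_expR.
have : kap * slam s w <= kap * - ((LB z + 1 + c0 + C) / kap) by rewrite ler_pM2l.
by rewrite mulrN mulrCA divff ?gt_eqF// mulr1; lra.
Qed.

(** The logarithm of the modulus of the reversed polynomial, the product of the [1 - z * a] with
    complex multiplication written in coordinates. The chart at infinity turns [slam] into [rlam]
    plus a logarithmic pole. *)
Definition rlam s z : R :=
  \sum_(a <- s) lam 0 (1 - (z.1 * a.1 - z.2 * a.2)) (z.1 * a.2 + z.2 * a.1).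

Lemma rlam_nil z : rlam [::] z = 0. Proof. by rewrite /rlam big_nil. Qed.

Lemma rlam_cons a s z : rlam (a :: s) z =
  lam 0 (1 - (z.1 * a.1 - z.2 * a.2)) (z.1 * a.2 + z.2 * a.1) + rlam s z.
Proof. by rewrite /rlam big_cons. Qed.

Lemma lam010 : lam 0 1 0 = 0 :> R.
Proof. by rewrite /lam expr1n expr0n /= !addr0 ln1 mulr0. Qed.

Lemma rlam00 s : rlam s (0, 0) = 0.
Proof. by apply: big1 => a _; rewrite /= !mul0r subrr subr0 addr0 lam010. Qed.

(** For nonzero [a], [1 - z * a] is [- a * (z - 1 / a)], so each term is a constant plus a kernel
    with pole at [inv_pt a]. *)
Lemma expn_rlam s : expn (rlam s) (0, 0) 0.
Proof.
elim: s => [|a s IH].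
  by rewrite (_ : rlam [::] = fun=> 0); [exact: expn_cst|apply/funext => w; rewrite rlam_nil].
rewrite (_ : rlam (a :: s) = (fun z => lam 0 (1 - (z.1 * a.1 - z.2 * a.2)) (z.1 * a.2 + z.2 * a.1) + rlam s z)); last first.
  by apply/funext => w; rewrite rlam_cons.
rewrite -[X in expn _ _ X](addr0 0); apply: expnD => //.
have [->|a0] := eqVneq a (0, 0).
  rewrite (_ : (fun z => _) = fun=> 0); first exact: expn_cst.
  by apply/funext => w; rewrite /= !mulr0 subrr subr0 addr0 lam010.
have N0 := sq_gt0 a0; set N := _ ^+ 2 + _ in N0.
have I0 : inv_pt a != (0, 0) by exact: inv_pt_neq0.
have d0 : 0 < (0 - (inv_pt a).1) ^+ 2 + (0 - (inv_pt a).2) ^+ 2 + 0.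
  by rewrite addr0 !sub0r !sqrrN inv_pt_sq invr_gt0.
have := expnD (expn_cst (2^-1 * ln N) (0, 0)) (@expn_lam R 0 (inv_pt a) (0, 0) (lexx 0) d0).
rewrite mul0r addr0 => H; apply: expn_near H _ _.
  rewrite /= !mul0r subrr subr0 addr0 lam010 /lam !sub0r !sqrrN inv_pt_sq addr0 -/N.
  by rewrite lnV ?posrE//; ring.
have nI : (0, 0) \notin [:: inv_pt a] by rewrite inE eq_sym.
apply: near_sqW (near_sq_notin nI) => w; rewrite inE => wa.
have D0 := dist_gt0 wa; rewrite /= in D0.
rewrite /lam /= !addr0 -mulrDr -lnM ?posrE//; congr (_ * ln _).
by rewrite /N; field; rewrite gt_eqF.
Qed.

Lemma near_rlam s : near_sq (0, 0) (fun w => w != (0, 0) ->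
  inv_pt w \notin s /\ slam s (inv_pt w) = rlam s w - (size s)%:R * lam 0 w.1 w.2).
Proof.
elim: s => [|a s IH].
  by exists 1 => // x y _ _; rewrite slam_nil rlam_nil mul0r subrr.
have na : near_sq (0, 0) (fun w => w != (0, 0) -> inv_pt w != a).
  have [->|a0] := eqVneq a (0, 0); first by exists 1 => // x y _; exact: inv_pt_neq0.
  have nI : (0, 0) \notin [:: inv_pt a] by rewrite inE eq_sym inv_pt_neq0.
  apply: near_sqW (near_sq_notin nI) => w; rewrite inE => wa w0.
  by apply: contra wa => /eqP <-; rewrite inv_ptK.
apply: near_sqW (near_sqI na IH) => w [h1 IHw] w0.
have {}h1 := h1 w0; have [h2 h3] := IHw w0.
split; first by rewrite in_cons negb_or h1.
rewrite slam_cons rlam_cons h3 /= -natr1 mulrDl mul1r.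
have N0 := sq_gt0 w0.
suff -> : lam 0 ((inv_pt w).1 - a.1) ((inv_pt w).2 - a.2) =
   lam 0 (1 - (w.1 * a.1 - w.2 * a.2)) (w.1 * a.2 + w.2 * a.1) - lam 0 w.1 w.2 by ring.
apply/eqP; rewrite -subr_eq opprK; apply/eqP.
rewrite /lam !addr0 -mulrDr -lnM ?posrE ?dist_gt0//; congr (_ * ln _).
by rewrite /inv_pt /=; field; rewrite gt_eqF.
Qed.

End PolynomialTests.

(** * Products of powers of polynomials and of the Green function *)

Section PerronMonomial.
Context {R : realType}.
Local Notation T := (measurableTypeR R).
Implicit Types (z w a : plane R) (s : seq (plane R)).
Variables (e : set R) (b : R) (rho : probability T R).
Hypotheses (cpt : compact e) (eb : forall x, e x -> `|x| <= b) (b0 : 0 < b).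
Hypotheses (rhoP : is_equilibrium_measure e rho) (e_cap : (0 < capacity e)%E).

Let meas := meas_e cpt.
Local Notation green := (green e rho).
Local Notation robin := (robin rho).

Variables (kap bet N c0 : R) (s s' : seq (plane R)) (W : set (plane R)) (r C : R).

(* The logarithm of [|p| ^ kap / |q| ^ bet * exp (- N * green)] up to a constant, for monic [p], [q] with roots [s], [s'];
   [def] is its order of vanishing at infinity. *)
Definition log_mono z := c0 + kap * slam s z - bet * slam s' z - N * green z.

Let def := N + bet * (size s')%:R - kap * (size s)%:R.

(** The value at [None] is the limit at infinity, where [green] minus [ln |z|] tends to [robin] and
    [def] is the remaining power of [1 / |z|]. *)
Definition mono_test (p : sphere R) : R :=
  match p with
  | Some z => if (z \in s) || `[< W z >] then 0 else expR (log_mono z)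
  | None => if 0 < def then 0 else expR (c0 - N * robin)
  end.

Hypotheses (kap0 : 0 < kap) (def0 : 0 <= def).
Hypothesis Wr : forall z, W z -> z.1 ^+ 2 + z.2 ^+ 2 <= r.

Lemma log_test_mono_infty : log_test C (mono_test \o @chart_infty R) (0, 0).
Proof.
(* [log_mono] read in the chart at infinity, without its logarithmic term [def * lam 0]. *)
pose H w := c0 + kap * rlam s w - bet * rlam s' w - N * (robin + Rpot rho e w).
have EH : expn H (0, 0) 0.
  have E1 := expnD (expnD (expn_cst c0 (0, 0)) (expnZ kap (expn_rlam s))) (expnZ (- bet) (expn_rlam s')).
  have E2 := expnZ (- N) (expnD (expn_cst robin (0, 0)) (expn_Rpot rho meas b0 eb)).
  have := expnD E1 E2; rewrite !(mulr0, addr0).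
  by congr (expn _ _ 0); apply/funext => w; rewrite /H /= !mulNr.
have H0 : H (0, 0) = c0 - N * robin.
  by rewrite /H !rlam00 (Rpot0 rho meas) !mulr0 !addr0 subr0.
pose r' := Num.max r (b ^+ 2) + 1.
have r'0 : 0 < r' by rewrite ltr_wpDl// le_max sqr_ge0 orbT.
have nf : near_sq (0, 0) (fun w => w != (0, 0) -> ~ W (inv_pt w) /\ finite_domain e (inv_pt w)).
  apply: (@near_sq00 _ _ r'^-1); first by rewrite invr_gt0.
  move=> w wr w0; have : r' < (inv_pt w).1 ^+ 2 + (inv_pt w).2 ^+ 2.
    by rewrite inv_pt_sq -[r']invrK ltf_pV2 ?posrE ?sq_gt0// invr_gt0.
  rewrite /r' => h; split.
    move=> /Wr h'; have : r <= Num.max r (b ^+ 2) by rewrite le_max lexx.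
    by lra.
  apply: (far_domain eb b0); apply: le_lt_trans h.
  by rewrite -[X in X <= _]addr0 lerD// le_max lexx orbT.
have HE : near_sq (0, 0) (fun w => w != (0, 0) ->
    mono_test (chart_infty w) = expR (H w + def * lam 0 w.1 w.2)).
  apply: near_sqW (near_sqI nf (near_sqI (near_rlam s) (near_rlam s'))) => w [h1 [h2 h3]] w0.
  have [nW fw] := h1 w0; have [ns es] := h2 w0; have [ns' es'] := h3 w0.
  rewrite chart_inftyE//= (negbTE ns) (asboolF nW)/=; congr expR.
  by rewrite /log_mono (green_chart cpt eb rhoP)// es es' /H /def; ring.
have [d0|d0] := ltP 0 def; last first.
  have {}d0 : def = 0 by apply/eqP; rewrite eq_le d0.
  apply: (log_test_exp C EH); apply: near_sqW HE => w /=.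
  have [->|w0] := eqVneq w (0, 0); last by move=> ->; rewrite // d0 mul0r addr0.
  by move=> _; rewrite /chart_infty eqxx /= d0 ltxx H0.
left.
have B := near_sq_bound (expn_cont EH).
have L := lam_small (0, 0) ((H (0, 0) + 1 + C) / def).
apply: near_sqW (near_sqI HE (near_sqI B L)) => w [h1 [h2 h3]] /=.
have [->|w0] := eqVneq w (0, 0).
  by rewrite /chart_infty eqxx /= d0 expR_ge0.
rewrite h1// ler_expR; have := h3 w0; rewrite /= !subr0 => h4.
have : def * lam 0 w.1 w.2 <= def * - ((H (0, 0) + 1 + C) / def) by rewrite ler_pM2l.
rewrite mulrN [def * (_ / _)]mulrC divfK ?gt_eqF//; lra.
Qed.

Lemma expn_log_mono_base z : finite_domain e z -> z \notin s' ->
  expn (fun w => - (bet * slam s' w) - N * green w) z 0.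
Proof.
move=> fz zs'.
have := expnD (expnZ (- bet) (expn_slam zs')) (expnZ (- N) (expn_green rho cpt eb fz)).
rewrite !(mulr0, addr0).
by congr (expn _ _ 0); apply/funext => w /=; rewrite !mulNr.
Qed.

Lemma log_test_mono z : finite_domain e z ->
  (z \notin s' /\ near_sq z (fun w => ~ W w)) \/
  near_sq z (fun w => ~ W w -> w \notin s -> log_mono w <= - C) ->
  log_test C (mono_test \o Some) z.
Proof.
move=> fz [[zs' nW]|n].
  have := log_test_roots C c0 s kap0 (expn_log_mono_base fz zs') nW.
  congr (log_test C _ z); apply/funext => w /=; case: ifP => // _; congr expR.
  by rewrite /log_mono; ring.
left; apply: near_sqW n => w /= h; case: ifPn => [_|]; first exact: expR_ge0.
by rewrite negb_or => /andP[h1 /asboolPn h2]; rewrite ler_expR h.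
Qed.

Variables (om : probability T R) (f : R -> R).
Hypothesis (cf : {within e, continuous f}) (fC : forall x, e x -> - C <= f x).
Hypothesis domW : forall z, finite_domain e z -> (z \notin s' /\ near_sq z (fun w => ~ W w)) \/
  near_sq z (fun w => ~ W w -> w \notin s -> log_mono w <= - C).
Hypothesis bd : forall x, e x -> forall eta, 0 < eta -> near_sq (x, 0) (fun z => finite_domain e z ->
  ~ W z -> z \notin s -> log_mono z <= f x + eta).

Lemma perron_mono p : is_harmonic_measure e p om ->
  ((ln (Num.max (mono_test p) (expR (- C))))%:E <= \int[om]_(x in e) (f x)%:E)%E.
Proof.
move=> omP; apply: (perron_core cpt eb b0 rhoP e_cap omP cf).
- by move=> z fz; apply: log_test_mono => //; exact: domW.
- exact: log_test_mono_infty.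
move=> x ex eta eta0; apply: near_sqW (bd ex eta0) => z h fz.
have fC' : - C <= f x + eta by have := fC ex; lra.
rewrite -ler_expR lnK ?posrE ?lt_max ?expR_gt0 ?orbT// ge_max !ler_expR fC' andbT /=.
case: ifPn => [_|]; first exact: expR_ge0.
by rewrite negb_or => /andP[h1 /asboolPn h2]; rewrite ler_expR h.
Qed.

Lemma perron_mono_fin z : is_harmonic_measure e (Some z) om -> z \notin s -> ~ W z ->
  ((log_mono z)%:E <= \int[om]_(x in e) (f x)%:E)%E.
Proof.
move=> omP zs Wz; apply: le_trans (perron_mono omP); rewrite lee_fin /= (negbTE zs) (asboolF Wz) /=.
by rewrite -[X in X <= _]expRK ler_ln ?posrE ?lt_max ?expR_gt0// le_max lexx.
Qed.

Lemma perron_mono_infty : is_harmonic_measure e None om -> def = 0 ->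
  ((c0 - N * robin)%:E <= \int[om]_(x in e) (f x)%:E)%E.
Proof.
move=> omP d0; apply: le_trans (perron_mono omP); rewrite lee_fin /= d0 ltxx.
by rewrite -[X in X <= _]expRK ler_ln ?posrE ?lt_max ?expR_gt0// le_max lexx.
Qed.

End PerronMonomial.

(** * The potential of harmonic measure *)

Section HarmonicPotential.
Context {R : realType}.
Local Notation T := (measurableTypeR R).
Implicit Types (z w a : plane R).
Variables (e : set R) (b : R) (rho om : probability T R) (p : ext_line R).
Hypotheses (cpt : compact e) (eb : forall x, e x -> `|x| <= b) (b0 : 0 < b).
Hypotheses (rhoP : is_equilibrium_measure e rho) (e_cap : (0 < capacity e)%E).
Hypotheses (omP : is_harmonic_measure e (sphere_of_line p) om).
Hypothesis pe : forall x, p = Some x -> ~ e x.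

Let meas := meas_e cpt.
Let re := rho_e cpt rhoP.
Local Notation green := (green e rho).
Local Notation robin := (robin rho).

Lemma om_e : om e = 1%E. Proof. by case: omP. Qed.

(* Where finite, [pole_cst + pole_pot] is what the potential of the harmonic measure at [p] should equal on e. *)
Definition pole_pot a : R := if p is Some x then - lam 0 (x - a.1) a.2 else 0.
Definition pole_cst : R := if p is Some x then green (x, 0) else robin.

Lemma log_dist_cont a x : finite_domain e a -> e x ->
  {for ((x, 0) : plane R), continuous (fun w => lam 0 (w.1 - a.1) (w.2 - a.2))}.
Proof.
move=> fa ex; apply: expn_cont (expn_lam _ _) => //; rewrite addr0 /=.
by apply: (@dist_gt0 _ (x, 0) a); apply/eqP => h; apply: (fa x ex).
Qed.

Lemma line_cont (h : plane R -> R) (x : R) : {for ((x, 0) : plane R), continuous h} ->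
  {for x, continuous (fun t : R => h (t, 0))}.
Proof.
move=> ch; have c1 : (fun y : R => y) @ x --> x by exact: cvg_id.
have c2 : (fun _ : R => 0 : R) @ x --> (0 : R) by exact: cvg_cst.
exact: (continuous_comp (cvg_pair c1 c2) ch).
Qed.

Lemma pt_within_cont (f : R -> R) : (forall x, e x -> {for x, continuous f}) ->
  {within e, continuous f}.
Proof.
move=> H; apply: continuous_in_subspaceT => x; rewrite inE; exact: H.
Qed.

Lemma log_dist_within a : finite_domain e a -> {within e, continuous (fun x : R => lam 0 (x - a.1) a.2)}.
Proof.
move=> fa; apply: pt_within_cont => x ex.
have := line_cont (log_dist_cont fa ex).
by congr {for x, continuous _}; apply/funext => t /=; rewrite sub0r /lam sqrrN.
Qed.

Lemma log_dist_lower a : finite_domain e a -> exists C, forall x, e x -> - C <= lam 0 (x - a.1) a.2.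
Proof.
move=> fa; have [s s0 sP] := finite_domain_dist cpt fa.
exists (- (2^-1 * ln s)) => x ex; rewrite opprK /lam addr0 ler_pM2l ?invr_gt0//.
have h := sP x ex; have h' : s <= (x - a.1) ^+ 2 + a.2 ^+ 2 by rewrite -(sqrrN (x - a.1)) opprB.
by rewrite ler_ln ?posrE// (lt_le_trans s0 h').
Qed.

Lemma Lpot_int a : finite_domain e a ->
  (\int[om]_(x in e) (lam 0 (x - a.1) a.2)%:E = (Lpot om 0 e a)%:E)%E.
Proof.
move=> fa; have [s s0 sP] := finite_domain_dist cpt fa.
have i0 : om.-integrable e (EFin \o (fun t => lam 0 (a.1 - t) a.2)).
  by apply: (lam_integrable om meas eb s0) => t et; rewrite addr0; exact: sP.
rewrite /Lpot /Rintegral fineK; last exact: (integrable_fin_num meas i0).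
by apply: eq_integral => x _; rewrite /lam -(sqrrN (x - a.1)) opprB.
Qed.

(** The Perron test is [|z - a| * exp (- green z)], with boundary data [ln |x - a|] because
    [green >= 0]. At a finite pole it does not vanish, as [a] is not the pole; at infinity the
    growths of [|z - a|] and [exp green] cancel up to [robin]. *)
Lemma pole_pot_le a : finite_domain e a -> p <> Some a.1 \/ a.2 != 0 ->
  - Lpot om 0 e a <= pole_cst + pole_pot a.
Proof.
move=> fa pa; have [C fC] := log_dist_lower fa.
have cf := log_dist_within fa.
have def0 : (1 : R) + 0 * (size ([::] : seq (plane R)))%:R - 1 * (size [:: a])%:R = 0.
  by rewrite mul0r addr0 mul1r subrr.
have W0 : forall z : plane R, set0 z -> z.1 ^+ 2 + z.2 ^+ 2 <= 0 by [].
have dW : forall z, finite_domain e z ->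
 z \notin [::] /\ near_sq z (fun w : plane R => ~ set0 w) \/
 near_sq z (fun w : plane R => ~ set0 w -> w \notin [:: a] -> log_mono e rho 1 0 1 0 [:: a] [::] w <= - C).
  by move=> z _; left; split => //; exists 1 => // ? ? _; apply.
have bd : forall x, e x -> forall eta, 0 < eta -> near_sq (x, 0) (fun z : plane R => finite_domain e z ->
    ~ set0 z -> z \notin [:: a] -> log_mono e rho 1 0 1 0 [:: a] [::] z <= lam 0 (x - a.1) a.2 + eta).
  move=> x ex eta eta0.
  have h : lam 0 (((x, 0) : plane R).1 - a.1) (((x, 0) : plane R).2 - a.2) < lam 0 (x - a.1) a.2 + eta.
    by rewrite /= /lam sub0r sqrrN ltrDl.
  apply: near_sqW (near_sq_cont_lt (log_dist_cont fa ex) h) => w /ltW hw fw _ _.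
  rewrite /log_mono slam_cons !slam_nil mul0r subr0 add0r !mul1r addr0.
  by have := green_ge0 cpt eb rhoP e_cap fw; lra.
move: omP pa; rewrite /pole_cst /pole_pot; case: (p) => [x0|] /= omP' pa.
  have xa : ((x0, 0) : plane R) \notin [:: a].
    rewrite inE; apply/eqP => xa; case: pa; rewrite -xa//=; last by rewrite eqxx.
  have := @perron_mono_fin R e b rho cpt eb b0 rhoP e_cap 1 0 1 0 [:: a] [::] set0 0 C
    ltr01 _ W0 om _ cf fC dW bd (x0, 0) omP' xa id.
  rewrite def0 lexx => /(_ isT); rewrite Lpot_int// lee_fin.
  rewrite /log_mono slam_cons !slam_nil mul0r subr0 add0r !mul1r addr0 /=.
  by rewrite /lam sub0r sqrrN; lra.
have := @perron_mono_infty R e b rho cpt eb b0 rhoP e_cap 1 0 1 0 [:: a] [::] set0 0 C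
    ltr01 _ W0 om _ cf fC dW bd omP' def0.
by rewrite def0 lexx => /(_ isT); rewrite Lpot_int// lee_fin; lra.
Qed.

Lemma pole_neq x : e x -> p <> Some x.
Proof. by move=> ex px; apply: (pe px). Qed.

Lemma upot_om_le x : p <> Some x -> (upot e om x <= (pole_cst + pole_pot (x, 0))%:E)%E.
Proof.
move=> px; apply/(upot_leP cpt eb) => k k0 _; rewrite (Lpot_shift _ _ _ (ltW k0)).
have k1 : Num.sqrt k != 0 by rewrite sqrtr_eq0 -ltNge.
have fk : finite_domain e (x, Num.sqrt k).
  by move=> t _ [_ /eqP]; rewrite (negbTE k1).
apply: le_trans (pole_pot_le fk _) _; first by right.
rewrite lerD2l /pole_pot; case: (p) px => // x0 px /=; rewrite lerN2.
have n0 : x0 != x by apply/eqP => h; apply: px; rewrite h.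
have d0 : 0 < (x0 - x) ^+ 2 by rewrite lt_def sqrf_eq0 subr_eq0 n0 sqr_ge0.
rewrite /lam ler_pM2l ?invr_gt0// !addr0 expr0n /= addr0 ler_ln ?posrE//.
  by rewrite lerDl sqr_ge0.
by rewrite ltr_wpDr// sqr_ge0.
Qed.

Lemma pole_pot_within : {within e, continuous (fun x : R => pole_cst + pole_pot (x, 0))}.
Proof.
rewrite /pole_pot; case: (p) pe => [x0 pe0|_]; last first.
  by move=> x; exact: cst_continuous.
have fx0 : finite_domain e (x0, 0) by move=> t et [xt]; apply: (pe0 x0) => //; rewrite xt.
apply: pt_within_cont => x ex; apply: forD; first exact: forC.
apply: forN; have := line_cont (log_dist_cont fx0 ex).
have E : (fun t : R => lam 0 (x0 - t) 0) = (fun t : R => lam 0 (t - x0) (0 - 0)).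
  by apply/funext => t; rewrite subrr /lam -(sqrrN (x0 - t)) opprB.
by rewrite /= E.
Qed.

Lemma pole_pot_integrable (m : probability T R) :
  m.-integrable e (EFin \o (fun x => pole_cst + pole_pot (x, 0))).
Proof. exact: (within_continuous_integrable cpt m pole_pot_within). Qed.

(** The potential of [om] is bounded above on e by a continuous function, hence its integral against
    [om] is finite. *)
Lemma Tint_om : (Tint om om < +oo)%E.
Proof.
have ome := om_e; apply: (Tint_lt_pinfty cpt eb ome); rewrite (log_energy_upot cpt eb ome).
have i := pole_pot_integrable om.
apply: (@le_lt_trans _ _ (\int[om]_(x in e) (pole_cst + pole_pot (x, 0))%:E)%E); last first.
  exact: (integrable_lty meas i).
rewrite /upot integral_subge0//; last 3 first.
- exact: measurable_tl1.
- by move=> x _; apply: tl_ge0.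
- exact: (@Lpot1_integrable _ e b cpt eb om om e ome meas (@subset_refl _ e)).
have iL := @Lpot1_integrable _ e b cpt eb om om e ome meas (@subset_refl _ e).
have iS := intD meas i iL.
rewrite leeBlDr ?(integrable_fin_num meas iL)// -integralD//.
apply: ge0_le_integral => //.
- by move=> x _; exact: tl_ge0.
- exact: measurable_tl1.
- by have := measurable_int _ iS; congr (measurable_fun _ _); apply/funext => x /=; rewrite EFinD.
move=> x ex; have := upot_om_le (pole_neq ex); rewrite /upot leeBlDr// -EFinD.
Qed.

(** The difference [h - upot] is nonnegative with nonpositive integral. The computation is carried
    out on [tl] and [Lpot] separately, so that every term is integrable. *)
Lemma upot_cmp_null (m : probability T R) (h : R -> R) : m e = 1%E ->
  m.-integrable e (EFin \o h) -> (forall x, e x -> (upot e om x <= (h x)%:E)%E) ->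
  (\int[m]_(x in e) (h x)%:E <= \int[m]_(x in e) upot e om x)%E ->
  m [set x | e x /\ (upot e om x < (h x)%:E)%E] = 0%E.
Proof.
move=> me ih le int_le; have ome := om_e.
set A := [set x | _].
have mh := measurable_int _ ih.
have mu D := @measurable_upot R e b cpt eb om D ome.
have mA : measurable (A : set T).
  rewrite (_ : A = e `&` [set x | (upot e om x < (EFin \o h) x)%E])//.
  exact: measurable_lte.
have Ae : A `<=` e by move=> x [].
have iL := @Lpot1_integrable _ e b cpt eb om m e ome meas (@subset_refl _ e).
have iS := intD meas ih iL.
have mtl D : measurable_fun D (fun x : T => tl om 1 e (x, 0%R)) by exact: (measurable_tl1 cpt).
have tl0 x : (0 <= tl om 1 e (x, 0%R))%E by exact: tl_ge0.
have tlle x : e x -> (tl om 1 e (x, 0%R) <= (h x + Lpot om 1 e (x, 0))%:E)%E.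
  by move=> /le; rewrite /upot leeBlDr.
have itl : m.-integrable e (fun x => tl om 1 e (x, 0%R)).
  apply: (le_integrable meas _ _ iS); first exact: mtl.
  move=> x ex; rewrite gee0_abs//; apply: le_trans (tlle x ex) _.
  by rewrite lee_fin ler_norm.
pose f x := ((h x + Lpot om 1 e (x, 0))%:E - tl om 1 e (x, 0%R))%E.
have fi : m.-integrable e f by exact: (integrableB meas iS itl).
have H := @gt0_null _ _ R m A f mA; apply: H.
- by apply: (measurable_funS meas Ae); exact: measurable_int fi.
- by move=> x [ex hx]; rewrite sube_gt0; move: hx; rewrite /upot lteBlDr.
apply: (@le_trans _ _ (\int[m]_(x in e) f x)%E).
  apply: ge0_subset_integral => //; first exact: measurable_int fi.
  move=> x ex; have := tlle x ex; have := tl0 x; rewrite /f.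
  by case: (tl om 1 e (x, 0)) => // u _; rewrite -EFinB !lee_fin subr_ge0.
have -> : (\int[m]_(x in e) f x = \int[m]_(x in e) (h x + Lpot om 1 e (x, 0%R))%:E - \int[m]_(x in e) tl om 1 e (x, 0%R))%E.
  by rewrite -integralB.
move: int_le; rewrite /upot integral_subge0//.
have -> : (\int[m]_(x in e) (h x + Lpot om 1 e (x, 0%R))%:E = \int[m]_(x in e) (h x)%:E + \int[m]_(x in e) (Lpot om 1 e (x, 0%R))%:E)%E.
  by under eq_integral do rewrite EFinD; rewrite integralD.
have := integrable_fin_num meas itl; have := integrable_fin_num meas iL; have := integrable_fin_num meas ih.
rewrite /comp; case: (\int[m]_(x in e) (h x)%:E)%E => // u _.
case: (\int[m]_(x in e) (Lpot om 1 e (x, 0%R))%:E)%E => // v _.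
case: (\int[m]_(x in e) tl om 1 e (x, 0%R))%E => // t _.
by change (u <= t - v -> u + v - t <= 0); lra.
Qed.

(** Reciprocity: the integral of the potential of [om] against [rho] equals that of [rho] against
    [om], which is [robin] as [om] has finite energy. The upper bound of [upot_om_le] has the same
    integral against [rho], so the inequality cannot be strict on a set of positive mass. *)
Lemma upot_om_ae : rho [set x | e x /\ (upot e om x < (pole_cst + pole_pot (x, 0))%:E)%E] = 0%E.
Proof.
have ome := om_e.
apply: upot_cmp_null => //.
- exact: pole_pot_integrable.
- by move=> x ex; apply: upot_om_le; exact: pole_neq.
rewrite (upot_intC cpt eb re ome) (upot_rho_int cpt eb rhoP e_cap ome Tint_om).
rewrite /pole_cst /pole_pot; case: (p) pe => [x0 pe0|_]; last first.
  by under eq_integral do rewrite addr0; rewrite integral_cst1.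
have fx0 : finite_domain e (x0, 0) by move=> t et [xt]; apply: (pe0 x0) => //; rewrite xt.
have [s s0 sP] := finite_domain_dist cpt fx0.
have i0 : rho.-integrable e (EFin \o (fun t => lam 0 (x0 - t) 0)).
  by apply: (lam_integrable rho meas eb s0) => t et; rewrite addr0; exact: (sP t et).
rewrite (_ : \int[rho]_(x in e) _ = \int[rho]_(x in e) ((green (x0, 0))%:E - (lam 0 (x0 - x) 0)%:E))%E; last first.
  by apply: eq_integral.
rewrite integralB//; last by apply: finite_measure_integrable_cst.
rewrite integral_cst1//.
have -> : (\int[rho]_(x in e) (lam 0 (x0 - x) 0)%:E = (Lpot rho 0 e (x0, 0))%:E)%E.
  by rewrite /Lpot /Rintegral fineK//; exact: (integrable_fin_num meas i0).
by rewrite -EFinB lee_fin /green addrK.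
Qed.

End HarmonicPotential.

(** * Comparison with the given Green function *)

Section Taylor.
Context {R : realType}.
Implicit Types (h : plane R -> R) (z : plane R).

Lemma differentiable_plane h z (v : plane R) : differentiable h z ->
  'D_v h z = v.1 * pdx h z + v.2 * pdy h z.
Proof.
move=> dh; rewrite /pdx /pdy !deriveE//.
have E : v = v.1 *: ((1, 0) : plane R) + v.2 *: ((0, 1) : plane R).
  by case: v => v1 v2 /=; congr pair; rewrite /= /GRing.scale /= !(mulr1, mulr0) ?addr0 ?add0r.
by rewrite {1}E linearD !linearZ.
Qed.

Lemma differentiable_near_sq h z eta : differentiable h z -> 0 < eta ->
  near_sq z (fun w => `|h w - (h z + ((w.1 - z.1) * pdx h z + (w.2 - z.2) * pdy h z))|
     <= eta * (`|w.1 - z.1| + `|w.2 - z.2|)).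
Proof.
move=> dh eta0; have /diff_locallyP[_ /eqaddoP/(_ _ eta0)/nbhs_planeP[d d0 H]] := dh.
exists d => // x y /H; rewrite /= !add0r => h1; rewrite ![z.1 + x]addrC ![z.2 + y]addrC !addrK.
have dE : 'd h z (x, y) = x * pdx h z + y * pdy h z.
  by rewrite -deriveE// differentiable_plane.
move: h1; rewrite !fctE /= dE.
have -> : ((x, y) + z : plane R) = (x + z.1, y + z.2) by case: z {dh H dE}.
move=> /le_trans; apply; rewrite ler_pM2l//.
by rewrite ge_max lerDl lerDr !normr_ge0.
Qed.

Lemma is_derive_line h z (x y t : R) : differentiable h (z.1 + t * x, z.2 + t * y) ->
  is_derive t 1 (fun t : R => h (z.1 + t * x, z.2 + t * y))
    (x * pdx h (z.1 + t * x, z.2 + t * y) + y * pdy h (z.1 + t * x, z.2 + t * y)).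
Proof.
move=> dh; set w := (_, _) in dh *.
have dv := @differentiable_plane h w (x, y) dh.
have E : (fun k : R => k^-1 *: (h (z.1 + (k *: (1 : R) + t) * x, z.2 + (k *: (1 : R) + t) * y) - h w)) =
         (fun k : R => k^-1 *: (h (k *: ((x, y) : plane R) + w) - h w)).
  apply/funext => k; congr (_ *: (h _ - _)); rewrite /w /GRing.scale /= mulr1.
  change ((z.1 + (k + t) * x, z.2 + (k + t) * y) = (k * x + (z.1 + t * x), k * y + (z.2 + t * y))).
  by congr pair; ring.
have dbl : derivable h w (x, y) by exact: diff_derivable.
split; first by rewrite /derivable E.
by rewrite -dv /derive E.
Qed.

Lemma sqr_sum_le (eta x y : R) : 0 < eta ->
  eta / 4 * ((x + y) * (x + y)) <= eta * (x ^+ 2 + y ^+ 2).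
Proof.
move=> eta0; have e1 : 0 <= eta * (x - y) ^+ 2 by rewrite mulr_ge0 ?sqr_ge0// ltW.
have e2 : 0 <= eta * (x ^+ 2 + y ^+ 2) by rewrite mulr_ge0 ?sqr_sum_ge0// ltW.
have -> : eta / 4 * ((x + y) * (x + y)) = eta * (x ^+ 2 + y ^+ 2) / 2 - eta * (x - y) ^+ 2 / 4 by field.
lra.
Qed.

Lemma sqr_sub_le (x y : R) : (x - y) ^+ 2 <= 2 * x ^+ 2 + 2 * y ^+ 2.
Proof. by have := sqr_ge0 (x + y); rewrite !expr2; lra. Qed.

(** The mean value theorem on the segment from [z] to [z + (x, y)], for [h] minus its candidate
    quadratic part; the first-order expansion of the gradient at [z] bounds the derivative.
    Differentiating along the segment produces half the sum of the two mixed partial derivatives. *)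
Lemma expn_C2 h z L : near_sq z (fun w => differentiable h w) ->
  differentiable (pdx h) z -> differentiable (pdy h) z ->
  L = 2^-1 * pdx (pdx h) z + 2^-1 * pdy (pdy h) z -> expn h z L.
Proof.
move=> dh dx dy ->.
set A := pdx (pdx h) z; set D := pdy (pdy h) z.
pose B1 := pdy (pdx h) z; pose B2 := pdx (pdy h) z.
exists (pdx h z), (pdy h z), (2^-1 * A), (2^-1 * (B1 + B2)), (2^-1 * D); split => // eta eta0.
have eta4 : 0 < eta / 4 by rewrite divr_gt0.
have [d d0 H] := near_sqI dh (near_sqI (differentiable_near_sq dx eta4) (differentiable_near_sq dy eta4)).
exists d => // x y xyd.
have {}H t : 0 <= t <= 1 -> let w := (z.1 + t * x, z.2 + t * y) in
   [/\ differentiable h w, `|pdx h w - (pdx h z + (t * x * A + t * y * B1))| <= eta / 4 * (`|x| + `|y|) &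
    `|pdy h w - (pdy h z + (t * x * B2 + t * y * D))| <= eta / 4 * (`|x| + `|y|)].
  move=> /andP[t0 t1] w.
  have t2 : (t * x) ^+ 2 + (t * y) ^+ 2 < d.
    apply: le_lt_trans xyd; rewrite !exprMn -mulrDr ler_piMl ?sqr_sum_ge0//.
    by rewrite expr_le1.
  have [h1 [h2 h3]] := H _ _ t2.
  have le : eta / 4 * (`|t * x| + `|t * y|) <= eta / 4 * (`|x| + `|y|).
    by rewrite ler_pM2l// !normrM ger0_norm// -mulrDr ler_piMl// addr_ge0.
  have e1 : z.1 + t * x - z.1 = t * x by ring.
  have e2 : z.2 + t * y - z.2 = t * y by ring.
  split => //; apply: le_trans le.
    by move: h2; rewrite /= e1 e2.
  by move: h3; rewrite /= e1 e2.
pose q2 := 2^-1 * A * x ^+ 2 + 2^-1 * (B1 + B2) * (x * y) + 2^-1 * D * y ^+ 2.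
pose l := pdx h z * x + pdy h z * y.
pose phi (t : R) := h (z.1 + t * x, z.2 + t * y) - (t * l + t ^+ 2 * q2).
pose dphi (t : R) := x * pdx h (z.1 + t * x, z.2 + t * y) + y * pdy h (z.1 + t * x, z.2 + t * y) - (l + 2 * t * q2).
have dphiP (t : R) : 0 <= t <= 1 -> is_derive t 1 phi (dphi t).
  move=> t01; have [dht _ _] := H t t01; have D1 := is_derive_line dht.
  have D2 : is_derive t 1 (fun t : R => t * l + t ^+ 2 * q2) (l + 2 * t * q2).
    by apply: is_derive_eq; rewrite /GRing.scale /=; ring.
  exact: is_deriveB.
have [| |c] := @MVT_segment R phi dphi 0 1 ler01.
- by move=> t; rewrite in_itv /= => /andP[/ltW h1 /ltW h2]; apply: dphiP; rewrite h1.
- apply: derivable_within_continuous => t; rewrite in_itv /= => /dphiP [? _]; exact.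
rewrite in_itv /= subr0 mulr1 => c01 E.
have -> : h (z.1 + x, z.2 + y) - (h z + quad (pdx h z) (pdy h z) (2^-1 * A) (2^-1 * (B1 + B2)) (2^-1 * D) x y) = dphi c.
  rewrite -E /phi !mul1r !mul0r expr1n expr0n /= !mul0r !mul1r !addr0 -surjective_pairing /quad /l /q2; ring.
have [_ h1 h2] := H c c01.
have -> : dphi c = x * (pdx h (z.1 + c * x, z.2 + c * y) - (pdx h z + (c * x * A + c * y * B1))) +
   y * (pdy h (z.1 + c * x, z.2 + c * y) - (pdy h z + (c * x * B2 + c * y * D))).
  by rewrite /dphi /l /q2; field.
move: h1 h2; set U := pdx h _ - _; set V := pdy h _ - _ => h1 h2.
have tri : `|x * U + y * V| <= `|x| * `|U| + `|y| * `|V|.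
  by rewrite -!normrM; exact: ler_normD.
apply: (le_trans tri).
have g1 := ler_wpM2l (normr_ge0 x) h1; have g2 := ler_wpM2l (normr_ge0 y) h2.
apply: le_trans (lerD g1 g2) _.
rewrite -mulrDl mulrCA -(real_normK (num_real x)) -(real_normK (num_real y)).
exact: sqr_sum_le.
Qed.

End Taylor.

Section GreenComparison.
Context {R : realType}.
Local Notation T := (measurableTypeR R).
Implicit Types (z w a : plane R).
Variables (e : set R) (b : R) (rho om : probability T R) (x0 : R) (g : plane R -> R).
Hypotheses (cpt : compact e) (eb : forall x, e x -> `|x| <= b) (b0 : 0 < b).
Hypotheses (rhoP : is_equilibrium_measure e rho) (e_cap : (0 < capacity e)%E).
Hypotheses (omP : is_harmonic_measure e (Some (x0, 0)) om) (x0e : ~ e x0).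
Hypothesis gP : is_green_function_infty e g.

Let meas := meas_e cpt.
Let re := rho_e cpt rhoP.

Lemma green_infty_expn z : finite_domain e z -> expn g z 0.
Proof.
move=> fz; have [[[C2 harm] _] _ _ _] := gP.
have [d1 [d2 d3] _ _] := C2 z fz.
apply: expn_C2 => //; last by rewrite -mulrDr harm// mulr0.
have ce : closed e by apply: compact_closed => //; exact: norm_hausdorff.
by apply: near_sqW (finite_domain_near ce fz) => w /C2 [].
Qed.

(** The test of [pole_pot_le] with [g] in place of [green]. As [g z - ln |z|] is only known to be
    bounded at infinity, the exponent [1 + del] makes the test vanish there; then [del] tends to
    0. *)
Lemma green_infty_pot_le a : finite_domain e a -> a != (x0, 0) ->
  - Lpot om 0 e a <= g (x0, 0) - lam 0 (x0 - a.1) a.2.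
Proof.
move=> fa ax0.
have fx0 : finite_domain e (x0, 0) by move=> t et [xt]; apply: x0e; rewrite xt.
have [[_ g0] _ [r [M gM]] _] := gP.
have [C0 fC0] := log_dist_lower cpt fa.
have cf := log_dist_within fa.
have key del : 0 < del -> - Lpot om 0 e a <= (1 + del) * g (x0, 0) - lam 0 (x0 - a.1) a.2.
  move=> del0.
  pose LB w := - (1 + del) * g w.
  pose Ef w := if (w \in [:: a]) || `[< set0 w >] then 0 else expR (0 + 1 * slam [:: a] w + LB w).
  pose E (s : sphere R) := if s is Some w then Ef w else 0.
  pose C := Num.max C0 (lam 0 (x0 - a.1) a.2 *- 1 + (1 + del) * g (x0, 0)).
  have EfE w : w != a -> Ef w = expR (lam 0 (w.1 - a.1) (w.2 - a.2) - (1 + del) * g w).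
    move=> wa; rewrite /Ef inE (negbTE wa) (asboolF (fun x => x)) /= slam_cons slam_nil /LB.
    by congr expR; ring.
  have fC x : e x -> - C <= lam 0 (x - a.1) a.2.
    by move=> /fC0; apply: le_trans; rewrite lerN2 le_max lexx.
  have tE z : finite_domain e z -> log_test C (E \o Some) z.
    move=> fz; apply: log_test_roots => //; last by exists 1 => // ? ? _; apply.
    by have := expnZ (- (1 + del)) (green_infty_expn fz); rewrite mulr0.
  have tinf : log_test C (E \o @chart_infty R) (0, 0).
    left.
    pose A := a.1 ^+ 2 + a.2 ^+ 2.
    have A0 : 0 <= A := sqr_sum_ge0 _ _.
    (* With [N] the squared modulus in the chart, the exponent of the test is at most
       [2^-1 * del * ln N + K - C], which [N < expR (- (2 * K / del))] brings below [- C]. *)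
    pose K := C + 2^-1 * ln (2 + 2 * A) + (1 + del) * `|M|.
    have K0 : 0 < expR (- (2 * K / del)) := expR_gt0 _.
    have r1 : 0 < (1 + r ^+ 2 + b ^+ 2)^-1 by rewrite invr_gt0 -addrA ltr_wpDr// addr_ge0 ?sqr_ge0.
    apply: (@near_sq00 _ _ (Num.min 1 (Num.min (1 + r ^+ 2 + b ^+ 2)^-1 (expR (- (2 * K / del)))))).
      by rewrite !lt_min ltr01 r1 K0.
    move=> w; rewrite !lt_min => /andP[w1 /andP[wr wK]] /=.
    have [->|w0] := eqVneq w (0, 0); first by rewrite /chart_infty eqxx expR_ge0.
    rewrite chart_inftyE//=.
    have [wa|wa] := eqVneq (inv_pt w) a.
      by rewrite /Ef wa inE eqxx expR_ge0.
    rewrite EfE// ler_expR.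
    have N0 := sq_gt0 w0; set N := w.1 ^+ 2 + w.2 ^+ 2 in w1 wr wK N0.
    have iN : (inv_pt w).1 ^+ 2 + (inv_pt w).2 ^+ 2 = N^-1 by rewrite inv_pt_sq.
    have N1 : 1 + r ^+ 2 + b ^+ 2 < N^-1.
      by rewrite -[X in X < _]invrK ltf_pV2 ?posrE// invr_gt0 -addrA ltr_wpDr// addr_ge0 ?sqr_ge0.
    have fw : finite_domain e (inv_pt w).
      by apply: (far_domain eb b0); rewrite iN; have := sqr_ge0 r; lra.
    have rm : r < modulus (inv_pt w).
      rewrite /modulus iN; apply: le_lt_trans (ler_norm r) _.
      rewrite -sqrtr_sqr ltr_sqrt; have := sqr_ge0 b; rewrite ?invr_gt0//; lra.
    have gl := gM _ fw rm.
    have lm : ln (modulus (inv_pt w)) = - (2^-1 * ln N).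
      have sq2 : modulus (inv_pt w) ^+ 2 = N^-1 by rewrite sqr_sqrtr ?sqr_sum_ge0.
      have m0 : 0 < modulus (inv_pt w) by rewrite sqrtr_gt0 iN invr_gt0.
      have := congr1 (@ln R) sq2; rewrite lnXn// lnV ?posrE// mulr2n => h; lra.
    rewrite lm in gl.
    have g1 : - (2^-1 * ln N) - `|M| <= g (inv_pt w).
      by move: gl; rewrite ler_norml => /andP[h _]; have := ler_norm M; lra.
    have l1 : lam 0 ((inv_pt w).1 - a.1) ((inv_pt w).2 - a.2) <= - (2^-1 * ln N) + 2^-1 * ln (2 + 2 * A).
      rewrite /lam addr0 -mulrN -mulrDr ler_pM2l ?invr_gt0// -lnV ?posrE// -lnM ?posrE ?invr_gt0//; last first.
        by rewrite ltr_wpDr// mulr_ge0.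
      have iN0 : 0 < N^-1 by rewrite invr_gt0.
      have iN1 : 1 <= N^-1 by have := sqr_ge0 r; have := sqr_ge0 b; lra.
      rewrite ler_ln ?posrE ?dist_gt0// ?mulr_gt0//; last by rewrite ltr_wpDr// mulr_ge0.
      apply: (@le_trans _ _ (2 * N^-1 + 2 * A)).
        rewrite -iN /A; have := sqr_sub_le (inv_pt w).1 a.1; have := sqr_sub_le (inv_pt w).2 a.2; lra.
      have : 0 <= 2 * A * (N^-1 - 1) by rewrite mulr_ge0 ?subr_ge0// mulr_ge0.
      lra.
    have lN : ln N <= - (2 * K / del) by rewrite -ler_expR lnK ?posrE// ltW.
    have lN' : del * ln N <= - (2 * K).
      have : del * ln N <= del * - (2 * K / del) by rewrite ler_pM2l.
      by rewrite mulrN [del * (_ / _)]mulrC divfK// gt_eqF.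
    have g2 : (1 + del) * (- (2^-1 * ln N) - `|M|) <= (1 + del) * g (inv_pt w).
      by rewrite ler_pM2l// ltr_wpDr// ltW.
    rewrite /K in lN'; lra.
  have bd x : e x -> forall eta, 0 < eta -> near_sq (x, 0) (fun z => finite_domain e z ->
     ln (Num.max (E (Some z)) (expR (- C))) <= lam 0 (x - a.1) a.2 + eta).
    move=> ex eta eta0.
    have h : lam 0 (((x, 0) : plane R).1 - a.1) (((x, 0) : plane R).2 - a.2) < lam 0 (x - a.1) a.2 + eta.
      by rewrite /= /lam sub0r sqrrN ltrDl.
    apply: near_sqW (near_sq_cont_lt (log_dist_cont fa ex) h) => w /ltW hw fw.
    have fCx := fC x ex.
    rewrite -ler_expR lnK ?posrE ?lt_max ?expR_gt0 ?orbT// ge_max !ler_expR; apply/andP; split; last by lra.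
    rewrite /E; have [->|wa] := eqVneq w a; first by rewrite /Ef inE eqxx expR_ge0.
    rewrite EfE// ler_expR; have gw := g0 w fw.
    have : 0 <= (1 + del) * g w by rewrite mulr_ge0// addr_ge0// ltW.
    lra.
  have := perron_core cpt eb b0 rhoP e_cap omP cf tE tinf bd.
  rewrite (Lpot_int om cpt eb fa) lee_fin /E EfE ?[_ == a]eq_sym//=.
  have le1 : lam 0 (x0 - a.1) (0 - a.2) - (1 + del) * g (x0, 0) <= ln (Num.max (expR (lam 0 (x0 - a.1) (0 - a.2) - (1 + del) * g (x0, 0))) (expR (- C))).
    by rewrite -[X in X <= _]expRK ler_ln ?posrE ?lt_max ?expR_gt0// le_max lexx.
  have -> : lam 0 (x0 - a.1) a.2 = lam 0 (x0 - a.1) (0 - a.2) by rewrite /lam sub0r sqrrN.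
  move=> h; have := le_trans le1 h; lra.
apply/ler_addgt0Pr => eta eta0.
have G1 : 0 < g (x0, 0) + 1 by rewrite ltr_wpDl// g0.
have := key (eta / (g (x0, 0) + 1)) (divr_gt0 eta0 G1).
set del := eta / _ => h.
have : del * (g (x0, 0) + 1) = eta by rewrite divfK// gt_eqF.
have d0 : 0 < del by rewrite divr_gt0.
lra.
Qed.

(** The bound on the potential of [om] is integrated against [rho]: the left side becomes [robin] by
    reciprocity and Frostman's theorem, the right side [g (x0, 0)] minus the integral of
    [ln |x0 - x|]. *)
Lemma green_le_green_infty : green e rho (x0, 0) <= g (x0, 0).
Proof.
have fx0 : finite_domain e (x0, 0) by move=> t et [xt]; apply: x0e; rewrite xt.
have ome : om e = 1%E by case: omP.
have omP' : is_harmonic_measure e (sphere_of_line (Some x0)) om by [].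
have pe (x : R) : Some x0 = Some x -> ~ e x by case=> <-.
have To := Tint_om cpt eb b0 rhoP e_cap omP' pe.
have [s s0 sP] := finite_domain_dist cpt fx0.
have i0 : rho.-integrable e (EFin \o (fun t => lam 0 (x0 - t) 0)).
  by apply: (lam_integrable rho meas eb s0) => t et; rewrite addr0; exact: (sP t et).
have ole x : e x -> (upot e om x <= (g (x0, 0))%:E - (lam 0 (x0 - x) 0)%:E)%E.
  move=> ex; rewrite -EFinB; apply/(upot_leP cpt eb) => k k0 _; rewrite (Lpot_shift _ _ _ (ltW k0)).
  have k1 : Num.sqrt k != 0 by rewrite sqrtr_eq0 -ltNge.
  have fk : finite_domain e (x, Num.sqrt k) by move=> t _ [_ /eqP]; rewrite (negbTE k1).
  apply: le_trans (green_infty_pot_le fk _) _; first by apply/eqP => -[_ /eqP]; rewrite (negbTE k1).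
  rewrite lerD2l /= lerN2.
  have n0 : x0 != x by apply/eqP => h; apply: x0e; rewrite h.
  have d0 : 0 < (x0 - x) ^+ 2 by rewrite lt_def sqrf_eq0 subr_eq0 n0 sqr_ge0.
  rewrite /lam ler_pM2l ?invr_gt0// !addr0 expr0n /= addr0 ler_ln ?posrE//.
    by rewrite lerDl sqr_ge0.
  by rewrite ltr_wpDr// sqr_ge0.
have := upot_rho_int cpt eb rhoP e_cap ome To; rewrite (upot_intC cpt eb ome re) => E.
have iG : rho.-integrable e (EFin \o (fun x => g (x0, 0) - lam 0 (x0 - x) 0)).
  by apply: intB => //; apply: finite_measure_integrable_cst.
have iL := @Lpot1_integrable _ e b cpt eb om rho e ome meas (@subset_refl _ e).
have : ((fine (log_energy rho))%:E <= \int[rho]_(x in e) ((g (x0, 0))%:E - (lam 0 (x0 - x) 0)%:E))%E.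
  rewrite -E /upot integral_subge0//; [|exact: (measurable_tl1 cpt)|by move=> x _; apply: tl_ge0].
  have iS := intD meas iG iL.
  rewrite leeBlDr ?(integrable_fin_num meas iL)//.
  have -> : (\int[rho]_(x in e) ((g (x0, 0))%:E - (lam 0 (x0 - x) 0)%:E) = \int[rho]_(x in e) (EFin \o (fun x => (g (x0, 0)) - (lam 0 (x0 - x) 0))%R) x)%E.
    by apply: eq_integral.
  rewrite -integralD//.
  apply: ge0_le_integral => //.
  - by move=> x _; exact: tl_ge0.
  - exact: (measurable_tl1 cpt).
  - by have := measurable_int _ iS; congr (measurable_fun _ _); apply/funext => x /=; rewrite EFinD.
  by move=> x ex; have := ole x ex; rewrite /upot leeBlDr.
rewrite integralB//; last by apply: finite_measure_integrable_cst.
rewrite integral_cst1//.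
have -> : (\int[rho]_(x in e) (lam 0 (x0 - x) 0)%:E = (Lpot rho 0 e (x0, 0))%:E)%E.
  by rewrite /Lpot /Rintegral fineK//; exact: (integrable_fin_num meas i0).
by rewrite -EFinB lee_fin /green /robin; lra.
Qed.

End GreenComparison.

(** * Harmonic measure is absolutely continuous *)

Section GreenPositive.
Context {R : realType}.
Local Notation T := (measurableTypeR R).
Implicit Types (z w a : plane R) (m : probability T R).
Variables (e : set R) (b : R).
Hypotheses (cpt : compact e) (eb : forall x, e x -> `|x| <= b).
Let meas := meas_e cpt.

Lemma Lpot_mono_k m k k' z : 0 < k -> k <= k' -> Lpot m k e z <= Lpot m k' e z.
Proof.
move=> k0 kk; have k'0 := lt_le_trans k0 kk.
apply: le_Rintegral => //.
- exact: (lam_int m meas eb z k0).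
- exact: (lam_int m meas eb z k'0).
move=> t et; apply: lam_mono => //; first exact: ltW.
by rewrite ltr_wpDl// sqr_sum_ge0.
Qed.

Lemma lam0_int m z : finite_domain e z -> m.-integrable e (EFin \o (fun t => lam 0 (z.1 - t) z.2)).
Proof.
move=> fz; have [s s0 sP] := finite_domain_dist cpt fz.
by apply: (lam_integrable m meas eb s0) => t et; rewrite addr0; exact: sP.
Qed.

Lemma Lpot_mono_0 m k z : finite_domain e z -> 0 < k -> Lpot m 0 e z <= Lpot m k e z.
Proof.
move=> fz k0; have [s s0 sP] := finite_domain_dist cpt fz.
apply: le_Rintegral => //.
- exact: lam0_int.
- exact: (lam_int m meas eb z k0).
move=> t et; apply: lam_mono => //; first exact: ltW.
by rewrite addr0; exact: lt_le_trans s0 (sP t et).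
Qed.

Variable rho : probability T R.
Hypotheses (rhoP : is_equilibrium_measure e rho) (e_cap : (0 < capacity e)%E).

Lemma half_add_le (X Y P Q : R) : X <= - Q -> P <= Q ->
  2^-1 * ((Y + X) *+ 2) <= 2^-1 * (Y *+ 2) - P.
Proof. by lra. Qed.

(* Strict concavity in the gaps: [ln ((x0 + s - t) (x0 - s - t)) < ln (x0 - t)^2]. *)
Lemma green_gt0 x0 : ~ e x0 -> 0 < green e rho (x0, 0).
Proof.
move=> ex0; have re := rho_e cpt rhoP.
have fin x : ~ e x -> finite_domain e (x, 0) by move=> ex t et [xt]; apply: ex; rewrite xt.
have [d d0 dP] := finite_domain_dist cpt (fin x0 ex0).
pose s := Num.sqrt (d / 2).
have s0 : 0 < s by rewrite sqrtr_gt0 divr_gt0.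
have s2 : s ^+ 2 = d / 2 by rewrite sqr_sqrtr// divr_ge0// ltW.
have dP' t : e t -> d <= (x0 - t) ^+ 2 by move=> et; have := dP t et; rewrite /= expr0n /= addr0.
have nes x : `|x - x0| <= s -> ~ e x.
  move=> xs ex; have := dP' x ex; rewrite -sqrrN opprB -real_normK ?num_real//.
  have : `|x - x0| ^+ 2 <= s ^+ 2 by rewrite lerXn2r ?nnegrE// ltW.
  rewrite s2; lra.
have f1 : finite_domain e (x0 + s, 0) by apply: fin; apply: nes; rewrite addrC addKr gtr0_norm.
have f2 : finite_domain e (x0 - s, 0).
  by apply: fin; apply: nes; rewrite addrC addKr normrN gtr0_norm.
have g1 := green_ge0 cpt eb rhoP e_cap f1; have g2 := green_ge0 cpt eb rhoP e_cap f2.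
pose U := (`|x0| + b) ^+ 2 + 1.
have U0 : 0 < U by rewrite ltr_wpDl// sqr_ge0.
have i1 := @lam0_int rho _ f1; have i2 := @lam0_int rho _ f2; have i0 := @lam0_int rho _ (fin x0 ex0).
have i12 := intD meas i1 i2.
have ic : rho.-integrable e (EFin \o (fun=> - (s ^+ 2 / U))) by apply: finite_measure_integrable_cst.
have i00 := intD meas i0 i0.
have i00c := intD meas i00 ic.
have : Lpot rho 0 e (x0 + s, 0) + Lpot rho 0 e (x0 - s, 0) <=
   Lpot rho 0 e (x0, 0) + Lpot rho 0 e (x0, 0) + - (s ^+ 2 / U).
  rewrite /Lpot -RintegralD//.
  have -> : - (s ^+ 2 / U) = \int[rho]_(t in e) (- (s ^+ 2 / U)).
    by rewrite Rintegral_cst// [fine _](_ : _ = 1); [rewrite mulr1|exact: (congr1 fine re)].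
  rewrite -RintegralD// -RintegralD//; apply: le_Rintegral => //.
  move=> t et /=; have dt := dP' t et.
  rewrite /lam !addr0 !expr0n /= !addr0 -!mulrDr.
  set u := x0 - t in dt *.
  have u0 : 0 < u ^+ 2 by exact: lt_le_trans d0 dt.
  have E1 : x0 + s - t = u + s by rewrite /u; ring.
  have E2 : x0 - s - t = u - s by rewrite /u; ring.
  have us : 0 < u ^+ 2 - s ^+ 2 by rewrite s2; lra.
  have n1 : 0 < (u + s) ^+ 2.
    rewrite lt_def sqr_ge0 andbT sqrf_eq0; apply/eqP => h.
    by move: us; rewrite subr_sqr h mulr0 ltxx.
  have n2 : 0 < (u - s) ^+ 2.
    rewrite lt_def sqr_ge0 andbT sqrf_eq0; apply/eqP => h.
    by move: us; rewrite subr_sqr h mul0r ltxx.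
  rewrite E1 E2 -!lnM ?posrE// -!exprMn.
  rewrite (_ : (u + s) * (u - s) = u ^+ 2 - s ^+ 2); last by ring.
  rewrite lnXn// (_ : u * u = u ^+ 2)// [in X in _ <= X]lnXn//.
  have un0 : u != 0 by rewrite -sqrf_eq0 gt_eqF.
  have -> : ln (u ^+ 2 - s ^+ 2) = ln (u ^+ 2) + ln (1 - s ^+ 2 / u ^+ 2).
    rewrite -lnM ?posrE//; first by congr ln; field.
    by rewrite subr_gt0 ltr_pdivrMr// mul1r -subr_gt0.
  have l1 : ln (1 + - (s ^+ 2 / u ^+ 2)) <= - (s ^+ 2 / u ^+ 2).
    apply: le_ln1Dx; rewrite ltrN2 ltr_pdivrMr// mul1r -subr_gt0//.
  have l2 : s ^+ 2 / U <= s ^+ 2 / u ^+ 2.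
    rewrite ler_pM2l ?exprn_gt0// lef_pV2 ?posrE// /U.
    have : u ^+ 2 <= (`|x0| + b) ^+ 2.
      rewrite -real_normK ?num_real// lerXn2r ?nnegrE ?addr_ge0//.
        by apply: le_trans (eb et).
      by apply: le_trans (ler_normB _ _) _; rewrite lerD2l eb.
    lra.
  exact: half_add_le l1 l2.
have q0 : 0 < s ^+ 2 / U by rewrite divr_gt0// exprn_gt0.
move: g1 g2; rewrite /green; lra.
Qed.

End GreenPositive.

(** * Comparison of Green functions with different poles *)

Section Gap.
Context {R : realType}.
Local Notation T := (measurableTypeR R).
Implicit Types (z w a : plane R).
Variables (e : set R) (b : R) (rho om : probability T R) (p : ext_line R).
Hypotheses (cpt : compact e) (eb : forall x, e x -> `|x| <= b) (b0 : 0 < b).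
Hypotheses (rhoP : is_equilibrium_measure e rho) (e_cap : (0 < capacity e)%E).
Hypotheses (omP : is_harmonic_measure e (sphere_of_line p) om).
Hypothesis pe : forall x, p = Some x -> ~ e x.

Let meas := meas_e cpt.
Let re := rho_e cpt rhoP.
Let ome := om_e omP.
Local Notation green := (green e rho).
Local Notation robin := (robin rho).
Local Notation pole_cst := (pole_cst e rho p).
Local Notation pole_pot := (pole_pot p).

(* For [k = 0] this is the Green function with pole at [p]. *)
Definition gap k z := pole_cst + pole_pot z + Lpot om k e z.

(** By [upot_om_ae] the gap decreases to a nonpositive limit [rho]-almost everywhere on e as [k]
    decreases to 0, so the sets where it exceeds [eta] decrease to a null set. Continuity on e
    provides the closed sets. *)
Lemma gap_small_set (eta q : R) : 0 < eta -> 0 < q -> exists k (G : set R),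
  [/\ 0 < k <= 1, closed G, (forall x, e x -> G x -> gap k (x, 0) <= eta) &
      fine (rho (e `\` G)) <= q].
Proof.
move=> eta0 q0.
pose k n : R := 1 / n.+1%:R.
have k0 n : 0 < k n by rewrite divr_gt0.
have k1 n : k n <= 1 by rewrite ler_pdivrMr// mul1r ler1n.
have kd n n' : (n <= n')%N -> k n' <= k n by move=> nn; rewrite ler_pM2l// lef_pV2 ?posrE// ler_nat.
have cgap n : {within e, continuous (fun x : R => gap (k n) (x, 0))}.
  have c1 := @pole_pot_within R e rho p pe.
  have c2 : {within e, continuous (fun x : R => Lpot om (k n) e (x, 0))}.
    by apply: pt_within_cont => x ex; apply: line_cont; exact: (Lpot_continuous (m := om) meas eb).
  move=> x; exact: (@forD R (subspace e) _ _ x (c1 x) (c2 x)).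
have clG n : exists V : set R, closed V /\ V `&` e = [set x | gap (k n) (x, 0) <= eta] `&` e.
  have /continuous_closedP/(_ [set y | y <= eta] (@closed_le _ _)) := cgap n.
  by move=> /closed_subspaceP[V cV VE]; exists V.
have [V VP] := choice clG.
have clV n : closed (V n) by case: (VP n).
have VE n : V n `&` e = [set x | gap (k n) (x, 0) <= eta] `&` e by case: (VP n).
pose F n := e `\` V n.
have FE n : F n = e `&` [set x | eta < gap (k n) (x, 0)].
  apply/seteqP; split => x [ex h]; split => //=.
    rewrite ltNge; apply/negP => h'; apply: h.
    have : (V n `&` e) x by rewrite VE; split.
    by case.
  by move=> Vx; move: h; have : (V n `&` e) x by []; rewrite VE => -[/= h _]; rewrite ltNge h.
have mF n : measurable (F n : set T) by apply: measurableD => //; exact: closed_measurable.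
have F0 : rho (\bigcap_n F n) = 0%E.
  pose N : set T := [set x | e x /\ (upot e om x < (pole_cst + pole_pot (x, 0))%:E)%E].
  have N0 : rho N = 0%E := upot_om_ae cpt eb b0 rhoP e_cap omP pe.
  have mN : measurable N.
    rewrite (_ : N = e `&` [set x | (upot e om x < (EFin \o (fun x : R => pole_cst + pole_pot (x, 0))%R) x)%E])//.
    apply: measurable_lte => //; first exact: (measurable_upot cpt eb).
    apply: (measurable_int rho); exact: pole_pot_integrable.
  apply/eqP; rewrite eq_le measure_ge0 andbT -N0; apply: le_measure; rewrite ?inE//.
    exact: bigcap_measurable.
  move=> x Fx; have ex : e x by case: (Fx 0%N I).
  split => //; apply: (@le_lt_trans _ _ (pole_cst + pole_pot (x, 0) - eta)%:E); last first.
    by rewrite lte_fin ltrBlDr ltrDl.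
  rewrite /upot leeBlDr// -EFinD; apply: (tl_leP (m := om) meas eb) => // n.
  have := Fx n I; rewrite FE => -[_ /=]; rewrite /gap /k; lra.
have : rho (F n) @[n --> \oo] --> rho (\bigcap_n F n).
  apply: nonincreasing_cvg_mu => //.
  - by apply: le_lt_trans (probability_le1 rho (mF 0%N)) _; rewrite ltry.
  - exact: bigcap_measurable.
  move=> n n' np; apply/subsetPset; rewrite !FE => x [ex /= h]; split => //=; apply: lt_le_trans h _.
  rewrite lerD2l; apply: (Lpot_mono_k cpt eb) => //; exact: kd.
rewrite F0 => /fine_cvgP[fin /cvgrPdist_lt /(_ _ q0)].
move=> H; have [n _ /(_ n (leqnn n)) f2] := H.
exists (k n), (V n); split; rewrite ?k0 ?k1//.
  move=> x ex Vx; have : (V n `&` e) x by [].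
  by rewrite VE => -[].
by apply: ltW; move: f2; rewrite sub0r normrN; apply: le_lt_trans; exact: ler_norm.
Qed.

Lemma lam_far_le k t z : e t -> k <= 1 -> 0 < (z.1 - t) ^+ 2 + z.2 ^+ 2 + k ->
  lam k (z.1 - t) z.2 <= lam 1 z.1 z.2 + 2^-1 * ln (2 + 2 * b ^+ 2).
Proof.
move=> et k1 pos; rewrite /lam -mulrDr ler_pM2l ?invr_gt0//.
have S0 := sqr_sum_ge0 z.1 z.2.
have b2 : 0 < 2 + 2 * b ^+ 2 by rewrite ltr_wpDr// mulr_ge0// sqr_ge0.
have S1 : 0 < z.1 ^+ 2 + z.2 ^+ 2 + 1 by rewrite ltr_wpDl.
rewrite -lnM ?posrE// ler_ln ?posrE ?mulr_gt0//.
have h := sqr_sub_le z.1 t.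
have tb : t ^+ 2 <= b ^+ 2.
  by rewrite -real_normK ?num_real// lerXn2r ?nnegrE ?eb// ltW.
have y0 := sqr_ge0 z.2; have x0 := sqr_ge0 z.1.
have p1 : 0 <= (z.1 ^+ 2 + z.2 ^+ 2) * b ^+ 2 by rewrite mulr_ge0// sqr_ge0.
lra.
Qed.

Lemma Lpot_far_le (m : probability T R) k z : m e = 1%E -> 0 < k -> k <= 1 ->
  Lpot m k e z <= lam 1 z.1 z.2 + 2^-1 * ln (2 + 2 * b ^+ 2).
Proof.
move=> me k0 k1.
rewrite -[X in _ <= X]mulr1 -[X in _ * X](_ : fine (m e) = 1); last exact: (congr1 fine me).
apply: Lpot_le => //.
- rewrite addr_ge0 ?lam1_ge0// mulr_ge0 ?invr_ge0// ln_ge0//.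
  by have := sqr_ge0 b; lra.
- exact: (lam_int m meas eb z k0).
by move=> t et; apply: lam_far_le => //; rewrite ltr_wpDl// sqr_sum_ge0.
Qed.

(** [domination_pot] for [rho], with the regularized gap in the comparison function and [G] from
    [gap_small_set]. The gap grows at most like one logarithm; [C >= 2], [eta < 1 / 2] and a mass at
    most [1 / 4] off [G] give [1 + eta < C * (1 - 1 / 4)]. *)
Lemma gap_le_aux (C Bp Lam0 : R) (X0 : set (plane R)) : 2 <= C -> closed X0 ->
  (forall z, ~ X0 z -> expn pole_pot z 0) -> (forall x, e x -> ~ X0 (x, 0)) ->
  (forall z, ~ X0 z -> pole_pot z <= Bp) ->
  (forall z, X0 z -> near_sq z (fun w => ~ X0 w ->
     [/\ finite_domain e w, (forall k, 0 < k -> k <= 1 -> gap k w + lam 1 w.1 w.2 <= C * green w) &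
        forall t, e t -> lam 0 (w.1 - t) w.2 <= Lam0])) ->
  forall w, finite_domain e w -> ~ X0 w -> gap 0 w <= C * green w.
Proof.
move=> C2 clX ep eX bp near w fw Xw.
have C0 : 0 < C by apply: lt_le_trans C2.
have [s s0 sP] := finite_domain_dist cpt fw.
pose s1 := Num.min s 1.
have s10 : 0 < s1 by rewrite lt_min s0 ltr01.
pose L0 := lam 1 b 0.
pose L1 := lam 1 w.1 w.2.
pose Lam := Num.max (Num.max Lam0 0) (lam 1 (b + b) 0).
have L00 : 0 <= L0 := lam1_ge0 _ _ (lexx _).
have L10 : 0 <= L1 := lam1_ge0 _ _ (lexx _).
pose A := C * (Lam + 2^-1 * `|ln s1|).
have A0 : 0 <= A.
  rewrite mulr_ge0 ?(ltW C0)// addr_ge0//; first by rewrite !le_max lexx orbT.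
pose L2 := 2^-1 * ln (2 + 2 * b ^+ 2).
have key eta : 0 < eta -> eta < 2^-1 -> gap 0 w <= C * green w + eta * (1 + L0 + A).
  move=> eta0 eta1.
  have q0 : 0 < Num.min eta 4^-1 by rewrite lt_min eta0 invr_gt0 ltr0n.
  have [k [G [/andP[k0 k1] cG GP Gq]]] := gap_small_set eta0 q0.
  pose be z := gap k z + eta * (lam 1 z.1 z.2 - L0) - C * robin - eta.
  have ebe z : ~ X0 z -> exists2 L, 0 < L & expn be z L.
    move=> Xz; have [l1 l10 e1] := expn_lam1 z.
    have [|l2 [l20 _ e2]] := @expn_Lpot _ om e b k k z.1 z.2 meas eb (ltW k0) k0.
      by move=> t _; rewrite lerDr sqr_sum_ge0.
    rewrite -surjective_pairing in e2.
    have E1 := expnD (expnD (expn_cst pole_cst z) (ep z Xz)) e2.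
    have E2 := expnZ eta (expnD e1 (expn_cst (- L0) z)).
    have E3 := expnD (expnD E1 E2) (expn_cst (- (C * robin) - eta) z).
    exists (0 + 0 + l2 + eta * (l1 + 0) + 0).
      by rewrite !addr0 add0r ltr_wpDl// mulr_gt0.
    suff -> : be = (fun w => pole_cst + pole_pot w + Lpot om k e w + eta * (lam 1 w.1 w.2 + - L0) + (- (C * robin) - eta)) by exact: E3.
    by apply/funext => v; rewrite /be /gap; ring.
  have gw : gap 0 w <= gap k w by rewrite lerD2l; exact: (Lpot_mono_0 cpt eb).
  have dp : - (C * Lpot rho 0 e w) + be w <= A * fine (rho (e `\` G)).
    rewrite /A; apply: (@domination_pot R e b rho cpt eb re G C (1 + eta)
       (pole_cst + Bp + L2 + C * `|robin|) Lam s1 X0 be w) => //.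
    - exists set0; split => // x [ex tx]; exfalso.
      have := upot_rho_le cpt eb rhoP e_cap x.
      by rewrite /upot tx.
    - by rewrite addr_ge0// ltW.
    - by move=> z /ebe[L L0' EL]; split; [exact: expn_lexp EL|exact: expn_cont EL].
    - by move=> x ex; have [L _] := ebe _ (eX x ex); exact: expn_cont.
    - move=> x ex Gx k' k'0 k'1.
      have := GP x ex Gx; have /upot_leP := upot_rho_le cpt eb rhoP e_cap x.
      move=> /(_ b cpt eb k' k'0 k'1) h1 h2; have l1 := lam1_le (eb ex).
      have h3 : C * - Lpot rho k' e (x, 0) <= C * robin by rewrite ler_pM2l.
      have h4 : eta * lam 1 x 0 <= eta * L0 by rewrite ler_pM2l.
      rewrite /be /=; lra.
    - by rewrite !le_max lexx orbT.
    - move=> x t ex et; rewrite le_max; apply/orP; right; apply: lam1_le.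
      by apply: le_trans (ler_normB _ _) _; apply: lerD; exact: eb.
    - move=> z Xz; apply: near_sqW (near z Xz) => v H Xv; have [fv h1 h2] := H Xv.
      split => //; last by move=> t et; apply: le_trans (h2 t et) _; rewrite !le_max lexx.
      have := h1 k k0 k1; have l1 := lam1_ge0 v.1 v.2 (lexx 1).
      have : eta * lam 1 v.1 v.2 <= 1 * lam 1 v.1 v.2 by rewrite ler_wpM2r//; lra.
      have : 0 <= eta * L0 by rewrite mulr_ge0// ltW.
      rewrite /be /green; lra.
    - move=> v Xv; rewrite /be /gap; have := bp v Xv.
      have := Lpot_far_le v ome k0 k1; rewrite -/L2.
      have : 0 <= eta * L0 by rewrite mulr_ge0// ltW.
      have : - (C * robin) <= C * `|robin|.
        by rewrite -mulrN ler_pM2l//; have := ler_norm (- robin); rewrite normrN.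
      lra.
    - have : fine (rho (e `\` G)) <= 4^-1 by apply: le_trans Gq _; rewrite ge_min lexx orbT.
      set q := fine _ => q4.
      have : 2 * (1 - q) <= C * (1 - q) by rewrite ler_wpM2r//; lra.
      lra.
    - by rewrite ge_min lexx orbT.
    - by move=> t et; apply: le_trans (sP t et); rewrite ge_min lexx.
  have : A * fine (rho (e `\` G)) <= A * eta.
    by rewrite ler_wpM2l//; apply: le_trans Gq _; rewrite ge_min lexx.
  have : 0 <= eta * L1 by rewrite mulr_ge0// ltW.
  by move: dp; rewrite /be /green -/L1; lra.
apply/ler_addgt0Pr => eps eps0.
have D0 : 0 < 1 + L0 + A by rewrite ltr_wpDr// ltr_wpDr.
pose eta := Num.min 3^-1 (eps / (1 + L0 + A)).
have eta0 : 0 < eta by rewrite lt_min invr_gt0 ltr0n divr_gt0.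
have eta1 : eta < 2^-1 by rewrite gt_min; apply/orP; left; lra.
apply: le_trans (key eta eta0 eta1) _; rewrite lerD2l.
by rewrite -ler_pdivlMr// ge_min lexx orbT.
Qed.

(** For a finite pole, a small disc [X0] around [x0] encloses the logarithmic pole of the gap; for
    the pole at infinity [X0] is empty and [C = 2]. *)
Lemma gap_le_line : exists2 C, 2 <= C & forall x y, e x -> y != 0 ->
  gap 0 (x, y) <= C * green (x, y).
Proof.
case Ep : p pe => [x0|] pe0; last first.
  exists 2 => // x y ex y0.
  apply: (@gap_le_aux 2 0 0 set0) => //.
  - exact: closed0.
  - by move=> z _; rewrite /pole_pot Ep; exact: expn_cst.
  - by move=> t _; exact.
  - by move=> z _; rewrite /pole_pot Ep.
  - by move=> t _ [_ /eqP]; rewrite (negbTE y0).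
have fx0 : finite_domain e (x0, 0) by move=> t et [xt]; apply: (pe0 x0) => //; rewrite xt.
have g0 : 0 < green (x0, 0) by apply: (green_gt0 cpt eb rhoP e_cap); exact: pe0.
have [s s0 sP] := finite_domain_dist cpt fx0.
have gc : {for ((x0, 0) : plane R), continuous (fun w => - green w)}.
  by apply: forN; exact: expn_cont (expn_green rho cpt eb fx0).
have ghalf : - green (x0, 0) < - (green (x0, 0) / 2) by lra.
have [d d0 dP] := near_sq_cont_lt gc ghalf.
pose d' := Num.min d (Num.min s 1).
have d'0 : 0 < d' by rewrite !lt_min d0 s0 ltr01.
pose r := d' / 2.
have r0 : 0 < r by rewrite divr_gt0.
pose D z := (z.1 - x0) ^+ 2 + z.2 ^+ 2.
have Dc z : {for z, continuous D}.
  apply: forD; apply: forX; last exact: cvg_snd.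
  by apply: forB; [exact: cvg_fst|exact: forC].
have Dd z : D z < d' -> [/\ finite_domain e z, green (x0, 0) / 2 <= green z & lam 1 z.1 z.2 <= lam 1 (2 * `|x0| + 2) 0].
  move=> Dz; move: (Dz); rewrite !lt_min => /andP[h1 /andP[h2 h3]]; split.
  - move=> t et zt; move: h2; rewrite /D zt /= expr0n /= addr0 -sqrrN opprB.
    by have := sP t et; rewrite /= expr0n /= addr0 leNgt => /negP.
  - have := dP (z.1 - x0) z.2 h1; rewrite /= add0r addrC subrK -surjective_pairing.
    by rewrite ltrN2 => /ltW.
  rewrite /lam ler_pM2l ?invr_gt0// ler_ln ?posrE; last 2 first.
  - by rewrite ltr_wpDl// sqr_sum_ge0.
  - by rewrite ltr_wpDl// sqr_sum_ge0.
  rewrite expr0n /= addr0 lerD2r.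
  move: h3; rewrite /D => h3.
  have := sqr_sub_le (z.1 - x0) (- x0); rewrite opprK subrK sqrrN => h4.
  have x02 : x0 ^+ 2 = `|x0| ^+ 2 by rewrite real_normK ?num_real.
  have : (2 * `|x0| + 2) ^+ 2 = 4 * `|x0| ^+ 2 + 8 * `|x0| + 4 by ring.
  have := normr_ge0 x0; have := sqr_ge0 z.2; have := sqr_ge0 `|x0|; lra.
pose X0 := [set z | D z <= r].
have clX : closed X0.
  apply: (@closed_comp _ _ D [set y | y <= r]); last exact: closed_le.
  by move=> z _; exact: Dc.
have ppE z : pole_pot z = - lam 0 (x0 - z.1) z.2 by rewrite /pole_pot Ep.
have DE z : (x0 - z.1) ^+ 2 + z.2 ^+ 2 = D z by rewrite /D -sqrrN opprB.
have ppl z : ~ X0 z -> pole_pot z <= - (2^-1 * ln r).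
  move=> /negP; rewrite -ltNge => rD.
  rewrite ppE lerN2 /lam addr0 DE ler_pM2l ?invr_gt0// ler_ln ?posrE ?(ltW rD)//.
  exact: lt_trans r0 rD.
pose L2 := 2^-1 * ln (2 + 2 * b ^+ 2).
pose M2 := lam 1 (2 * `|x0| + 2) 0.
pose M1 := pole_cst - 2^-1 * ln r + 2 * M2 + L2.
(* Near the disc [green] is at least half of its value at [x0], and outside [X0] the gap plus
   [lam 1] is at most [M1] there; [C] is chosen so that [C * green >= M1]. *)
pose C := 2 + 2 * `|M1| / green (x0, 0).
have C2 : 2 <= C by rewrite lerDl divr_ge0// ?mulr_ge0// ltW.
have CM : M1 <= C * (green (x0, 0) / 2).
  apply: le_trans (ler_norm _) _.
  have -> : C * (green (x0, 0) / 2) = green (x0, 0) + `|M1| by rewrite /C; field; rewrite gt_eqF.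
  by rewrite lerDr ltW.
exists C => // x y ex y0.
apply: (@gap_le_aux C (- (2^-1 * ln r)) (M2 + L2) X0) => //.
- move=> z /negP; rewrite -ltNge => rD.
  have pos : 0 < (z.1 - x0) ^+ 2 + (z.2 - 0) ^+ 2 + 0 by rewrite subr0 addr0; exact: lt_trans rD.
  have := expnZ (-1) (@expn_lam R 0 (x0, 0) z (lexx 0) pos); rewrite mul0r mulr0.
  congr (expn _ z 0); apply/funext => w.
  by rewrite ppE mulN1r /lam /= subr0 -(sqrrN (x0 - w.1)) opprB.
- move=> t et; rewrite /X0 /mkset /D /= expr0n /= addr0 => h; have := sP t et; rewrite /= expr0n /= addr0.
  rewrite -sqrrN opprB => h'; have : d' <= s by rewrite !ge_min lexx orbT.
  move: h; rewrite /r; lra.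
- move=> z Xz; have Dz : D z < d' by apply: le_lt_trans Xz _; rewrite /r; lra.
  apply: near_sqW (near_sq_cont_lt (Dc z) Dz) => w /Dd[h1 h2 h3] Xw; split => //.
    move=> k k0 k1; have := Lpot_far_le w ome k0 k1; rewrite -/L2 => h4.
    have h5 : C * (green (x0, 0) / 2) <= C * green w by rewrite ler_wpM2l//; apply: le_trans C2.
    have := ppl w Xw; rewrite -/M2 in h3; rewrite /gap; move: CM; rewrite /M1; lra.
  move=> t et; apply: le_trans (@lam_far_le 0 t w et ler01 _) _; last by rewrite lerD2r.
  rewrite addr0; have [s' s'0 s'P] := finite_domain_dist cpt h1.
  exact: lt_le_trans s'0 (s'P t et).
- by move=> t _ [_ /eqP]; rewrite (negbTE y0).
rewrite /X0 /mkset /D /= => h; have := sP x ex; rewrite /= expr0n /= addr0.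
rewrite -sqrrN opprB => h'; have : d' <= s by rewrite !ge_min lexx orbT.
by have := sqr_ge0 y; move: h; rewrite /r; lra.
Qed.

End Gap.

Section TailComparison.
Context {R : realType}.
Local Notation T := (measurableTypeR R).
Implicit Types (z w a : plane R).
Variables (e : set R) (b : R) (rho om : probability T R) (p : ext_line R).
Hypotheses (cpt : compact e) (eb : forall x, e x -> `|x| <= b) (b0 : 0 < b).
Hypotheses (rhoP : is_equilibrium_measure e rho) (e_cap : (0 < capacity e)%E).
Hypotheses (omP : is_harmonic_measure e (sphere_of_line p) om).
Hypothesis pe : forall x, p = Some x -> ~ e x.

Let meas := meas_e cpt.
Let ome := om_e omP.
Local Notation green := (green e rho).
Local Notation robin := (robin rho).
Local Notation pole_cst := (pole_cst e rho p).
Local Notation pole_pot := (pole_pot p).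

Lemma tl_upot (m : probability T R) k x : 0 < k ->
  (tl m k e (x, 0%R) = upot e m x + (Lpot m k e (x, 0%R))%:E)%E.
Proof.
move=> k0; have := tl_add m meas eb (x, 0) k0 ltr01.
rewrite /upot; case: (tl m k e (x, 0)) => [u||]; case: (tl m 1 e (x, 0)) => [v||] //=.
by rewrite -!EFinD => -[E]; congr EFin; lra.
Qed.

Lemma Lpot_line (m : probability T R) x y : Lpot m (y ^+ 2) e (x, 0) = Lpot m 0 e (x, y).
Proof.
by rewrite /Lpot; apply: eq_Rintegral => t _; rewrite /lam /= expr0n /= !addr0.
Qed.

Lemma tl_rho_green x y : upot e rho x = robin%:E -> y != 0 ->
  tl rho (y ^+ 2) e (x, 0) = (green (x, y))%:E.
Proof.
by move=> ux y0; rewrite tl_upot ?exprn_even_gt0// ux Lpot_line.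
Qed.

Lemma pole_pot_line : exists2 C2, 0 <= C2 & forall x y, e x ->
  pole_pot (x, 0) - pole_pot (x, y) <= C2 * y ^+ 2.
Proof.
rewrite /pole_pot; case Ep: p pe => [x0|] pe0; last by exists 0 => // x y _; rewrite subrr mul0r.
have fx0 : finite_domain e (x0, 0) by move=> t et [xt]; apply: (pe0 x0) => //; rewrite xt.
have [s s0 sP] := finite_domain_dist cpt fx0.
exists s^-1; first by rewrite invr_ge0 ltW.
move=> x y ex /=; have := sP x ex; rewrite /= expr0n /= addr0 => sx.
have u0 : 0 < (x0 - x) ^+ 2 by exact: lt_le_trans s0 sx.
rewrite opprK addrC /lam expr0n /= !addr0 -mulrBr -ln_div ?posrE//; last by rewrite ltr_wpDr// sqr_ge0.
have -> : ((x0 - x) ^+ 2 + y ^+ 2) / (x0 - x) ^+ 2 = 1 + y ^+ 2 / (x0 - x) ^+ 2.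
  by rewrite mulrDl divff// gt_eqF.
have q0 : 0 <= y ^+ 2 / (x0 - x) ^+ 2 by rewrite divr_ge0// sqr_ge0.
have l1 : ln (1 + y ^+ 2 / (x0 - x) ^+ 2) <= y ^+ 2 / (x0 - x) ^+ 2 by apply: le_ln1Dx; lra.
have l2 : y ^+ 2 / (x0 - x) ^+ 2 <= s^-1 * y ^+ 2.
  by rewrite mulrC ler_wpM2r ?sqr_ge0// lef_pV2 ?posrE.
apply: le_trans l2; apply: le_trans l1.
by rewrite ler_piMl ?ln_ge0 ?lerDl//; lra.
Qed.

(** Where the potential of [rho] equals [robin], the tail of [rho] at scale [y] is [green (x, y)].
    The tail of [om] is at most the gap at [(x, y)] plus the variation of [pole_pot] over the height
    [y], which is quadratic since the pole is off e. *)
Lemma tail_cmp : exists C C2, [/\ 0 < C, 0 <= C2 & forall x y, e x -> upot e rho x = robin%:E -> y != 0 ->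
  (tl om (y ^+ 2) e (x, 0%R) <= (C * green (x, y) + C2 * y ^+ 2)%:E)%E].
Proof.
have [C C2 CP] := gap_le_line cpt eb b0 rhoP e_cap omP pe.
have [C' C'0 C'P] := pole_pot_line.
exists C, C'; split => //; first by apply: lt_le_trans C2.
move=> x y ex ux y0; have y2 : 0 < y ^+ 2 by rewrite exprn_even_gt0.
rewrite tl_upot//.
have := upot_om_le cpt eb b0 rhoP e_cap omP (pole_neq pe ex).
have h1 := CP x y ex y0; have h2 := C'P x y ex.
move=> h; apply: (le_trans (leeD2r _ h)).
by rewrite -EFinD lee_fin Lpot_line; move: h1; rewrite /gap; lra.
Qed.

Lemma ae_regular : om [set x | e x /\ upot e rho x != robin%:E] = 0%E.
Proof. exact: (upot_rho_ae cpt eb rhoP e_cap ome (Tint_om cpt eb b0 rhoP e_cap omP pe)). Qed.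

End TailComparison.

(** * From tails to masses of small balls *)

Section BallComparison.
Context {R : realType}.
Local Notation T := (measurableTypeR R).

(** A real-valued tail kernel, so that it is a random variable; [fine] sends the diagonal value
    [+oo] to 0, which is harmless for a measure without an atom at [x]. *)
Definition tlog (y x t : R) : R := fine (tker (y ^+ 2) ((x - t) ^+ 2)).

Lemma tlogE y x t : tlog y x t = if x == t then 0 else 2^-1 * ln (1 + y ^+ 2 / (x - t) ^+ 2).
Proof.
rewrite /tlog /tker sqrf_eq0 subr_eq0; case: eqVneq => // xt /=.
have u0 : 0 < (x - t) ^+ 2 by rewrite exprn_even_gt0//= subr_eq0.
by rewrite -ln_div ?posrE// ?ltr_wpDr ?sqr_ge0// mulrDl divff// gt_eqF.
Qed.

Lemma tlog_ge0 y x t : 0 <= tlog y x t.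
Proof.
rewrite tlogE; case: eqVneq => // xt; rewrite mulr_ge0 ?invr_ge0// ln_ge0//.
by rewrite lerDl divr_ge0// sqr_ge0.
Qed.

(** Bernoulli's inequality [1 + q <= (1 + q / 9) ^+ 9]. *)
Lemma tlog_scale y x t : tlog y x t <= 9 * tlog (y / 3) x t.
Proof.
rewrite !tlogE; case: eqVneq => [_|xt]; first by rewrite mulr0.
have u0 : 0 < (x - t) ^+ 2 by rewrite exprn_even_gt0//= subr_eq0.
set q := y ^+ 2 / (x - t) ^+ 2.
have q0 : 0 <= q by rewrite divr_ge0// sqr_ge0.
have -> : (y / 3) ^+ 2 / (x - t) ^+ 2 = q / 9 by rewrite /q; field; rewrite subr_eq0.
have q9 : 0 < 1 + q / 9 by rewrite ltr_wpDr// divr_ge0.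
rewrite mulrCA ler_pM2l ?invr_gt0// mulr_natl -lnXn// ler_ln ?posrE ?exprn_gt0//; last first.
  by rewrite ltr_wpDr.
have Ber n : 1 + n%:R * (q / 9) <= (1 + q / 9) ^+ n.
  elim: n => [|n IH]; first by rewrite mul0r addr0 expr0.
  rewrite exprS; have := ler_wpM2l (ltW q9) IH; apply: le_trans.
  rewrite -natr1; have : 0 <= n%:R * (q / 9) ^+ 2 by rewrite mulr_ge0// sqr_ge0.
  by rewrite expr2; lra.
by have := Ber 9%N; apply: le_trans; lra.
Qed.

Lemma measurable_tlog y x : measurable_fun [set: T] (tlog y x : T -> R).
Proof.
have h : measurable_fun [set: T] (fun t : T => tker (y ^+ 2) ((x - t) ^+ 2)).
  by apply: (measurableT_comp (@measurable_tker R _)); apply: measurable_funX; exact: measurable_funB.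
by apply: (measurableT_comp _ h).
Qed.

Lemma tlog_gt y x t r : 0 < r -> x != t ->
  (r < tlog y x t) = ((x - t) ^+ 2 * (expR (2 * r) - 1) < y ^+ 2).
Proof.
move=> r0 xt; rewrite tlogE (negbTE xt).
have u0 : 0 < (x - t) ^+ 2 by rewrite exprn_even_gt0//= subr_eq0.
have p0 : 0 < 1 + y ^+ 2 / (x - t) ^+ 2 by rewrite ltr_wpDr// divr_ge0// sqr_ge0.
transitivity (2 * r < ln (1 + y ^+ 2 / (x - t) ^+ 2)); first by rewrite ltr_pdivlMl.
rewrite -[RHS]/(_ < _) -[LHS]ltr_expR lnK ?posrE//.
by rewrite -ltrBlDl ltr_pdivlMr// [(expR _ - 1) * _]mulrC.
Qed.

Variables (rho om : probability T R).

(** The set where [tlog y x] exceeds [r] is, up to its centre, the ball of radius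
    [y / sqrt (exp (2 * r) - 1)], so the integral of [tlog] is the integral over [r] of masses of
    balls. If the reverse inequality held for all small radii, integrating it would contradict
    [tail]. Scale [y / 3] for [rho] gives the ratio 3 of the radii, and [tlog_scale] converts it
    into the factor 9. *)
Lemma ball_cmp (C C2 x d eta : R) : 0 < C -> 0 <= C2 -> om [set x] = 0%E -> 0 < d -> 0 < eta ->
  (forall y, 0 < y -> (\int[om]_t (tlog y x t)%:E <=
     C%:E * \int[rho]_t (tlog y x t)%:E + (C2 * y ^+ 2)%:E)%E) ->
  (forall y, (\int[rho]_t (tlog y x t)%:E < +oo)%E) ->
  exists2 s, 0 < s < d & (om (ball x (3 * s)) <= (9 * C)%:E * rho (ball x s) + (eta * s)%:E)%E.
Proof.
move=> C0 C20 omx d0 eta0 tail fin; apply: contrapT => H.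
have {}H s : 0 < s < d -> ((9 * C)%:E * rho (ball x s) + (eta * s)%:E <= om (ball x (3 * s)))%E.
  by move=> sd; apply: contrapT => /negP; rewrite -ltNge => /ltW h; apply: H; exists s.
pose K := C / (2 * d ^+ 2) + C2 + 1.
have K0 : 0 < K by rewrite ltr_wpDl// addr_ge0// divr_ge0 ?mulr_ge0 ?sqr_ge0// ltW.
(* For [y] this small, the errors of order [y ^+ 2] collected in [K] lie below the gain
   [eta * y * expR (- 2) / 3] of order [y]. *)
pose y := Num.min d (eta * expR (- 2) / 3 / K / 2).
have y0 : 0 < y by rewrite lt_min d0 !divr_gt0// mulr_gt0// expR_gt0.
have yd : y <= d by rewrite ge_min lexx.
have yK : y * K < eta * expR (- 2) / 3.
  have : y <= eta * expR (- 2) / 3 / K / 2 by rewrite ge_min lexx orbT.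
  rewrite ler_pdivlMr// ler_pdivlMr// => h.
  have : 0 < y * K by rewrite mulr_gt0.
  lra.
(* For [r > r0] the radius attached to [r] is below [d]; for smaller [r] the trivial bound 1 on
   probabilities is used. *)
pose r0 := y ^+ 2 / (18 * d ^+ 2).
have d2 : 0 < 18 * d ^+ 2 by rewrite mulr_gt0// exprn_gt0.
have r00 : 0 < r0 by rewrite divr_gt0// exprn_gt0.
have r01 : r0 < 1.
  rewrite ltr_pdivrMr// mul1r; have : y ^+ 2 <= d ^+ 2 by rewrite lerXn2r ?nnegrE// ltW.
  have : 0 < d ^+ 2 by rewrite exprn_gt0.
  lra.
pose X : {RV om >-> R} := @mfun_Sub _ _ T R (tlog y x) (mem_set (measurable_tlog y x)).
pose Y : {RV rho >-> R} := @mfun_Sub _ _ T R (tlog (y / 3) x) (mem_set (measurable_tlog (y / 3) x)).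
pose mu := @lebesgue_measure R.
pose D : set R := `[0%R, +oo[%classic.
(* For [1 <= r <= 2] the radius [s] is at least [y * expR (- 2) / 3], so the term [eta * s]
   contributes to first order in [y]. *)
have ptw r : D r -> ((9 * C)%:E * ccdf Y r + (eta * y * expR (- 2) / 3)%:E * (\1_(`[1%R, 2%R]%classic) r)%:E <=
   ccdf X r + (9 * C)%:E * (\1_(`[0%R, r0]%classic) r)%:E)%E.
  rewrite /D /= in_itv /= andbT => rge0.
  have Y1 : (ccdf Y r <= 1)%E by exact: probability_le1.
  have X0 : (0 <= ccdf X r)%E by exact: measure_ge0.
  have fY : ccdf Y r \is a fin_num by exact: fin_num_measure.
  have [rr0|rr0] := leP r r0.
    rewrite [X in (_ + _ * X <= _)%E](_ : _ = 0%E); last first.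
      rewrite indicE memNset//= in_itv /= => /andP[h _].
      by have := lt_le_trans r01 h; rewrite ltNge rr0.
    rewrite [X in (_ <= _ + _ * X)%E](_ : _ = 1%E); last first.
      by rewrite indicE mem_set//= in_itv /= rge0 rr0.
    rewrite mule0 adde0 mule1 -[X in (X <= _)%E]add0e; apply: leeD => //.
    by rewrite -[X in (_ <= X)%E]mule1 lee_pmul2l// lte_fin mulr_gt0.
  rewrite [X in (_ <= _ + _ * X)%E](_ : _ = 0%E); last first.
    by rewrite indicE memNset//= in_itv /= rge0 /= leNgt rr0.
  rewrite mule0 adde0.
  have rp := lt_trans r00 rr0.
  pose q := expR (2 * r) - 1.
  have q2r : 2 * r <= q by rewrite /q; have := expR_ge1Dx (2 * r); lra.
  have q0 : 0 < q by apply: lt_le_trans q2r; rewrite mulr_gt0.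
  pose s := y / (3 * Num.sqrt q).
  have sq0 : 0 < Num.sqrt q by rewrite sqrtr_gt0.
  have s0 : 0 < s by rewrite divr_gt0// mulr_gt0.
  have s2 : s ^+ 2 = y ^+ 2 / (9 * q).
    by rewrite /s expr_div_n exprMn sqr_sqrtr ?(ltW q0)//; congr (_ / (_ * _)); ring.
  have sd : s < d.
    rewrite -(ltr_pXn2r (n := 2))// ?nnegrE ?(ltW s0) ?(ltW d0)// s2 ltr_pdivrMr ?mulr_gt0//.
    move: rr0; rewrite /r0 ltr_pdivrMr// => h.
    have : d ^+ 2 * (2 * r) <= d ^+ 2 * q by rewrite ler_pM2l// exprn_gt0.
    lra.
  have xs (t : R) u : 0 < u -> (`|x - t| < u) = ((x - t) ^+ 2 < u ^+ 2).
    by move=> u0; rewrite -(real_normK (num_real (x - t))) ltr_pXn2r// ?nnegrE// ltW.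
  have c1 : (ccdf Y r <= rho (ball x s))%E.
    rewrite /ccdf /distribution /pushforward; apply: le_measure; rewrite ?inE.
    - by rewrite -[X in measurable X]setTI; exact: (measurable_tlog (y / 3) x).
    - exact: measurable_ball.
    move=> t /=; rewrite in_itv /= andbT => h; rewrite /ball /= xs//.
    have [xt|xt] := eqVneq x t.
      by rewrite xt subrr expr0n /= exprn_gt0.
    move: h; rewrite tlog_gt// s2 ltr_pdivlMr ?mulr_gt0// -/q expr_div_n => h.
    have -> : (x - t) ^+ 2 * (9 * q) = 9 * ((x - t) ^+ 2 * q) by ring.
    by move: h; rewrite (_ : 3 ^+ 2 = 9) ?ltr_pdivlMr//; [rewrite mulrC|ring].
  have c2 : (om (ball x (3 * s)) <= ccdf X r)%E.
    have mB : measurable (ball x (3 * s) : set T) by exact: measurable_ball.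
    have -> : om (ball x (3 * s)) = om (ball x (3 * s) `\` [set x]).
      apply/eqP; rewrite eq_le; apply/andP; split; last first.
        by apply: le_measure; rewrite ?inE//; exact: measurableD.
      apply: (@le_trans _ _ (om ((ball x (3 * s) `\` [set x]) `|` [set x]))).
        apply: le_measure; rewrite ?inE//.
          by apply: measurableU => //; exact: measurableD.
        by move=> t h; have [->|xt] := eqVneq t x; [right|left; split => //; exact/eqP].
      apply: le_trans (measureU2 _ _ _) _ => //; first exact: measurableD.
      by rewrite [X in (_ + X <= _)%E](_ : _ = 0%E); [rewrite adde0|exact: omx].
    rewrite /ccdf /distribution /pushforward; apply: le_measure; rewrite ?inE.
    - exact: measurableD.
    - by rewrite -[X in measurable X]setTI; exact: (measurable_tlog y x).
    move=> t [/= h tx]; rewrite in_itv /= andbT.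
    have xt : x != t by rewrite eq_sym; exact/eqP.
    have h' : `|x - t| < 3 * s by exact: h.
    rewrite xs in h'; last by rewrite mulr_gt0.
    have E3 : (3 * s) ^+ 2 = y ^+ 2 / q by rewrite exprMn s2; field; rewrite gt_eqF.
    by rewrite tlog_gt// -/q; move: h'; rewrite E3 ltr_pdivlMr.
  have sd' : 0 < s < d by rewrite s0 sd.
  apply: le_trans (le_trans (H s sd') c2).
  apply: leeD; first by rewrite lee_pmul2l// lte_fin mulr_gt0.
  rewrite -EFinM lee_fin indicE; have [/set_mem /=|_] := boolP (r \in _); last first.
    by rewrite mulr0 mulr_ge0// ltW.
  rewrite in_itv /= mulr1 => /andP[_ r2].
  rewrite /s -!mulrA ler_pM2l// ler_pM2l// invfM mulrC ler_pM2l ?invr_gt0//.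
  rewrite expRN lef_pV2 ?posrE ?expR_gt0//.
  have : q <= expR 2 ^+ 2.
    rewrite -expRM_natl /q; have : expR (2 * r) <= expR (2%:R * 2) :> R by rewrite ler_expR; lra.
    lra.
  by move=> /ler_wsqrtr; rewrite sqrtr_sqr ger0_norm ?expR_ge0.
have mI (A : set R) : measurable A -> measurable_fun D (fun r => (\1_A r)%:E).
  by move=> mA; apply/measurable_EFinP; exact: measurable_indic.
have c0 : 0 <= 9 * C by rewrite mulr_ge0// ltW.
have e0 : 0 <= eta * y * expR (- 2) / 3 by rewrite divr_ge0// !mulr_ge0 ?expR_ge0// ltW.
have mX : measurable_fun D (ccdf X) by apply: measurable_funTS; exact: ccdf_measurable.
have mY : measurable_fun D (ccdf Y) by apply: measurable_funTS; exact: ccdf_measurable.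
have mD : measurable D by exact: measurable_itv.
have i0 (A : set R) r : (0 <= (\1_A r)%:E)%E by rewrite lee_fin.
have : (\int[mu]_(r in D) ((9 * C)%:E * ccdf Y r + (eta * y * expR (- 2) / 3)%:E * (\1_(`[1%R, 2%R]%classic) r)%:E) <=
  \int[mu]_(r in D) (ccdf X r + (9 * C)%:E * (\1_(`[0%R, r0]%classic) r)%:E))%E.
  apply: ge0_le_integral => //.
  - by move=> r _; apply: adde_ge0; rewrite mule_ge0// ?measure_ge0.
  - apply: emeasurable_funD; apply: measurable_funeM => //; exact: mI.
  - apply: emeasurable_funD => //; apply: measurable_funeM; exact: mI.
have lin (F : R -> \bar R) (c1 c2 : R) (A : set R) : measurable_fun D F -> (forall r, 0 <= F r)%E ->
    0 <= c1 -> 0 <= c2 -> measurable A ->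
    (\int[mu]_(r in D) (c1%:E * F r + c2%:E * (\1_A r)%:E) = c1%:E * \int[mu]_(r in D) F r + c2%:E * mu (A `&` D))%E.
  move=> mF F0 c10 c20 mA; rewrite ge0_integralD//.
  - rewrite ge0_integralZl//.
    rewrite ge0_integralZl//; try exact: mI.
    by rewrite integral_indic.
  - by move=> r _; rewrite mule_ge0// lee_fin.
  - by apply: measurable_funeM.
  - by move=> r _; rewrite mule_ge0// lee_fin.
  - by apply: measurable_funeM; exact: mI.
have EX : (\int[mu]_(r in D) ccdf X r = \int[om]_t (tlog y x t)%:E)%E.
  by rewrite -ge0_expectation_ccdf ?expectation_def// => t; exact: tlog_ge0.
have EY : (\int[mu]_(r in D) ccdf Y r = \int[rho]_t (tlog (y / 3) x t)%:E)%E.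
  by rewrite -ge0_expectation_ccdf ?expectation_def// => t; exact: tlog_ge0.
have YX0 : (forall r, 0 <= ccdf Y r)%E by move=> r; exact: measure_ge0.
have XX0 : (forall r, 0 <= ccdf X r)%E by move=> r; exact: measure_ge0.
rewrite lin//.
rewrite [X in (_ <= X)%E](_ : _ = \int[mu]_(r in D) (1%:E * ccdf X r + (9 * C)%:E * (\1_(`[0%R, r0]%classic) r)%:E))%E; last first.
  by apply: eq_integral => r _; rewrite mul1e.
rewrite lin// mul1e EX EY.
have -> : mu (`[1%R, 2%R]%classic `&` D) = 1%E.
  rewrite (_ : _ `&` _ = `[1%R, 2%R]%classic).
    by rewrite /mu lebesgue_measure_itv /= lte_fin ltr1n -EFinB; congr EFin; ring.
  apply/setIidPl => r; rewrite /D /= !in_itv /= => /andP[h _].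
  by rewrite andbT; exact: le_trans h.
have -> : mu (`[0%R, r0]%classic `&` D) = r0%:E.
  rewrite (_ : _ `&` _ = `[0%R, r0]%classic).
    by rewrite /mu lebesgue_measure_itv /= lte_fin r00 sube0.
  by apply/setIidPl => r; rewrite /D /= !in_itv /= => /andP[-> _].
have sc : (\int[rho]_t (tlog y x t)%:E <= 9%:E * \int[rho]_t (tlog (y / 3) x t)%:E)%E.
  rewrite -ge0_integralZl//; last 2 first.
  - by apply/measurable_EFinP; exact: measurable_tlog.
  - by move=> t _; rewrite lee_fin tlog_ge0.
  apply: ge0_le_integral => //.
  - by move=> t _; rewrite lee_fin tlog_ge0.
  - by apply/measurable_EFinP; exact: measurable_tlog.
  - by apply: measurable_funeM; apply/measurable_EFinP; exact: measurable_tlog.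
  by move=> t _; rewrite -EFinM lee_fin tlog_scale.
have ge0 (m : probability T R) y' : (0 <= \int[m]_t (tlog y' x t)%:E)%E.
  by apply: integral_ge0 => t _; rewrite lee_fin tlog_ge0.
have := tail y y0; move: sc (fin y) (fin (y / 3)) (ge0 rho y) (ge0 rho (y / 3)) (ge0 om y).
case: (\int[rho]_t (tlog y x t)%:E)%E => // A.
case: (\int[rho]_t (tlog (y / 3) x t)%:E)%E => // B.
case: (\int[om]_t (tlog y x t)%:E)%E => // E.
change (A <= 9 * B -> (A%:E < +oo)%E -> (B%:E < +oo)%E -> 0 <= A -> 0 <= B -> 0 <= E ->
  E <= C * A + C2 * y ^+ 2 -> 9 * C * B + eta * y * expR (- 2) / 3 * 1 <= E + 9 * C * r0 -> False).
move=> h1 _ _ _ _ _ h2 h3.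
have h4 : C * A <= C * (9 * B) by rewrite ler_pM2l.
have h5 : 9 * C * r0 = y * (y * (C / (2 * d ^+ 2))) by rewrite /r0; field; rewrite gt_eqF.
have h6 : y * (y * K) < y * (eta * expR (- 2) / 3) by rewrite ltr_pM2l.
have h7 : 0 < y * y by rewrite mulr_gt0.
move: h6; rewrite /K; move: h2; rewrite expr2 => h2 h6.
lra.
Qed.

End BallComparison.

Section ClosedOuter.
Context {R : realType} (m : probability (measurableTypeR R) R).
Local Notation T := (measurableTypeR R).

Lemma closed_outer (F : set R) eps : closed F -> 0 < eps ->
  exists V : set R, [/\ open V, F `<=` V & (m V <= m F + eps%:E)%E].
Proof.
move=> cF eps0.
pose V n := \bigcup_(x in F) (ball x n.+1%:R^-1 : set R).
have oV n : open (V n) by apply: bigcup_open => x _; apply: ball_open; rewrite invr_gt0.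
have mV n : measurable (V n : set T) by exact: open_measurable.
have mF : measurable (F : set T) by exact: closed_measurable.
have FV n : F `<=` V n by move=> x Fx; exists x => //; apply: ballxx; rewrite invr_gt0.
have IV : \bigcap_n V n = F.
  apply/seteqP; split => [x Vx|x Fx n _]; last exact: FV.
  apply: cF => A /nbhs_ballP[d /= d0 dA].
  have [n _ nd] := near_infty_natSinv_lt (PosNum d0).
  have [y Fy yx] := Vx n I; exists y; split => //; apply: dA.
  by apply: ball_sym; apply: le_ball yx; apply: ltW; exact: (nd n (leqnn n)).
have : m (V n) @[n --> \oo] --> m (\bigcap_n V n).
  apply: nonincreasing_cvg_mu => //.
  - by apply: le_lt_trans (probability_le1 m (mV 0%N)) _; rewrite ltry.
  - exact: bigcap_measurable.
  move=> n p np; apply/subsetPset => x [y Fy yx]; exists y => //; apply: le_ball yx.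
  by rewrite lef_pV2 ?posrE// ler_nat.
rewrite IV => cv.
have fF : m F \is a fin_num by exact: fin_num_measure.
have mFe : fine (m F) < fine (m F) + eps by rewrite ltrDl.
rewrite -(fineK fF) in cv; have /fine_cvgP[_ /cvgr_lt/(_ _ mFe)[n _ nP]] := cv.
exists (V n); split => //; rewrite -(fineK fF) -[X in (X <= _)%E]fineK ?fin_num_measure//.
by rewrite -EFinD lee_fin; apply: ltW; exact: (nP n (leqnn n)).
Qed.

Lemma measure_bigsetU_le (I : Type) (s : seq I) (B : I -> set R) :
  (forall i, measurable (B i : set T)) ->
  (m (\big[setU/set0]_(i <- s) B i) <= \sum_(i <- s) m (B i))%E.
Proof.
move=> mB; elim: s => [|i s IH]; first by rewrite !big_nil measure0.
rewrite !big_cons; apply: le_trans (measureU2 _ _ _) _ => //.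
  exact: bigsetU_measurable.
by rewrite leeD2l.
Qed.

End ClosedOuter.

Lemma trivIset_sum_le {R : realType} (m : {measure set (measurableTypeR R) -> \bar R})
    (s : seq R) (B : R -> set R) (A : set R) : uniq s ->
  (forall i, measurable (B i : set (measurableTypeR R))) -> measurable (A : set (measurableTypeR R)) ->
  trivIset [set` s] B -> (forall i, i \in s -> B i `<=` A) ->
  (\sum_(i <- s) m (B i) <= m A)%E.
Proof.
move=> us mB mA tB BA.
rewrite fsbig_seq// -measure_fin_bigcup//.
apply: le_measure; rewrite ?inE//.
  by apply: fin_bigcup_measurable.
by move=> x [i /= /BA]; apply.
Qed.

(** * Covering argument for null compact sets *)

Section AbsoluteContinuity.
Context {R : realType}.
Local Notation T := (measurableTypeR R).
Implicit Types (z w a : plane R).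
Variables (e : set R) (b : R) (rho om : probability T R) (p : ext_line R).
Hypotheses (cpt : compact e) (eb : forall x, e x -> `|x| <= b) (b0 : 0 < b).
Hypotheses (rhoP : is_equilibrium_measure e rho) (e_cap : (0 < capacity e)%E).
Hypotheses (omP : is_harmonic_measure e (sphere_of_line p) om).
Hypothesis pe : forall x, p = Some x -> ~ e x.

Let meas := meas_e cpt.
Let re := rho_e cpt rhoP.
Let ome := om_e omP.
Local Notation robin := (robin rho).

Lemma upot_le_closed (m : probability T R) c : closed [set x : R | (upot e m x <= c%:E)%E].
Proof.
have -> : [set x : R | (upot e m x <= c%:E)%E] = \bigcap_n [set x : R | - Lpot m (n.+1%:R^-1) e (x, 0) <= c].
  apply/seteqP; split => x.
    move=> /(upot_leP cpt eb) H n _; apply: H; rewrite ?invr_gt0// invf_le1// ?ler1n//.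
  move=> H; rewrite /= /upot leeBlDr// -EFinD; apply: (tl_leP (m := m) meas eb) => // n.
  by have := H n I; rewrite /= div1r; lra.
apply: closed_bigI => n _.
apply: (@closed_comp _ _ (fun x : R => - Lpot m n.+1%:R^-1 e (x, 0)) [set y | y <= c]); last exact: closed_le.
move=> x _; apply: cvgN; apply: line_cont.
by apply: (Lpot_continuous (m := m) meas eb); rewrite invr_gt0.
Qed.

Lemma tl_line_cst (m : probability T R) y x : tl m (y ^+ 2) e (x, 0) = (\int[m]_(t in e) tker (y ^+ 2) ((x - t) ^+ 2))%E.
Proof. by apply: eq_integral => t _ /=; rewrite expr0n /= addr0. Qed.

Lemma measurable_tker_sq k x (E : set T) : measurable_fun E (fun t : T => tker k ((x - t) ^+ 2)).
Proof.
apply: measurable_funTS; apply: (measurableT_comp (@measurable_tker R k)).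
by apply: measurable_funX; exact: measurable_funB.
Qed.

Lemma tl_integrable (m : probability T R) y x : (tl m (y ^+ 2) e (x, 0%R) < +oo)%E ->
  m.-integrable e (fun t => tker (y ^+ 2) ((x - t) ^+ 2)).
Proof.
move=> fin; apply/integrableP; split; first exact: measurable_tker_sq.
rewrite tl_line_cst in fin; apply: le_lt_trans fin.
rewrite le_eqVlt; apply/orP; left; apply/eqP; apply: eq_integral => t _.
by rewrite gee0_abs// tker_ge0// sqr_ge0.
Qed.

(** The kernel is [+oo] at [t = x], so a finite integral excludes an atom. *)
Lemma tl_fin_null (m : probability T R) y x : e x -> (tl m (y ^+ 2) e (x, 0%R) < +oo)%E -> m [set x] = 0%E.
Proof.
move=> ex fin; have [N [mN N0 NP]] := integrable_ae meas (tl_integrable fin).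
apply/eqP; rewrite eq_le measure_ge0 andbT -N0; apply: le_measure; rewrite ?inE//.
by move=> _ ->; apply: NP => /= /(_ ex); rewrite subrr expr0n /= /tker eqxx.
Qed.

Lemma tlog_int_le (m : probability T R) y x : m e = 1%E ->
  (\int[m]_t (tlog y x t)%:E <= tl m (y ^+ 2) e (x, 0%R))%E.
Proof.
move=> me; rewrite tl_line_cst (integral_carrier meas (carrier0 cpt me)); last first.
  by apply/measurable_EFinP; exact: measurable_tlog.
apply: ge0_le_integral => //.
- by move=> t _; rewrite lee_fin tlog_ge0.
- by apply/measurable_EFinP; apply: measurable_funTS; exact: measurable_tlog.
- exact: measurable_tker_sq.
move=> t _; rewrite /tlog; have : (0 <= tker (y ^+ 2) ((x - t) ^+ 2))%E by apply: tker_ge0; exact: sqr_ge0.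
by case: (tker _ _) => [u||] //= _; rewrite leey.
Qed.

Lemma tlog_int (m : probability T R) y x : m e = 1%E -> (tl m (y ^+ 2) e (x, 0%R) < +oo)%E ->
  (\int[m]_t (tlog y x t)%:E = tl m (y ^+ 2) e (x, 0%R))%E.
Proof.
move=> me fin; rewrite tl_line_cst (integral_carrier meas (carrier0 cpt me)); last first.
  by apply/measurable_EFinP; exact: measurable_tlog.
apply: ae_eq_integral => //.
- by apply/measurable_EFinP; apply: measurable_funTS; exact: measurable_tlog.
- exact: measurable_tker_sq.
have [N [mN N0 NP]] := integrable_ae meas (tl_integrable fin).
exists N; split => //; apply: subset_trans NP => t /= H H'; apply: H => et.
by rewrite /tlog fineK//; exact: H'.
Qed.

Lemma ball_cmp_regular : exists2 C, 0 < C & forall x d eta, e x -> upot e rho x = robin%:E ->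
  0 < d -> 0 < eta ->
  exists2 s, 0 < s < d & (om (ball x (3 * s)) <= (9 * C)%:E * rho (ball x s) + (eta * s)%:E)%E.
Proof.
have [C [C2 [C0 C20 CP]]] := tail_cmp cpt eb b0 rhoP e_cap omP pe.
exists C => // x d eta ex ux d0 eta0.
have tlr y : y != 0 -> tl rho (y ^+ 2) e (x, 0) = (green e rho (x, y))%:E.
  exact: (tl_rho_green cpt eb).
have omx : om [set x] = 0%E.
  have := CP x 1 ex ux (oner_neq0 R) => h.
  by apply: (@tl_fin_null om 1) => //; apply: le_lt_trans h _; rewrite ltry.
apply: (@ball_cmp R rho om C C2) => //.
- move=> y y0; have yn : y != 0 by rewrite gt_eqF.
  rewrite (@tlog_int rho y)//; last by rewrite tlr// ltry.
  rewrite tlr//; apply: le_trans (tlog_int_le _ _ ome) _.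
  by have := CP x y ex ux yn; rewrite EFinD EFinM.
move=> y; apply: le_lt_trans (tlog_int_le _ _ re) _.
have [->|yn] := eqVneq y 0; last by rewrite tlr// ltry.
apply: (@le_lt_trans _ _ (tl rho (1 ^+ 2) e (x, 0%R))); last by rewrite tlr ?oner_neq0// ltry.
by apply: tl_mono_k => //; rewrite ?expr1n expr0n.
Qed.

(* The Green functions with poles at [p] and at infinity are comparable near e, which bounds the harmonic measure
   of small balls; a Vitali covering of [K] concludes. *)
Lemma om_null_compact (K : set R) : compact K -> K `<=` e -> rho K = 0%E -> om K = 0%E.
Proof.
move=> cK Ke rK; apply/eqP/negPn/negP => omK.
have clK : closed K by apply: compact_closed => //; exact: norm_hausdorff.
have mK : measurable (K : set T) by exact: closed_measurable.
have fK : om K \is a fin_num by exact: fin_num_measure.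
have mK0 : 0 < fine (om K).
  by rewrite fine_gt0// lt_def omK measure_ge0/= ltey_eq fK.
set m0 := fine (om K) in mK0.
have [C C0 CP] := ball_cmp_regular.
(* The points of e where the potential of [rho] is below [robin] lie in countably many closed
   [om]-null sets. They are covered by an open set [W] of mass at most [m0 / 2], so that the regular
   remainder [K'] is still compact. *)
pose Cn n := e `&` [set x : R | (upot e rho x <= (robin - n.+1%:R^-1)%:E)%E].
have ce : closed e by apply: compact_closed => //; exact: norm_hausdorff.
have cCn n : closed (Cn n) by apply: closedI => //; exact: upot_le_closed.
have Cn0 n : om (Cn n) = 0%E.
  have ae0 := ae_regular cpt eb b0 rhoP e_cap omP pe.
  apply/eqP; rewrite eq_le measure_ge0 andbT -ae0; apply: le_measure; rewrite ?inE.
  - exact: closed_measurable.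
  - rewrite (_ : [set x | _] = e `&` [set x | upot e rho x != robin%:E])//.
    apply: emeasurable_neq => //; exact: (measurable_upot cpt eb).
  move=> x [ex h]; split => //; rewrite lt_eqF//; apply: le_lt_trans h _.
  by rewrite lte_fin ltrBlDr ltrDl invr_gt0.
pose ep n := (m0 / 2) / (2 ^ n.+1)%:R.
have ep0 n : 0 < ep n by rewrite !divr_gt0// ltr0n expn_gt0.
have VP n := closed_outer om (cCn n) (ep0 n).
have [V VVP] := choice VP.
have oV n : open (V n) by case: (VVP n).
have mV n : measurable (V n : set T) by exact: open_measurable.
pose W := \bigcup_n V n.
have oW : open W by exact: bigcup_open.
have mW : measurable (W : set T) by exact: open_measurable.
have omW : (om W <= (m0 / 2)%:E)%E.
  apply: le_trans (@generalized_Boole_inequality _ _ _ om V mV mW) _.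
  have m20 : 0 <= m0 / 2 by rewrite divr_ge0// ltW.
  apply: le_trans (epsilon_trick0 xpredT m20); apply: lee_nneseries => [n _ _|n _].
    exact: measure_ge0.
  by have [_ _] := VVP n; rewrite Cn0 add0e.
pose K' := K `\` W.
have cK' : compact K'.
  by apply: (subclosed_compact _ cK) => [|x []//]; rewrite /K' setDE; apply: closedI => //; exact: open_closedC.
have mK' : measurable (K' : set T) by exact: measurableD.
have omK' : m0 / 2 <= fine (om K').
  have : (om K <= om K' + om W)%E.
    apply: (@le_trans _ _ (om (K' `|` W))); last exact: measureU2.
    apply: le_measure; rewrite ?inE//; first exact: measurableU.
    by move=> x Kx; have [Wx|Wx] := pselect (W x); [right|left].
  have fK' : om K' \is a fin_num by exact: fin_num_measure.
  rewrite -(fineK fK) -(fineK fK') => h.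
  have := le_trans h (leeD2l _ omW); rewrite -EFinD lee_fin -/m0; lra.
have reg x : K' x -> e x /\ upot e rho x = robin%:E.
  move=> [Kx Wx]; have ex := Ke x Kx; split => //.
  apply/eqP; rewrite eq_le (upot_rho_le cpt eb rhoP e_cap)//= leNgt; apply/negP => lt.
  apply: Wx; have : exists n, (upot e rho x <= (robin - n.+1%:R^-1)%:E)%E.
    have := upot_gt_oo e rho x; case: (upot e rho x) lt => // u ul _.
    have du : 0 < robin - u by rewrite subr_gt0.
    have [n _ nd] := near_infty_natSinv_lt (PosNum du).
    by exists n; rewrite lee_fin lerBrDr -lerBrDl; apply: ltW; exact: (nd n (leqnn n)).
  by move=> [n hn]; exists n => //; have [_ sub _] := VVP n; apply: sub; split.
(* [b + 2] bounds the sum of the radii, since the disjoint balls have radius at most 1 and centre in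
   e. The choice gives [om K'] at most [m0 / 4], against at least [m0 / 2]. *)
pose eta := m0 / 4 / (9 * C + b + 2).
have D0 : 0 < 9 * C + b + 2 by rewrite !addr_gt0// mulr_gt0.
have eta0 : 0 < eta by rewrite !divr_gt0.
have clK' : closed K' by apply: compact_closed => //; exact: norm_hausdorff.
have [U [oU K'U rU]] := closed_outer rho clK' eta0.
have rK' : rho K' = 0%E.
  apply/eqP; rewrite eq_le measure_ge0 andbT -rK; apply: le_measure; rewrite ?inE//.
  by move=> x [].
rewrite rK' add0e in rU.
have sP x : exists s, 0 < s /\ (K' x -> [/\ s <= 1, ball x s `<=` U &
    (om (ball x (3 * s)) <= (9 * C)%:E * rho (ball x s) + (eta * s)%:E)%E]).
  have [Kx|Kx] := pselect (K' x); last by exists 1; split.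
  have [ex ux] := reg x Kx.
  have /nbhs_ballP[d /= d0 dU] : nbhs x U by apply: open_nbhs_nbhs; split => //; exact: K'U.
  have d10 : 0 < Num.min d 1 by rewrite lt_min d0 ltr01.
  have [s /andP[s0 sd] sle] := CP x _ eta ex ux d10 eta0.
  move: sd; rewrite lt_min => /andP[sd s1].
  exists s; split => // _; split => //; first exact: ltW.
  by apply: subset_trans dU; apply: le_ball; exact: ltW.
have [s sPs] := choice sP.
have s0 x : 0 < s x by case: (sPs x).
pose B x : set R := ball x (s x).
have := cK'; rewrite compact_cover => /(_ R K' B)[].
- by move=> x _; apply: ball_open.
- by move=> x Kx; exists x => //; exact: ballxx.
move=> F FK cov.
have isB x : is_ball (B x) by exact: is_ball_ball.
have B0 x : B x !=set0 by exists x; exact: ballxx.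
have [D [uD DF tD cD]] := vitali_lemma_finite_cover isB B0 (finmap.enum_fset F).
have DK x : x \in D -> K' x by move=> /DF xF; have := FK x xF; rewrite inE.
have mB x : measurable (B x : set T) by exact: measurable_ball.
have mB3 x : measurable (ball x (3 * s x) : set T) by exact: measurable_ball.
have cov3 : K' `<=` \big[setU/set0]_(x <- D) (ball x (3 * s x) : set R).
  move=> x /cov[i /= iF Bix].
  have [|j Dj] := cD x; first by exists i.
  rewrite /= /B scale_ballE// => h.
  by rewrite -bigcup_seq; exists j.
have mU : measurable (U : set T) by exact: open_measurable.
have l1 : (om K' <= \sum_(x <- D) om (ball x (3 * s x)))%E.
  apply: le_trans (measure_bigsetU_le om D mB3).
  by apply: le_measure; rewrite ?inE//; exact: bigsetU_measurable.
have l2 : (\sum_(x <- D) om (ball x (3 * s x)) <= \sum_(x <- D) ((9 * C)%:E * rho (B x) + (eta * s x)%:E))%E.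
  rewrite big_seq [leRHS]big_seq; apply: lee_sum => x xD.
  by have [_ /(_ (DK x xD))[]] := sPs x.
have C90 : 0 <= 9 * C by rewrite mulr_ge0// ltW.
have l3 : (\sum_(x <- D) ((9 * C)%:E * rho (B x) + (eta * s x)%:E) =
   (9 * C)%:E * (\sum_(x <- D) rho (B x)) + (eta * \sum_(x <- D) s x)%:E)%E.
  rewrite big_split/=; congr (_ + _)%E.
    by rewrite ge0_sume_distrr// => x _.
  by rewrite mulr_sumr sumEFin.
have l4 : (\sum_(x <- D) rho (B x) <= rho U)%E.
  apply: trivIset_sum_le => // x xD.
  by have [_ /(_ (DK x xD))[]] := sPs x.
have l5 : \sum_(x <- D) s x <= b + 2.
  have : (\sum_(x <- D) @lebesgue_measure R (B x) <= @lebesgue_measure R (ball (0%R : R) (b + 1)%R))%E.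
    apply: (@trivIset_sum_le R (@lebesgue_measure R)) => //; first exact: measurable_ball.
    move=> x xD y; have [_ /(_ (DK x xD))[s1 _ _]] := sPs x.
    have [ex _] := reg x (DK x xD).
    rewrite /B /ball /= sub0r normrN => h.
    have := eb ex; have := ler_distD x y 0; rewrite !subr0 distrC => h1 h2.
    by apply: le_lt_trans h1 _; lra.
  rewrite lebesgue_measure_ball ?addr_ge0//; last exact: ltW.
  rewrite (eq_bigr (fun x => (s x *+ 2)%:E)); last by move=> x _; rewrite /B lebesgue_measure_ball// ltW.
  rewrite sumEFin lee_fin sumrMnl; lra.
have fin1 : rho U \is a fin_num by exact: fin_num_measure.
have : (om K' <= (9 * C * eta + eta * (b + 2))%:E)%E.
  apply: le_trans l1 _; apply: le_trans l2 _; rewrite l3 EFinD; apply: leeD.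
    by rewrite (EFinM (9 * C) eta) lee_wpmul2l//; apply: le_trans l4 _.
  by rewrite lee_fin ler_pM2l.
have fK' : om K' \is a fin_num by exact: fin_num_measure.
rewrite -(fineK fK') lee_fin.
have -> : 9 * C * eta + eta * (b + 2) = m0 / 4 by rewrite /eta; field; rewrite gt_eqF.
lra.
Qed.

End AbsoluteContinuity.

(** * Chebyshev polynomials *)

Section Chebyshev.
Variable S : comNzRingType.
Implicit Types (x y : S).

(* Homogeneous Chebyshev polynomials: [cheb k (y * cos t) y = y ^ k * cos (k t)]. *)
Fixpoint cheb (k : nat) x y : S :=
  if k is k'.+1 then
    if k' is k''.+1 then 2 * x * cheb k' x y - y ^+ 2 * cheb k'' x y else x
  else 1.

Lemma chebSS k x y : cheb k.+2 x y = 2 * x * cheb k.+1 x y - y ^+ 2 * cheb k x y.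
Proof. by []. Qed.

Lemma nat_ind2 (P : nat -> Prop) : P 0%N -> P 1%N ->
  (forall k, P k -> P k.+1 -> P k.+2) -> forall k, P k.
Proof.
move=> P0 P1 PS k; suff: P k /\ P k.+1 by case.
by elim: k => [//|k [h1 h2]]; split => //; exact: PS.
Qed.

Lemma cheb_roots k x y l m : l + m = 2 * x -> l * m = y ^+ 2 ->
  2 * cheb k x y = l ^+ k + m ^+ k.
Proof.
move=> h1 h2; elim/nat_ind2: k => [||k IH1 IH2].
- by rewrite /= !expr0 mulr1.
- by rewrite /= !expr1.
by rewrite chebSS mulrBr mulrCA [X in _ - X]mulrCA IH1 IH2 -h1 -h2 !exprS; ring.
Qed.

End Chebyshev.

Section ChebyshevReal.
Context {R : realType}.
Implicit Types (x y : R).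

Lemma cheb_bound k x y : 0 < y -> `|x| <= y -> `|cheb k x y| <= y ^+ k.
Proof.
move=> yp xy; pose t := acos (x / y).
have y0 := ltW yp; have yn : y != 0 by rewrite gt_eqF.
have xy1 : -1 <= x / y <= 1.
  by rewrite -ler_norml normrM normfV (ger0_norm y0) ler_pdivrMr// mul1r.
have ct : cos t = x / y by rewrite acosK// in_itv.
have xE : x = y * cos t by rewrite ct mulrC divfK.
have -> : cheb k x y = y ^+ k * cos (k%:R * t).
  elim/nat_ind2: k => [||k IH1 IH2].
  - by rewrite /= expr0 mul0r cos0 mulr1.
  - by rewrite /= expr1 mul1r.
  rewrite chebSS IH1 IH2 xE.
  have E1 : k.+2%:R * t = k.+1%:R * t + t by rewrite -natr1; ring.
  have E2 : k%:R * t = k.+1%:R * t - t by rewrite -[k.+1%:R]natr1; ring.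
  by rewrite E1 E2 cosB cosD !exprS expr0; ring.
rewrite normrM normrX (ger0_norm y0) ler_piMr ?exprn_ge0//.
by rewrite ler_norml cos_geN1 cos_le1.
Qed.

Lemma cheb_upper k x y : `|cheb k x y| <= (2 * `|x| + `|y|) ^+ k.
Proof.
have X0 := normr_ge0 x; have Y0 := normr_ge0 y.
have B0 : 0 <= 2 * `|x| + `|y| by rewrite addr_ge0// mulr_ge0.
elim/nat_ind2: k => [||k IH1 IH2].
- by rewrite /= expr0 normr1.
- by rewrite /= expr1; lra.
rewrite chebSS; apply: le_trans (ler_normB _ _) _.
have -> : `|2 * x * cheb k.+1 x y| = 2 * `|x| * `|cheb k.+1 x y| by rewrite !normrM ger0_norm.
have -> : `|y ^+ 2 * cheb k x y| = `|y| ^+ 2 * `|cheb k x y| by rewrite normrM normrX.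
have h1 : 2 * `|x| * `|cheb k.+1 x y| <= 2 * `|x| * (2 * `|x| + `|y|) ^+ k.+1.
  by rewrite ler_wpM2l// mulr_ge0.
have h2 : `|y| ^+ 2 * `|cheb k x y| <= `|y| ^+ 2 * (2 * `|x| + `|y|) ^+ k.
  by rewrite ler_wpM2l// exprn_ge0.
apply: le_trans (lerD h1 h2) _; rewrite !exprS.
move: (_ ^+ k) (exprn_ge0 k B0) => B Bk {h1 h2 IH1 IH2}.
move: `|x| `|y| X0 Y0 {B0} => u v X0 Y0.
have : 0 <= 2 * u * v * B by rewrite !mulr_ge0.
have -> : (2 * u + v) * ((2 * u + v) * B) = 2 * u * ((2 * u + v) * B) + v * (v * v ^+ 0) * B + 2 * u * v * B by rewrite expr0; ring.
by rewrite lerDl.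
Qed.

(** By [cheb_roots] with the roots [x + d] and [x - d], where [d ^+ 2 = x ^+ 2 - y ^+ 2], twice the
    value is at least [(x + d) ^+ k], and [d >= x - |y|]. *)
Lemma cheb_lower k x y : `|y| <= x -> (2 * x - `|y|) ^+ k / 2 <= cheb k x y.
Proof.
move=> yx; have x0 : 0 <= x by apply: le_trans yx.
have y2 : y ^+ 2 <= x ^+ 2 by rewrite -real_normK ?num_real// lerXn2r ?nnegrE.
pose d := Num.sqrt (x ^+ 2 - y ^+ 2).
have d0 : 0 <= d := sqrtr_ge0 _.
have d2 : d ^+ 2 = x ^+ 2 - y ^+ 2 by rewrite sqr_sqrtr// subr_ge0.
have dx : d <= x.
  by rewrite -(ler_pXn2r (n := 2))// ?nnegrE// d2; have := sqr_ge0 y; lra.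
have xd : x - `|y| <= d.
  rewrite -(ler_pXn2r (n := 2))// ?nnegrE ?subr_ge0// d2 -(real_normK (num_real y)).
  have : 0 <= `|y| * (x - `|y|) by rewrite mulr_ge0// subr_ge0.
  by rewrite sqrrB !expr2; lra.
have h1 : (x + d) + (x - d) = 2 * x by ring.
have h2 : (x + d) * (x - d) = y ^+ 2 
  by rewrite mulrC -subr_sqr d2; ring.
have := cheb_roots k h1 h2 => E.
have : (2 * x - `|y|) ^+ k <= (x + d) ^+ k.
  by rewrite lerXn2r ?nnegrE; lra.
have : 0 <= (x - d) ^+ k by rewrite exprn_ge0// subr_ge0.
lra.
Qed.

Implicit Types (p q : {poly R}).

Lemma horner_cheb k p q x : (cheb k p q).[x] = cheb k p.[x] q.[x].
Proof.
elim/nat_ind2: k => [||k IH1 IH2] //; first by rewrite /= hornerC.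
rewrite !chebSS -IH1 -IH2 !expr2 hornerD hornerN !hornerM.
by rewrite -(polyC_natr R 2) hornerC.
Qed.

Lemma size_cheb k p q n : (size p <= n.+1)%N -> (size q <= n.+1)%N ->
  (size (cheb k p q) <= (k * n).+1)%N.
Proof.
move=> sp sq; elim/nat_ind2: k => [||k IH1 IH2].
- by rewrite /= size_poly1.
- by rewrite mul1n.
rewrite chebSS; apply: leq_trans (size_polyD _ _) _; rewrite geq_max size_polyN; apply/andP; split.
  apply: leq_trans (size_polyMleq _ _) _.
  have s2 : (size (2 * p)%R <= n.+1)%N.
    by rewrite -[2]/(2%:R) -polyC_natr mul_polyC (leq_trans (size_scale_leq _ _)).
  move: (leq_add s2 IH2); move: (_ + _)%N => m; rewrite !mulSn; lia.
apply: leq_trans (size_polyMleq _ _) _.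
have s2 : (size (q ^+ 2)%R <= (2 * n).+1)%N.
  by rewrite expr2; apply: leq_trans (size_polyMleq _ _) _; move: (leq_add sq sq); move: (_ + _)%N => m; lia.
move: (leq_add s2 IH1); move: (_ + size _)%N => m; rewrite !mulSn; lia.
Qed.

(** The power [2 ^+ k] is the gain of the Chebyshev polynomial at infinity; [q] has smaller degree
    and does not reach the leading coefficient. *)
Lemma lead_cheb k p q n : size p = n.+1 -> (size q <= n)%N ->
  size (cheb k.+1 p q) = (k.+1 * n).+1 /\
  lead_coef (cheb k.+1 p q) = 2 ^+ k * lead_coef p ^+ k.+1.
Proof.
move=> sp sq; have p0 : p != 0 by rewrite -size_poly_eq0 sp.
have n2 : (2 : R) != 0 by rewrite pnatr_eq0.
elim/nat_ind2: k => [||k [IH1 IH1'] [IH2 IH2']].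
- by rewrite /= mul1n expr0 mul1r expr1.
- have E : cheb 2 p q = 2%:P * (p * p) - q ^+ 2 by rewrite chebSS /= polyC_natr; ring.
  have s1 : size (2%:P * (p * p)) = (2 * n).+1 by rewrite size_Cmul// size_mul// sp; lia.
  have s2 : (size (- q ^+ 2) < size (2%:P * (p * p)%R)%R)%N.
    rewrite s1 size_polyN expr2 (leq_ltn_trans (size_polyMleq _ _))//.
    by move: (leq_add sq sq); move: (size q + _)%N => m; lia.
  rewrite E size_polyDl// lead_coefDl// s1; split => //.
  by rewrite !lead_coefM lead_coefC expr2 expr1.
have c0 : cheb k.+2 p q != 0 by rewrite -size_poly_eq0 IH2.
have E : cheb k.+3 p q = 2%:P * (p * cheb k.+2 p q) - q ^+ 2 * cheb k.+1 p q.
  by rewrite chebSS polyC_natr; ring.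
have s1 : size (2%:P * (p * cheb k.+2 p q)) = (k.+3 * n).+1.
  by rewrite size_Cmul// size_mul// sp IH2 !mulSn; lia.
have s2 : (size (- (q ^+ 2 * cheb k.+1 p q)) < size (2%:P * (p * cheb k.+2 p q))%R)%N.
  rewrite s1 size_polyN; apply: leq_ltn_trans (size_polyMleq _ _) _; rewrite IH1.
  have [->|q0] := eqVneq q 0; first by rewrite expr0n /= size_poly0 !mulSn; lia.
  have : (0 < size q)%N by rewrite size_poly_gt0.
  have s3 : (size (q ^+ 2)%R <= (size q + size q).-1)%N by rewrite expr2 size_polyMleq.
  move: s3 sq; rewrite !mulSn; move: (size (q ^+ 2)%R) (size q) => a c; lia.
rewrite E size_polyDl// lead_coefDl// s1; split => //.
by rewrite !lead_coefM lead_coefC IH2' !exprS; ring.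
Qed.

End ChebyshevReal.

(** * Polynomials as Perron tests *)

Section RealParts.
Context {R : realType}.
Implicit Types (P : {poly R[i]}) (p : {poly R}) (x : R).

Lemma horner_part (f : R[i] -> R) P x : f 0 = 0 -> (forall u v, f (u + v) = f u + f v) ->
  (forall u (c : R), f (u * (c%:C)%C) = f u * c) -> (map_poly f P).[x] = f P.[(x%:C)%C].
Proof.
move=> f0 fD fM; elim/poly_ind: P => [|P c IH]; first by rewrite /map_poly size_poly0 poly_def big_ord0 !horner0 f0.
rewrite !hornerE fD fM -IH.
have -> : map_poly f (P * 'X + c%:P) = map_poly f P * 'X + (f c)%:P.
  apply/polyP => i; rewrite coef_map_id0// !coefD !coefMX !coefC coef_map_id0// fD.
  by case: i => [|i] /=; rewrite ?f0.
by rewrite !hornerE.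
Qed.

(** On the line its modulus is at most that of [P], and it inherits the value 1 at a real point as
    well as monicity, so the extremal problem reduces to real polynomials. *)
Definition re_poly P := map_poly (@complex.Re R) P.
Definition im_poly P := map_poly (@complex.Im R) P.

Lemma horner_re_poly P x : (re_poly P).[x] = complex.Re P.[(x%:C)%C].
Proof. by apply: horner_part => // [[a b] [c d]|[a b] c] //=; rewrite mulr0 subr0. Qed.

Lemma horner_im_poly P x : (im_poly P).[x] = complex.Im P.[(x%:C)%C].
Proof. by apply: horner_part => // [[a b] [c d]|[a b] c] //=; rewrite mulr0 add0r. Qed.

Lemma poly_absE P x : poly_abs P x = Num.sqrt ((re_poly P).[x] ^+ 2 + (im_poly P).[x] ^+ 2).
Proof. by rewrite /poly_abs normc_def horner_re_poly horner_im_poly. Qed.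

Lemma re_poly_le P x : `|(re_poly P).[x]| <= poly_abs P x.
Proof. by rewrite poly_absE -sqrtr_sqr ler_wsqrtr// lerDl sqr_ge0. Qed.

Lemma im_poly_le P x : `|(im_poly P).[x]| <= poly_abs P x.
Proof. by rewrite poly_absE -sqrtr_sqr ler_wsqrtr// lerDr sqr_ge0. Qed.

Lemma real_minorant P : P != 0 -> exists2 p : {poly R}, p != 0 & forall x, `|p.[x]| <= poly_abs P x.
Proof.
move=> P0; have [E|h] := eqVneq (re_poly P) 0; last by exists (re_poly P) => // x; exact: re_poly_le.
have [E'|h] := eqVneq (im_poly P) 0; last by exists (im_poly P) => // x; exact: im_poly_le.
case/eqP: P0; apply/polyP => i; rewrite coef0.
have : (re_poly P)`_i = 0 by rewrite E coef0.
have : (im_poly P)`_i = 0 by rewrite E' coef0.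
by rewrite !coef_map_id0//; case: (P`_i) => a b /= -> ->.
Qed.

Lemma size_re_poly P : (size (re_poly P) <= size P)%N.
Proof. exact: size_poly. Qed.

Lemma re_poly_monic P : P \is monic -> re_poly P \is monic /\ size (re_poly P) = size P.
Proof.
move=> mP; have lP : P`_(size P).-1 = 1 by exact/eqP.
have sP : (0 < size P)%N by rewrite size_poly_gt0 monic_neq0.
have h : (re_poly P)`_(size P).-1 = 1 by rewrite coef_map_id0// lP.
have sE : size (re_poly P) = size P.
  apply/eqP; rewrite eqn_leq size_re_poly -(prednK sP) ltnNge; apply/negP => /leq_sizeP /(_ _ (leqnn _)).
  by rewrite h => /eqP; rewrite oner_eq0.
by split => //; rewrite monicE lead_coefE sE h.
Qed.

Definition normsq (u : R[i]) : R := complex.Re u ^+ 2 + complex.Im u ^+ 2.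

Lemma normsqM u v : normsq (u * v) = normsq u * normsq v.
Proof. by case: u v => a b [c d]; rewrite /normsq /=; ring. Qed.

Lemma normsq_ge0 u : 0 <= normsq u. Proof. by rewrite addr_ge0// sqr_ge0. Qed.

Lemma normsq_roots (r : seq R[i]) x :
  let s := [seq (complex.Re u, complex.Im u) | u <- r] in
  let N := normsq (\prod_(u <- r) ((x%:C)%C - u)) in
  (N == 0) = ((x, 0) \in s) /\ (N != 0 -> 2^-1 * ln N = slam s (x, 0)).
Proof.
elim: r => [|[a b] r IH] /=.
  by rewrite big_nil /normsq /= expr1n expr0n /= addr0 oner_eq0 slam_nil ln1 mulr0.
rewrite big_cons normsqM slam_cons in_cons mulf_eq0; move: IH => /= [IH1 IH2].
have E : normsq ((x%:C)%C - (a +i* b)%C) = (x - a) ^+ 2 + (0 - b) ^+ 2 by [].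
split.
  rewrite IH1 E; congr (_ || _); rewrite paddr_eq0 ?sqr_ge0// !sqrf_eq0 !subr_eq0.
  by rewrite xpair_eqE.
rewrite negb_or => /andP[h1 h2]; rewrite lnM ?posrE ?lt_def ?h1 ?h2 ?normsq_ge0//.
by rewrite mulrDr IH2// E /lam /= addr0.
Qed.

Lemma poly_slam p : p != 0 -> exists s : seq (plane R), size s = (size p).-1 /\
  forall x, (p.[x] == 0) = ((x, 0) \in s) /\
    (p.[x] != 0 -> ln `|p.[x]| = ln `|lead_coef p| + slam s (x, 0)).
Proof.
move=> p0; have [r rE] := closed_field_poly_normal (map_poly (real_complex R) p).
exists [seq (complex.Re u, complex.Im u) | u <- r].
have l0 : lead_coef p != 0 by rewrite lead_coef_eq0.
have lE : lead_coef (map_poly (real_complex R) p) = (lead_coef p)%:C%C by rewrite lead_coef_map.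
have lC0 : (lead_coef p)%:C%C != 0 by rewrite fmorph_eq0.
split.
  rewrite size_map -(size_map_poly (real_complex R)) rE size_scale ?lE//.
  by rewrite size_prod_XsubC.
move=> x; have [h1 h2] := normsq_roots r x.
set N := normsq _ in h1 h2.
have E : p.[x] ^+ 2 = lead_coef p ^+ 2 * N.
  have -> : p.[x] ^+ 2 = normsq (p.[x]%:C)%C by rewrite /normsq /= expr0n addr0.
  rewrite -horner_map rE lE hornerZ normsqM /normsq /= expr0n addr0; congr (_ * normsq _).
  rewrite horner_prod; apply: eq_bigr => u _; by rewrite hornerXsubC.
have pN : (p.[x] == 0) = (N == 0) by rewrite -sqrf_eq0 E mulf_eq0 sqrf_eq0 (negbTE l0).
split; first by rewrite pN.
rewrite pN => N0; rewrite -h2//.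
have NP : 0 < N by rewrite lt_def N0 normsq_ge0.
have : ln (`|p.[x]| ^+ 2) = ln (`|lead_coef p| ^+ 2 * N) by rewrite !real_normK ?num_real// E.
rewrite [RHS]lnM ?posrE ?exprn_gt0 ?normr_gt0//.
by rewrite !lnXn ?normr_gt0 ?pN//; lra.
Qed.

Lemma horner_continuous p : continuous (fun x => p.[x]).
Proof.
elim/poly_ind: p => [|p c IH] x.
  by rewrite (_ : (fun x => _) = fun=> 0); [exact: cvg_cst|apply/funext => t; rewrite horner0].
rewrite (_ : (fun x => _) = (fun x => p.[x] * x + c)); last by apply/funext => t; rewrite !hornerE.
by apply: cvgD; [apply: cvgM; [exact: IH|exact: cvg_id]|exact: cvg_cst].
Qed.

Definition root_prod (t : seq R) x := \prod_(a <- t) `|x - a|.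

(** The zeros on e are divided out one by one; the remaining polynomial has no zero on the compact
    set e and is bounded below there. *)
Lemma root_prod_minorant (e : set R) p : compact e -> p != 0 -> exists t, exists2 d, 0 < d &
  (forall a, a \in t -> e a) /\ forall x, e x -> d * root_prod t x <= `|p.[x]|.
Proof.
move=> cpt; have [n] := ubnP (size p); elim: n => // n IH in p *; rewrite ltnS => sp p0.
have [[a [ea pa]]|H] := pselect (exists a, e a /\ p.[a] = 0).
  have /factor_theorem[q qE] : root p a by apply/eqP.
  have q0 : q != 0 by apply: contraNneq p0 => q0; rewrite qE q0 mul0r.
  have sq : (size q < n)%N.
    apply: leq_trans sp; rewrite qE size_Mmonic ?monicXsubC// size_XsubC addn2 /=//.
  have [t [d d0 [te tP]]] := IH q sq q0.
  exists (a :: t), d => //; split => [c|x ex]; first by rewrite in_cons => /orP[/eqP ->//|/te].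
  rewrite qE hornerM hornerXsubC normrM /root_prod big_cons mulrCA mulrC.
  by rewrite ler_wpM2r// tP.
exists [::].
have [[x0 ex0]|ne] := pselect (e !=set0); last first.
  by exists 1 => //; split => // x ex; case: ne; exists x.
have c1 : {within e, continuous (fun x => `|p.[x]|)}.
  by apply: continuous_subspaceT => x; apply: cvg_norm; exact: horner_continuous.
have [|c ec cP] := compact_EVT_min _ cpt c1; first by exists x0.
have ec' : e c by rewrite inE in ec.
exists `|p.[c]|; first by rewrite normr_gt0; apply/eqP => pc; apply: H; exists c.
by split => // x ex; rewrite /root_prod big_nil mulr1; apply: cP; rewrite inE.
Qed.

End RealParts.

Section RootProducts.
Context {R : realType}.
Implicit Types (t : seq R) (x : R).

Definition line_pts t : seq (plane R) := [seq (a, 0) | a <- t].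

Lemma mem_line_pts t x : ((x, 0) \in line_pts t) = (x \in t).
Proof. by rewrite mem_map// => a c []. Qed.

Lemma root_prod_ge0 t x : 0 <= root_prod t x.
Proof. by apply: prodr_ge0. Qed.

Lemma root_prod_gt0 t x : x \notin t -> 0 < root_prod t x.
Proof.
move=> xt; rewrite lt_def root_prod_ge0 andbT prodf_seq_neq0; apply/allP => a at_ /=.
by rewrite normr_eq0 subr_eq0; apply: contraNneq xt => ->.
Qed.

Lemma ln_root_prod t x : x \notin t -> ln (root_prod t x) = slam (line_pts t) (x, 0).
Proof.
elim: t => [|a t IH]; first by rewrite /root_prod big_nil slam_nil ln1.
rewrite in_cons negb_or => /andP[xa xt]; rewrite /= slam_cons -IH// /root_prod big_cons.
have xa' : 0 < `|x - a| by rewrite normr_gt0 subr_eq0.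
rewrite lnM ?posrE//; last exact: root_prod_gt0.
congr (_ + _); rewrite /lam subrr expr0n /= !addr0 -real_normK ?num_real//.
by rewrite lnXn// -[X in _ * X]mulr_natl mulrA mulVf ?mul1r// pnatr_eq0.
Qed.

Lemma root_prod_continuous t : continuous (root_prod t).
Proof.
elim: t => [|a t IH] x.
  by rewrite (_ : root_prod _ = fun=> 1); [exact: cvg_cst|apply/funext => y; rewrite /root_prod big_nil].
rewrite (_ : root_prod _ = (fun y => `|y - a| * root_prod t y)); last first.
  by apply/funext => y; rewrite /root_prod big_cons.
apply: cvgM; last exact: IH.
by apply: cvg_norm; apply: cvgB; [exact: cvg_id|exact: cvg_cst].
Qed.

Lemma set_mem_cons (a : R) t : [set` a :: t] = [set a] `|` [set` t].
Proof.
apply/seteqP; split=> x /=; rewrite in_cons; first by case/orP => [/eqP|]; [left|right].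
by case=> [->|->]; rewrite ?eqxx ?orbT.
Qed.

Lemma measurable_mem t : measurable ([set` t] : set (measurableTypeR R)).
Proof.
elim: t => [|a t IH]; last by rewrite set_mem_cons; exact: measurableU.
by rewrite (_ : [set` _] = set0)//; apply/seteqP; split.
Qed.

End RootProducts.

Section AlmostEverywhereIntegrals.
Context {R : realType} (m : probability (measurableTypeR R) R).
Local Notation T := (measurableTypeR R).

Lemma le_integral_off (D N : set T) (f g : T -> R) : measurable D -> measurable N -> m N = 0%E ->
  m.-integrable D (EFin \o f) -> m.-integrable D (EFin \o g) ->
  (forall x, D x -> ~ N x -> f x <= g x) ->
  (\int[m]_(x in D) (f x)%:E <= \int[m]_(x in D) (g x)%:E)%E.
Proof.
move=> mD mN N0 iF iG fg.
rewrite (negligible_integral mN mD iF N0) (negligible_integral mN mD iG N0).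
have mDN : measurable (D `\` N) by exact: measurableD.
apply: (le_integral mDN).
- by apply: (integrableS mD) => //; exact: subDsetl.
- by apply: (integrableS mD) => //; exact: subDsetl.
by move=> x; rewrite inE => -[Dx Nx]; rewrite lee_fin fg.
Qed.

End AlmostEverywhereIntegrals.

(** * Polynomials against boundary data with logarithmic singularities *)

Section PerronPolynomial.
Context {R : realType}.
Local Notation T := (measurableTypeR R).
Variables (e : set R) (b : R) (rho om : probability T R) (p : ext_line R).
Hypotheses (cpt : compact e) (eb : forall x, e x -> `|x| <= b) (b0 : 0 < b).
Hypotheses (rhoP : is_equilibrium_measure e rho) (e_cap : (0 < capacity e)%E).
Hypotheses (omP : is_harmonic_measure e (sphere_of_line p) om).
Hypothesis pe : forall x, p = Some x -> ~ e x.

Let meas := meas_e cpt.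
Local Notation green := (green e rho).
Local Notation robin := (robin rho).

Variable t : seq R.
Hypothesis te : forall a, a \in t -> e a.

Lemma tl_om_fin a : e a -> (tl om 1 e (a, 0%R) < +oo)%E.
Proof.
move=> ea; have h := upot_om_le cpt eb b0 rhoP e_cap omP (pole_neq pe ea).
have : (upot e om a < +oo)%E by apply: le_lt_trans h _; rewrite ltry.
rewrite /upot; by case: (tl om 1 e (a, 0)) => [r _| |_] //; rewrite ltry.
Qed.

Lemma om_point a : e a -> om [set a] = 0%E.
Proof. by move=> ea; apply: (tl_fin_null cpt (y := 1) ea); rewrite expr1n; exact: tl_om_fin. Qed.

Lemma om_seq : om [set` t] = 0%E.
Proof.
elim: t te => [|a s IH] se; first by rewrite set_nil measure0.
rewrite set_mem_cons; apply/eqP; rewrite eq_le measure_ge0 andbT.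
have mS := measurable_mem s.
apply: le_trans (measureU2 _ _ _) _ => //.
have h1 : (om [set a] <= 0)%E by rewrite om_point//; apply: se; rewrite mem_head.
have h2 : (om [set` s] <= 0)%E.
  by rewrite IH// => c cs; apply: se; rewrite in_cons cs orbT.
by have := leeD h1 h2; rewrite adde0.
Qed.

(** Off [a] the integrand is at most [|lam 1|] plus the tail kernel with pole [a], and the tail of
    [om] at [a] is finite. *)
Lemma lam_point_integrable a : e a -> om.-integrable e (EFin \o (fun x => lam 0 (x - a) 0)).
Proof.
move=> ea.
have h : (tl om (1 ^+ 2) e (a, 0%R) < +oo)%E by rewrite expr1n; exact: tl_om_fin.
have iT := tl_integrable h.
have cL : {within e, continuous (fun x : R => `|lam 1 (x - a) 0|)}.
  apply: pt_within_cont => x ex; apply: for_comp; last exact: norm_continuous.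
  rewrite /lam; apply: forZ; apply: for_ln; first by rewrite ltr_wpDl// sqr_sum_ge0.
  by do 2 (apply: forD; last exact: forC); apply: forX; apply: forB; [exact: cvg_id|exact: forC].
have iL := within_continuous_integrable cpt om cL.
apply: (le_integrable meas _ _ (integrableD meas iL iT)).
  apply/measurable_EFinP; apply: measurable_funTS.
  apply: measurable_funM => //; apply: measurableT_comp => //.
  by do 2 (apply: measurable_funD => //); apply: measurable_funX; apply: measurable_funB.
move=> x ex /=; rewrite /tker expr1n sqrf_eq0 subr_eq0.
have [->|xa] := eqVneq a x.
  by rewrite addey// leey.
have u0 : 0 < (x - a) ^+ 2 by rewrite exprn_even_gt0//= subr_eq0 eq_sym.
rewrite -EFinD /= lee_fin /lam expr0n /= !addr0 -(sqrrN (a - x)) opprB.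
set u := _ ^+ 2 in u0 *.
have h1 : 0 <= ln (u + 1) by rewrite ln_ge0// lerDr ltW.
have h2 : ln u <= ln (u + 1) by rewrite ler_ln ?posrE// ?ltr_wpDr//; lra.
rewrite (ger0_norm (x := 2^-1 * ln (u + 1))) ?mulr_ge0//.
rewrite [leRHS]ger0_norm; last lra.
by rewrite ler_norml; lra.
Qed.

Lemma slam_integrable : om.-integrable e (EFin \o (fun x => slam (line_pts t) (x, 0))).
Proof.
elim: t te => [|a s IH] se.
  rewrite (_ : EFin \o _ = EFin \o cst 0); first exact: finite_measure_integrable_cst.
  by apply/funext => x /=; rewrite slam_nil.
have i1 : om.-integrable e (EFin \o (fun x => lam 0 (x - a) 0)).
  by apply: lam_point_integrable; apply: se; rewrite mem_head.
have i2 := IH (fun c cs => se c (mem_behead (s := a :: s) cs)).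
have := integrableD meas i1 i2; congr (om.-integrable _ _).
by apply/funext => x /=; rewrite slam_cons subrr EFinD.
Qed.

Lemma ln_root_prod_integrable : om.-integrable e (EFin \o (fun x => `|ln (root_prod t x)|)).
Proof.
have mp : measurable_fun (e : set T) (fun x => `|ln (root_prod t x)|).
  apply: measurable_funTS; apply: measurableT_comp => //; apply: measurableT_comp => //.
  by apply: continuous_measurable_fun; exact: root_prod_continuous.
have i := integrable_abse slam_integrable.
have mS := measurable_mem t.
have mS' : measurable (e `\` [set` t] : set T) by exact: measurableD.
apply/(negligible_integrable mS meas _ om_seq); first exact/measurable_EFinP.
have i' := integrableS meas mS' (@subDsetl _ e _) i.
apply: (eq_integrable mS' _ _ _ i') => x; rewrite inE => -[ex xt] /=.
by rewrite ln_root_prod//; apply/negP.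
Qed.

Variables (Q B : R -> R) (q0 : R).
Hypotheses (cQ : continuous Q) (cB : continuous B).
Hypotheses (q00 : 0 < q0) (Q0 : forall x, e x -> q0 <= Q x) (B0 : forall x, 0 <= B x).

Let f x := ln (Q x + B x / root_prod t x).

Lemma log_weight_bound : exists K, forall x, e x -> `|f x| <= K + `|ln (root_prod t x)|.
Proof.
have /compact_bounded[M [_ MP]] := continuous_compact (continuous_subspaceT cQ) cpt.
have /compact_bounded[N [_ NP]] := continuous_compact (continuous_subspaceT cB) cpt.
pose q1 := Num.max (M + 1) 1; pose b1 := Num.max (N + 1) 1.
have q11 : 1 <= q1 by rewrite le_max lexx orbT.
have b11 : 1 <= b1 by rewrite le_max lexx orbT.
exists (`|ln q0| + ln (q1 + b1)) => x ex.
have Qq : Q x <= q1.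
  apply: le_trans (ler_norm _) _; apply: MP; last by exists x.
  by rewrite /q1 lt_max ltrDl ltr01.
have Bb : B x <= b1.
  apply: le_trans (ler_norm _) _; apply: NP; last by exists x.
  by rewrite /b1 lt_max ltrDl ltr01.
have P0 := root_prod_ge0 t x; set Psi := root_prod t x in P0 *.
have S0 : 0 <= B x / Psi by rewrite divr_ge0// B0.
have l0 : ln q0 <= f x.
  by rewrite /f ler_ln ?posrE//; [have := Q0 ex; lra|rewrite ltr_wpDr// (lt_le_trans q00)// Q0].
have L0 : 0 <= ln (q1 + b1) by rewrite ln_ge0//; lra.
have l1 : f x <= ln (q1 + b1) + `|ln Psi|.
  have Y : Q x + B x / Psi <= (q1 + b1) * expR `|ln Psi|.
    have e1 : 1 <= expR `|ln Psi| by rewrite -expR0 ler_expR.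
    have e2 : Psi^-1 <= expR `|ln Psi|.
      have [P00|Pn] := eqVneq Psi 0; first by rewrite P00 invr0 expR_ge0.
      have Pp : 0 < Psi by rewrite lt_def Pn.
      rewrite -[leLHS]lnK ?posrE ?invr_gt0// ler_expR lnV ?posrE//.
      by apply: le_trans (ler_norm _) _; rewrite normrN.
    rewrite mulrDl lerD//.
      by apply: (le_trans Qq); rewrite ler_peMr//; lra.
    by apply: ler_pM => //; rewrite invr_ge0.
  rewrite -[X in _ + X]expRK -lnM ?posrE ?expR_gt0//; last lra.
  rewrite ler_ln ?posrE//; first by rewrite ltr_wpDr// (lt_le_trans q00)// Q0.
  by rewrite mulr_gt0 ?expR_gt0//; lra.
have n0 := normr_ge0 (ln q0); have n1 := normr_ge0 (ln Psi).
have := ler_norm (- ln q0); rewrite normrN => n2.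
by rewrite ler_norml; apply/andP; split; lra.
Qed.

Lemma log_weight_measurable : measurable_fun (e : set T) (f : T -> R).
Proof.
have mQ := subspace_continuous_measurable_fun meas (continuous_subspaceT cQ).
have mB := subspace_continuous_measurable_fun meas (continuous_subspaceT cB).
have mP : measurable_fun (e : set T) (root_prod t : T -> R).
  by apply: measurable_funTS; apply: continuous_measurable_fun; exact: root_prod_continuous.
apply: measurableT_comp => //; apply: measurable_funD => //; apply: measurable_funM => //.
rewrite (_ : (fun x => _) = (fun x => root_prod t x `^ (-1))); last first.
  by apply/funext => x; rewrite powR_inv1// root_prod_ge0.
by apply: (@measurableT_comp _ _ _ _ _ _ (fun y : R => y `^ (-1))) => //; exact: measurable_powR.
Qed.

Lemma log_weight_integrable : om.-integrable e (EFin \o f).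
Proof.
have [K KP] := log_weight_bound.
have iK := integrableD meas (finite_measure_integrable_cst om K meas) ln_root_prod_integrable.
apply: (le_integrable meas _ _ iK); first by apply/measurable_EFinP; exact: log_weight_measurable.
move=> x ex /=; rewrite lee_fin; apply: le_trans (KP x ex) _; exact: ler_norm.
Qed.

Variables (P : {poly R}) (k n : nat).
Hypotheses (k0 : (0 < k)%N) (P0 : P != 0) (sP : (size P <= (k * n).+1)%N).
Hypothesis PB : forall x, e x -> x \notin t -> `|P.[x]| <= (Q x + B x / root_prod t x) ^+ k.

(** The condition for [k^-1 ln |P| - n * green] to be finite at the pole: at infinity, [P] must have
    full degree. *)
Definition pole_ok : Prop := if p is Some x then P.[x] != 0 : Prop else size P = (k * n).+1.
Definition pole_val : R := if p is Some x then k%:R^-1 * ln `|P.[x]| - n%:R * green (x, 0)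
  else k%:R^-1 * ln `|lead_coef P| - n%:R * robin.

Lemma poly_bound : exists2 M, 1 <= M & forall x, e x -> `|P.[x]| <= M.
Proof.
have cP : {within e, continuous (fun x => P.[x])}.
  by apply: continuous_subspaceT; exact: horner_continuous.
have /compact_bounded[M [_ MP]] := continuous_compact cP cpt.
exists (Num.max (M + 1) 1); first by rewrite le_max lexx orbT.
move=> x ex; apply: MP; last by exists x.
by rewrite lt_max ltrDl ltr01.
Qed.

Lemma ln_root_prod_bound : exists2 L, 0 <= L & forall x, e x -> x \notin t -> ln (root_prod t x) <= L.
Proof.
have cP : {within e, continuous (root_prod t)}.
  by apply: continuous_subspaceT; exact: root_prod_continuous.
have /compact_bounded[M [_ MP]] := continuous_compact cP cpt.
exists (ln (Num.max (M + 1) 1)); first by rewrite ln_ge0// le_max lexx orbT.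
move=> x ex xt; rewrite ler_ln ?posrE ?root_prod_gt0// ?lt_max ?ltr01 ?orbT//.
apply: le_trans (ler_norm _) _; apply: MP; last by exists x.
by rewrite lt_max ltrDl ltr01.
Qed.

Section Damped.
Variables (s : seq (plane R)) (M L ep : R).
Hypothesis sE : forall x, (P.[x] == 0) = ((x, 0) \in s) /\
  (P.[x] != 0 -> ln `|P.[x]| = ln `|lead_coef P| + slam s (x, 0)).
Hypotheses (M1 : 1 <= M) (PM : forall x, e x -> `|P.[x]| <= M).
Hypotheses (L0 : 0 <= L) (PL : forall x, e x -> x \notin t -> ln (root_prod t x) <= L).
Hypotheses (ss : size s = (size P).-1) (ep0 : 0 < ep).

Let d : R := (size t)%:R.
Let c0 := k%:R^-1 * ln `|lead_coef P|.
(** The boundary function [f] is in general unbounded near the points of [t]. Multiplying the test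
    by [root_prod t ^ ep] makes it vanish there, so that the continuous [phi] can be its majorant;
    the extra multiple [ep * d] of [green] cancels the added growth at infinity. *)
Let lmono := log_mono e rho k%:R^-1 (- ep) (n%:R + ep * d) c0 s (line_pts t).
(* Where the root product is below this threshold, the damping term beats [ln M]. *)
Let thr := expR ((ln q0 - ln M) / ep).
Let phi x := ln (Num.max (Q x) q0 + B x / Num.max (root_prod t x) thr) + ep * L.

Let thr0 : 0 < thr. Proof. exact: expR_gt0. Qed.

Let max0 x : 0 < Num.max (root_prod t x) thr.
Proof. by rewrite lt_max thr0 orbT. Qed.

Let kp : 0 < (k%:R : R)^-1. Proof. by rewrite invr_gt0 ltr0n. Qed.

Lemma damped_cont : {within e, continuous phi}.
Proof.
apply: pt_within_cont => x ex; apply: forD; last exact: forC.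
apply: for_ln; first by rewrite ltr_wpDr ?divr_ge0// ?(ltW (max0 _))// lt_max q00 orbT.
apply: forD; first by apply: for_max; [exact: cQ|exact: forC].
apply: forM; first exact: cB.
apply: cvgV; first by rewrite gt_eqF.
by apply: for_max; [exact: root_prod_continuous|exact: forC].
Qed.

Lemma damped_ge x : e x -> ln q0 <= phi x.
Proof.
move=> ex; have h : 0 <= B x / Num.max (root_prod t x) thr by rewrite divr_ge0// ltW.
have h2 : 0 <= ep * L by rewrite mulr_ge0 ?(ltW ep0).
rewrite /phi (max_idPl (Q0 ex)) -[leLHS]addr0 lerD// ler_ln ?posrE//.
  by rewrite ler_wpDr// Q0.
by rewrite ltr_wpDr// (lt_le_trans q00 (Q0 ex)).
Qed.

Lemma damped_le x : x \notin t -> e x -> phi x <= f x + ep * L.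
Proof.
move=> xt ex; have Pp := root_prod_gt0 xt; have Qp := lt_le_trans q00 (Q0 ex).
rewrite /phi (max_idPl (Q0 ex)) /f lerD2r ler_ln ?posrE ?ltr_wpDr ?divr_ge0 ?(ltW (max0 _)) ?(ltW Pp)//.
by rewrite lerD2l ler_wpM2l// lef_pV2 ?posrE// le_max lexx.
Qed.

Lemma damped_poly_le x : e x -> x \notin t -> P.[x] != 0 ->
  k%:R^-1 * ln `|P.[x]| + ep * ln (root_prod t x) <= phi x.
Proof.
move=> ex xt Px; have Pp := root_prod_gt0 xt.
have P1 : 0 < `|P.[x]| by rewrite normr_gt0.
have [h|h] := leP thr (root_prod t x).
  rewrite /phi (max_idPl h) (max_idPl (Q0 ex)); apply: lerD; last by rewrite ler_pM2l// PL.
  have Qp : 0 < Q x + B x / root_prod t x.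
    by rewrite ltr_wpDr ?(lt_le_trans q00 (Q0 ex))// divr_ge0 ?B0// ltW.
  rewrite mulrC ler_pdivrMr ?ltr0n// mulr_natr -lnXn// ler_ln ?posrE ?exprn_gt0//.
  exact: PB.
apply: le_trans (damped_ge ex).
have M0 : 0 <= ln M by rewrite ln_ge0.
have h1 : k%:R^-1 * ln `|P.[x]| <= ln M.
  have h2 : ln `|P.[x]| <= ln M by rewrite ler_ln ?posrE ?PM// (lt_le_trans ltr01).
  apply: (@le_trans _ _ (k%:R^-1 * ln M)); first by rewrite ler_pM2l.
  by rewrite ler_piMl// invf_le1 ?ltr0n// ler1n.
have h2 : ep * ln (root_prod t x) <= ln q0 - ln M.
  rewrite -ler_pdivlMl// mulrC -[leRHS]expRK ler_ln ?posrE//; exact: ltW.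
lra.
Qed.

Lemma damped_boundary x : e x -> forall eta, 0 < eta -> near_sq (x, 0) (fun z => finite_domain e z ->
  ~ (set0 z) -> z \notin s -> lmono z <= phi x + eta).
Proof.
move=> ex eta eta0.
have N0 : 0 <= n%:R + ep * d by rewrite addr_ge0// mulr_ge0// ltW.
pose h z := c0 + k%:R^-1 * slam s z + ep * slam (line_pts t) z.
suff H : near_sq (x, 0) (fun z => finite_domain e z -> z \notin s -> h z <= phi x + eta).
  apply: near_sqW H => z H fz _ zs; apply: le_trans (H fz zs).
  rewrite /lmono /log_mono /h mulNr opprK gerBl mulr_ge0//; exact: (green_ge0 cpt eb rhoP e_cap).
have fpts z : finite_domain e z -> z \notin line_pts t.
  by move=> fz; apply/mapP => -[a at_ za]; apply: (fz a (te at_)).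
have [xs|xs] := boolP ((x, 0) \in s).
  have [K HK] := slam_above (line_pts t) (x, 0).
  have := slam_small (k%:R * (ep * K + c0 - phi x - eta)) xs => HS.
  apply: near_sqW (near_sqI HK HS) => z [h1 h2] fz zs.
  have {}h2 : k%:R^-1 * slam s z <= - (ep * K + c0 - phi x - eta).
    by rewrite mulrC ler_pdivrMr ?ltr0n// mulNr mulrC; exact: h2.
  have {}h1 : ep * slam (line_pts t) z <= ep * K by rewrite ler_pM2l.
  by rewrite /h; lra.
have [xt|xt] := boolP (x \in t).
  have [K HK] := slam_above s (x, 0).
  have xt' : (x, 0) \in line_pts t by rewrite mem_line_pts.
  have := slam_small ((k%:R^-1 * K + c0 - phi x - eta) / ep) xt' => HS.
  apply: near_sqW (near_sqI HK HS) => z [h1 h2] fz zs.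
  have {}h2 : ep * slam (line_pts t) z <= - (k%:R^-1 * K + c0 - phi x - eta).
    by have := h2 (fpts z fz); rewrite -mulNr ler_pdivlMr// mulrC.
  have {}h1 : k%:R^-1 * slam s z <= k%:R^-1 * K by rewrite ler_pM2l.
  by rewrite /h; lra.
have xt' : (x, 0) \notin line_pts t by rewrite mem_line_pts.
have ch : {for (x, 0), continuous h}.
  apply: forD; last by apply: forZ; exact: expn_cont (expn_slam xt').
  by apply: forD; [exact: forC|apply: forZ; exact: expn_cont (expn_slam xs)].
have hx : h (x, 0) < phi x + eta.
  have [p1 p2] := sE x; rewrite -p1 in xs.
  have := damped_poly_le ex xt xs; rewrite (p2 xs) ln_root_prod// mulrDr /h /c0; lra.
by apply: near_sqW (near_sq_cont_lt ch hx) => z /ltW.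
Qed.

Let def0 : (n%:R + ep * d) + (- ep) * (size (line_pts t))%:R - k%:R^-1 * (size s)%:R
  = n%:R - k%:R^-1 * (size s)%:R.
Proof. by rewrite size_map mulNr addrK. Qed.

Let def_ge0 : 0 <= (n%:R + ep * d) + (- ep) * (size (line_pts t))%:R - k%:R^-1 * (size s)%:R.
Proof.
rewrite def0 subr_ge0 mulrC ler_pdivrMr ?ltr0n// -natrM ler_nat ss mulnC.
by rewrite -ltnS prednK// size_poly_gt0.
Qed.

Definition damped_shift : R := if p is Some x then slam (line_pts t) (x, 0) - d * green (x, 0)
  else - (d * robin).

Lemma damped_perron : pole_ok ->
  ((pole_val + ep * damped_shift)%:E <= \int[om]_(x in e) (phi x)%:E)%E.
Proof.
have Wr : forall z : plane R, set0 z -> z.1 ^+ 2 + z.2 ^+ 2 <= 0 by [].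
have fC x : e x -> - - ln q0 <= phi x by rewrite opprK; exact: damped_ge.
have domW z : finite_domain e z -> (z \notin line_pts t /\ near_sq z (fun w => ~ set0 w)) \/
    near_sq z (fun w => ~ set0 w -> w \notin s -> lmono w <= - - ln q0).
  move=> fz; left; split; last by exists 1 => // x y _ [].
  by apply/mapP => -[a at_ za]; apply: (fz a (te at_)).
move: omP pe; rewrite /pole_ok /pole_val /damped_shift; case: p => [x|] /= omP' pe' ok.
  have [h1 h2] := sE x.
  have xs : (x, 0) \notin s by rewrite -h1.
  have := perron_mono_fin cpt eb b0 rhoP e_cap kp def_ge0 Wr damped_cont fC domW damped_boundary omP' xs.
  move=> /(_ (fun F => F)); congr ((_ %:E <= _)%E).
  by rewrite /log_mono h2// /c0; ring.
have d0 : (n%:R + ep * d) + (- ep) * (size (line_pts t))%:R - k%:R^-1 * (size s)%:R = 0.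
  rewrite def0 ss ok /= natrM mulrA mulVf ?mul1r ?subrr// pnatr_eq0 -lt0n//.
have := perron_mono_infty cpt eb b0 rhoP e_cap kp def_ge0 Wr damped_cont fC domW damped_boundary omP' d0.
by congr ((_ %:E <= _)%E); rewrite /c0; ring.
Qed.

Lemma damped_integral_le : (\int[om]_(x in e) (phi x)%:E <= \int[om]_(x in e) (f x + ep * L)%:E)%E.
Proof.
apply: (le_integral_off meas (measurable_mem t) om_seq).
- exact: (within_continuous_integrable cpt om damped_cont).
- have := integrableD meas log_weight_integrable (finite_measure_integrable_cst om (ep * L) meas).
  by congr (om.-integrable _ _); apply/funext => x /=; rewrite EFinD.
by move=> x ex xt; apply: damped_le => //; apply/negP.
Qed.

End Damped.

(** The corrections in [damped_perron] and [damped_integral_le] are linear in [ep], which tends to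
    0. *)
Lemma perron_poly : pole_ok -> (pole_val%:E <= \int[om]_(x in e) (f x)%:E)%E.
Proof.
move=> ok; have iF := log_weight_integrable.
have [s [ss sE]] := poly_slam P0; have [M M1 PM] := poly_bound; have [L L0 PL] := ln_root_prod_bound.
have ifin := integrable_fin_num meas iF; rewrite -[leRHS]fineK//.
set I := fine _; rewrite lee_fin; apply/ler_addgt0Pr => eta eta0.
pose D := L - damped_shift; pose ep := eta / (`|D| + 1).
have D1 : 0 < `|D| + 1 by rewrite ltr_wpDl.
have ep0 : 0 < ep by rewrite divr_gt0.
have := le_trans (damped_perron sE M1 PM L0 PL ss ep0 ok) (damped_integral_le M L ep).
have -> : (\int[om]_(x in e) (f x + ep * L)%:E = (I + ep * L)%:E)%E.
  under eq_integral do rewrite EFinD.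
  rewrite (integralD meas iF (finite_measure_integrable_cst om (ep * L) meas)) EFinD /I fineK//.
  by congr (_ + _)%E; rewrite (integral_cst1 cpt _ (om_e omP)).
rewrite lee_fin => h.
have : ep * D <= eta.
  have : ep * D <= ep * (`|D| + 1) by rewrite ler_pM2l// (le_trans (ler_norm D))// lerDl.
  by rewrite /ep divfK ?gt_eqF.
by rewrite /D mulrBr; lra.
Qed.

End PerronPolynomial.

(** * Bernstein approximation *)

Section Bernstein.
Context {R : realType}.
Implicit Types (g h : nat -> R) (x c : R).

(* Evaluated at [x], the mean of [g] under the binomial law with parameters [n] and [x]. *)
Fixpoint bernstein (n : nat) g : {poly R} :=
  if n is n'.+1 then 'X * bernstein n' (g \o S) + (1 - 'X) * bernstein n' g
  else (g 0%N)%:P.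

Lemma bernsteinS n g x : (bernstein n.+1 g).[x] =
  x * (bernstein n (g \o S)).[x] + (1 - x) * (bernstein n g).[x].
Proof. by rewrite /= !hornerE. Qed.

Lemma bernstein_le n g h x : 0 <= x <= 1 -> (forall i, (i <= n)%N -> g i <= h i) ->
  (bernstein n g).[x] <= (bernstein n h).[x].
Proof.
move=> /andP[x0 x1]; elim: n => [|n IH] in g h *; first by move=> /(_ 0%N (leqnn _)); rewrite /= !hornerE.
move=> gh; rewrite !bernsteinS lerD// ler_wpM2l ?subr_ge0//; apply: IH => i ni; apply: gh => //.
exact: leqW.
Qed.

(** The second moment of the binomial law about [c] is squared bias plus variance; the recursion
    moves [c] by one. *)
Lemma bernstein_sq n (al be : R) c x : (bernstein n (fun i => al + be * (i%:R - c) ^+ 2)).[x] =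
  al + be * ((n%:R * x - c) ^+ 2 + n%:R * (x * (1 - x))).
Proof.
elim: n => [|n IH] in c *; first by rewrite /= !hornerE; ring.
rewrite bernsteinS IH.
have -> : (fun i : nat => al + be * (i%:R - c) ^+ 2) \o S = (fun i => al + be * (i%:R - (c - 1)) ^+ 2).
  by apply/funext => i /=; rewrite -natr1; ring.
by rewrite IH -natr1; ring.
Qed.

(** A linear modulus is majorized by a quadratic, [|u| <= d + u ^+ 2 / d], so that the second moment
    controls the error; [n >= d ^- 2] makes the variance term at most [L * d]. *)
Lemma bernstein_cvg (f : R -> R) (L eta : R) : 0 <= L -> 0 < eta ->
  (forall x y, 0 <= x <= 1 -> 0 <= y <= 1 -> `|f x - f y| <= L * `|x - y|) ->
  exists p : {poly R}, forall x, 0 <= x <= 1 -> `|p.[x] - f x| <= eta.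
Proof.
move=> L0 eta0 fL.
pose d := eta / (2 * (L + 1)).
have d0 : 0 < d by rewrite divr_gt0// mulr_gt0//; lra.
pose n := (Num.truncn (d ^- 2)).+1.
have n0 : 0 < n%:R :> R by rewrite ltr0n.
have nd : (n%:R * d ^+ 2)^-1 <= 1.
  have h : d ^- 2 < n%:R by exact: truncnS_gt.
  have d2 : 0 < d ^+ 2 by exact: exprn_gt0.
  have n2 : 0 < n%:R * d ^+ 2 by rewrite mulr_gt0.
  rewrite invf_le1//; apply: ltW.
  by have := h; rewrite -(ltr_pM2r d2) mulVf// gt_eqF.
exists (bernstein n (fun i => f (i%:R / n%:R))) => x x01; have /andP[x0 x1] := x01.
have key (i : nat) : (i <= n)%N -> `|f (i%:R / n%:R) - f x| <= L * d + L / (n%:R ^+ 2 * d) * (i%:R - n%:R * x) ^+ 2.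
  move=> ni; have i01 : 0 <= (i%:R / n%:R : R) <= 1.
    by rewrite divr_ge0 ?ler0n//= ler_pdivrMr// mul1r ler_nat.
  apply: le_trans (fL _ _ i01 x01) _.
  have -> : i%:R - n%:R * x = n%:R * (i%:R / n%:R - x) by field; rewrite gt_eqF.
  set u := _ / _ - x.
  have -> : L / (n%:R ^+ 2 * d) * (n%:R * u) ^+ 2 = L * (u ^+ 2 / d).
    by field; rewrite !gt_eqF.
  rewrite -mulrDr ler_wpM2l// -real_normK ?num_real//.
  have : 0 <= (`|u| - d) ^+ 2 by exact: sqr_ge0.
  have -> : d + `|u| ^+ 2 / d = (d ^+ 2 + `|u| ^+ 2) / d by field; rewrite gt_eqF.
  rewrite ler_pdivlMr// sqrrB -mulr_natl => h.
  have : 0 <= `|u| * d by rewrite mulr_ge0// ltW.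
  lra.
have xx : x * (1 - x) <= 1.
  by apply: le_trans (_ : 1 * (1 - x) <= _); [rewrite ler_wpM2r ?subr_ge0|rewrite mul1r gerBl].
have bnd : L * d + L / (n%:R ^+ 2 * d) * (n%:R * (x * (1 - x))) <= eta.
  have -> : L / (n%:R ^+ 2 * d) * (n%:R * (x * (1 - x))) = L * d * ((n%:R * d ^+ 2)^-1 * (x * (1 - x))).
    by field; rewrite !gt_eqF.
  have h1 : (n%:R * d ^+ 2)^-1 * (x * (1 - x)) <= 1.
    rewrite -[leRHS]mulr1; apply: ler_pM => //; last by rewrite mulr_ge0// subr_ge0.
    by rewrite invr_ge0 mulr_ge0 ?ltW// exprn_gt0.
  have h2 : L * d * ((n%:R * d ^+ 2)^-1 * (x * (1 - x))) <= L * d by rewrite ler_piMr// mulr_ge0// ltW.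
  have h3 : 2 * (L * d) <= eta.
    have -> : 2 * (L * d) = L / (L + 1) * eta by rewrite /d; field; rewrite gt_eqF//; lra.
    by rewrite ler_piMl ?(ltW eta0)// ler_pdivrMr ?mul1r; lra.
  lra.
have E s : (bernstein n (fun i => f x + s * L * d + s * (L / (n%:R ^+ 2 * d)) * (i%:R - n%:R * x) ^+ 2)).[x] =
    f x + s * (L * d + L / (n%:R ^+ 2 * d) * (n%:R * (x * (1 - x)))).
  by rewrite bernstein_sq subrr; ring.
rewrite ler_norml; apply/andP; split.
  rewrite lerBrDl; apply: le_trans (_ : (bernstein n (fun i => f x + (-1) * L * d + (-1) * (L / (n%:R ^+ 2 * d)) * (i%:R - n%:R * x) ^+ 2)).[x] <= _).
    by rewrite E; lra.
  by apply: bernstein_le => // i ni; have := key i ni; rewrite ler_norml => /andP[h _]; lra.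
rewrite lerBlDl; apply: le_trans (_ : (bernstein n (fun i => f x + 1 * L * d + 1 * (L / (n%:R ^+ 2 * d)) * (i%:R - n%:R * x) ^+ 2)).[x] <= _); last first.
  by rewrite E; lra.
by apply: bernstein_le => // i ni; have := key i ni; rewrite ler_norml => /andP[_ h]; lra.
Qed.

Lemma lipschitz_poly_approx (f : R -> R) (b L eta : R) : 0 < b -> 0 <= L -> 0 < eta ->
  (forall x y, `|x| <= b -> `|y| <= b -> `|f x - f y| <= L * `|x - y|) ->
  exists p : {poly R}, forall x, `|x| <= b -> `|p.[x] - f x| <= eta.
Proof.
move=> b0 L0 eta0 fL.
have b2 : 0 < 2 * b by rewrite mulr_gt0.
have bd s : 0 <= s <= 1 -> `|2 * b * s - b| <= b.
  move=> /andP[s0 s1]; have := mulr_ge0 (ltW b0) s0; have : 0 <= b * (1 - s) by rewrite mulr_ge0 ?(ltW b0)// subr_ge0.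
  by rewrite ler_norml => h1 h2; apply/andP; split; lra.
have Lb : 0 <= L * (2 * b) by rewrite mulr_ge0// ltW.
have [|p pP] := @bernstein_cvg (fun s => f (2 * b * s - b)) (L * (2 * b)) eta Lb eta0.
  move=> x y hx hy; apply: le_trans (fL _ _ (bd x hx) (bd y hy)) _.
  have -> : 2 * b * x - b - (2 * b * y - b) = 2 * b * (x - y) by ring.
  by rewrite [`|_ * (x - y)|]normrM (gtr0_norm b2) -mulrA.
exists (p \Po ((2 * b)^-1 *: ('X + b%:P))) => x xb.
rewrite horner_comp hornerZ hornerD hornerX hornerC.
have := pP ((2 * b)^-1 * (x + b)); have -> : 2 * b * ((2 * b)^-1 * (x + b)) - b = x by field; rewrite gt_eqF.
apply; move: xb; rewrite ler_norml => /andP[h1 h2]; apply/andP; split.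
  by rewrite mulr_ge0 ?invr_ge0 ?(ltW b2)//; lra.
by rewrite mulrC ler_pdivrMr// mul1r; lra.
Qed.

End Bernstein.

(** * Regularization of the weight *)

Section UpperSemicontinuous.
Context {R : realType}.
Local Notation T := (measurableTypeR R).
Variables (e : set R) (w : R -> R).
Hypotheses (cpt : compact e) (w_usc : usc_on e (fun x => (w x)%:E)).

Let ce : closed e. Proof. by apply: compact_closed cpt; exact: norm_hausdorff. Qed.

Lemma usc_closed c : closed [set x | e x /\ c <= w x].
Proof.
move=> x cx; have ex : e x by apply: ce => B /cx[y [[ey _] By]]; exists y.
split => //; rewrite leNgt; apply/negP => wc.
have /(_ _)[] := cx (fun y => e y -> ((w y)%:E < c%:E)%E).
  by apply: (w_usc ex); rewrite lte_fin.
by move=> y [[ey cy] /(_ ey)]; rewrite lte_fin ltNge cy.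
Qed.

Lemma usc_measurable : measurable_fun (e : set T) (w : T -> R).
Proof.
have me := closed_measurable ce.
apply: (measurability (@RGenCInfty.G R)); first exact: RGenCInfty.measurableE.
move=> _ [_ [r] -> <-].
rewrite (_ : _ `&` _ = [set x | e x /\ r <= w x]); first by apply: closed_measurable; exact: usc_closed.
by apply/seteqP; split => y /=; rewrite in_itv/= andbT.
Qed.

Lemma usc_bounded : exists W, forall x, e x -> w x <= W.
Proof.
have := cpt; rewrite compact_near_coveringP => H.
have := H R (pinfty_nbhs R) (fun W x => e x -> w x <= W) _ _ => {}H.
have [|M [_ MP]] := H; last by exists (M + 1) => x ex; apply: (MP (M + 1)); rewrite ?ltrDl.
move=> x ex; have Hx : \forall y \near x, e y -> w y < w x + 1.
  by have /(w_usc ex) : ((w x)%:E < (w x + 1)%:E)%E by rewrite lte_fin ltrDl.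
exists ([set y | e y -> w y < w x + 1], [set W | w x + 1 < W]) => /=.
  by split => //; exists (w x + 1); split; [exact: num_real|].
by move=> [y W] /= [h1 h2] ey; rewrite ltW// (lt_trans (h1 ey)).
Qed.

(** For [a < c] the weight is discontinuous at these points, and the sets with rational [a < c]
    contain every point of e where lower semicontinuity fails. *)
Definition usc_jump (a c : R) := [set x | e x /\ c <= w x] `&` closure [set y | e y /\ w y <= a].

Lemma usc_jump_compact a c : compact (usc_jump a c).
Proof.
apply: (subclosed_compact _ cpt); last by move=> x [[]].
by apply: closedI; [exact: usc_closed|exact: closed_closure].
Qed.

Lemma usc_jump_not_cont a c x : a < c -> usc_jump a c x -> ~ (w @ within e (nbhs x) --> w x).
Proof.
move=> ac [[ex cx] clx] /cvgr_gt /(_ a); rewrite (lt_le_trans ac cx) => /(_ isT) H.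
by have [y [[ey wy] /(_ ey)]] := clx _ H; rewrite ltNge wy.
Qed.

Lemma not_lsc_jump x c0 : e x -> c0 < w x -> ~ (\forall y \near within e (nbhs x), c0 < w y) ->
  exists q : rat * rat, q.1 < q.2 /\ usc_jump (ratr q.1) (ratr q.2) x.
Proof.
move=> ex cx H; have [a ] := rat_in_itvoo cx; rewrite in_itv/= => /andP[a1 a2].
have [c ] := rat_in_itvoo a2; rewrite in_itv/= => /andP[c1 c2].
exists (a, c); split; first by rewrite -(ltr_rat R).
split; first by split => //; exact: ltW.
move=> B Bx; apply: contrapT => H'; apply: H; apply: filterS Bx => y By ey.
rewrite ltNge; apply/negP => wy; apply: H'; exists y; split => //; split => //.
by rewrite (le_trans wy)// ltW.
Qed.

(** The jump sets with rational levels are compact and countably many; continuity makes them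
    [rho]-null and [cmp] makes them [om]-null. *)
Lemma usc_lsc_ae (rho om : probability T R) :
  (forall K, compact K -> K `<=` e -> rho K = 0%E -> om K = 0%E) ->
  {ae rho, forall x, e x -> w @ within e (nbhs x) --> w x} ->
  {ae om, forall x, e x -> forall c, c < w x -> \forall y \near within e (nbhs x), c < w y}.
Proof.
move=> cmp [N [mN N0 NP]].
pose F n : set T := if unpickle n is Some q then
  (if (q : rat * rat).1 < q.2 then usc_jump (ratr q.1) (ratr q.2) else set0) else set0.
have FN n : om.-negligible (F n).
  rewrite /F; case: unpickle => [[a c]|]; last exact: negligible_set0.
  case: ifPn => /= ac; last exact: negligible_set0.
  have cJ := @usc_jump_compact (ratr a) (ratr c).
  have clJ : closed (usc_jump (ratr a) (ratr c)) by apply: compact_closed cJ; exact: norm_hausdorff.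
  apply/negligibleP; first exact: closed_measurable.
  apply: cmp => //; first by move=> x [[]].
  apply/eqP; rewrite eq_le measure_ge0 andbT -N0; apply: le_measure; rewrite ?inE//.
    exact: closed_measurable.
  move=> x Jx; apply: NP => /= /(_ Jx.1.1); apply: usc_jump_not_cont Jx.
  by rewrite ltr_rat.
have := negligible_bigcup FN; apply: negligibleS => x /= /not_implyP[ex /existsNP[c /not_implyP[cx H]]].
have [q [q12 qJ]] := not_lsc_jump ex cx H.
exists (pickle q); first exact: I.
rewrite /F pickleK q12; exact: qJ.
Qed.

End UpperSemicontinuous.

Section LipschitzRegularization.
Context {R : realType}.
Variables (e : set R) (w : R -> R).
Hypotheses (ne : e !=set0) (w0 : forall x, e x -> 0 <= w x).
Implicit Types c x y : R.

(** The Pasch-Hausdorff envelope, the largest [c]-Lipschitz minorant of [w] on e. At points of lower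
    semicontinuity it increases to [w] with [c]. *)
Definition lip_reg c x : R := inf [set w y + c * `|x - y| | y in e].

Lemma lip_reg_has_inf c x : 0 <= c -> has_inf [set w y + c * `|x - y| | y in e].
Proof.
move=> c0; split; first by have [y ey] := ne; exists (w y + c * `|x - y|); exists y.
by exists 0 => _ [y ey <-]; rewrite addr_ge0 ?w0// mulr_ge0.
Qed.

Lemma lip_reg_le c x y : 0 <= c -> e y -> lip_reg c x <= w y + c * `|x - y|.
Proof. by move=> c0 ey; apply: ge_inf; [exact: (lip_reg_has_inf x c0).2|exists y]. Qed.

Lemma lip_reg_ge c x l : 0 <= c -> (forall y, e y -> l <= w y + c * `|x - y|) -> l <= lip_reg c x.
Proof.
move=> c0 H; apply: lb_le_inf; first exact: (lip_reg_has_inf x c0).1.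
by move=> _ [y ey <-]; exact: H.
Qed.

Lemma lip_reg_le_weight c x : 0 <= c -> e x -> lip_reg c x <= w x.
Proof. by move=> c0 ex; have := lip_reg_le x c0 ex; rewrite subrr normr0 mulr0 addr0. Qed.

Lemma lip_reg_lip c x y : 0 <= c -> `|lip_reg c x - lip_reg c y| <= c * `|x - y|.
Proof.
move=> c0; have H u v : lip_reg c u - lip_reg c v <= c * `|u - v|.
  rewrite lerBlDr addrC -lerBlDr; apply: lip_reg_ge => // s es.
  rewrite lerBlDr; apply: le_trans (lip_reg_le u c0 es) _.
  by rewrite -addrA lerD2l -mulrDr ler_wpM2l// [leRHS]addrC ler_distD.
by rewrite ler_norml H andbT lerNl opprB distrC H.
Qed.

Lemma lip_reg_minorant c x (A : R -> R) : 0 <= c -> e x -> (forall y, e y -> A y <= w y) ->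
  (forall y, e y -> A x - A y <= c * `|x - y|) -> A x <= lip_reg c x.
Proof.
move=> c0 ex Aw Ac; apply: lip_reg_ge => // y ey.
by have := Aw y ey; have := Ac y ey; lra.
Qed.

Lemma lip_reg_cvg x l : e x -> l < w x -> (\forall y \near within e (nbhs x), l < w y) ->
  exists2 c0, 0 <= c0 & forall c, c0 <= c -> l <= lip_reg c x.
Proof.
move=> ex lw /nbhs_ballP[d /= d0 dP].
exists (Num.max l 0 / d); first by rewrite divr_ge0 ?(ltW d0)// le_max lexx orbT.
move=> c h; have c0 : 0 <= c by apply: le_trans h; rewrite divr_ge0 ?(ltW d0)// le_max lexx orbT.
apply: lip_reg_ge => // y ey; have cxy : 0 <= c * `|x - y| by rewrite mulr_ge0.
have [xy|xy] := ltP `|x - y| d.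
  by have := dP y xy ey; lra.
have : l <= c * d by rewrite -ler_pdivrMr//; apply: le_trans h; rewrite ler_pM2r ?invr_gt0// le_max lexx.
have : c * d <= c * `|x - y| by rewrite ler_wpM2l.
by have := w0 ey; lra.
Qed.

Lemma lip_reg_continuous c : 0 <= c -> continuous (lip_reg c).
Proof.
move=> c0 x; apply/cvgrPdist_lt => eps eps0; have c1 : 0 < c + 1 by rewrite ltr_wpDl.
apply/nbhs_ballP; exists (eps / (c + 1)); first by rewrite /= divr_gt0.
move=> y; rewrite /ball /= ltr_pdivlMr// mulrC => xy; apply: le_lt_trans (lip_reg_lip x y c0) _.
by apply: le_lt_trans xy; rewrite ler_wpM2r// lerDl.
Qed.

Lemma poly_lipschitz (p : {poly R}) b : exists2 L, 0 <= L &
  forall x y, `|x| <= b -> `|y| <= b -> `|p.[x] - p.[y]| <= L * `|x - y|.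
Proof.
elim/poly_ind: p => [|p c [L L0 LP]].
  by exists 0 => // x y _ _; rewrite !horner0 subrr normr0 mul0r.
exists (L * `|b| + `|p.[0]| + L * `|b|); first by rewrite !addr_ge0// mulr_ge0.
move=> x y xb yb; rewrite !hornerE.
have b0 : 0 <= b by apply: le_trans xb.
have -> : p.[x] * x + c - (p.[y] * y + c) = (p.[x] - p.[y]) * x + p.[y] * (x - y) by ring.
apply: le_trans (ler_normD _ _) _; rewrite !normrM -addrA mulrDl; apply: lerD.
  rewrite mulrAC ler_pM// ?LP//; first exact: (le_trans xb (ler_norm _)).
rewrite ler_wpM2r//; have := LP y 0 yb; rewrite normr0 subr0 => /(_ b0) h.
have h2 : L * `|y| <= L * `|b| by rewrite ler_wpM2l// (le_trans yb)// ler_norm.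
by have := ler_normD (p.[y] - p.[0]) p.[0]; rewrite subrK; lra.
Qed.

End LipschitzRegularization.

(** * Polynomial approximation of the reciprocal weight *)

Section WeightTests.
Context {R : realType}.
Local Notation T := (measurableTypeR R).
Variables (e : set R) (b : R) (w : R -> R) (A : {poly R}) (t : seq R) (dl : R).
Hypotheses (cpt : compact e) (eb : forall x, e x -> `|x| <= b) (b0 : 0 < b) (ne : e !=set0).
Hypotheses (w_ge0 : forall x, e x -> 0 <= w x) (w_usc : usc_on e (fun x => (w x)%:E)).
Hypotheses (Aw : forall x, e x -> `|A.[x]| <= w x) (dl0 : 0 < dl).
Hypothesis tA : forall x, e x -> dl * root_prod t x <= `|A.[x]|.

Let meas := meas_e cpt.

Section Regularized.
Variables (c et : R) (Q : {poly R}).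
Hypotheses (c0 : 0 <= c) (et0 : 0 < et).
Hypothesis cA : forall x y, `|x| <= b -> `|y| <= b -> `|A.[x] - A.[y]| <= c * `|x - y|.

Local Notation F := (lip_reg e w c).
(** The floor [et] keeps the reciprocal bounded and Lipschitz; since [F <= w], it is at least
    [1 / w] wherever [F >= et]. *)
Definition inv_reg x : R := (Num.max (F x) et)^-1.

Lemma inv_reg_gt0 x : 0 < inv_reg x.
Proof. by rewrite invr_gt0 lt_max et0 orbT. Qed.

Lemma inv_reg_approx : exists q : {poly R}, forall x, `|x| <= b -> inv_reg x <= q.[x] <= inv_reg x + et.
Proof.
have e2 : 0 < et / 2 by rewrite divr_gt0.
have ce : 0 <= c / et ^+ 2 by rewrite divr_ge0// exprn_ge0// ltW.
have [|q qP] := lipschitz_poly_approx (f := inv_reg) b0 ce e2.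
  move=> x y _ _; have := lip_reg_lip ne w_ge0 x y c0.
  rewrite /inv_reg; set u := F x; set v := F y => uv.
  have mx : et <= Num.max u et by rewrite le_max lexx orbT.
  have my : et <= Num.max v et by rewrite le_max lexx orbT.
  have mx0 := lt_le_trans et0 mx; have my0 := lt_le_trans et0 my.
  have h : `|Num.max u et - Num.max v et| <= `|u - v|.
    have := ler_norm (u - v); have := ler_norm (- (u - v)); rewrite normrN.
    move: `|u - v| => d; rewrite ler_norml.
    by case: (leP u et) => hu; case: (leP v et) => hv h1 h2; apply/andP; split; lra.
  have -> : (Num.max u et)^-1 - (Num.max v et)^-1 = (Num.max v et - Num.max u et) / (Num.max u et * Num.max v et).
    by field; rewrite !gt_eqF.
  rewrite normrM normfV (gtr0_norm (mulr_gt0 mx0 my0)) distrC mulrAC.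
  apply: ler_pM; [by []|by rewrite invr_ge0 ltW ?mulr_gt0|exact: le_trans h uv|].
  by rewrite lef_pV2 ?posrE ?mulr_gt0 ?exprn_gt0// expr2 ler_pM// ltW.
exists (q + (et / 2)%:P) => x xb; have := qP x xb; rewrite !hornerE ler_norml => /andP[h1 h2].
by apply/andP; split; lra.
Qed.

Hypothesis Qi : forall x, `|x| <= b -> inv_reg x <= Q.[x] <= inv_reg x + et.

(** Equal to 1 where [F <= et] and to 0 where [F >= 2 * et]: it marks the places where [Q] may fall
    below [1 / w]. There [cut_term / root_prod] stands in for [2 / w], since [dl * root_prod <= w];
    the 2 comes from [cheb_upper]. *)
Definition cutoff x : R := Num.min 1 (Num.max 0 (2 - F x / et)).
Definition cut_term x : R := 2 * cutoff x / dl.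

Lemma cutoff_ge0 x : 0 <= cutoff x.
Proof. by rewrite le_min ler01 le_max lexx. Qed.

Lemma cutoff_le1 x : cutoff x <= 1.
Proof. by rewrite ge_min lexx. Qed.

Lemma cut_term_ge0 x : 0 <= cut_term x.
Proof. by rewrite divr_ge0 ?(ltW dl0)// mulr_ge0// cutoff_ge0. Qed.

Lemma cut_term_continuous : continuous cut_term.
Proof.
have cF := lip_reg_continuous ne w_ge0 c0.
move=> x; apply: (@forM R R (fun y => 2 * cutoff y) (fun=> dl^-1)); last exact: forC.
apply: forZ; apply: (@continuous_min R R (fun=> 1)); first exact: forC.
apply: for_max; first exact: forC.
by apply: forB; [exact: forC|apply: forM; [exact: cF|exact: forC]].
Qed.

Lemma root_prod_lt_weight x : e x -> x \notin t -> 0 < dl * root_prod t x <= F x.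
Proof.
move=> ex xt; rewrite mulr_gt0//=; last exact: root_prod_gt0.
apply: le_trans (tA ex) _; apply: (lip_reg_minorant ne w_ge0 c0 ex Aw) => y ey.
by apply: le_trans (lerB_dist _ _) _; apply: cA; exact: eb.
Qed.

Lemma weight_gt0 x : e x -> x \notin t -> 0 < w x.
Proof. by move=> ex xt; apply: lt_le_trans (Aw ex); apply: lt_le_trans (tA ex); rewrite mulr_gt0// root_prod_gt0. Qed.

(** Where [et <= F] one has [|u| <= 1 / w <= Q] and [cheb_bound] applies; elsewhere the cutoff is 1
    and [2 |u|] is absorbed by the term with [root_prod]. *)
Lemma cheb_test k u x : e x -> x \notin t -> `|u| * w x <= 1 ->
  `|cheb k u Q.[x]| <= (Q.[x] + cut_term x / root_prod t x) ^+ k.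
Proof.
move=> ex xt uw; have Pp := root_prod_gt0 xt; have wp := weight_gt0 ex xt.
have Fw := lip_reg_le_weight ne w_ge0 c0 ex.
have /andP[Qg _] := Qi (eb ex); have Qp := lt_le_trans (inv_reg_gt0 x) Qg.
have B0 : 0 <= cut_term x / root_prod t x by rewrite divr_ge0 ?cut_term_ge0// ltW.
have uw' : `|u| <= (w x)^-1 by rewrite -ler_pdivlMr// in uw; rewrite -[X in _ <= X]mul1r.
have [h|h] := leP et (F x).
  have uQ : `|u| <= Q.[x].
    apply: le_trans uw' _; apply: le_trans Qg; rewrite /inv_reg (max_idPl h) lef_pV2 ?posrE//.
    exact: lt_le_trans h.
  apply: le_trans (cheb_bound k Qp uQ) _.
  by rewrite lerXn2r ?nnegrE ?addr_ge0 ?(ltW Qp)// lerDl.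
apply: le_trans (cheb_upper k u _) _.
have S1 : 0 <= 2 * `|u| + `|Q.[x]| by rewrite addr_ge0// mulr_ge0.
have S2 : 0 <= Q.[x] + cut_term x / root_prod t x by rewrite addr_ge0// ltW.
rewrite lerXn2r ?nnegrE// [`|Q.[x]|]gtr0_norm// addrC lerD2l.
have -> : cut_term x = 2 / dl.
  rewrite /cut_term /cutoff (min_idPl _) ?mulr1// le_max; apply/orP; right.
  have : F x / et <= 1 by rewrite ler_pdivrMr// mul1r ltW.
  by lra.
rewrite -mulrA -invfM ler_pM2l//; apply: le_trans uw' _.
have /andP[d1 d2] := root_prod_lt_weight ex xt.
by rewrite lef_pV2 ?posrE// (le_trans d2).
Qed.

Definition log_test_fun x : R := ln (Q.[x] + cut_term x / root_prod t x).

(** The bound is independent of [c], [et] and [Q]: it is the dominating function in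
    [weight_tests]. *)
Lemma log_test_fun_bound W x : et <= 1 -> (forall y, e y -> w y <= W) -> e x -> x \notin t ->
  `|log_test_fun x| <= ln (W + 1) + ln (1 + 3 / dl) + `|ln (root_prod t x)|.
Proof.
move=> et1 wW ex xt; have Pp := root_prod_gt0 xt; have wp := weight_gt0 ex xt.
have Fw := lip_reg_le_weight ne w_ge0 c0 ex.
have /andP[Qg Qe] := Qi (eb ex); have Qp := lt_le_trans (inv_reg_gt0 x) Qg.
have B0 : 0 <= cut_term x / root_prod t x by rewrite divr_ge0 ?cut_term_ge0// ltW.
have W0 : 0 < W by apply: lt_le_trans (wW x ex).
have l1 : 0 <= ln (W + 1) by rewrite ln_ge0//; lra.
have d3 : 0 <= 3 / dl by rewrite divr_ge0// ltW.
have l2 : 0 <= ln (1 + 3 / dl) by rewrite ln_ge0// lerDl.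
have l3 := normr_ge0 (ln (root_prod t x)).
have lo : - ln (W + 1) <= log_test_fun x.
  have W1 : 0 < W + 1 by lra.
  have QB : 0 < Q.[x] + cut_term x / root_prod t x by rewrite ltr_wpDr.
  rewrite -lnV ?posrE// ler_ln ?posrE ?invr_gt0//.
  have : (W + 1)^-1 <= inv_reg x.
    rewrite lef_pV2 ?posrE ?ltr_wpDl ?(ltW W0)// ?lt_max ?et0 ?orbT// ge_max; apply/andP; split; last by lra.
    by have := wW x ex; lra.
  lra.
have hi : log_test_fun x <= ln (1 + 3 / dl) + `|ln (root_prod t x)|.
  have e1 : 1 <= expR `|ln (root_prod t x)| by rewrite -expR0 ler_expR.
  have e2 : (root_prod t x)^-1 <= expR `|ln (root_prod t x)|.
    rewrite -[leLHS]lnK ?posrE ?invr_gt0// ler_expR lnV ?posrE//.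
    by apply: le_trans (ler_norm _) _; rewrite normrN.
  have /andP[q1 q2] := root_prod_lt_weight ex xt.
  have h1 : inv_reg x <= dl^-1 / root_prod t x.
    by rewrite -invfM lef_pV2 ?posrE// ?lt_max ?et0 ?orbT// le_max q2.
  have h2 : cut_term x / root_prod t x <= 2 / dl / root_prod t x.
    rewrite ler_pM2r ?invr_gt0// ler_pM2r ?invr_gt0//.
    by have := cutoff_le1 x; lra.
  have h3 : Q.[x] + cut_term x / root_prod t x <= (1 + 3 / dl) * expR `|ln (root_prod t x)|.
    have : 3 / dl / root_prod t x <= 3 / dl * expR `|ln (root_prod t x)| by rewrite ler_wpM2l.
    have -> : 3 / dl / root_prod t x = dl^-1 / root_prod t x + 2 / dl / root_prod t x by ring.
    by rewrite mulrDl; lra.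
  rewrite -[X in _ + X]expRK -lnM ?posrE ?expR_gt0 ?ltr_wpDr//.
  by rewrite ler_ln ?posrE ?mulr_gt0 ?expR_gt0 ?ltr_wpDr.
by rewrite ler_norml; apply/andP; split; lra.
Qed.

End Regularized.

Variables (om : probability T R) (L : R).
Hypotheses (L0 : 0 <= L)
  (cL : forall x y, `|x| <= b -> `|y| <= b -> `|A.[x] - A.[y]| <= L * `|x - y|).
Hypotheses (ot : om [set` t] = 0%E) (it : om.-integrable e (EFin \o (fun x => `|ln (root_prod t x)|))).
Hypothesis lsc : {ae om, forall x, e x -> forall c, c < w x -> \forall y \near within e (nbhs x), c < w y}.

(** The slopes start at [L], so that [|A|] stays below every regularization by
    [lip_reg_minorant]. *)
Let cc (j : nat) : R := j%:R + L.
Let cc0 j : 0 <= cc j. Proof. by rewrite addr_ge0. Qed.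
Let et (j : nat) : R := harmonic j.
Let et0 j : 0 < et j. Proof. by rewrite /et /= invr_gt0. Qed.
Let et1 j : et j <= 1. Proof. by rewrite /et /= invf_le1// ler1n. Qed.
Let ccL j x y : `|x| <= b -> `|y| <= b -> `|A.[x] - A.[y]| <= cc j * `|x - y|.
Proof. by move=> xb yb; apply: le_trans (cL xb yb) _; rewrite ler_wpM2r// lerDr. Qed.

Lemma lip_reg_lim x : e x -> (forall c, c < w x -> \forall y \near within e (nbhs x), c < w y) ->
  (fun j => lip_reg e w (cc j) x) @ \oo --> w x.
Proof.
move=> ex lx; apply/cvgrPdist_le => ep ep0.
have lw : w x - ep < w x by rewrite gtrBl.
have [c0 c00 cP] := lip_reg_cvg ne w_ge0 ex lw (lx _ lw).
near=> j.
have h : w x - ep <= lip_reg e w (cc j) x.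
  apply: cP; apply: (@le_trans _ _ j%:R); last by rewrite lerDl.
  by near: j; exact: nbhs_infty_ger.
have := lip_reg_le_weight ne w_ge0 (cc0 j) ex => h'.
by rewrite ger0_norm; lra.
Unshelve. all: by end_near. Qed.

Lemma log_test_fun_lim (Q : nat -> {poly R}) x : e x -> x \notin t ->
  (forall j x, `|x| <= b -> inv_reg (cc j) (et j) x <= (Q j).[x] <= inv_reg (cc j) (et j) x + et j) ->
  (forall c, c < w x -> \forall y \near within e (nbhs x), c < w y) ->
  (fun j => log_test_fun (cc j) (et j) (Q j) x) @ \oo --> - ln (w x).
Proof.
move=> ex xt QP lx; have wp := weight_gt0 ex xt.
have cF := lip_reg_lim ex lx.
have ce : et @ \oo --> 0 by exact: cvg_harmonic.
have cG : (fun j => inv_reg (cc j) (et j) x) @ \oo --> (w x)^-1.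
  apply: cvgV; first by rewrite gt_eqF.
  apply: cvg_trans (cF); apply: near_eq_cvg; near=> j.
  have h1 : w x / 2 < lip_reg e w (cc j) x.
    by near: j; apply: (cvgr_gt _ cF); rewrite ltr_pdivrMr// mulr_natr mulr2n ltrDl.
  have h2 : et j < w x / 4.
    by near: j; apply: (cvgr_lt _ ce); rewrite divr_gt0.
  by rewrite (max_idPl _)//; lra.
have cQ : (fun j => (Q j).[x]) @ \oo --> (w x)^-1.
  have cG' : (fun j => inv_reg (cc j) (et j) x + et j) @ \oo --> (w x)^-1.
    by rewrite -[X in _ --> X]addr0; exact: cvgD.
  by apply: (squeeze_cvgr _ cG cG'); near=> j; apply: QP; exact: eb.
have cB : (fun j => cut_term (cc j) (et j) x / root_prod t x) @ \oo --> 0.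
  apply: (@cvg_trans _ ((fun _ : nat => 0 : R) @ \oo)); last exact: cvg_cst.
  apply: near_eq_cvg; near=> j.
  have h1 : w x / 2 < lip_reg e w (cc j) x.
    by near: j; apply: (cvgr_gt _ cF); rewrite ltr_pdivrMr// mulr_natr mulr2n ltrDl.
  have h2 : et j < w x / 4.
    by near: j; apply: (cvgr_lt _ ce); rewrite divr_gt0.
  rewrite /cut_term /cutoff (max_idPl _) ?mulr0 ?(min_idPr _) ?mulr0 ?mul0r//.
  rewrite subr_le0 ler_pdivlMr//; lra.
rewrite -lnV ?posrE//; apply: continuous_cvg; first by apply: continuous_ln; rewrite invr_gt0.
by rewrite -[X in _ --> X]addr0; exact: cvgD.
Unshelve. all: by end_near. Qed.

Lemma lne_weight_measurable : measurable_fun (e : set T) (fun x => lne (w x)%:E).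
Proof.
have mw := usc_measurable cpt w_usc.
apply: measurable_fun_if => //.
- by apply: measurable_fun_ler => //.
- apply/measurable_EFinP; apply: measurableT_comp => //.
  by apply: measurable_funS mw => // x [].
Qed.

(** Dominated convergence: off an [om]-null set [w] is positive and lower semicontinuous, so the
    integrands tend to [- ln w], and their common bound is integrable by [it]. *)
Lemma weight_tests : exists (Q : nat -> {poly R}) (B : nat -> R -> R),
  [/\ forall j, continuous (B j) /\ (forall x, 0 <= B j x),
      exists2 q0, 0 < q0 & forall j x, e x -> q0 <= (Q j).[x],
      forall j k u x, e x -> x \notin t -> `|u| * w x <= 1 ->
        `|cheb k u (Q j).[x]| <= ((Q j).[x] + B j x / root_prod t x) ^+ k,
      om.-integrable e (fun x => lne (w x)%:E) &
      (fun j => \int[om]_(x in e) (ln ((Q j).[x] + B j x / root_prod t x))%:E)%E @ \oo -->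
        (- \int[om]_(x in e) lne (w x)%:E)%E].
Proof.
have [Q QP] := choice (fun j => inv_reg_approx (cc0 j) (et0 j)).
have [W wW] := usc_bounded cpt w_usc.
have mS := measurable_mem t.
exists Q, (fun j => cut_term (cc j) (et j)).
have cv : {ae om, forall x, e x -> (fun j => (log_test_fun (cc j) (et j) (Q j) x)%:E) @ \oo --> (- lne (w x)%:E)%E}.
  have nt : {ae om, forall x, x \notin t}.
    by exists [set` t]; split => // x /= /negP; rewrite negbK.
  have := negligibleU lsc nt; apply: negligibleS => x /= H; apply: contrapT => /not_orP[/contrapT lx /contrapT xt].
  apply: H => ex; have wp := weight_gt0 ex xt.
  rewrite /lne ifF; last by rewrite leNgt wp.
  rewrite -EFinN; apply: cvg_EFin; first exact: nearW.
  exact: log_test_fun_lim (lx ex).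
have W0 : 0 <= W by have [x ex] := ne; apply: le_trans (w_ge0 ex) (wW x ex).
have bnd : {ae om, forall x j, e x ->
    (`|(log_test_fun (cc j) (et j) (Q j) x)%:E| <= (ln (W + 1) + ln (1 + 3 / dl))%:E + (`|ln (root_prod t x)|)%:E)%E}.
  exists [set` t]; split => // x /= H; apply: contrapT => /negP xt; apply: H => j ex.
  rewrite -EFinD lee_fin /=.
  exact: (log_test_fun_bound (cc0 j) (et0 j) (@ccL j) (QP j) (et1 j) wW ex xt).
have iK := integrableD meas (finite_measure_integrable_cst om (ln (W + 1) + ln (1 + 3 / dl)) meas) it.
have mf j : measurable_fun (e : set T) (fun x => (log_test_fun (cc j) (et j) (Q j) x)%:E).
  apply/measurable_EFinP.
  have cQ : continuous (fun x => (Q j).[x]) by exact: horner_continuous.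
  have cB : continuous (cut_term (cc j) (et j)) by exact: cut_term_continuous.
  have H := log_weight_measurable cpt t cQ cB.
  exact: H.
have ml := lne_weight_measurable.
have mN : measurable_fun (e : set T) (fun x => (- lne (w x)%:E)%E) by exact: measurableT_comp.
have [iN _ lim] := dominated_convergence meas mf mN cv iK bnd.
have iL : om.-integrable e (fun x => lne (w x)%:E).
  by have := integrableN iN; congr (om.-integrable _ _); apply/funext => x /=; rewrite oppeK.
split=> [j|||//|].
- by split; [exact: cut_term_continuous|exact: cut_term_ge0].
- exists (W + 1)^-1; first by rewrite invr_gt0 ltr_wpDl.
  move=> j x ex; have /andP[h _] := QP j x (eb ex); apply: le_trans h.
  rewrite lef_pV2 ?posrE ?ltr_wpDl// ?lt_max ?et0 ?orbT// ge_max; apply/andP; split.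
    by have := lip_reg_le_weight ne w_ge0 (cc0 j) ex; have := wW x ex; lra.
  by have := et1 j; lra.
- by move=> j k u x ex xt uw; exact: (cheb_test (cc0 j) (et0 j) (@ccL j) (QP j) k ex xt uw).
by rewrite -integralN//; exact: integrable_add_def.
Qed.

End WeightTests.

(** * The lower bound *)

Section ChebyshevExtremal.
Context {R : realType}.

(* In the remaining case [Y] dominates [X] outright, hence the factor in front of [`|Y|]. *)
Lemma cheb_extremal k (X Y E : R) : (0 < k)%N -> 0 < X ->
  (cheb k X Y != 0 -> ln `|cheb k X Y| <= k%:R * E) ->
  2 * X <= 2 * `|Y| + expR (ln 2 / k%:R + E).
Proof.
move=> k0 X0 H; have kn : k%:R != 0 :> R by rewrite pnatr_eq0 -lt0n.
have [YX|XY] := leP `|Y| X; last first.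
  by have := expR_ge0 (ln 2 / k%:R + E); lra.
have h := cheb_lower k YX.
have d0 : 0 < 2 * X - `|Y| by lra.
have c0 : 0 < cheb k X Y by apply: lt_le_trans h; rewrite divr_gt0// exprn_gt0.
have := H; rewrite gt_eqF// gtr0_norm// => /(_ isT) h2.
have h3 : ln ((2 * X - `|Y|) ^+ k / 2) <= k%:R * E.
  by apply: le_trans h2; rewrite ler_ln ?posrE// divr_gt0// exprn_gt0.
rewrite ln_div ?posrE ?exprn_gt0// lnXn// in h3.
have h4 : ln (2 * X - `|Y|) <= ln 2 / k%:R + E.
  rewrite -(ler_pM2l (x := k%:R)) ?ltr0n// mulrDr mulrCA divff// mulr1 mulr_natl; lra.
have : 2 * X - `|Y| <= expR (ln 2 / k%:R + E) by rewrite -[leLHS]lnK ?posrE// ler_expR.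
by have := normr_ge0 Y; lra.
Qed.

End ChebyshevExtremal.

Section LowerBounds.
Context {R : realType}.
Local Notation T := (measurableTypeR R).
Variables (e : set R) (b : R) (rho om : probability T R) (p : ext_line R) (w : R -> R).
Hypotheses (cpt : compact e) (eb : forall x, e x -> `|x| <= b) (b0 : 0 < b).
Hypotheses (rhoP : is_equilibrium_measure e rho) (e_cap : (0 < capacity e)%E).
Hypotheses (omP : is_harmonic_measure e (sphere_of_line p) om).
Hypothesis pe : forall x, p = Some x -> ~ e x.
Hypothesis w_ge0 : forall x, e x -> 0 <= w x.
Variables (t : seq R) (Q : {poly R}) (B : R -> R) (q0 I : R) (k : nat).
Hypotheses (te : forall a, a \in t -> e a) (k0 : (0 < k)%N).
Hypotheses (cB : continuous B) (B0 : forall x, 0 <= B x) (q00 : 0 < q0).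
Hypothesis Q0 : forall x, e x -> q0 <= Q.[x].
Hypothesis Qc : forall k u x, e x -> x \notin t -> `|u| * w x <= 1 ->
  `|cheb k u Q.[x]| <= (Q.[x] + B x / root_prod t x) ^+ k.
Hypothesis II : (\int[om]_(x in e) (ln (Q.[x] + B x / root_prod t x))%:E <= I%:E)%E.

Definition pole_size : R := if p is Some x then `|Q.[x]| else 0.
Definition pole_polys n : set {poly R[i]} := if p is Some x then residual_polys x n else monic_polys n.

(** [perron_poly] is applied to the Chebyshev polynomial [C] of [re_poly P / M] and [Q]. At a finite
    pole its value is [cheb k M^-1 Q.[x]]; at infinity [Q] has lower degree and the leading
    coefficient decides. *)
Lemma norm_lower_bound n P M : (size Q <= n)%N -> pole_polys n P -> 0 < M ->
  (forall x, e x -> w x * poly_abs P x <= M) ->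
  2 <= M * (2 * pole_size + expR (ln 2 / k%:R + (n%:R * pole_cst e rho p + I))).
Proof.
move=> sQ PP M0 PM.
pose q := M^-1 *: re_poly P; pose C := cheb k q Q.
have Mi : 0 < M^-1 by rewrite invr_gt0.
have sP : (size P <= n.+1)%N.
  by move: PP; rewrite /pole_polys; case: p => [x|] /= [] // _ ->.
have sq : (size q <= n.+1)%N by rewrite (leq_trans (size_scale_leq _ _))// (leq_trans (size_re_poly P)).
have sC : (size C <= (k * n).+1)%N by apply: size_cheb => //; exact: leqW.
have CB x : e x -> x \notin t -> `|C.[x]| <= (Q.[x] + B x / root_prod t x) ^+ k.
  move=> ex xt; rewrite horner_cheb; apply: Qc => //.
  rewrite hornerZ normrM gtr0_norm// -mulrA mulrC ler_pdivrMr// mul1r mulrC.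
  by apply: le_trans (PM x ex); rewrite ler_wpM2l ?w_ge0// re_poly_le.
have cQ : continuous (fun x => Q.[x]) by exact: horner_continuous.
have K0 : 0 < k%:R :> R by rewrite ltr0n.
have main : C != 0 -> pole_ok p C k n -> pole_val e rho p C k n <= I.
  move=> C0 ok; rewrite -lee_fin; apply: le_trans II.
  exact: (perron_poly cpt eb b0 rhoP e_cap omP pe te cQ cB q00 Q0 B0 k0 C0 sC CB ok).
suff H : 2 * M^-1 <= 2 * pole_size + expR (ln 2 / k%:R + (n%:R * pole_cst e rho p + I)).
  by rewrite mulrC -ler_pdivrMr.
rewrite /pole_size /pole_cst; move: PP main; rewrite /pole_polys /pole_ok /pole_val.
case: p => [x [_ P1]|[mP sP']] main.
  apply: (@cheb_extremal R k M^-1 Q.[x] _ k0 Mi).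
  have -> : cheb k M^-1 Q.[x] = C.[x].
    by rewrite horner_cheb hornerZ horner_re_poly P1 mulr1.
  move=> Cx; have C0 : C != 0 by apply: contraNneq Cx => ->; rewrite horner0.
  have := main C0 Cx; rewrite lerBlDr mulrC ler_pdivrMr// mulrC => h.
  by rewrite addrC.
have [mr sr] := re_poly_monic mP.
have sq' : size q = n.+1 by rewrite size_scale ?gt_eqF// sr.
(* The leading coefficient carries [2 ^+ k'] with [k' = k - 1]; the missing factor 2 is the term
   [ln 2 / k] of the conclusion. *)
case: (k) k0 @C main K0 sC CB => // k' _ C main K0 sC CB.
have [sC' lC] := lead_cheb k' sq' sQ.
have C0 : C != 0 by rewrite -size_poly_gt0 sC'.
have lq : lead_coef q = M^-1 by rewrite lead_coefZ (eqP mr) mulr1.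
have := main C0 sC'; rewrite /C lC lq gtr0_norm; last by rewrite mulr_gt0 ?exprn_gt0.
rewrite lnM ?posrE ?exprn_gt0// !lnXn// -[ln 2 *+ _]mulr_natl -[ln M^-1 *+ _]mulr_natl.
rewrite mulrDr [X in _ + X - _]mulrA mulVf ?gt_eqF// mul1r => h.
rewrite mulr0 add0r -[leLHS]lnK ?posrE ?mulr_gt0// ler_expR lnM ?posrE//.
have -> : ln 2 / k'.+1%:R = ln 2 - k'.+1%:R^-1 * (k'%:R * ln 2) :> R.
  have : k'.+1%:R != 0 :> R by rewrite gt_eqF.
  by rewrite -natr1 => hk; field.
by move: h; move: (_^-1 * (_ * _)) (n%:R * _) (ln M^-1) => u v s; lra.
Qed.

End LowerBounds.

Section LimInf.
Context {R : realType}.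

Lemma le_limn_einf (u : nat -> \bar R) l : (\forall n \near \oo, (l <= u n)%E) -> (l <= limn_einf u)%E.
Proof.
move=> [N _ H]; rewrite limn_einf_lim; apply: lime_ge; first exact: is_cvg_einfs.
exists N => // n /= Nn; apply/ereal_infP => _ [m /= nm <-].
by apply: H => /=; exact: leq_trans nm.
Qed.

(** If the supremum were below [M0], the midpoint between the two would be an admissible bound,
    positive even when the supremum is 0. *)
Lemma sup_norm_ge (e : set R) (f : R -> R) (M0 : R) : e !=set0 -> (forall x, e x -> 0 <= f x) ->
  (forall M, 0 < M -> (forall x, e x -> f x <= M) -> M0 <= M) ->
  (M0%:E <= ereal_sup [set (f x)%:E | x in e])%E.
Proof.
move=> [x0 ex0] f0 H; rewrite leNgt; apply/negP => lt.
set s := ereal_sup _ in lt.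
have s_ub x : e x -> ((f x)%:E <= s)%E by move=> ex; apply: ereal_sup_ubound; exists x.
have s0 : (0 <= s)%E by apply: le_trans (s_ub _ ex0); rewrite lee_fin f0.
move: s lt s_ub s0 => [s||]// lt s_ub s0; rewrite ?lte_fin ?lee_fin in lt s0.
have : M0 <= (s + M0) / 2.
  apply: H; first by rewrite divr_gt0//; lra.
  by move=> x /s_ub; rewrite lee_fin; lra.
by lra.
Qed.

End LimInf.

(** * Widom factors *)

Section WidomFactors.
Context {R : realType}.
Local Notation T := (measurableTypeR R).
Variables (e : set R) (b : R) (rho om : probability T R) (p : ext_line R) (w : R -> R) (g : plane R -> R).
Hypotheses (cpt : compact e) (eb : forall x, e x -> `|x| <= b) (b0 : 0 < b).
Hypotheses (rhoP : is_equilibrium_measure e rho) (e_cap : (0 < capacity e)%E).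
Hypotheses (omP : is_harmonic_measure e (sphere_of_line p) om).
Hypothesis pe : forall x, p = Some x -> ~ e x.
Hypothesis gP : is_green_function_infty e g.
Hypotheses (ne : e !=set0) (w_ge0 : forall x, e x -> 0 <= w x).
Local Notation h := (pole_cst e rho p).

(** At infinity the prefactor is exactly [exp (n * robin)] by [capacityE]; at a finite point
    [green_le_green_infty] gives the direction that a lower bound requires. *)
Lemma widom_factorE n : exists2 a, expR (n%:R * h) <= a &
  widom_factor e g w p n = (a%:E * ereal_inf [set weighted_norm e w P | P in pole_polys p n])%E.
Proof.
move: pe omP; rewrite /pole_cst /pole_polys; case: p => [x|] pe' omP'.
  exists (expR (n%:R * g (x, 0))) => //; rewrite ler_expR ler_wpM2l//.
  exact: (green_le_green_infty cpt eb b0 rhoP e_cap omP' (pe' x erefl) gP).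
exists (expR (n%:R * robin rho)) => //; rewrite /widom_factor (capacityE cpt eb rhoP e_cap).
by rewrite expRN exprVn invrK expRM_natl.
Qed.

Lemma widom_factor_ge n (l : R) : 0 < l ->
  (forall P M, pole_polys p n P -> 0 < M -> (forall x, e x -> w x * poly_abs P x <= M) ->
     l <= M * expR (n%:R * h)) ->
  (l%:E <= widom_factor e g w p n)%E.
Proof.
move=> l0 H; have [a ha ->] := widom_factorE n.
have a0 : 0 < a by apply: lt_le_trans ha; exact: expR_gt0.
have -> : l%:E = (a%:E * (l / a)%:E)%E by rewrite -EFinM mulrCA divff ?mulr1// gt_eqF.
apply: lee_wpmul2l; first by rewrite lee_fin ltW.
apply/ereal_infP => _ [P PP <-]; apply: sup_norm_ge => //.
  by move=> x ex; rewrite mulr_ge0 ?w_ge0// poly_absE sqrtr_ge0.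
move=> M M0 MP; rewrite ler_pdivrMr//; apply: le_trans (H P M PP M0 MP) _.
by rewrite ler_pM2l.
Qed.

Lemma pole_cst_gt0 : p <> None -> 0 < h.
Proof.
move: pe; rewrite /pole_cst; case: p => [x pe' _|//]; apply: (green_gt0 cpt eb rhoP e_cap); exact: pe'.
Qed.

(** At infinity [pole_size] is 0; otherwise the exponent is positive by [green_gt0] and the
    exponential outgrows any constant. *)
Lemma pole_decay (Q : {poly R}) (C tau : R) : 0 <= C -> 0 < tau ->
  \forall n \near \oo, C * pole_size p Q <= tau * expR (n%:R * h).
Proof.
move=> C0 tau0.
have [pn|pn] := pselect (p = None).
  by apply: nearW => n; rewrite /pole_size pn mulr0 mulr_ge0 ?expR_ge0// ltW.
have h0 := pole_cst_gt0 pn; near=> n.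
have H : C * pole_size p Q / (tau * h) <= n%:R by near: n; exact: nbhs_infty_ger.
rewrite ler_pdivrMr ?mulr_gt0// in H.
have E : n%:R * h <= expR (n%:R * h) by apply: le_trans (expR_ge1Dx _); rewrite lerDr.
apply: le_trans H _; rewrite mulrCA ler_pM2l//.
Unshelve. all: by end_near. Qed.

End WidomFactors.

Theorem theorem3p1 (R : realType) (e : set R) (xs : ext_line R) (w : R -> R)
    (rho om : probability (measurableTypeR R) R) (g : plane R -> R)
    (e_compact : compact e)
    (e_cap : (0 < capacity e)%E)
    (xs_notin : ~ (Some @` e) xs)
    (rhoP : is_equilibrium_measure e rho)
    (gP : is_green_function_infty e g)
    (omP : is_harmonic_measure e (sphere_of_line xs) om)
    (wP : is_weight e w)
    (w_cont : {ae rho, forall x, e x -> w @ within e (nbhs x) --> w x})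
    (w_ge : exists P : {poly R[i]},
       P != 0 /\ forall x, e x -> poly_abs P x <= w x) :
  (2%:E * szego_factor e w om <= limn_einf (widom_factor e g w xs))%E.
Proof.
have [w_ge0 w_usc _] := wP.
have pe x : xs = Some x -> ~ e x by move=> xsx ex; apply: xs_notin; exists x.
have ome : om e = 1%E := om_e omP.
have ne : e !=set0.
  apply/set0P/eqP => e0; move: ome; rewrite e0 measure0 => /eqP.
  by rewrite eqe eq_sym oner_eq0.
have [b b0 eb] : exists2 b, 0 < b & forall x, e x -> `|x| <= b.
  have [M [_ MP]] := compact_bounded e_compact; exists (Num.max (M + 1) 1); first by rewrite lt_max ltr01 orbT.
  by move=> x ex; apply: MP => //; rewrite lt_max ltrDl ltr01.
have [P [P0 Pw]] := w_ge; have [A A0 AP] := real_minorant P0.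
have Aw x : e x -> `|A.[x]| <= w x by move=> ex; apply: le_trans (AP x) (Pw x ex).
have [t [dl dl0 [te tA]]] := root_prod_minorant e_compact A0.
have [L L0 cL] := poly_lipschitz A b.
have lsc := usc_lsc_ae e_compact w_usc (om_null_compact e_compact eb b0 rhoP e_cap omP pe) w_cont.
have ot := om_seq e_compact eb b0 rhoP e_cap omP pe te.
have it := ln_root_prod_integrable e_compact eb b0 rhoP e_cap omP pe te.
have [Q [B [BP [q0 q00 Q0] Qc iw lim]]] := weight_tests e_compact eb b0 ne w_ge0 w_usc Aw dl0 tA L0 cL ot it lsc.
have jfin := integrable_fin_num (meas_e e_compact) iw.
rewrite /szego_factor; move: lim; rewrite -(fineK jfin); set J := fine _ => lim.
set h := pole_cst e rho xs.
have key (l : R) : 0 < l -> l < 2 * expR J -> (l%:E <= limn_einf (widom_factor e g w xs))%E.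
  (* The slack [d] is spent in thirds: on the integral for [Q j], on [ln 2 / k], and on the strict
     inequality [l * E < 2]. *)
  move=> l0 lJ; pose d := ln 2 + J - ln l.
  have d0 : 0 < d.
    by rewrite subr_gt0 -[X in _ < _ + X]expRK -lnM ?posrE ?expR_gt0// ltr_ln ?posrE// mulr_gt0 ?expR_gt0.
  have [j Ij] : exists j, (\int[om]_(x in e) (ln ((Q j).[x] + B j x / root_prod t x))%:E <= (- J + d / 3)%:E)%E.
    have lt : (- J%:E < (- J + d / 3)%:E)%E by rewrite -EFinN lte_fin ltrDl divr_gt0.
    have [N _ /(_ N (leqnn N)) /= H] := lim _ (open_ereal_lt_ereal lt).
    by exists N; exact: ltW.
  have [k k0 kd] : exists2 k, (0 < k)%N & ln 2 / k%:R <= d / 3.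
    exists (Num.truncn (ln 2 / (d / 3))).+1 => //.
    have := truncnS_gt (ln 2 / (d / 3)); rewrite ltr_pdivrMr ?divr_gt0// => hk.
    by rewrite ler_pdivrMr ?ltr0n// mulrC ltW.
  have [cB B0] := BP j.
  have low n := @norm_lower_bound R e b rho om xs w e_compact eb b0 rhoP e_cap omP pe w_ge0 t (Q j) (B j) q0 (- J + d / 3) k te k0 cB B0 q00 (Q0 j) (Qc j) Ij n.
  pose E := expR (ln 2 / k%:R + (- J + d / 3)).
  have lE : l * E < 2.
    rewrite -[X in X * _]lnK ?posrE// -expRD -[ltRHS]lnK ?posrE// ltr_expR.
    by move: kd d0; rewrite /d; move: (ln 2 / k%:R) => u; lra.
  have tau0 : 0 < 2 - l * E by rewrite subr_gt0.
  have l20 : 0 <= l * 2 by rewrite mulr_ge0// ltW.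
  apply: le_limn_einf.
  (* The margin [2 - l * E] pays for the term with the value of [Q j] at the pole. *)
  have dec := pole_decay e_compact eb rhoP e_cap pe (Q j) l20 tau0; near=> n.
  apply: (widom_factor_ge e_compact eb b0 rhoP e_cap omP pe gP ne w_ge0 l0) => M' M PP M0 MP.
  have sQ : (size (Q j) <= n)%N by near: n; exact: nbhs_infty_ge.
  have := low n M' M sQ PP M0 MP.
  have : l * 2 * pole_size xs (Q j) <= (2 - l * E) * expR (n%:R * h) by near: n.
  have -> : expR (ln 2 / k%:R + (n%:R * h + (- J + d / 3))) = expR (n%:R * h) * E.
    by rewrite -expRD; congr expR; ring.
  move: (expR (n%:R * h)) (expR_gt0 (n%:R * h)) => X X0 h1 h2.
  have h3 : l * (2 * pole_size xs (Q j) + X * E) <= 2 * X by rewrite mulrDr; lra.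
  have h4 : l * 2 <= M * (l * (2 * pole_size xs (Q j) + X * E)).
    by rewrite mulrCA ler_pM2l.
  have h5 : M * (l * (2 * pole_size xs (Q j) + X * E)) <= M * (2 * X) by rewrite ler_pM2l.
  by rewrite -(ler_pM2r (ltr0n R 2)) -mulrA [X * _]mulrC; exact: le_trans h4 h5.
have eS : expeR J%:E = (expR J)%:E by [].
rewrite eS -EFinM; apply/lee_subgt0Pr => eps eps0; rewrite -EFinB.
have S0 := expR_gt0 J.
(* The maximum with [expR J] keeps the level positive when [eps] is large. *)
apply: le_trans (key (Num.max (2 * expR J - eps) (expR J)) _ _).
- by rewrite lee_fin le_max lexx.
- by rewrite lt_max S0 orbT.
- by rewrite gt_max; apply/andP; split; lra.
Unshelve. all: by end_near. Qed.
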